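(* Let $k$ be an algebraically closed field of characteristic $2$. Let $X$ be a weak del Pezzo surface of degree $4$ over $k$ whose $(-1)$- and $(-2)$-curves are exactly four $(-2)$-curves $C_1,\dots,C_4$ and four $(-1)$-curves $L_1,\dots,L_4$ with the following incidence graph: $L_i$ meets exactly $C_i$ and $C_{i+1}$ for $i=1,2,3$, $L_4$ meets exactly $C_4$ and $C_1$ (so the eight curves form a cycle $C_1,L_1,C_2,L_2,C_3,L_3,C_4,L_4$), and there are no other intersections. Then $X$ carries a $5$-parameter family of regular foliations such that each member of the family is not $2$-closed.
   Context: A weak del Pezzo surface is a smooth projective surface $X$ such that $-K_X$ is nef and big; its degree is $K_X^2$. A $(-m)$-curve is a smooth rational curve of self-intersection $-m$. In the incidence graph, an edge means that the two curves meet transversally at exactly one point. A foliation $\mathcal F$ on a smooth surface $X$ is (codimension one) given by a saturated coherent rank-one subsheaf $T_{\mathcal F}\subset T_X$ closed under the Lie bracket. It is regular if $T_{\mathcal F}$ and $T_X/T_{\mathcal F}$ are both locally free. In characteristic $2$ it is $2$-closed if $v^2=v\circ v\in T_{\mathcal F}$ for every local section $v$ of $T_{\mathcal F}$ (viewed as a derivation of $\mathcal O_X$). A ''$5$-parameter family'' of foliations on $X$ means a family of pairwise distinct foliations on $X$, depending algebraically on its parameter, indexed by the points of a nonempty Zariski open subset of a projective space $\mathbb P^5_k$. *)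

(* Defs.v *)
From mathcomp Require Import all_boot all_order all_algebra.
From mathcomp Require Import boolp classical_sets functions cardinality fsbigop.
From mathcomp Require Import mpoly.

Set Implicit Arguments.
Unset Strict Implicit.
Unset Printing Implicit Defensive.

Import GRing.Theory.
Local Open Scope ring_scope.
Local Open Scope classical_set_scope.

(* Classical varieties over an algebraically closed field k: "point" always
   means closed point, and all local rings, ideals and modules are realised
   inside the function field K or inside K -> K (derivations of K). *)

(* Each k-point of P^n has a unique representative whose first nonzero
   coordinate is 1, so Leibniz equality is equality of points. *)
Definition ppoint (k : closedFieldType) (n : nat) :=
  {p : 'rV[k]_n.+1 | [exists i, (p 0 i == 1) &&
                       [forall j : 'I_n.+1, (j < i)%N ==> (p 0 j == 0)]]}.

Definition peval (k : closedFieldType) n (F : {mpoly k[n.+1]})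
  (p : ppoint k n) : k := F.@[fun i => val p 0 i].

Definition zariski_open (k : closedFieldType) n (U : set (ppoint k n)) :=
  forall p, U p -> exists d (H : {mpoly k[n.+1]}),
    [/\ H \is d.-homog, peval H p != 0 & forall q, peval H q != 0 -> U q].

Definition zariski_closed (k : closedFieldType) n (Z : set (ppoint k n)) :=
  zariski_open (~` Z).

(* Open sets of P^m x P^n: the sums below are the bihomogeneous polynomials. *)
Definition zariski_open_prod (k : closedFieldType) m n
    (W : ppoint k m -> ppoint k n -> Prop) :=
  forall p q, W p q -> exists da db s (A : 'I_s -> {mpoly k[m.+1]})
      (B : 'I_s -> {mpoly k[n.+1]}),
    let H p' q' := \sum_(j < s) peval (A j) p' * peval (B j) q' in
    [/\ forall j, A j \is da.-homog, forall j, B j \is db.-homog,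
        H p q != 0 & forall p' q', H p' q' != 0 -> W p' q'].

Definition irreducible_closed (k : closedFieldType) n (Z : set (ppoint k n)) :=
  [/\ zariski_closed Z, Z !=set0 &
      forall A B, zariski_closed A -> zariski_closed B ->
        Z `<=` A `|` B -> Z `<=` A \/ Z `<=` B].

(* An integral closed subvariety of P^n, given by its function field and its
   generic point, i.e. the homogeneous coordinates as elements of the function
   field (up to a common factor); its homogeneous ideal is spanned by the
   homogeneous forms F with F(gen_pt) = 0. *)
Record projective_variety (k : closedFieldType) := ProjectiveVariety {
  pdim : nat;
  fun_field : fieldType;
  const : {rmorphism k -> fun_field};
  gen_pt : 'I_pdim.+1 -> fun_field;
  gen_pt_neq0 : exists i, gen_pt i != 0;
  gen_pt_generates : forall f : fun_field,
    exists d (F G : {mpoly k[pdim.+1]}),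
      [/\ F \is d.-homog, G \is d.-homog, mmap const gen_pt G != 0 &
          f = mmap const gen_pt F / mmap const gen_pt G] }.

Section Variety.
Context (k : closedFieldType) (X : projective_variety k).
Local Notation K := (fun_field X).
Local Notation form := {mpoly k[(pdim X).+1]}.
Local Notation pt := (ppoint k (pdim X)).
Local Notation cst := (@const k X).

Definition geval (F : form) : K := mmap cst (@gen_pt k X) F.

Definition points : set pt :=
  [set p | forall d (F : form), F \is d.-homog -> geval F = 0 -> peval F p = 0].

Definition alg_independent m (t : 'I_m -> K) :=
  forall P : {mpoly k[m]}, mmap cst t P = 0 -> P = 0.

Definition has_dim (d : nat) :=
  (exists t : 'I_d -> K, alg_independent t) /\
  (forall t : 'I_d.+1 -> K, ~ alg_independent t).

Definition vanishes_on (F : form) (Z : set pt) := forall p, Z p -> peval F p = 0.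

(* For Z irreducible closed in X: the local ring O_{X,Z} of X at the generic
   point of Z. *)
Definition local_ring (Z : set pt) : set K :=
  [set f | exists d (F G : form), [/\ F \is d.-homog, G \is d.-homog,
     ~ vanishes_on G Z & f = geval F / geval G]].

(* For Z contained in Y: the ideal of Y in O_{X,Z}. *)
Definition local_ideal (Y Z : set pt) : set K :=
  [set f | exists d (F G : form), [/\ F \is d.-homog, G \is d.-homog,
     vanishes_on F Y, ~ vanishes_on G Z & f = geval F / geval G]].

Definition max_ideal (Z : set pt) : set K := local_ideal Z Z.

Definition O_at (p : pt) : set K := local_ring [set p].

(* On a surface: u, v generate the maximal ideal at p. *)
Definition local_params (p : pt) (u v : K) :=
  [/\ max_ideal [set p] u, max_ideal [set p] v &
      forall f, max_ideal [set p] f ->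
        exists a b, [/\ O_at p a, O_at p b & f = a * u + b * v]].

(* Over an algebraically closed field, smooth = regular at closed points. *)
Definition smooth_surface :=
  has_dim 2 /\ (forall p, points p -> exists u v, local_params p u v).

(* Irreducible closed subsets of X of codimension one. *)
Definition prime_divisor (C : set pt) :=
  [/\ irreducible_closed C, C `<` points &
      forall Z, irreducible_closed Z -> C `<=` Z -> Z `<` points -> Z = C].

Definition has_ord (C : set pt) (f : K) (m : int) :=
  exists t u, [/\ t != 0, max_ideal C t,
     (forall g, max_ideal C g -> exists2 a, local_ring C a & g = a * t),
     local_ring C u /\ ~ max_ideal C u & f = u * t ^ m].

Definition ord (C : set pt) (f : K) : int := xget 0 [set m | has_ord C f m].

(* The coefficient function of a Weil divisor. *)
Definition is_divisor (D : set pt -> int) :=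
  finite_set [set C | D C != 0] /\ (forall C, D C != 0 -> prime_divisor C).

Definition curve_divisor (C : set pt) : set pt -> int :=
  fun Z => ((Z == C) : nat)%:Z.

Definition lin_equiv (D E : set pt -> int) :=
  exists2 f : K, f != 0 & forall C, prime_divisor C -> D C - E C = ord C f.

(* dim_k of A / J, for k-subspaces J of A of finite codimension. *)
Definition has_quot_dim (A J : set K) (m : nat) :=
  exists e : 'I_m -> K, (forall i, A (e i)) /\
    (forall f, A f -> exists! c : 'rV[k]_m, J (f - \sum_i cst (c 0 i) * e i)).

Definition quot_dim (A J : set K) : nat := xget 0%N [set m | has_quot_dim A J m].

Definition sum_local_ideals (C C' : set pt) (p : pt) : set K :=
  [set f | exists g h, [/\ local_ideal C [set p] g,
                           local_ideal C' [set p] h & f = g + h]].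

Definition local_mult (C C' : set pt) (p : pt) : nat :=
  quot_dim (O_at p) (sum_local_ideals C C' p).

(* For distinct curves. *)
Definition curve_inter (C C' : set pt) : int :=
  \sum_(p \in C `&` C') (local_mult C C' p)%:Z.

(* Defined by moving both divisors in their linear equivalence classes so that
   they share no component; on a smooth projective surface this is always
   possible and the value is unique. *)
Definition has_inter (D D' : set pt -> int) (m : int) :=
  exists E E', [/\ is_divisor E /\ lin_equiv D E,
                   is_divisor E' /\ lin_equiv D' E',
                   forall C, E C = 0 \/ E' C = 0 &
     m = \sum_(C \in [set: set pt]) \sum_(C' \in [set: set pt])
           E C * E' C' * curve_inter C C'].

Definition inter (D D' : set pt -> int) : int := xget 0 [set m | has_inter D D' m].

Definition nef (D : set pt -> int) :=
  forall C, prime_divisor C -> 0 <= inter D (curve_divisor C).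

(* H^0(X, O_X(D)). *)
Definition RR_space (D : set pt -> int) : set K :=
  [set f | f = 0 \/ forall C, prime_divisor C -> 0 <= ord C f + D C].

Definition k_independent N (f : 'I_N -> K) :=
  forall c : 'I_N -> k, \sum_i cst (c i) * f i = 0 -> forall i, c i = 0.

(* h^0(mD) >= m^2 / c for all large m, on a surface. *)
Definition big (D : set pt -> int) :=
  exists c m0 : nat, forall m : nat, (m0 <= m)%N ->
    exists N (f : 'I_N -> K), [/\ k_independent f,
      forall i, RR_space (fun C => D C *+ m) (f i) & (m ^ 2 <= c * N)%N].

Definition derivation (D : K -> K) :=
  [/\ forall f g, D (f + g) = D f + D g,
      forall f g, D (f * g) = D f * g + f * D g &
      forall c : k, D (cst c) = 0].

(* The rational 2-form h du /\ dv, as an alternating form on derivations. *)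
Definition two_form (h u v : K) (D E : K -> K) : K :=
  h * (D u * E v - E u * D v).

Definition two_form_eq (w w' : (K -> K) -> (K -> K) -> K) :=
  forall D E, derivation D -> derivation E -> w D E = w' D E.

(* W is the divisor of a nonzero rational 2-form h da /\ db. *)
Definition is_canonical (W : set pt -> int) :=
  is_divisor W /\
  exists h a b : K, ~ two_form_eq (two_form h a b) (fun _ _ => 0) /\
    (forall C p u v g, prime_divisor C -> C p -> local_params p u v ->
       two_form_eq (two_form h a b) (two_form g u v) -> W C = ord C g).

Definition canonical_divisor : set pt -> int :=
  xget (fun=> 0) [set W | is_canonical W].

Definition anticanonical_divisor : set pt -> int :=
  fun C => - canonical_divisor C.

Definition weak_del_pezzo :=
  [/\ smooth_surface, nef anticanonical_divisor & big anticanonical_divisor].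

Definition degree : int := inter canonical_divisor canonical_divisor.

(* O_{C,p} = O_{X,p} / I_C is a discrete valuation ring. *)
Definition smooth_curve (C : set pt) :=
  forall p, C p -> exists2 g, max_ideal [set p] g &
    forall f, max_ideal [set p] f ->
      exists2 a, O_at p a & local_ideal C [set p] (f - a * g).

(* The function field O_{X,C} / m_C of C is k(t) with t transcendental. *)
Definition rational_curve (C : set pt) :=
  exists t, [/\ local_ring C t,
    forall P : {poly k}, P != 0 -> ~ max_ideal C (map_poly cst P).[t] &
    forall f, local_ring C f -> exists P Q : {poly k},
      Q != 0 /\ max_ideal C ((map_poly cst Q).[t] * f - (map_poly cst P).[t])].

Definition neg_curve (m : nat) (C : set pt) :=
  [/\ prime_divisor C, smooth_curve C, rational_curve C &
      inter (curve_divisor C) (curve_divisor C) = - m%:Z].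

Definition meet_transversally_once (C C' : set pt) :=
  exists p, C `&` C' = [set p] /\
    (forall f, max_ideal [set p] f -> sum_local_ideals C C' p f).

(* Stalk at p of the tangent sheaf T_X. *)
Definition tangent (p : pt) : set (K -> K) :=
  [set D | derivation D /\ (forall f, O_at p f -> O_at p (D f))].

Definition span_at (p : pt) r (v : 'I_r -> K -> K) : set (K -> K) :=
  [set D | exists a : 'I_r -> K, (forall i, O_at p (a i)) /\
                                 D = fun f => \sum_i a i * v i f].

(* Subsheaves of T_X (sitting in the constant sheaf Der_k(K)) are given by
   their stalks: the sections over U are the elements of all F p, p in U.
   A coherent subsheaf is one whose stalks are, locally on X, generated by
   finitely many sections. *)
Definition coherent_subsheaf (F : pt -> set (K -> K)) :=
  forall p, points p -> exists V r (v : 'I_r -> K -> K),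
    [/\ zariski_open V, V p & forall q, points q -> V q ->
        (forall i, tangent q (v i)) /\ F q = span_at q v].

(* The generic stalk is a line. *)
Definition rank_one (F : pt -> set (K -> K)) :=
  exists v : K -> K, [/\ derivation v, exists f, v f != 0 &
    forall p, points p ->
      (forall D, F p D -> exists a, D = fun f => a * v f) /\
      (exists2 D, F p D & exists f, D f != 0)].

(* T_X / F is torsion free. *)
Definition saturated (F : pt -> set (K -> K)) :=
  forall p D a, points p -> tangent p D -> O_at p a -> a != 0 ->
    F p (fun f => a * D f) -> F p D.

Definition bracket_closed (F : pt -> set (K -> K)) :=
  forall p D E, points p -> F p D -> F p E ->
    F p (fun f => D (E f) - E (D f)).

Definition foliation (F : pt -> set (K -> K)) :=
  [/\ coherent_subsheaf F, rank_one F, saturated F & bracket_closed F].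

(* The O_{X,p}-module M / N is free (of finite rank). *)
Definition free_quotient (p : pt) (M N : set (K -> K)) :=
  exists r (e : 'I_r -> K -> K), (forall i, M (e i)) /\
    (forall D, M D -> exists! a : 'rV[K]_r, (forall i, O_at p (a 0 i)) /\
                        N (fun f => D f - \sum_i a 0 i * e i f)).

(* T_F and T_X / T_F are coherent, hence locally free as soon as their stalks
   are free. *)
Definition regular_foliation (F : pt -> set (K -> K)) :=
  forall p, points p -> free_quotient p (F p) [set (fun=> 0)] /\
                        free_quotient p (tangent p) (F p).

Definition two_closed (F : pt -> set (K -> K)) :=
  forall p v, points p -> F p v -> F p (v \o v).

Definition same_foliation (F G : pt -> set (K -> K)) :=
  forall p, points p -> F p = G p.

(* Near (lam, p), up to a unit, a section over P^m x X of the pullback of T_X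
   is a form in the homogeneous coordinates of P^m with coefficients in the
   stalk of T_X at p. *)
Definition algebraic_vector_field m (p : pt) (v : ppoint k m -> K -> K) :=
  exists d s (P : 'I_s -> {mpoly k[m.+1]}) (D : 'I_s -> K -> K),
    [/\ forall j, P j \is d.-homog, forall j, tangent p (D j) &
        forall mu f, v mu f = \sum_j cst (peval (P j) mu) * D j f].

(* The T_F, lam in U, are the restrictions to the fibres {lam} x X of a
   coherent subsheaf of the pullback of T_X to U x X. *)
Definition algebraic_family m (U : set (ppoint k m))
    (F : ppoint k m -> pt -> set (K -> K)) :=
  forall lam p, U lam -> points p ->
    exists W r (v : 'I_r -> ppoint k m -> K -> K),
      [/\ zariski_open_prod W, W lam p,
          forall i, algebraic_vector_field p (v i) &
          forall mu q, U mu -> points q -> W mu q ->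
            F mu q = span_at q (fun i => v i mu)].

Definition foliation_family m (U : set (ppoint k m))
    (F : ppoint k m -> pt -> set (K -> K)) :=
  [/\ zariski_open U, U !=set0,
      forall lam, U lam -> foliation (F lam),
      forall lam mu, U lam -> U mu -> same_foliation (F lam) (F mu) -> lam = mu &
      algebraic_family U F].

End Variety.

(* Main.v *)
(** X is a toric surface (P^1 x P^1 blown up in the torus-fixed points), and the proof
recovers its torus. Each chain L + C + L of curves of type (-1, -2, -1) moves in a pencil: the
Riemann-Roch inequality on multiples of the chain, obtained by counting sections on the
rational curves it consists of, gives functions x, y whose divisors are differences of opposite
chains. Off the cycle Z of the eight curves, a canonical divisor is linearly equivalent to an
effective divisor E - Z with E disjoint from Z and E^2 = 0, and a function vanishing on E forces
E = 0; so dx dy / (x y) has divisor exactly -Z, and x, y are local coordinates off Z. With x_i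
running over x, y, 1/x, 1/y, the vector fields
a x d/dx + b y d/dy + (sum_i g_i x_i) (x d/dx + y d/dy) have simple poles along the C_i; for
a + b and all g_i nonzero, multiplying by local equations of the C_i leaves no zero, which gives
regular foliations parametrized by an open subset of P^5. *)

(* The count of sections of n times a chain is sharp only up to a constant independent of n. The
   remedy is a rational curve G that meets the chain once, at its end: sections restrict injectively
   to polynomials of degree at most n in a coordinate t of G, and the missing codimension stays
   bounded. Hence the polynomials that extend to X contain a nonzero ideal (f), and the quotient of
   the extensions of f t and f has poles on one chain only, because all its powers share the same
   defect.

   Characteristic 2 enters through dlog x = dlog(1/x): the field multiplies each x_i by a_i + g with
   one and the same g = sum of the g_m x_m, and g cancels in every product x_i x_j. Such products
   serve as coordinates near the L_i and the corners, which is why poles occur along the C_i only.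
   The same cancellation excludes zeros off the cycle once a + b is nonzero. Each x_m alone has a
   pole along C_m, so 1 and the x_m are linearly independent; this excludes 2-closedness and
   separates the members of the family. The six coefficients count up to a common scalar, whence
   P^5. *)
Require Import Defs.
From mathcomp Require Import all_boot all_order all_algebra.
From mathcomp Require Import boolp classical_sets functions cardinality fsbigop.
From mathcomp Require Import mpoly.
From mathcomp Require Import ring zify.
From HB Require Import structures.

Set Implicit Arguments.
Unset Strict Implicit.
Unset Printing Implicit Defensive.

Import GRing.Theory.
Local Open Scope ring_scope.
Local Open Scope classical_set_scope.

(** * Noetherian rings *)

Section Noetherian.

Definition isideal (R : comNzRingType) (I : set R) :=
 [/\ I 0, forall f g, I f -> I g -> I (f + g) & forall a f, I f -> I (a * f)].

(** Generators are peeled off one at a time, so coefficients stay existential and inductions follow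
    the list. *)
Fixpoint inspan (R : comNzRingType) (s : seq R) (f : R) : Prop :=
 if s is a :: s' then exists c, inspan s' (f - c * a) else f = 0.

Definition noetherian (R : comNzRingType) :=
 forall I : set R, isideal I -> exists s : seq R,
  (forall a, a \in s -> I a) /\ (forall f, I f -> inspan s f).

Lemma ideal_span (R : comNzRingType) (I : set R) s f :
 isideal I -> (forall a, a \in s -> I a) -> inspan s f -> I f.
move=> [I0 ID IM];elim: s f => [|a s IHs] f h;first by move=> ->.
case=> c /IHs hf;rewrite -[f](subrK (c * a));apply: ID.
 by apply: hf => b bs;apply: h;rewrite inE bs orbT.
by apply/IM/h;rewrite inE eqxx.
Qed.

Lemma span_ideal (R : comNzRingType) (s : seq R) : isideal (inspan s).
elim: s => [|a s [I0 ID IM]].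
 by split=> // [f g -> ->|b f ->];rewrite ?addr0 ?mulr0.
split=> [|f g [c hc] [d hd]|b f [c hc]].
- by exists 0;rewrite mul0r subr0.
- by exists (c + d);rewrite mulrDl opprD addrACA;apply: ID.
- by exists (b * c);rewrite -mulrA -mulrBr;apply: IM.
Qed.

Lemma mem_span (R : comNzRingType) (s : seq R) a : a \in s -> inspan s a.
elim: s => [//|b s IHs];rewrite inE => /orP [/eqP ->|/IHs h].
 by exists 1;rewrite mul1r subrr;case: (span_ideal s).
by exists 0;rewrite mul0r subr0.
Qed.

(** Each of the finitely many generators of the ideal spanned by S involves finitely many elements
    of S, so generators can be taken in S itself. This lets Noetherianity pass to local rings, where
    S is a set of numerators. *)
Lemma noetherian_set (R : comNzRingType) (S : set R) : noetherian R ->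
 exists s : seq R, (forall a, a \in s -> S a) /\ (forall f, S f -> inspan s f).
move=> nR;pose I : set R := fun f => exists s : seq R,
 (forall a, a \in s -> S a) /\ inspan s f.
have mono s t f : {subset s <= t} -> inspan s f -> inspan t f.
 move=> st;apply: ideal_span;first exact: span_ideal.
 move=> a /st;apply: mem_span.
have [|s0 [h0 g0]] := nR I.
 split.
 - by exists [::].
 - move=> f g [s [hs fs]] [t [ht gt]];exists (s ++ t);split.
  by move=> a;rewrite mem_cat => /orP [/hs|/ht].
  have [_ ID _] := span_ideal (s ++ t);apply: ID.
  by apply: mono fs => a;rewrite mem_cat => ->.
  by apply: mono gt => a;rewrite mem_cat => ->;rewrite orbT.
 - move=> a f [s [hs fs]];exists s;split=> //.
  by have [_ _] := span_ideal s;apply.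
have [s [hs hss]] : exists s : seq R, (forall a, a \in s -> S a) /\
  forall a, a \in s0 -> inspan s a.
 elim: s0 h0 {g0} => [|a s0 IHs] h0;first by exists [::].
 have [|s [hs hss]] := IHs;first by move=> b bs;apply: h0;rewrite inE bs orbT.
 have [t [ht at_]] := h0 a (mem_head _ _).
 exists (t ++ s);split;first by move=> b;rewrite mem_cat => /orP [/ht|/hs].
 move=> b;rewrite inE => /orP [/eqP ->|/hss].
  by apply: mono at_ => c;rewrite mem_cat => ->.
 by apply: mono => c;rewrite mem_cat orbC => ->.
exists s;split=> // f Sf.
apply: (ideal_span (span_ideal s) hss);apply: g0;exists [:: f];split.
 by move=> a;rewrite inE => /eqP ->.
by apply: mem_span;rewrite inE.
Qed.

Lemma noetherian_surj (R S : comNzRingType) (phi : {rmorphism R -> S}) :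
 (forall y, exists x, phi x = y) -> noetherian R -> noetherian S.
move=> sur nR I [I0 ID IM].
have [|s [hs gs]] := nR (fun x => I (phi x)).
 split=> [|f g|a f];rewrite ?rmorph0 ?rmorphD ?rmorphM//;[exact: ID | exact: IM].
exists (map phi s);split;first by move=> a /mapP [x /hs h ->].
move=> f;have [x <-] := sur f => /gs.
elim: s x {hs gs} => [|a s IHs] x;first by move->;rewrite rmorph0.
by case=> c /IHs h;exists (phi c);rewrite -rmorphM -rmorphB.
Qed.

Lemma noetherian_field (F : fieldType) : noetherian F.
move=> I [I0 ID IM];have [[x [Ix nx]]|no] := pselect (exists x, I x /\ x != 0).
 exists [:: x];split;first by move=> a;rewrite inE => /eqP ->.
 by move=> f _;exists (f / x);rewrite divfK// subrr.
exists [::];split=> // f If;apply: contra_notP no => /eqP nf;by exists f.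
Qed.

Lemma hilbert_basis (R : comNzRingType) : noetherian R -> noetherian {poly R}.
move=> nR I [I0 ID IM].
(* [L d] is the ideal of degree-d coefficients of the elements of I of degree at most d. These
   ideals increase with d and are constant from some [D] on, so the lists [G d] with d at most [D]
   generate I. *)
pose L d : set R := fun a => exists f : {poly R}, [/\ I f, (size f <= d.+1)%N & f`_d = a].
have idL d : isideal (L d).
 split.
 - by exists 0;rewrite size_poly0 coef0.
 - move=> a b [f [If sf <-]] [g [Ig sg <-]];exists (f + g);split;first exact: ID.
  by apply: leq_trans (size_polyD _ _) _;rewrite geq_max sf.
  by rewrite coefD.
 - move=> c a [f [If sf <-]];exists (c%:P * f);split;first exact: IM.
  rewrite mul_polyC;apply: leq_trans (size_scale_leq _ _) sf.
  by rewrite coefCM.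
have L1 d a : L d a -> L d.+1 a.
 move=> [f [If sf <-]];exists (f * 'X);split;first by rewrite mulrC;apply: IM.
  by apply: leq_trans (size_polyMleq _ _) _;rewrite size_polyX addn2.
 by rewrite coefMX.
have Lm d e a : (d <= e)%N -> L d a -> L e a.
 move=> /subnK <-;elim: (e - d)%N => [//|m IH] /IH;exact: L1.
have [|s [hs gs]] := nR (fun a => exists d, L d a).
 split.
 - by exists 0%N;case: (idL 0%N).
 - move=> a b [d hd] [e he];exists (maxn d e).
  have [_ LD _] := idL (maxn d e).
  by apply: LD;[apply: Lm hd;rewrite leq_maxl | apply: Lm he;rewrite leq_maxr].
 - by move=> a f [d hd];exists d;have [_ _] := idL d;apply.
have [D hD] : exists D, forall a, a \in s -> L D a.
 elim: s hs {gs} => [|a s IHs] hs;first by exists 0%N.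
 have [|D hD] := IHs;first by move=> b bs;apply: hs;rewrite inE bs orbT.
 have [e he] := hs a (mem_head _ _);exists (maxn D e) => b.
 rewrite inE => /orP [/eqP ->|/hD];first by apply: Lm he;rewrite leq_maxr.
 by apply: Lm;rewrite leq_maxl.
have LD d a : (D <= d)%N -> L d a -> L D a.
 move=> _ h;apply: (ideal_span (idL D) hD);apply: gs;by exists d.
have /choice [G hG] (d : nat) : exists Gd : seq {poly R},
  (forall f, f \in Gd -> I f /\ (size f <= d.+1)%N) /\
  forall a, L d a -> inspan (map (fun f : {poly R} => f`_d) Gd) a.
 have [t [ht gt]] := nR _ (idL d).
 have [u [hu eu]] : exists u : seq {poly R},
  (forall f, f \in u -> I f /\ (size f <= d.+1)%N) /\
  map (fun f : {poly R} => f`_d) u = t.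
  elim: t ht {gt} => [|a t IHt] ht;first by exists [::].
  have [|u [hu <-]] := IHt;first by move=> b bs;apply: ht;rewrite inE bs orbT.
  have [f [If sf <-]] := ht a (mem_head _ _);exists (f :: u);split=> //.
  by move=> g;rewrite inE => /orP [/eqP ->|/hu].
 by exists u;rewrite eu.
have redG d e (f : {poly R}) : (d <= e)%N -> (size f <= e.+1)%N -> L d f`_e ->
  exists g, [/\ inspan (G d) g, (size (f - g)%R <= e)%N & I g].
 move=> de sf;have [hG1 hG2] := hG d => /hG2.
 elim: (G d) f sf hG1 {hG2} => [|h u IHu] f sf hG1.
  move=> fe0;exists 0;split=> //;rewrite subr0.
  apply/leq_sizeP => j;rewrite leq_eqVlt => /orP [/eqP <- //|ej].
  by move/leq_sizeP: sf;apply.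
 case=> c hc;pose q := c%:P * 'X^(e - d) * h.
 have [Ih sh] := hG1 h (mem_head _ _).
 have sq : (size q <= e.+1)%N.
  apply/leq_sizeP => j ej;rewrite /q -mulrA coefCM coefXnM.
  case: ifP => _;rewrite ?mulr0//.
  move/leq_sizeP: sh => ->;rewrite ?mulr0//.
  rewrite ltn_subRL subnK//.
 have qe : q`_e = c * h`_d.
  rewrite /q -mulrA coefCM coefXnM ltnNge leq_subr.
  by rewrite subKn.
 have [|||g [sg hg Ig]] := IHu (f - q).
 - by apply: leq_trans (size_polyD _ _) _;rewrite size_polyN geq_max sf.
 - by move=> g gu;apply: hG1;rewrite inE gu orbT.
 - by rewrite coefB qe.
 exists (g + q);split.
 - by exists (c%:P * 'X^(e - d));rewrite -/q addrK.
 - by rewrite (addrC g) opprD addrA.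
 - by apply: ID => //;apply: IM.
pose W := flatten [seq G d | d <- iota 0 D.+1].
have memW d g : (d <= D)%N -> inspan (G d) g -> inspan W g.
 move=> dD;apply: ideal_span;first exact: span_ideal.
 move=> a aG;apply: mem_span;apply/flattenP;exists (G d) => //.
 by apply/map_f;rewrite mem_iota.
exists W;split.
 by move=> a /flattenP [u /mapP [d _ ->]];have [h _] := hG d => /h [].
have main n : forall f : {poly R}, I f -> (size f <= n)%N -> inspan W f.
 have [W0 WD WM] := span_ideal W.
 elim: n => [|n IHn] f If sf.
  by move: sf;rewrite leqn0 size_poly_eq0 => /eqP ->.
 have Lf : L n f`_n by exists f.
 have [d [dD dn Ld]] : exists d, [/\ (d <= D)%N, (d <= n)%N & L d f`_n].
  have [nD|Dn] := leqP n D;first by exists n.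
  by exists D;split;rewrite ?(ltnW Dn)//;apply: (LD n) => //;apply: ltnW.
 have [g [sg hg Ig]] := redG d n f dn sf Ld.
 rewrite -[f](subrK g);apply: WD;last exact: memW sg.
 apply: IHn hg;apply: ID => //;rewrite -mulN1r;exact: IM.
by move=> f If;apply: (main (size f)).
Qed.

Lemma noetherian_mpoly (F : fieldType) n : noetherian {mpoly F[n]}.
elim: n => [|n IHn].
 apply: (@noetherian_surj F {mpoly F[0]} (@mpolyC 0 F));last exact: noetherian_field.
 move=> p;exists (p@_0%MM);apply/mpolyP => m;rewrite mcoeffC.
 by rewrite (_ : m = 0%MM) ?eqxx ?mulr1//;apply/mnmP;case.
pose phi : {rmorphism {poly {mpoly F[n]}} -> {mpoly F[n.+1]}} :=
 horner_eval ('X_ord_max) \o map_poly (@mwiden n F).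
apply: (@noetherian_surj _ _ phi);last exact: hilbert_basis.
pose im y := exists x, phi x = y.
have imD x y : im x -> im y -> im (x + y).
 by move=> [u <-] [v <-];exists (u + v);rewrite rmorphD.
have imM x y : im x -> im y -> im (x * y).
 by move=> [u <-] [v <-];exists (u * v);rewrite rmorphM.
have im1 : im 1 by exists 1;rewrite rmorph1.
move=> p;rewrite [p]mpolyE;apply: (big_ind im) => //.
 by exists 0;rewrite rmorph0.
move=> m _;rewrite -mul_mpolyC;apply: (imM).
 by exists (p@_m)%:MP%:P;rewrite /= map_polyC /= mwidenC /horner_eval hornerC.
rewrite mpolyXE_id;apply: (big_ind im im1 imM) => i _.
elim: (m i) => [|d IHd];first by rewrite expr0.
rewrite exprS;apply: (imM) => //.
have [j ij|ij] := unliftP ord_max i.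
 exists ('X_j)%:P;rewrite /= map_polyC /= mwidenX /horner_eval hornerC.
 by rewrite mnmwiden1 ij;congr (mpolyX _ (mnm1 _));apply: val_inj => /=;rewrite /bump leqNgt ltn_ord.
by exists 'X;rewrite /= map_polyX /horner_eval hornerX ij.
Qed.
End Noetherian.

(** * Nullstellensatz *)

Lemma ex_minimal (T : Type) (P : T -> Prop) (f : T -> nat) :
 (exists x, P x) -> exists x, P x /\ forall y, P y -> (f x <= f y)%N.
move=> [x0 Px0];have ex : exists n, `[< exists x, P x /\ f x = n >].
 by exists (f x0);apply/asboolP;exists x0.
case: (ex_minnP ex) => n /asboolP [x [Px fx]] min;exists x;split=> // y Py.
by rewrite fx;apply: min;apply/asboolP;exists y.
Qed.

Section PrimeField.
Variables (R : comNzRingType) (I : set R).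
Hypothesis idI : isideal I.
Hypothesis I1 : ~ I 1.
Hypothesis prI : forall f g, I (f * g) -> I f \/ I g.

Definition pideal (x : R) : bool := `[< I x >].

Lemma pideal_closed : idealr_closed pideal.
have [I0 ID IM] := idI;split.
- exact/asboolP.
- by apply/negP => /asboolP.
- by move=> a x y /asboolP Ix /asboolP Iy;apply/asboolP/ID => //;apply: IM.
Qed.
HB.instance Definition _ := isIdealr.Build R pideal pideal_closed.

Lemma pideal_prime : prime_idealr_closed pideal.
by move=> u v /asboolP /prI [] h;apply/orP;[left|right];apply/asboolP. Qed.
HB.instance Definition _ := isPrimeIdealrClosed.Build R pideal pideal_prime.

Local Notation Q := (Quotient.quot (pideal : prime_idealr R)).

Definition qunit (x : Q) := `[< exists y : Q, y * x = 1 >].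
Definition qinv (x : Q) : Q :=
 if pselect (exists y : Q, y * x = 1) is left h then sval (cid h) else x.

Lemma qmulVx : {in qunit, left_inverse 1 qinv *%R}.
move=> x /asboolP h;rewrite /qinv;case: pselect => [h'|//].
by case: cid.
Qed.
Lemma qunitP (x y : Q) : y * x = 1 -> qunit x.
by move=> h;apply/asboolP;exists y. Qed.
Lemma qinv_out : {in [predC qunit], qinv =1 id}.
move=> x /negP h;rewrite /qinv;case: pselect => // h'.
by exfalso;apply: h;apply/asboolP.
Qed.
Definition Qr := Q.
HB.instance Definition _ := GRing.ComNzRing.on Qr.
HB.instance Definition _ := GRing.ComNzRing_hasMulInverse.Build Qr qmulVx qunitP qinv_out.
HB.instance Definition _ := GRing.ComUnitRing_isIntegral.Build Qr
 (@Quotient.rquot_IdomainAxiom R (pideal : prime_idealr R)).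

(** The fraction field of R/I makes a prime ideal a point with coordinates in a field, the input of
    the Nullstellensatz. Inverses in the quotient are chosen classically, to reach the structure of
    an integral domain. *)
Lemma field_of_prime : exists (L : fieldType) (phi : {rmorphism R -> L}),
 forall x, phi x = 0 <-> I x.
pose p1 : {rmorphism R -> Qr} := (\pi_Q)%qT.
exists {fraction Qr}, (@tofrac Qr \o p1) => x.
split=> [/eqP|Ix].
 rewrite tofrac_eq0;have -> : (p1 x == 0) = (x - 0 \in (pideal : prime_idealr R)).
  by rewrite -(rmorph0 p1) -Quotient.idealrBE.
 by rewrite subr0 => /asboolP.
apply/eqP;rewrite tofrac_eq0;have -> : (p1 x == 0) = (x - 0 \in (pideal : prime_idealr R)).
 by rewrite -(rmorph0 p1) -Quotient.idealrBE.
by rewrite subr0;apply/asboolP.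
Qed.
End PrimeField.

Section Nullstellensatz.
Context (k : closedFieldType).

Lemma mmap_muni (S : comNzRingType) (f : {rmorphism k -> S}) n (a : 'I_n.+1 -> S)
  (F : {mpoly k[n.+1]}) :
 mmap f a F = (map_poly (mmap f (a \o widen_ord (leqnSn n))) (muni F)).[a ord_max].
rewrite muniE raddf_sum /= horner_sum;apply: eq_bigr => m _.
rewrite -!mul_polyC !rmorphM /= !map_polyC /= !hornerM !hornerC.
rewrite mmapZ mmapX map_polyXn hornerXn -mulrA;congr (_ * _).
rewrite /mmap1 big_ord_recr;congr (_ * _).
by apply: eq_bigr => i _;rewrite mnmE.
Qed.

(** Induction on the number of coordinates, specialising all but the last one c first. If c is
    transcendental over the others, almost any value will do. If c is algebraic, it is sent to a
    root of its specialised minimal equation G, and h stays nonzero there because a relation U h + V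
    G = W with W constant in the last variable survives specialisation. *)
Lemma nullstellensatz (L : fieldType) (phi : {rmorphism k -> L}) n (a : 'I_n -> L)
  (h : {mpoly k[n]}) : mmap phi a h != 0 ->
 exists b : 'I_n -> k, (forall F, mmap phi a F = 0 -> F.@[b] = 0) /\ h.@[b] != 0.
elim: n a h => [|n IHn] a h nh.
 have C (F : {mpoly k[0]}) : F = (F@_0%MM)%:MP.
  apply/mpolyP => m;rewrite mcoeffC (_ : m = 0%MM) ?eqxx ?mulr1//.
  by apply/mnmP;case.
 exists (fun=> 0);split=> [F|].
  rewrite (C F) mmapC mevalC => /eqP.
  by rewrite fmorph_eq0 => /eqP.
 by move: nh;rewrite (C h) mmapC mevalC fmorph_eq0.
pose a' := a \o widen_ord (leqnSn n);pose c := a ord_max.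
pose ev : {rmorphism {mpoly k[n]} -> L} := mmap phi a'.
pose evp : {rmorphism {poly {mpoly k[n]}} -> {poly L}} := map_poly ev.
pose bx (b : 'I_n -> k) x (i : 'I_n.+1) :=
 if unlift ord_max i is Some j then b j else x.
have bxE b x F : F.@[bx b x] = (map_poly (meval b) (muni F)).[x].
 rewrite /meval mmap_muni {2}/bx unlift_none;congr (_.[x]).
 apply: eq_map_poly => G;apply: meval_eq => i.
 have e : widen_ord (leqnSn n) i = lift ord_max i.
  by apply: val_inj;rewrite /= /bump leqNgt ltn_ord.
 by rewrite /= e /bx liftK.
have evE F : mmap phi a F = (evp (muni F)).[c] by rewrite mmap_muni.
have spec b (F : {poly {mpoly k[n]}}) : (forall G, ev G = 0 -> G.@[b] = 0) ->
  evp F = 0 -> map_poly (meval b) F = 0.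
 move=> hb /polyP F0;apply/polyP => i;move: (F0 i).
 by rewrite !coef_map !coef0 => /hb.
have root b x (F : {mpoly k[n.+1]}) : (forall G, ev G = 0 -> G.@[b] = 0) ->
  evp (muni F) = 0 -> F.@[bx b x] = 0.
 by move=> hb /(spec b _ hb);rewrite bxE => ->;rewrite horner0.
(* [B P] says that P is a nontrivial equation for c over the earlier coordinates. *)
pose B (P : {poly {mpoly k[n]}}) := evp P != 0 /\ (evp P).[c] = 0.
have [nB|/contrapT exB] := pselect (~ exists P, B P).
 have nH : evp (muni h) != 0.
  by apply: contraNN nh => /eqP e;rewrite evE e horner0.
 have lh : ev (muni h)`_(size (evp (muni h))).-1 != 0.
  by rewrite -coef_map lead_coef_eq0.
 have [b [hb nb]] := IHn a' _ lh.
 have nhb : map_poly (meval b) (muni h) != 0.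
  apply: contraNN nb => /eqP /polyP /(_ (size (evp (muni h))).-1).
  by rewrite coef_map coef0 => ->.
 have /closed_nonrootP [x nx] := nhb.
 exists (bx b x);split;last by rewrite bxE.
 move=> F F0;apply: root hb _;apply: contra_notP nB => /eqP nz.
 by exists (muni F);split=> //;rewrite -evE.
have trunc (P : {poly {mpoly k[n]}}) : exists P0, evp P0 = evp P /\ size P0 = size (evp P).
 exists (take_poly (size (evp P)) P).
 have e : evp (take_poly (size (evp P)) P) = evp P.
  apply/polyP => i;rewrite !coef_map coef_take_poly.
  by case: ltnP => // /leq_sizeP/(_ _ (leqnn _));rewrite coef_map /= => ->;rewrite mmap0.
 split=> //;apply/eqP;rewrite eqn_leq size_take_poly -{1}e.
 exact: size_poly.
have leadn0 (P : {poly {mpoly k[n]}}) : size P = size (evp P) -> evp P != 0 ->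
  ev (lead_coef P) != 0.
 by move=> e nz;rewrite lead_coefE e -coef_map -lead_coefE lead_coef_eq0.
have pdiv (P D : {poly {mpoly k[n]}}) : D != 0 -> exists N Q R,
  lead_coef D ^+ N *: P = Q * D + R /\ (size R < size D)%N.
 move=> nD;exists (Pdiv.CommonRing.rscalp P D), (Pdiv.CommonRing.rdivp P D),
  (Pdiv.CommonRing.rmodp P D);split;first exact: Pdiv.ComRing.rdivp_eq.
 exact: Pdiv.CommonRing.ltn_rmodpN0.
have [G1 [[nG1 rG1] minG1]] := ex_minimal (fun P => size (evp P)) exB.
have [G [eG sG]] := trunc G1;rewrite -eG in sG.
have nG : evp G != 0 by rewrite eG.
have rG : (evp G).[c] = 0 by rewrite eG.
have minG P : B P -> (size G <= size (evp P))%N by rewrite sG eG;apply: minG1.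
have nG0 : G != 0 by apply: contraNN nG => /eqP ->;rewrite rmorph0.
have szev (P : {poly {mpoly k[n]}}) : (size (evp P) <= size P)%N by exact: size_poly.
(* A minimal [W] in the ideal of h and G acts as their gcd: it divides both up to powers of its
   leading coefficient. Since h(c) is nonzero, so is W(c), hence c is a root of the cofactor of W in
   G; minimality of G forces W to be constant. *)
pose C (W : {poly {mpoly k[n]}}) := evp W != 0 /\ exists U V, evp W = evp (U * muni h + V * G).
have exC : exists W, C W.
 by exists G;split=> //;exists 0, 1;rewrite mul0r add0r mul1r.
have [W1 [[nW1 [U [V eUV]]] minW1]] := ex_minimal (fun P => size (evp P)) exC.
have [W [eW sW]] := trunc W1;rewrite -eW in sW.
have nW : evp W != 0 by rewrite eW.
have nW0 : W != 0 by apply: contraNN nW => /eqP ->;rewrite rmorph0.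
have gW := leadn0 _ sW nW;have gG := leadn0 _ sG nG.
have evpZ d P : evp (d *: P) = ev d *: evp P.
 by rewrite -mul_polyC rmorphM /= map_polyC mul_polyC.
have divW P : (exists U V, evp P = evp (U * muni h + V * G)) ->
  exists N Q, ev (lead_coef W) ^+ N *: evp P = evp Q * evp W.
 move=> [U' [V' eP]];have [N [Q [R [eq sR]]]] := pdiv P W nW0.
 exists N, Q;have {eq} : evp R = ev (lead_coef W) ^+ N *: evp P - evp Q * evp W.
  have := congr1 evp eq;rewrite evpZ rmorphXn rmorphD rmorphM => ->.
  by rewrite addrAC subrr add0r.
 have [-> /esym/eqP|nR eR] := eqVneq (evp R) 0;first by rewrite subr_eq0 => /eqP.
 have CR : C R.
  split=> //;exists ((lead_coef W ^+ N) *: U' - Q * U), ((lead_coef W ^+ N) *: V' - Q * V).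
  rewrite eR eP eW eUV -rmorphXn -evpZ -rmorphM -rmorphB;congr (evp _).
  rewrite scalerDr !mulrBl -!scalerAl mulrDr !mulrA.
  by rewrite opprD addrACA.
 have := leq_ltn_trans (leq_trans (minW1 _ CR) (szev R)) sR.
 by rewrite sW eW ltnn.
have [N1 [Q1 e1]] : exists N Q, ev (lead_coef W) ^+ N *: evp (muni h) = evp Q * evp W.
 by apply: divW;exists 1, 0;rewrite mul1r mul0r addr0.
have [N2 [Q2 e2]] : exists N Q, ev (lead_coef W) ^+ N *: evp G = evp Q * evp W.
 by apply: divW;exists 0, 1;rewrite mul1r mul0r add0r.
have nWc : (evp W).[c] != 0.
 apply: contraNneq nh => e;have := congr1 (horner^~ c) e1.
 rewrite hornerZ hornerM e mulr0 evE => /eqP.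
 by rewrite mulf_eq0 expf_eq0 (negbTE gW) andbF.
have Q2c : (evp Q2).[c] = 0.
 have := congr1 (horner^~ c) e2;rewrite hornerZ hornerM rG mulr0 => /esym/eqP.
 by rewrite mulf_eq0 (negbTE nWc) orbF => /eqP.
have nQ2 : evp Q2 != 0.
 apply: contraTneq gW => e;move/eqP: e2;rewrite e mul0r scaler_eq0 (negbTE nG) orbF.
 by rewrite expf_eq0 => /andP [_ /eqP ->];rewrite eqxx.
have sW1 : size W = 1%N.
 have e : size G = (size (evp Q2) + size W).-1.
  by rewrite sG sW -(size_mul nQ2 nW) -e2 size_scale// expf_neq0.
 have := minG Q2 (conj nQ2 Q2c);rewrite e.
 have : (0 < size W)%N by rewrite lt0n size_poly_eq0.
 by move: size size => u v;clear;lia.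
have sG1 : (1 < size G)%N.
 rewrite ltn_neqAle lt0n size_poly_eq0 nG0 andbT eq_sym.
 apply: contraTneq nG => sG';have /size_poly1P [d nd ed] : size (evp G) == 1%N by rewrite -sG sG'.
 by move: rG;rewrite ed hornerC => /eqP;rewrite (negbTE nd).
have [b [hb nb]] : exists b : 'I_n -> k, (forall F, ev F = 0 -> F.@[b] = 0) /\
  (lead_coef W * lead_coef G).@[b] != 0.
 by apply: IHn;rewrite rmorphM mulf_neq0.
move: nb;rewrite mevalM mulf_eq0 negb_or => /andP [nbW nbG].
pose mb : {rmorphism {poly {mpoly k[n]}} -> {poly k}} := map_poly (meval b).
have mbZ d P : mb (d *: P) = d.@[b] *: mb P.
 by rewrite -mul_polyC rmorphM /= map_polyC mul_polyC.
have szG : size (mb G) = size G by apply: size_map_poly_id0.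
have [x rx] : exists x, (mb G).[x] = 0.
 have /closed_rootP [x /rootP rx] : size (mb G) != 1%N by rewrite szG;case: size sG1 => [|[]].
 by exists x.
exists (bx b x);split.
 move=> F F0;have [N [Q [R [eq sR]]]] := pdiv (muni F) G nG0.
 have eR : evp R = 0.
  have [//|nR] := eqVneq (evp R) 0;have := szev R;rewrite leqNgt.
  move=> /negP [];apply: leq_trans sR _;apply: minG;split=> //.
  have := congr1 (fun p => (evp p).[c]) eq.
  rewrite evpZ rmorphD rmorphM hornerZ hornerD hornerM rG mulr0 add0r => <-.
  by rewrite -evE F0 mulr0.
 have := congr1 (fun p => (mb p).[x]) eq.
 rewrite mbZ rmorphD rmorphM hornerZ hornerD hornerM rx mulr0 add0r.
 have -> : mb R = 0 by apply: spec hb eR.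
 rewrite horner0 rmorphXn => /eqP;rewrite mulf_eq0 expf_eq0 (negbTE nbG) andbF.
 by rewrite bxE => /eqP.
have : mb (U * muni h + V * G - W) = 0.
 by apply: spec hb _;rewrite rmorphB eW eUV subrr.
move/(congr1 (horner^~ x));rewrite rmorphB rmorphD !rmorphM !hornerE rx mulr0 addr0.
rewrite bxE;apply: contra_eq_neq => ->;rewrite mulr0 sub0r oppr_eq0.
have [w ew] : exists w, W = w%:P by exists W`_0;apply: size1_polyC;rewrite sW1.
by move: nbW;rewrite ew lead_coefC /= map_polyC hornerC.
Qed.
End Nullstellensatz.

(** * Projective Nullstellensatz *)

Lemma prime_avoiding (R : comNzRingType) (J : set R) (u : R) : isideal J ->
 (forall n, ~ J (u ^+ n)) -> exists Q : set R, [/\ isideal Q, ~ Q 1,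
  forall f g, Q (f * g) -> Q f \/ Q g, J `<=` Q & forall n, ~ Q (u ^+ n)].
move=> idJ hJ.
(* Taking the union with J makes the empty chain, whose union is the empty set, admissible for
   Zorn's lemma. *)
pose P (A : set R) := isideal (A `|` J) /\ forall n, ~ (A `|` J) (u ^+ n).
have [|A [[idA hA] maxA]] := @Zorn_bigcup _ P.
 move=> F FP Ftot;split;last first.
  by move=> n [[B FB Bu]|/hJ//];have [_ /(_ n)] := FP _ FB;apply;left.
 have [J0 JD JM] := idJ;split.
 - by right.
 - move=> f g [[B FB Bf]|Jf] [[B' FB' B'g]|Jg].
  + have [BB'|B'B] := Ftot _ _ FB FB'.
  have [[_ h _] _] := FP _ FB'.
  have [] := h f g;[by left;apply: BB'|by left| |by right].
  by left;exists B'.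
  have [[_ h _] _] := FP _ FB.
  have [] := h f g;[by left|by left;apply: B'B| |by right].
  by left;exists B.
  + have [[_ h _] _] := FP _ FB;have [] := h f g;[by left|by right| |by right].
  by left;exists B.
  + have [[_ h _] _] := FP _ FB';have [] := h f g;[by right|by left| |by right].
  by left;exists B'.
  + by right;apply: JD.
 - move=> a f [[B FB Bf]|Jf];last by right;apply: JM.
  have [[_ _ h] _] := FP _ FB;have [] := h a f;[by left| |by right].
  by left;exists B.
have [Q0 QD QM] := idA.
have Q1 : ~ (A `|` J) 1 by have := hA 0%N.
exists (A `|` J);split => //.
move=> f g Qfg;apply: contrapT => /not_orP [nf ng].
have ext h : ~ (A `|` J) h -> exists n a, (A `|` J) (u ^+ n - a * h).
 move=> nh;pose B := [set x | exists a, (A `|` J) (x - a * h)].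
 have AB : A `<=` B by move=> Ax;exists 0;rewrite mul0r subr0;left.
 have JB : B `|` J = B.
  apply/seteqP;split=> x;last by left.
  by move=> [//|Jx];exists 0;rewrite mul0r subr0;right.
 have nP : ~ P B.
  apply: maxA;split=> // BA;apply: nh;left;apply: BA.
  by exists 1;rewrite mul1r subrr.
 apply: contra_notP nP => no;split;rewrite JB;last first.
  by move=> n [a ha];apply: no;exists n, a.
 split.
 - by exists 0;rewrite mul0r subr0.
 - by move=> x y [a ha] [b hb];exists (a + b);rewrite mulrDl opprD addrACA;apply: QD.
 - by move=> a x [b hb];exists (a * b);rewrite -mulrA -mulrBr;apply: QM.
have [n [a ha]] := ext _ nf;have [n' [b hb]] := ext _ ng.
apply: (hA (n + n')%N);rewrite exprD.
have -> : u ^+ n * u ^+ n' = u ^+ n' * (u ^+ n - a * f) + (a * f) * (u ^+ n' - b * g)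
  + (a * b) * (f * g) by ring.
by apply: (QD);[apply: (QD);apply: (QM)|apply: (QM)].
Qed.

Section Homog.
Context (k : closedFieldType) (n : nat).
Local Notation form := {mpoly k[n.+1]}.
Local Notation pt := (ppoint k n).

Lemma homog_scale (S : comNzRingType) (f : {rmorphism k -> S}) d (F : form) (c : S) v :
 F \is d.-homog -> mmap f (fun i => c * v i) F = c ^+ d * mmap f v F.
move=> /dhomogP hF;rewrite /mmap mulr_sumr big_seq [RHS]big_seq.
apply: eq_bigr => m /hF /= <-;rewrite mulrCA;congr (_ * _).
rewrite mdegE expr_sum -big_split;apply: eq_bigr => i _;exact: exprMn.
Qed.

Lemma rmorph_mmap (S : comNzRingType) (phi : {rmorphism form -> S}) (F : form) :
 phi F = mmap (phi \o @mpolyC _ k) (fun i => phi 'X_i) F.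
rewrite {1}[F]mpolyE rmorph_sum;apply: eq_bigr => m _.
rewrite -mul_mpolyC rmorphM;congr (_ * _).
by rewrite mpolyXE_id rmorph_prod;apply: eq_bigr => i _;rewrite rmorphXn.
Qed.
Lemma pt_coord (p : pt) : exists i, val p 0 i = 1.
by case: p => p /= /existsP [i /andP [/eqP h _]];exists i. Qed.

Lemma pt_proportional (p q : pt) c : (forall i, val p 0 i = c * val q 0 i) -> p = q.
move=> h;apply: val_inj;apply/rowP => i;rewrite h.
suff -> : c = 1 by rewrite mul1r.
have /existsP [a /andP [/eqP pa /forallP pa']] := valP p.
have /existsP [b /andP [/eqP qb /forallP qb']] := valP q.
have nc : c != 0 by apply: contraTneq (oner_neq0 k) => e;rewrite -pa h e mul0r eqxx.
case: (ltngtP a b) => [ab|ba|ab].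
- have := implyP (qb' a) ab => /eqP e;move: pa;rewrite h e mulr0 => /eqP.
 by rewrite eq_sym oner_eq0.
- have := implyP (pa' b) ba;rewrite h qb mulr1 => /eqP e.
 by rewrite e eqxx in nc.
- by move: pa;rewrite h (_ : a = b) ?qb ?mulr1//;apply: val_inj.
Qed.

Lemma pt_of_vector (b : 'I_n.+1 -> k) i0 : b i0 != 0 ->
 exists (p : pt) c, c != 0 /\ forall i, b i = c * val p 0 i.
move=> nb;pose i := [arg min_(i < i0 | (b i != 0)%R) (i : nat)]%N.
have [nbi mini] : b i != 0 /\ forall j, b j != 0 -> (i <= j)%N.
 by rewrite /i;case: arg_minnP.
have pP : [exists i1, ((\row_j (b j / b i)) 0 i1 == 1) &&
  [forall j : 'I_n.+1, (j < i1)%N ==> ((\row_j (b j / b i)) 0 j == 0)]].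
 apply/existsP;exists i;rewrite mxE divff// eqxx;apply/forallP => j.
 apply/implyP;rewrite mxE => ji;rewrite mulf_eq0 invr_eq0 (negbTE nbi) orbF.
 by apply: contraTT ji => /mini;rewrite leqNgt.
by exists (exist _ (\row_j (b j / b i)) pP : pt), (b i);split=> // j;rewrite mxE mulrC divfK.
Qed.

Lemma peval_vector (p : pt) c b d (F : form) : (forall i, b i = c * val p 0 i) ->
 F \is d.-homog -> F.@[b] = c ^+ d * peval F p.
move=> hb hF;rewrite -(homog_scale idfun c _ hF);exact: meval_eq.
Qed.

Lemma nullst_proj (L : fieldType) (phi : {rmorphism k -> L}) (a : 'I_n.+1 -> L) i0 d
  (H : form) : a i0 != 0 -> H \is d.-homog -> mmap phi a H != 0 ->
 exists p : pt, (forall e (F : form), F \is e.-homog -> mmap phi a F = 0 -> peval F p = 0)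
  /\ peval H p != 0.
move=> na hH nH;pose z i := a i / a i0.
have az e (F : form) : F \is e.-homog -> mmap phi a F = a i0 ^+ e * mmap phi z F.
 move=> hF;rewrite -(homog_scale phi _ _ hF);apply: eq_bigr => m _;congr (_ * _).
 by apply: eq_bigr => i _;rewrite mulrC divfK.
(* The factor ['X_i0] keeps the specialised vector nonzero, so that it defines a point of projective
   space. *)
have nz : mmap phi z (H * 'X_i0) != 0.
 rewrite rmorphM /= mmapX mmap1U /z divff// mulr1.
 by apply: contraNneq nH => e;rewrite (az _ _ hH) e mulr0.
have [b [hb]] := nullstellensatz nz.
rewrite mevalM mevalXU mulf_eq0 negb_or => /andP [nHb nb].
have [p [c [nc hc]]] := pt_of_vector nb.
exists p;split.
 move=> e F hF;rewrite (az _ _ hF) => /eqP;rewrite mulf_eq0 expf_eq0 (negbTE na) andbF.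
 move=> /eqP /hb;rewrite (peval_vector hc hF) => /eqP.
 by rewrite mulf_eq0 expf_eq0 (negbTE nc) andbF => /eqP.
by apply: contraNneq nHb => e;rewrite (peval_vector hc hH) e mulr0.
Qed.

(* J is a graded family of forms; it need not be given by a single ideal of polynomials. *)
Definition graded_ideal (J : nat -> form -> Prop) :=
 [/\ forall d F, J d F -> F \is d.-homog, forall d, J d 0,
  forall d F G, J d F -> J d G -> J d (F + G) &
  forall d e F G, J d F -> G \is e.-homog -> J (d + e)%N (G * F)].

Definition hspan (J : nat -> form -> Prop) : set form := fun F =>
 exists s : seq (nat * form), (forall x, x \in s -> J x.1 x.2) /\ F = \sum_(x <- s) x.2.

Lemma hspan_ideal J : graded_ideal J -> isideal (hspan J).
move=> [Jh J0 JD JM].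
have ID F G : hspan J F -> hspan J G -> hspan J (F + G).
 move=> [s [hs ->]] [t [ht ->]];exists (s ++ t);rewrite big_cat;split=> // x.
 by rewrite mem_cat => /orP [/hs|/ht].
split=> //;first by exists [::];rewrite big_nil.
move=> a F [s [hs ->]];rewrite [a]mpolyE mulr_suml;apply: big_ind => //.
 by exists [::];rewrite big_nil.
move=> m _;exists [seq ((x.1 + mdeg m)%N, a@_m *: 'X_[m] * x.2) | x <- s].
rewrite big_map mulr_sumr;split=> // x /mapP [y /hs Jy ->].
by apply: JM => //;apply: dhomogZ;rewrite dhomogX.
Qed.

Lemma hspan_homog J d F : graded_ideal J -> F \is d.-homog -> hspan J F -> J d F.
move=> [Jh J0 JD JM] hF [s [hs eF]];rewrite -(pihomog_dE hF) eF raddf_sum /= big_seq.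
apply: big_ind => // [F' G'|x /hs Jx];first exact: JD.
have [e|ne] := eqVneq x.1 d;first by rewrite -e pihomog_dE//;apply: Jh.
by rewrite (pihomog_ne0 ne (Jh _ _ Jx)).
Qed.
Lemma hspan_mem (J : nat -> form -> Prop) d F : J d F -> hspan J F.
by move=> JF;exists [:: (d, F)];rewrite big_seq1;split=> // x;rewrite inE => /eqP ->.
Qed.

(** Some power of every variable lies in the span: otherwise a prime ideal containing J but no power
    of ['X_i] gives a zero over a field, which specialises to a k-point. This is the main finiteness
    device below: a property of forms that is stable under sums and multiples is checked near each
    point and then holds in all large degrees. *)
Lemma forms_of_no_zero J : graded_ideal J ->
 (forall p : pt, exists d F, J d F /\ peval F p != 0) ->
 exists N, forall d F, (N <= d)%N -> F \is d.-homog -> J d F.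
move=> gJ noz;have [Jh J0 JD JM] := gJ.
pose I := hspan J;have idI : isideal I := hspan_ideal gJ.
have JI d F : F \is d.-homog -> I F -> J d F by exact: hspan_homog.
have /choice [N hN] (i : 'I_n.+1) : exists N, I ('X_i ^+ N).
 apply: contrapT => /forallNP no.
 have [Q [idQ Q1 prQ IQ nQ]] := prime_avoiding idI no.
 have [L [phi hphi]] := field_of_prime idQ Q1 prQ.
 have nX : phi 'X_i != 0.
  by apply/eqP => /hphi h;apply: (nQ 1%N).
 have h1 : (1 : form) \is 0.-homog by exact: dhomog1.
 have [|p [hp _]] := @nullst_proj L (phi \o @mpolyC _ k) (fun i => phi 'X_i) i 0%N 1 nX h1.
  by rewrite rmorph1 oner_eq0.
 have [d [F [JF /negP []]]] := noz p;apply/eqP/hp;first exact: Jh JF.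
 rewrite -rmorph_mmap;apply/hphi/IQ/(hspan_mem JF).
(* A monomial of larger degree than the sum of the [N i] is divisible by some ['X_i ^+ N i]. *)
exists (\sum_i N i).+1 => d F dN hF;apply: JI => //;rewrite [F]mpolyE big_seq.
have [I0 ID IM] := idI;apply: (big_ind I I0 ID).
move=> m mF;have md : mdeg m = d by move/dhomogP: hF => /(_ _ mF).
rewrite -mul_mpolyC;apply: (IM).
have [i hi] : exists i, (N i <= m i)%N.
 apply: contrapT => /forallNP no;move: dN;rewrite -md mdegE ltnNge => /negP [].
 apply: leq_sum => i _;rewrite ltnW// ltnNge;apply/negP/no.
have -> : 'X_[m] = 'X_[(m - U_(i) *+ N i)%MM] * 'X_i ^+ N i :> form.
 rewrite mpolyXn -mpolyXD submK//;apply/mnm_lepP => j;rewrite mulmnE mnm1E.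
 by case: eqP => [<-|_];rewrite ?mul1n.
exact: (IM).
Qed.
End Homog.

(** * Two-dimensional regular local rings *)

Section LocalRing.
Context (K : fieldType) (O : set K).
Hypothesis O1 : O 1.
Hypothesis OB : forall f g, O f -> O g -> O (f - g).
Hypothesis OM : forall f g, O f -> O g -> O (f * g).
Variables (u v : K).
Hypotheses (Ou : O u) (Ov : O v).

Let O0 : O 0. by rewrite -(subrr 1);apply: OB. Qed.
Let ON f : O f -> O (- f). by move=> Of;rewrite -sub0r;apply: OB. Qed.
Let OD f g : O f -> O g -> O (f + g).
by move=> Of Og;rewrite -[g]opprK;apply: OB => //;apply: ON. Qed.
Let OX f n : O f -> O (f ^+ n).
by move=> Of;elim: n => [|n];rewrite ?expr0 ?exprS//;apply: OM. Qed.

Definition oideal (J : set K) := [/\ J `<=` O, J 0, forall f g, J f -> J g -> J (f + g)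
 & forall a f, O a -> J f -> J (a * f)].

Lemma oidealN J f : oideal J -> J f -> J (- f).
by move=> [_ _ _ JM] Jf;rewrite -mulN1r;apply: (JM) => //;apply: ON. Qed.
Lemma oidealB J f g : oideal J -> J f -> J g -> J (f - g).
by move=> iJ Jf Jg;have [_ _ JD _] := iJ;apply: (JD) => //;apply: oidealN. Qed.

Definition odvd (t f : K) := exists2 a, O a & f = a * t.

Lemma oideal_dvd t : O t -> oideal (odvd t).
move=> Ot;split.
- by move=> f [a Oa ->];apply: OM.
- by exists 0;rewrite ?mul0r.
- by move=> f g [a Oa ->] [b Ob ->];exists (a + b);rewrite ?mulrDl//;apply: OD.
- by move=> a f Oa [b Ob ->];exists (a * b);rewrite ?mulrA//;apply: OM.
Qed.

Fixpoint ospan (s : seq K) (f : K) : Prop :=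
 if s is a :: s' then exists2 c, O c & ospan s' (f - c * a) else f = 0.

Lemma ospan_ideal J s f : oideal J -> (forall a, a \in s -> J a) -> ospan s f -> J f.
move=> [JO J0 JD JM];elim: s f => [|a s IHs] f h;first by move=> ->.
case=> c Oc /IHs hf;rewrite -[f](subrK (c * a));apply: (JD).
 by apply: hf => b bs;apply: h;rewrite inE bs orbT.
by apply: (JM) => //;apply: h;rewrite inE eqxx.
Qed.

Hypothesis noeth : forall S : set K, S `<=` O -> exists s : seq K,
 (forall a, a \in s -> S a) /\ (forall f, S f -> ospan s f).

Definition mxi (f : K) := exists a b, [/\ O a, O b & f = a * u + b * v].
Hypothesis mx1 : ~ mxi 1.
Hypothesis Oinv : forall f, O f -> ~ mxi f -> O f^-1.

Lemma mxi_ideal : oideal mxi.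
split.
- by move=> f [a [b [Oa Ob ->]]];apply: OD;apply: OM.
- by exists 0, 0;rewrite !mul0r addr0.
- move=> f g [a [b [Oa Ob ->]]] [c [d [Oc Od ->]]];exists (a + c), (b + d).
 by rewrite !mulrDl addrACA;split=> //;apply: OD.
- move=> c f Oc [a [b [Oa Ob ->]]];exists (c * a), (c * b).
 by rewrite mulrDr !mulrA;split=> //;apply: OM.
Qed.
Let mu : mxi u. by exists 1, 0;rewrite mul1r mul0r addr0. Qed.
Let mv : mxi v. by exists 0, 1;rewrite mul1r mul0r add0r. Qed.

Lemma one_sub_unit e : mxi e -> O (1 - e)^-1 /\ 1 - e != 0.
move=> me;have [mO m0 mD mM] := mxi_ideal.
have nm : ~ mxi (1 - e) by move=> h;apply: mx1;rewrite -(subrK e 1);apply: mD.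
split;first by apply: Oinv => //;apply: OB => //;apply: mO.
by apply/eqP => e0;apply: nm;rewrite e0.
Qed.

(** Generators of N modulo J are eliminated one at a time; each satisfies a relation with
    coefficient 1 - e, e in the maximal ideal, and is solved for. *)
Lemma nakayama (J N : set K) : oideal J -> oideal N ->
 (forall x, N x -> exists a b j, [/\ N a, N b, J j & x = u * a + v * b + j]) ->
 N `<=` J.
move=> iJ iN h;have [JO J0 JD JM] := iJ;have [NO N0 ND NM] := iN.
have [s [sN gs]] := noeth NO.
have [t [tN gt]] : exists t, (forall a, a \in t -> N a) /\
  forall x, N x -> exists2 j, J j & ospan t (x - j).
 by exists s;split=> // Nx;exists 0;rewrite ?subr0//;apply: gs.
elim: t tN gt => [|a t IHt] tN gt.
 by move=> x /gt [j Jj /eqP];rewrite subr_eq0 => /eqP ->.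
apply: (IHt) => [b bt|];first by apply: tN;rewrite inE bt orbT.
have red x : N x -> exists c j, [/\ O c, J j & ospan t (x - j - c * a)].
 by move=> /gt [j Jj [c Oc hc]];exists c, j.
have spD f g : ospan t f -> ospan t g -> ospan t (f + g).
 elim: t f g {tN gt red IHt} => [|b t IHt] f g;first by move=> -> ->;rewrite addr0.
 move=> [c Oc hc] [d Od hd];exists (c + d);first exact: OD.
 by rewrite mulrDl opprD addrACA;apply: (IHt).
have spM c f : O c -> ospan t f -> ospan t (c * f).
 elim: t f {tN gt red spD IHt} => [|b t IHt] f Oc;first by move=> ->;rewrite mulr0.
 move=> [d Od hd];exists (c * d);first exact: OM.
 by rewrite -mulrA -mulrBr;apply: (IHt).
have [x1 [x2 [j [N1 N2 Jj ea]]]] := h a (tN _ (mem_head _ _)).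
have [c1 [j1 [Oc1 Jj1 s1]]] := red _ N1;have [c2 [j2 [Oc2 Jj2 s2]]] := red _ N2.
pose e := u * c1 + v * c2.
have me : mxi e by exists c1, c2;rewrite /e mulrC (mulrC v).
have [Oi ni] := one_sub_unit me;pose i := (1 - e)^-1.
pose ja := i * (u * j1 + v * j2 + j).
have Jja : J ja by apply: (JM) => //;apply: (JD) => //;apply: (JD);apply: (JM).
have sa : ospan t (a - ja).
 have -> : a - ja = i * (u * (x1 - j1 - c1 * a) + v * (x2 - j2 - c2 * a)).
  have ai : a = i * ((1 - e) * a) by rewrite mulrA mulVf// mul1r.
  rewrite {1}ai -mulrBr;rewrite {1}mulrBl {1}ea /e;ring.
 by apply: (spM) => //;apply: (spD);apply: (spM).
move=> x /red [c [j' [Oc Jj' sx]]];exists (j' + c * ja).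
 by apply: (JD) => //;apply: (JM).
have -> : x - (j' + c * ja) = (x - j' - c * a) + c * (a - ja) by ring.
by apply: (spD) => //;apply: (spM).
Qed.

Lemma ideal_avoiding (B C : set K) : oideal B -> (forall x, B x -> ~ C x) ->
 exists Q : set K, [/\ oideal Q, B `<=` Q, forall x, Q x -> ~ C x &
  forall h, O h -> ~ Q h -> exists a q, [/\ O a, Q q & C (q + a * h)]].
move=> iB BC.
pose P (A : set K) := oideal (A `|` B) /\ forall x, (A `|` B) x -> ~ C x.
have [|A [[iA hA] maxA]] := @Zorn_bigcup _ P.
 move=> F FP Ftot;split;last first.
  by move=> x [[A FA Ax]|/BC//];have [_] := FP _ FA;apply;left.
 have [BO B0 BD BM] := iB;split.
 - by move=> x [[A FA Ax]|/BO//];have [[h _ _ _] _] := FP _ FA;apply: h;left.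
 - by right.
 - move=> f g [[A FA Af]|Bf] [[A' FA' A'g]|Bg].
  + have [AA'|A'A] := Ftot _ _ FA FA'.
  have [[_ _ h _] _] := FP _ FA'.
  have [] := h f g;[by left;apply: AA'|by left| |by right].
  by left;exists A'.
  have [[_ _ h _] _] := FP _ FA.
  have [] := h f g;[by left|by left;apply: A'A| |by right].
  by left;exists A.
  + have [[_ _ h _] _] := FP _ FA;have [] := h f g;[by left|by right| |by right].
  by left;exists A.
  + have [[_ _ h _] _] := FP _ FA';have [] := h f g;[by right|by left| |by right].
  by left;exists A'.
  + by right;apply: (BD).
 - move=> a f Oa [[A FA Af]|Bf];last by right;apply: (BM).
  have [[_ _ _ h] _] := FP _ FA;have [] := h a f;[by []|by left| |by right].
  by left;exists A.
exists (A `|` B);split => //.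
move=> h Oh nh;apply: contrapT => no;have [AO A0 AD AM] := iA.
pose A' := [set x | exists a q, [/\ O a, (A `|` B) q & x = q + a * h]].
have AA' : A `|` B `<=` A' by move=> x Ax;exists 0, x;rewrite mul0r addr0.
have e' : A' `|` B = A'.
 by apply/seteqP;split=> x;[case=> // Bx;apply: AA';right|left].
have sAA' : A `<` A'.
 split;first by move=> x Ax;apply: AA';left.
 move=> A'A;apply: nh;left;apply: A'A;exists 1, 0.
 by rewrite mul1r add0r.
apply: (maxA A' sAA');split;rewrite e';last first.
 by move=> x [a [q [Oa Aq ->]]] Cx;apply: no;exists a, q.
split.
- by move=> x [a [q [Oa Aq ->]]];apply: OD;[apply: AO|apply: OM].
- exact: AA'.
- move=> x y [a [q [Oa Aq ->]]] [a' [q' [Oa' Aq' ->]]];exists (a + a'), (q + q').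
 by split;[exact: OD|exact: (AD)|rewrite mulrDl addrACA].
- move=> c x Oc [a [q [Oa Aq ->]]];exists (c * a), (c * q).
 by split;[exact: OM|exact: (AM)|rewrite mulrDr mulrA].
Qed.

Fixpoint mpow n (f : K) : Prop :=
 if n is n'.+1 then exists a b, [/\ mpow n' a, mpow n' b & f = u * a + v * b] else O f.

Lemma mpow_ideal n : oideal (mpow n).
elim: n => [|n [PO P0 PD PM]];first by split.
split.
- by move=> f [a [b [/PO Oa /PO Ob ->]]];apply: OD;apply: OM.
- by exists 0, 0;rewrite !mulr0 addr0.
- move=> f g [a [b [Pa Pb ->]]] [c [d [Pc Pd ->]]];exists (a + c), (b + d).
 by split;[exact: (PD)|exact: (PD)|rewrite !mulrDr addrACA].
- move=> c f Oc [a [b [Pa Pb ->]]];exists (c * a), (c * b).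
 by split;[exact: (PM)|exact: (PM)|rewrite mulrDr !(mulrCA c)].
Qed.

Lemma mpow_mul n e f : mxi e -> mpow n f -> mpow n.+1 (e * f).
move=> [a [b [Oa Ob ->]]] hf;have [_ _ _ PM] := mpow_ideal n.
exists (a * f), (b * f);split;[exact: (PM)|exact: (PM)|ring].
Qed.

Lemma mpow_in J a n : oideal J -> J (u ^+ a) -> J (v ^+ n) -> mpow (a + n) `<=` J.
move=> [JO J0 JD JM] Ja Jn f.
suff main N i j f' : (a + n <= N + (i + j))%N -> mpow N f' -> J (u ^+ i * v ^+ j * f').
 by move=> /(main _ 0%N 0%N);rewrite !mul1r;apply;rewrite !addn0.
elim: N i j f' => [|N IHN] i j f' le.
 move=> Of;have [ai|ia] := leqP a i.
  rewrite -(subnK ai) exprD.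
  have -> : u ^+ (i - a) * u ^+ a * v ^+ j * f' = (u ^+ (i - a) * v ^+ j * f') * u ^+ a by ring.
  by apply: (JM) => //;apply: OM => //;apply: OM;apply: OX.
 have nj : (n <= j)%N by lia.
 rewrite -(subnK nj) exprD.
 have -> : u ^+ i * (v ^+ (j - n) * v ^+ n) * f' = (u ^+ i * v ^+ (j - n) * f') * v ^+ n by ring.
 by apply: (JM) => //;apply: OM => //;apply: OM;apply: OX.
move=> [x [y [hx hy ->]]].
have -> : u ^+ i * v ^+ j * (u * x + v * y) =
  u ^+ i.+1 * v ^+ j * x + u ^+ i * v ^+ j.+1 * y by rewrite !exprS;ring.
apply: (JD);apply: (IHN) => //;lia.
Qed.

(** Krull's intersection theorem modulo J, by Zorn's lemma. Let N be the intersection of the J + m^n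
    and M = mN + J. An ideal Q containing M and maximal with the intersection of Q and N inside M
    contains a power of m; hence N lies in Q, so in M, and Nakayama puts N inside J. *)
Lemma krull J x : oideal J -> O x ->
 (forall n, exists2 w, mpow n w & J (x - w)) -> J x.
move=> iJ Ox hx;have [JO J0 JD JM] := iJ.
pose N : set K := fun x => O x /\ forall n, exists2 w, mpow n w & J (x - w).
have iN : oideal N.
 split.
 - by move=> f [].
 - by split=> // n;exists 0;rewrite ?subrr;have [] := mpow_ideal n.
 - move=> f g [Of hf] [Og hg];split=> [|n];first exact: OD.
  have [w1 h1 J1] := hf n;have [w2 h2 J2] := hg n;have [_ _ PD _] := mpow_ideal n.
  by exists (w1 + w2);[exact: (PD)|rewrite opprD addrACA;apply: (JD)].
 - move=> a f Oa [Of hf];split=> [|n];first exact: OM.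
  have [w h1 J1] := hf n;have [_ _ _ PM] := mpow_ideal n.
  by exists (a * w);[exact: (PM)|rewrite -mulrBr;apply: (JM)].
have [NO N0 ND NM] := iN.
pose M : set K := fun x => exists a b j, [/\ N a, N b, J j & x = u * a + v * b + j].
have iM : oideal M.
 split.
 - by move=> f [a [b [j [/NO Na /NO Nb /JO Jj ->]]]];apply: OD => //;apply: OD;apply: OM.
 - by exists 0, 0, 0;rewrite !mulr0 !addr0.
 - move=> f g [a [b [j [Na Nb Jj ->]]]] [a' [b' [j' [Na' Nb' Jj' ->]]]].
  exists (a + a'), (b + b'), (j + j');split;[exact: (ND)|exact: (ND)|exact: (JD)|ring].
 - move=> c f Oc [a [b [j [Na Nb Jj ->]]]];exists (c * a), (c * b), (c * j).
  split;[exact: (NM)|exact: (NM)|exact: (JM)|ring].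
have [Q [iQ MQ QN maxQ]] := @ideal_avoiding M (fun x => N x /\ ~ M x) iM
 (fun x Mx h => proj2 h Mx).
have QNM y : Q y -> N y -> M y by move=> Qy Ny;apply: contrapT => nM;apply: (QN y).
have [QO Q0 QD QM] := iQ.
have mNM e y : mxi e -> N y -> M (e * y).
 move=> [a [b [Oa Ob ->]]] Ny;exists (a * y), (b * y), 0.
 split;[exact: (NM)|exact: (NM)|exact: J0|ring].
(* The ideals (Q : e^n) become constant at some n. Were e^n outside Q, maximality would give an
   element q + a e^n of N outside M. Its product with e lies in M, so a e^(n+1), and then a e^n,
   lies in Q, which puts the element in M after all. *)
have nil e : mxi e -> exists n, Q (e ^+ n).
 move=> me;have Oe : O e by have [h _ _ _] := mxi_ideal;apply: h.
 have [s [hs gs]] := noeth (S := [set r | O r /\ exists n, Q (e ^+ n * r)]) (fun _ => @proj1 _ _).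
 have [n hn] : exists n, forall r, r \in s -> Q (e ^+ n * r).
  elim: s hs {gs} => [|r s IHs] hs;first by exists 0%N.
  have [|n hn] := IHs;first by move=> r' r's;apply: hs;rewrite inE r's orbT.
  have [Or [n' hn']] := hs r (mem_head _ _);exists (n + n')%N => r'.
  rewrite inE => /orP [/eqP ->|/hn h];first by rewrite exprD -mulrA;apply: (QM) => //;apply: OX.
  by rewrite exprD mulrAC mulrC;apply: (QM) => //;apply: OX.
 have st r : O r -> Q (e ^+ n.+1 * r) -> Q (e ^+ n * r).
  move=> Or hr;have : ospan s r by apply: gs;split=> //;exists n.+1.
  have : oideal [set y | O y /\ Q (e ^+ n * y)].
  split;[by move=> y []|by rewrite /= mulr0| |].
  - by move=> f g [Of hf] [Og hg];split;[exact: OD|rewrite mulrDr;apply: (QD)].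
  - by move=> c f Oc [Of hf];split;[exact: OM|rewrite mulrCA;apply: (QM)].
  move=> id /(ospan_ideal id) [];last by [].
  by move=> r' r's;split;[case: (hs _ r's)|exact: hn].
 exists n;apply: contrapT => nq.
 have [a [q [Oa Qq [Ny nM]]]] := maxQ (e ^+ n) (OX n Oe) nq.
 apply: nM;apply: QNM => //;apply: (QD) => //;rewrite mulrC;apply: st => //.
 have -> : e ^+ n.+1 * a = e * (q + a * e ^+ n) - e * q by rewrite exprS;ring.
 apply: oidealB => //;last exact: (QM).
 by apply: MQ;apply: (mNM).
have [n1 h1] := nil u mu;have [n2 h2] := nil v mv.
apply: (nakayama iJ iN _ (conj Ox hx)) => y Ny.
apply: QNM => //;have [_ /(_ (n1 + n2)%N) [w hw Jyw]] := Ny.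
rewrite -[y](subrK w);apply: (QD);last exact: (mpow_in iQ h1 h2).
by apply: MQ;exists 0, 0, (y - w);rewrite !mulr0 !add0r.
Qed.

Definition oprime (Q : set K) := [/\ oideal Q, ~ Q 1 &
 forall f g, O f -> O g -> Q (f * g) -> Q f \/ Q g].

Lemma oprime_avoiding (B : set K) h : oideal B -> O h -> (forall n, ~ B (h ^+ n)) ->
 exists Q, [/\ oprime Q, B `<=` Q & ~ Q h].
move=> iB Oh hB;have [|Q [iQ BQ QC maxQ]] := @ideal_avoiding B (fun x => exists n, x = h ^+ n) iB.
 by move=> x Bx [n e];apply: (hB n);rewrite -e.
have [QO Q0 QD QM] := iQ.
exists Q;split=> //;last by move=> Qh;apply: (QC h Qh);exists 1%N.
split=> //;first by move=> Q1;apply: (QC 1 Q1);exists 0%N.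
move=> f g Of Og Qfg;apply: contrapT => /not_orP [nf ng].
have [a [q [Oa Qq [n e]]]] := maxQ _ Of nf;have [b [r [Ob Qr [n' e']]]] := maxQ _ Og ng.
apply: (QC (h ^+ (n + n')%N));last by exists (n + n')%N.
rewrite exprD -e -e'.
have -> : (q + a * f) * (r + b * g) = (r + b * g) * q + a * f * r + a * b * (f * g) by ring.
apply: (QD);first apply: (QD);apply: (QM) => //.
- apply: OD;[exact: QO|exact: OM].
- exact: OM.
- exact: OM.
Qed.

(** Modulo u, an element not divisible by u is a unit times a power of v. An element t of Q for
    which this power is minimal generates Q modulo uQ, because Q is prime and does not contain u;
    Nakayama then gives Q = (t). *)
Lemma prime_principal_aux (Q : set K) : oprime Q -> (exists2 f, Q f & f != 0) -> ~ Q u ->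
 (forall f, mxi f -> exists a b, [/\ O a, O b & f = a * u + b * v]) ->
 exists2 t, Q t & Q `<=` odvd t.
move=> [iQ Q1 prQ] [f0 Qf0 nf0] nQu _;have [QO Q0 QD QM] := iQ.
have iu : oideal (odvd u) by exact: oideal_dvd.
have divu x : Q x -> odvd u x -> exists2 y, Q y & x = u * y.
 move=> Qx [y Oy e];exists y;last by rewrite mulrC.
 by move: Qx;rewrite e => /prQ [].
have iz : oideal [set 0].
 split=> //;first by move=> _ ->.
  by move=> f g -> ->;rewrite addr0.
 by move=> a f _ ->;rewrite mulr0.
(* The expansion along powers of v must stop at a unit coefficient; otherwise x lies in (u) + m^n
   for all n, hence in (u) by Krull. *)
have dec x : O x -> ~ odvd u x -> exists n e w, [/\ O e, ~ mxi e, O w & x = v ^+ n * e + u * w].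
 move=> Ox nu;apply: contrapT => no;apply: nu;apply: krull => // n.
 suff [e [w [Oe Ow ->]]] : exists e w, [/\ O e, O w & x = v ^+ n * e + u * w].
  exists (v ^+ n * e);last by exists w => //;rewrite addrAC subrr add0r mulrC.
  elim: n {no} => [|n IHn];first by rewrite mul1r.
  by rewrite exprS -mulrA;apply: mpow_mul.
 elim: n => [|n [e [w [Oe Ow ex]]]].
  by exists x, 0;rewrite mul1r mulr0 addr0.
 have [[a [b [Oa Ob ee]]]|ne] := pselect (mxi e);last by case: no;exists n, e, w.
 exists b, (w + v ^+ n * a);split=> //.
  by apply: OD => //;apply: OM => //;apply: OX.
 rewrite ex ee exprS;ring.
have [x1 [Qx1 nx1]] : exists x, Q x /\ ~ odvd u x.
 apply: contrapT => /forallNP no.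
 suff /(_ _ Qf0) /eqP : Q `<=` [set 0] by rewrite (negbTE nf0).
 apply: (nakayama iz iQ) => x Qx.
 have [y Qy ->] : exists2 y, Q y & x = u * y.
  by apply: divu;apply: contrapT => h;apply: (no x).
 by exists y, 0, 0;rewrite mulr0 !addr0.
pose good (z : K * nat) := exists e w, [/\ Q z.1, O e, ~ mxi e, O w & z.1 = v ^+ z.2 * e + u * w].
have [[t n] [[e [w [/= Qt Oe ne Ow et]]] minn]] : exists z, good z /\ forall z', good z' -> (z.2 <= z'.2)%N.
 apply: ex_minimal;have [n [e [w [Oe ne Ow ex]]]] := dec _ (QO _ Qx1) nx1.
 by exists (x1, n), e, w.
exists t => //;apply: (nakayama (oideal_dvd (QO _ Qt)) iQ) => x Qx.
have [ux|nux] := pselect (odvd u x).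
 have [y Qy ->] := divu _ Qx ux;exists y, 0, 0;rewrite mulr0 !addr0;split=> //.
 by exists 0;rewrite ?mul0r.
have [n' [e' [w' [Oe' ne' Ow' ex]]]] := dec _ (QO _ Qx) nux.
have nn' : (n <= n')%N by apply: (minn (x, n'));exists e', w'.
have Oi := Oinv Oe ne;have n0 : e != 0.
 by apply/eqP => e0;apply: ne;rewrite e0;have [] := mxi_ideal.
pose c := e^-1 * e' * v ^+ (n' - n).
have Oc : O c by apply: OM;[exact: OM|exact: OX].
have [||y Qy ey] := divu (x - c * t).
- by apply: oidealB => //;apply: (QM).
- exists (w' - c * w);first by apply: OB => //;apply: OM.
 rewrite ex et -(subnK nn') exprD /c.
 have -> : e^-1 * e' * v ^+ (n' - n) * (v ^+ n * e + u * w) =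
  v ^+ (n' - n) * v ^+ n * e' * (e^-1 * e) + e^-1 * e' * v ^+ (n' - n) * (u * w) by ring.
 rewrite mulVf//;ring.
exists y, 0, (c * t);rewrite mulr0 addr0 -ey subrK;split=> //.
by exists c.
Qed.
End LocalRing.

(** * Reversed polynomials, for expansions at a pole *)

Section RevPoly.
Variable F : fieldType.

Definition revp d (P : {poly F}) : {poly F} := \poly_(i < d.+1) P`_(d - i).

Lemma revp0 d (P : {poly F}) : (revp d P)`_0 = P`_d.
by rewrite coef_poly subn0. Qed.

Lemma revp_neq0 d (P : {poly F}) : P != 0 -> (size P <= d.+1)%N -> revp d P != 0.
move=> nP sP;apply: contraNneq nP => e;apply/eqP/polyP => i;rewrite coef0.
have [le|lt] := leqP i d;last by rewrite nth_default//;apply: leq_trans sP _.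
have : (revp d P)`_(d - i) = 0 by rewrite e coef0.
by rewrite coef_poly ltnS leq_subr subKn.
Qed.

Lemma revp_horner (L : fieldType) (f : {rmorphism F -> L}) d (P : {poly F}) (t : L) : t != 0 -> (size P <= d.+1)%N ->
 (map_poly f (revp d P)).[t] = t ^+ d * (map_poly f P).[t^-1].
move=> nt sP;rewrite (horner_coef_wide (n := d.+1));last by rewrite size_map_poly size_poly.
rewrite (horner_coef_wide (n := d.+1));last by rewrite size_map_poly.
rewrite mulr_sumr (reindex_inj rev_ord_inj);apply: eq_bigr => i _.
have le : (i <= d)%N := ltn_ord i.
rewrite !coef_map coef_poly /= subSS ltnS leq_subr subKn// mulrCA.
have -> : t ^+ d = t ^+ (d - i) * t ^+ i by rewrite -exprD subnK.
by rewrite exprVn -mulrA mulfV ?mulr1 ?expf_neq0.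
Qed.
End RevPoly.

Section Surface.
Context (k : closedFieldType) (X : projective_variety k).
Local Notation K := (fun_field X).
Local Notation form := {mpoly k[(pdim X).+1]}.
Local Notation pt := (ppoint k (pdim X)).
Local Notation div := (set pt -> int).
Local Notation cst := (@const k X).
Local Notation gev := (@geval k X).
Local Notation fq y F d := (gev F / gev y ^+ d).
Local Notation van := vanishes_on.
Local Notation cdiv := curve_divisor.
Local Notation Xpts := (@points k X).
Local Notation lr := (@local_ring k X).
Local Notation mi := (@max_ideal k X).
Local Notation mx p := (@max_ideal k X [set p]).
Local Notation hqd := (@has_quot_dim k X).
Local Notation pdiv C := (@prime_divisor k X C).
Local Notation der := (@derivation k X).

(** * Dimensions of subquotients of the function field *)

Section QuotDim.
Implicit Types (A B J : set K).

Definition ksub A :=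
 [/\ A 0, forall f g, A f -> A g -> A (f + g) & forall c f, A f -> A (cst c * f)].

Lemma ksub0 A : ksub A -> A 0. by case. Qed.
Lemma ksubD A f g : ksub A -> A f -> A g -> A (f + g). case=> _ h _;apply: h. Qed.
Lemma ksubZ A c f : ksub A -> A f -> A (cst c * f). case=> _ _;apply. Qed.
Lemma ksubN A f : ksub A -> A f -> A (- f).
by move=> sA /(ksubZ (-1) sA);rewrite rmorphN1 mulN1r. Qed.
Lemma ksubB A f g : ksub A -> A f -> A g -> A (f - g).
by move=> sA Af Ag;apply: ksubD => //;apply: ksubN. Qed.
Lemma ksub_sum A (I : Type) (r : seq I) (P : pred I) (F : I -> K) :
 ksub A -> (forall i, P i -> A (F i)) -> A (\sum_(i <- r | P i) F i).
move=> sA h;elim/big_ind: _ => //;[exact: ksub0 | move=> f g;exact: ksubD].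
Qed.
Lemma ksub_transD A f g : ksub A -> A f -> A (f + g) -> A g.
by move=> sA Af /(ksubB sA)/(_ Af);rewrite addrAC subrr add0r. Qed.

Definition lcomb n (e : 'I_n -> K) (c : 'rV[k]_n) : K := \sum_i cst (c 0 i) * e i.

Lemma lcombD n (e : 'I_n -> K) c d : lcomb e (c + d) = lcomb e c + lcomb e d.
by rewrite -big_split;apply: eq_bigr => i _;rewrite mxE rmorphD mulrDl. Qed.
Lemma lcombN n (e : 'I_n -> K) c : lcomb e (- c) = - lcomb e c.
by rewrite -sumrN;apply: eq_bigr => i _;rewrite mxE rmorphN mulNr. Qed.
Lemma lcombB n (e : 'I_n -> K) c d : lcomb e (c - d) = lcomb e c - lcomb e d.
by rewrite lcombD lcombN. Qed.
Lemma lcombZ n (e : 'I_n -> K) a c : lcomb e (a *: c) = cst a * lcomb e c.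
by rewrite mulr_sumr;apply: eq_bigr => i _;rewrite mxE rmorphM mulrA. Qed.
Lemma lcomb0 n (e : 'I_n -> K) : lcomb e 0 = 0.
by rewrite /lcomb big1// => i _;rewrite mxE rmorph0 mul0r. Qed.
Lemma lcomb_in A n (e : 'I_n -> K) c : ksub A -> (forall i, A (e i)) -> A (lcomb e c).
by move=> sA h;apply: ksub_sum => // i _;apply: ksubZ. Qed.
Lemma lcomb_delta n (e : 'I_n -> K) i : lcomb e (delta_mx 0 i) = e i.
rewrite /lcomb (bigD1 i)//= big1 ?addr0 ?mxE ?eqxx ?rmorph1 ?mul1r// => j ne.
by rewrite mxE (negbTE ne) rmorph0 mul0r.
Qed.

Definition catfam m n (e : 'I_m -> K) (d : 'I_n -> K) (i : 'I_(m + n)) : K :=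
 match fintype.split i with inl a => e a | inr b => d b end.

Lemma lcomb_cat m n (e : 'I_m -> K) (d : 'I_n -> K) c :
 lcomb (catfam e d) c = lcomb e (lsubmx c) + lcomb d (rsubmx c).
rewrite /lcomb big_split_ord;congr (_ + _);apply: eq_bigr => i _;rewrite mxE /catfam.
 by rewrite (unsplitK (inl i : 'I_m + 'I_n)).
by rewrite (unsplitK (inr i : 'I_m + 'I_n)).
Qed.

Lemma hqdP A J n : ksub A -> ksub J ->
 hqd A J n <-> exists e : 'I_n -> K, [/\ forall i, A (e i),
  forall f, A f -> exists c, J (f - lcomb e c) & forall c, J (lcomb e c) -> c = 0].
move=> sA sJ;split=> -[e].
 move=> [Ae h];exists e;split=> // [f /h [c [Jc _]]|c Jc];first by exists c.
 have [c0 [_ u]] := h 0 (ksub0 sA).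
 rewrite -(u c) ?(u 0)//.
  by have := lcomb0 e;rewrite /lcomb => ->;rewrite subr0;apply: ksub0.
 by rewrite sub0r;apply: ksubN.
move=> [Ae gen fr];exists e;split=> // f /gen [c Jc];exists c;split=> // d Jd.
apply/eqP;rewrite -subr_eq0;apply/eqP/fr;rewrite lcombB.
rewrite -[lcomb e c](subrK f) -addrA;apply: ksubD => //.
by rewrite -opprB;apply: ksubN.
Qed.

Lemma hqd_add A B J m n : ksub A -> ksub B -> ksub J ->
 J `<=` B -> B `<=` A -> hqd A B m -> hqd B J n -> hqd A J (m + n).
move=> sA sB sJ JB BA /(hqdP _ sA sB) [e [Ae ge fe]] /(hqdP _ sB sJ) [d [Bd gd fd]].
apply/(hqdP _ sA sJ);exists (catfam e d);split.
- move=> i;rewrite /catfam;case: (fintype.split i) => a;[exact: Ae | apply/BA/Bd].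
- move=> f /ge [c /gd [c' Jc]];exists (row_mx c c').
 by rewrite lcomb_cat row_mxKl row_mxKr opprD addrA.
- move=> c;rewrite lcomb_cat => Jc.
 have Bl : B (lcomb e (lsubmx c)).
  by apply: (ksub_transD sB (lcomb_in (rsubmx c) sB Bd));rewrite addrC;apply: JB.
 move/fe: Bl => l0;move: Jc;rewrite l0 lcomb0 add0r => /fd r0.
 by rewrite -[c]hsubmxK l0 r0 row_mx0.
Qed.

Lemma hqd0 A J : ksub A -> ksub J -> A `<=` J -> hqd A J 0.
move=> sA sJ AJ;apply/(hqdP _ sA sJ);exists (fun=> 0);split=> [i|f Af|c _].
- exact: ksub0.
- by exists 0;rewrite lcomb0 subr0;apply: AJ.
- by rewrite thinmx0.
Qed.

Lemma hqd_uniq A J m n : ksub A -> ksub J -> hqd A J m -> hqd A J n -> m = n.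
move=> sA sJ.
suff le : forall m n, hqd A J m -> hqd A J n -> (m <= n)%N.
 by move=> hm hn;apply/eqP;rewrite eqn_leq !le.
move=> {}m {}n /(hqdP _ sA sJ) [e [Ae ge fe]] /(hqdP _ sA sJ) [d [Ad gd fd]].
have /choice [M hM] i : exists c, J (e i - lcomb d c) by apply: gd.
pose N : 'M[k]_(m, n) := \matrix_i M i.
have key c : J (lcomb e c - lcomb d (c *m N)).
 have -> : lcomb e c - lcomb d (c *m N) = \sum_i cst (c 0 i) * (e i - lcomb d (M i)).
  rewrite (eq_bigr (fun i => cst (c 0 i) * e i - cst (c 0 i) * lcomb d (M i))).
  rewrite sumrB;congr (_ - _).
  under [RHS]eq_bigr do rewrite mulr_sumr.
  rewrite exchange_big;apply: eq_bigr => j _.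
  rewrite mxE rmorph_sum mulr_suml;apply: eq_bigr => i.
  by rewrite mxE rmorphM mulrA.
  by move=> i _;rewrite mulrBr.
 by apply: ksub_sum => // i _;apply: ksubZ.
have : row_free N.
 rewrite -kermx_eq0;apply/eqP/row_matrixP => i;rewrite row0;apply: fe.
 have := key (row i (kermx N)).
 by rewrite -row_mul mulmx_ker row0 lcomb0 subr0.
rewrite /row_free => /eqP <-;apply: rank_leq_col.
Qed.

(** The family e spans A modulo J from outside: its members need not lie in A. Its last vector is
    removed by passing to the part A' of A spanned by the others, and A/A' has dimension at most
    one. *)
Lemma hqd_fin n (e : 'I_n -> K) A J : ksub A -> ksub J -> J `<=` A ->
 (forall f, A f -> exists c, J (f - lcomb e c)) -> exists2 m, (m <= n)%N & hqd A J m.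
elim: n e A => [|n IHn] e A sA sJ JA h.
 exists 0%N => //;apply: hqd0 => // f /h [c].
 by rewrite /lcomb big_ord0 subr0.
pose e' i := e (widen_ord (leqnSn n) i).
have eE c : lcomb e c = lcomb e' (\row_i c 0 (widen_ord (leqnSn n) i))
  + cst (c 0 ord_max) * e ord_max.
 by rewrite /lcomb big_ord_recr;congr (_ + _);apply: eq_bigr => i _;rewrite mxE.
pose A' : set K := fun f => A f /\ exists c, J (f - lcomb e' c).
have sA' : ksub A'.
 split.
 - by split;[exact: ksub0 | exists 0;rewrite lcomb0 subr0;apply: ksub0].
 - move=> f g [Af [c Jc]] [Ag [d Jd]];split;first exact: ksubD.
  by exists (c + d);rewrite lcombD opprD addrACA;apply: ksubD.
 - move=> a f [Af [c Jc]];split;first exact: ksubZ.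
  by exists (a *: c);rewrite lcombZ -mulrBr;apply: ksubZ.
have JA' : J `<=` A'.
 by move=> Jf;split;[exact: JA | exists 0;rewrite lcomb0 subr0].
have A'A : A' `<=` A by move=> f [].
have [m mn hm] := IHn e' A' sA' sJ JA' (fun f h => proj2 h).
have [AA'|] := pselect (A `<=` A').
 have <- : A' = A by apply/seteqP.
 by exists m => //;apply: leqW.
move=> /existsNP [f0 /not_implyP [Af0 nA'f0]].
have [c0 Jc0] := h _ Af0.
have nz : c0 0 ord_max != 0.
 apply: contra_notN nA'f0 => /eqP z;split=> //.
 exists (\row_i c0 0 (widen_ord (leqnSn n) i)).
 by move: Jc0;rewrite eE z rmorph0 mul0r addr0.
exists m.+1 => //;apply: (@hqd_add A A' J 1 m) => //.
apply/(hqdP _ sA sA');exists (fun=> f0);split=> //.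
- move=> f Af;have [c Jc] := h _ Af.
 pose a := c 0 ord_max / c0 0 ord_max.
 exists (const_mx a);rewrite /lcomb big_ord1 mxE;split.
  by apply: ksubB => //;apply: ksubZ.
 exists ((\row_i c 0 (widen_ord (leqnSn n) i)) -
  a *: (\row_i c0 0 (widen_ord (leqnSn n) i))).
 rewrite lcombB lcombZ.
 move: (ksubB sJ Jc (ksubZ a sJ Jc0));rewrite !eE.
 congr J;rewrite mulrBr mulrDr mulrA -rmorphM divfK//.
 ring.
- move=> c;rewrite /lcomb big_ord1 => hc;apply/rowP => i;rewrite ord1 mxE.
 apply: contra_notP nA'f0 => /eqP nc.
 by rewrite -[f0]mul1r -(rmorph1 cst) -(mulVf nc) rmorphM -mulrA;apply: ksubZ.
Qed.
End QuotDim.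

(** * Local rings *)

Section Local.

Implicit Types (Z Y : set pt) (p q : pt) (F G : form).

Lemma gevM F G : gev (F * G) = gev F * gev G. by rewrite /geval rmorphM. Qed.
Lemma gevD F G : gev (F + G) = gev F + gev G. by rewrite /geval rmorphD. Qed.
Lemma gevB F G : gev (F - G) = gev F - gev G. by rewrite /geval rmorphB. Qed.
Lemma gevXn F m : gev (F ^+ m) = gev F ^+ m. by rewrite /geval rmorphXn. Qed.
Lemma gev0 : gev 0 = 0. by rewrite /geval rmorph0. Qed.
Lemma gev1 : gev 1 = 1. by rewrite /geval rmorph1. Qed.
Lemma gevC c : gev c%:MP = cst c. by rewrite /geval mmapC. Qed.
Lemma gevZ c F : gev (c *: F) = cst c * gev F. by rewrite -mul_mpolyC gevM gevC. Qed.
Lemma gevX i : gev 'X_i = @gen_pt k X i. by rewrite /geval mmapX mmap1U. Qed.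
Lemma gev_sum (I : Type) (r : seq I) (P : pred I) (F : I -> form) :
 gev (\sum_(i <- r | P i) F i) = \sum_(i <- r | P i) gev (F i).
by rewrite /geval rmorph_sum. Qed.
Lemma pevM p F G : peval (F * G) p = peval F p * peval G p. exact: mevalM. Qed.
Lemma pevD p F G : peval (F + G) p = peval F p + peval G p. exact: mevalD. Qed.
Lemma pevB p F G : peval (F - G) p = peval F p - peval G p. exact: mevalB. Qed.
Lemma pevXn p F m : peval (F ^+ m) p = peval F p ^+ m. exact: rmorphXn. Qed.
Lemma pev0 p : peval (0 : form) p = 0. exact: meval0. Qed.
Lemma pev1 p : peval (1 : form) p = 1. exact: meval1. Qed.
Lemma pevC p c : peval (c%:MP : form) p = c. exact: mevalC. Qed.
Lemma pevZ p c F : peval (c *: F) p = c * peval F p. exact: mevalZ. Qed.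
Lemma pevX p i : peval ('X_i : form) p = val p 0 i. exact: mevalXU. Qed.
Lemma homogX1 i : ('X_i : form) \is 1.-homog.
by rewrite dhomogX /= mdeg1. Qed.
Lemma homogC c : (c%:MP : form) \is 0.-homog.
rewrite -[c%:MP]mulr1 mul_mpolyC;apply: dhomogZ;apply: dhomog1. Qed.

Lemma exists_pt d F : F \is d.-homog -> gev F != 0 -> exists2 p, Xpts p & peval F p != 0.
move=> hF nF;have [i ni] := @gen_pt_neq0 k X.
have [p [hp np]] := nullst_proj ni hF nF.
by exists p.
Qed.

(** Primality of the homogeneous ideal without closedness. Points, curves and X itself are treated
    at once, so their local rings share one theory. *)
Definition prime_set Z := [/\ Z !=set0, Z `<=` Xpts &
 forall d e F G, F \is d.-homog -> G \is e.-homog -> van (F * G) Z ->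
  van F Z \/ van G Z].

Lemma prime_pt p : Xpts p -> prime_set [set p].
move=> Xp;split;[by exists p|by move=> _ ->|].
move=> d e F G _ _ /(_ p erefl);rewrite pevM => /eqP;rewrite mulf_eq0.
by case/orP => /eqP h;[left|right] => _ ->.
Qed.
Coercion prime_pt : points >-> prime_set.

Lemma vanishes_pt F p : van F [set p] <-> peval F p = 0.
by split=> [|h _ ->]//;apply. Qed.
Lemma pt_linear p : exists i, peval ('X_i : form) p = 1.
by have [i hi] := pt_coord p;exists i;rewrite pevX. Qed.

Lemma pt_coordinate p : exists i, [/\ peval ('X_i : form) p = 1, ('X_i : form) \is 1.-homog &
 ~ van ('X_i : form) [set p]].
have [i hi] := pt_linear p;exists i;split=> //;first exact: homogX1.
by move/vanishes_pt/eqP;rewrite hi oner_eq0.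
Qed.

Section PrimeSet.
Variables (Z : set pt).
Hypothesis pZ : prime_set Z.
Local Notation O := (lr Z).
Local Notation m := (mi Z).

Lemma gev_neq0 d G : G \is d.-homog -> ~ van G Z -> gev G != 0.
move=> hG nG;apply/eqP => e;apply: nG => p Zp.
have [_ /(_ _ Zp) Xp _] := pZ;apply: Xp hG e.
Qed.
Lemma nvanM d e F G : F \is d.-homog -> G \is e.-homog ->
 ~ van F Z -> ~ van G Z -> ~ van (F * G) Z.
by case: pZ => _ _ h hF hG nF nG /(h _ _ _ _ hF hG) []. Qed.
Lemma vanMr F G : van G Z -> van (F * G) Z.
by move=> h p /h e;rewrite pevM e mulr0. Qed.
Lemma nvan1 : ~ van (1 : form) Z.
by have [[p Zp] _ _] := pZ;move=> /(_ p Zp) /eqP;rewrite pev1 oner_eq0. Qed.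

Lemma lring_cst c : O (cst c).
exists 0%N, c%:MP, 1;split;[exact: homogC|exact: dhomog1|exact: nvan1|].
by rewrite gevC gev1 divr1.
Qed.
Lemma lring1 : O 1. rewrite -(rmorph1 cst);apply: lring_cst. Qed.
Lemma lring0 : O 0. rewrite -(rmorph0 cst);apply: lring_cst. Qed.

Lemma lringM f g : O f -> O g -> O (f * g).
move=> [d [F [G [hF hG nG ->]]]] [e [F' [G' [hF' hG' nG' ->]]]].
exists (d + e)%N, (F * F'), (G * G');split;rewrite ?dhomogM//;first exact: nvanM hG hG' nG nG'.
by rewrite !gevM mulf_div.
Qed.

Lemma lringD f g : O f -> O g -> O (f + g).
move=> [d [F [G [hF hG nG ->]]]] [e [F' [G' [hF' hG' nG' ->]]]].
exists (d + e)%N, (F * G' + F' * G), (G * G');split;rewrite ?dhomogM//.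
- apply: rpredD;[exact: dhomogM|rewrite addnC;exact: dhomogM].
- exact: nvanM hG hG' nG nG'.
- by rewrite gevD !gevM addf_div ?(gev_neq0 hG nG) ?(gev_neq0 hG' nG').
Qed.
Lemma lringN f : O f -> O (- f).
move=> Of;rewrite -mulN1r -(rmorphN1 cst);apply: lringM => //;apply: lring_cst. Qed.
Lemma lringB f g : O f -> O g -> O (f - g).
by move=> Of Og;apply: lringD => //;apply: lringN. Qed.
Lemma lringX f e : O f -> O (f ^+ e).
move=> Of;elim: e => [|e];rewrite ?exprS;[exact: lring1|exact: lringM]. Qed.
Lemma lring_sum (I : Type) (r : seq I) (P : pred I) (F : I -> K) :
 (forall i, P i -> O (F i)) -> O (\sum_(i <- r | P i) F i).
move=> h;apply: big_ind => //;[exact: lring0 | exact: lringD]. Qed.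

Lemma max_idealE d F G : F \is d.-homog -> G \is d.-homog -> ~ van G Z ->
 m (gev F / gev G) <-> van F Z.
move=> hF hG nG;split;last by move=> vF;exists d, F, G.
move=> [e [F' [G' [hF' hG' vF' nG']]]].
move=> /eqP;rewrite eqr_div ?(gev_neq0 hG nG) ?(gev_neq0 hG' nG')// => /eqP e1.
have : van (F * G') Z.
 move=> p Zp;have [_ /(_ _ Zp) Xp _] := pZ.
 have : gev (F * G' - F' * G) = 0 by rewrite gevB !gevM e1 subrr.
 have h : F * G' - F' * G \is (d + e).-homog.
  apply: rpredB;[exact: dhomogM|rewrite addnC;exact: dhomogM].
 by move/(Xp _ _ h);rewrite pevB [X in - X]pevM vF'// mul0r subr0.
by have [_ _ h] := pZ;case/(h _ _ _ _ hF hG').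
Qed.
Lemma max_sub f : m f -> O f.
by move=> [d [F [G [hF hG vF nG ->]]]];exists d, F, G. Qed.

Lemma max_not1 : ~ m 1.
have h : (1 : form) \is 0.-homog by exact: dhomog1.
have := max_idealE h h nvan1;rewrite gev1 divr1 => e /e;exact: nvan1.
Qed.

Lemma max0 : m 0.
exists 0%N, 0, 1;split;[by rewrite rpred0|exact: dhomog1| |exact: nvan1|].
 by move=> p _;rewrite pev0.
by rewrite gev0 mul0r.
Qed.

Lemma maxM f g : O f -> m g -> m (f * g).
move=> [d [F [G [hF hG nG ->]]]] [e [F' [G' [hF' hG' vF' nG' ->]]]].
exists (d + e)%N, (F * F'), (G * G');split;rewrite ?dhomogM//.
- exact: vanMr.
- exact: nvanM hG hG' nG nG'.
- by rewrite !gevM mulf_div.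
Qed.

Lemma maxD f g : m f -> m g -> m (f + g).
move=> [d [F [G [hF hG vF nG ->]]]] [e [F' [G' [hF' hG' vF' nG' ->]]]].
exists (d + e)%N, (F * G' + F' * G), (G * G');split;rewrite ?dhomogM//.
- apply: rpredD;[exact: dhomogM|rewrite addnC;exact: dhomogM].
- by move=> p Zp;rewrite pevD !pevM vF// vF'// !mul0r addr0.
- exact: nvanM hG hG' nG nG'.
- by rewrite gevD !gevM addf_div ?(gev_neq0 hG nG) ?(gev_neq0 hG' nG').
Qed.
Lemma maxN f : m f -> m (- f).
move=> mf;rewrite -mulN1r -(rmorphN1 cst);apply: maxM => //;apply: lring_cst. Qed.
Lemma maxB f g : m f -> m g -> m (f - g).
by move=> mf mg;apply: maxD => //;apply: maxN. Qed.
Lemma max_ksub : ksub m.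
split=> [|f g|c f];[exact: max0 | exact: maxD | apply: maxM;exact: lring_cst]. Qed.
Lemma lring_ksub : ksub O.
split=> [|f g|c f];[exact: lring0 | exact: lringD | apply: lringM;exact: lring_cst]. Qed.

Lemma max_prime f g : O f -> O g -> m (f * g) -> m f \/ m g.
move=> [d [F [G [hF hG nG ->]]]] [e [F' [G' [hF' hG' nG' ->]]]].
have hFF := dhomogM hF hF';have hGG := dhomogM hG hG'.
rewrite mulf_div -!gevM => /(max_idealE hFF hGG (nvanM hG hG' nG nG')) v.
by have [_ _ h] := pZ;case: (h _ _ _ _ hF hF' v) => w;
 [left;apply/(max_idealE hF hG nG)|right;apply/(max_idealE hF' hG' nG')].
Qed.
Lemma max_nunit f : m f -> f != 0 -> ~ O f^-1.
move=> mf nf /maxM /(_ mf);rewrite mulVf//;apply: max_not1. Qed.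

Lemma lring_inv f : O f -> ~ m f -> O f^-1 /\ ~ m f^-1.
move=> [d [F [G [hF hG nG ef]]]] nm;rewrite {}ef in nm *.
have nF : ~ van F Z by move=> vF;apply: nm;apply/(max_idealE hF hG nG).
rewrite invf_div;split;first by exists d, G, F.
by move/(max_idealE hG hF nF).
Qed.
Lemma lring_neq0 f : ~ m f -> f != 0.
move=> nm;apply/eqP => e;apply: nm;rewrite e;apply: max0. Qed.

Lemma max_exp f e : O f -> m (f ^+ e) -> m f.
move=> Of;elim: e => [|e IH];first by rewrite expr0 => /max_not1.
by rewrite exprS => /max_prime []//;apply: lringX.
Qed.
End PrimeSet.

Lemma lring_mono Z Y : prime_set Y -> Z `<=` Y ->
 lr Z `<=` lr Y.
move=> _ ZY f [d [F [G [hF hG nG ->]]]];exists d, F, G;split=> // v;apply: nG => p /ZY;exact: v.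
Qed.

Lemma local_idealE Y Z f : prime_set Y -> prime_set Z -> Z `<=` Y ->
 local_ideal Y Z f <-> lr Z f /\ mi Y f.
move=> pY pZ ZY.
have nm G : ~ van G Z -> ~ van G Y by move=> nG v;apply: nG => p /ZY;exact: v.
split.
 move=> [d [F [G [hF hG vF nG ->]]]];split;first by exists d, F, G.
 by exists d, F, G;split=> //;apply: nm.
move=> [[d [F [G [hF hG nG ->]]]]] /(max_idealE pY hF hG (nm _ nG)) vF.
by exists d, F, G.
Qed.

Lemma value_at p f : Xpts p -> O_at p f -> exists c, mx p (f - cst c).
move=> Xp [d [F [G [hF hG nG ->]]]];have nGp : peval G p != 0.
 by apply/eqP => e;apply: nG;apply/vanishes_pt.
exists (peval F p / peval G p).
exists d, (F - (peval F p / peval G p) *: G), G;split=> //.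
- by rewrite rpredB// dhomogZ.
- by apply/vanishes_pt;rewrite pevB pevZ divfK// subrr.
- rewrite gevB gevZ mulrBl mulfK// (gev_neq0 Xp hG)//.
Qed.

Lemma O_atP p f : O_at p f <-> exists d F G,
 [/\ F \is d.-homog, G \is d.-homog, peval G p != 0 & f = gev F / gev G].
split=> -[d [F [G [hF hG nG ->]]]];exists d, F, G;split=> //.
 by apply/eqP => e;apply: nG;apply/vanishes_pt.
by move/vanishes_pt => e;rewrite e eqxx in nG.
Qed.

Lemma m_atP p f : mi [set p] f <-> exists d F G,
 [/\ F \is d.-homog, G \is d.-homog, peval F p = 0, peval G p != 0 & f = gev F / gev G].
split=> -[d [F [G [hF hG vF nG ->]]]];exists d, F, G;split=> //.
- exact/vanishes_pt.
- by apply/eqP => e;apply: nG;apply/vanishes_pt.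
- exact/vanishes_pt.
- by move/vanishes_pt => e;rewrite e eqxx in nG.
Qed.

Lemma prime_irreducible Z : irreducible_closed Z -> Z `<=` Xpts -> prime_set Z.
move=> [cZ nZ irr] ZX;split=> // d e F G hF hG v.
have cl c (H : form) : H \is c.-homog -> zariski_closed [set q : pt | peval H q = 0].
 move=> hH p nH;exists c, H;split=> //;first exact/eqP.
 by move=> q /eqP h.
have [|h|h] := irr _ _ (cl _ _ hF) (cl _ _ hG).
- by move=> p /v /eqP;rewrite pevM mulf_eq0 => /orP [] /eqP;[left|right].
- by left => p /h.
- by right => p /h.
Qed.
End Local.

(** * Closed sets *)

Lemma noetherian_max (R : comNzRingType) (P : set R -> Prop) : noetherian R ->
 (exists I, isideal I /\ P I) ->
 exists I, [/\ isideal I, P I & forall J, isideal J -> P J -> I `<=` J -> J `<=` I].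
move=> nR [I0 [id0 P0]];apply: contrapT => no.
pose T := {I : set R | isideal I /\ P I}.
have /choice [nx hnx] (I : T) : exists J : T, sval I `<=` sval J /\ ~ (sval J `<=` sval I).
 apply: contrapT => noJ;apply: no;exists (sval I);case: (svalP I) => idI PI.
 split=> // J idJ PJ IJ;apply: contrapT => nJI;apply: noJ.
 by exists (exist _ J (conj idJ PJ)).
pose ch := fix ch n := if n is n'.+1 then nx (ch n') else (exist _ I0 (conj id0 P0) : T).
have mono n e : (n <= e)%N -> sval (ch n) `<=` sval (ch e).
 move=> /subnK <-;elim: (e - n)%N => [//|d IH] x /IH h.
 by have [h1 _] := hnx (ch (d + n)%N);apply: h1.
have idc n : isideal (sval (ch n)) by case: (svalP (ch n)).
have [|s [hs gs]] := nR [set x | exists n, sval (ch n) x].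
 split.
 - by exists 0%N;have [h _ _] := idc 0%N.
 - move=> f g [n hf] [e hg];exists (maxn n e);have [_ ID _] := idc (maxn n e).
  by apply: (ID);[apply: mono hf;rewrite leq_maxl|apply: mono hg;rewrite leq_maxr].
 - by move=> a f [n hf];exists n;have [_ _ IM] := idc n;apply: (IM).
have [N hN] : exists N, forall a, a \in s -> sval (ch N) a.
 elim: s hs {gs} => [|a s IHs] hs;first by exists 0%N.
 have [|N hN] := IHs;first by move=> b bs;apply: hs;rewrite inE bs orbT.
 have [e he] := hs a (mem_head _ _);exists (maxn N e) => b.
 rewrite inE => /orP [/eqP ->|/hN h];first by apply: mono he;rewrite leq_maxr.
 by apply: mono h;rewrite leq_maxl.
have [_ []] := hnx (ch N);move=> x hx;apply: (ideal_span (idc N) hN);apply: gs.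
by exists N.+1.
Qed.

Section Closed.
Implicit Types (Z Y : set pt) (p q : pt) (F G : form).

Lemma separate_points p q : p <> q ->
 exists L : form, [/\ L \is 1.-homog, peval L p = 0 & peval L q != 0].
move=> npq;have [i hi] := pt_coord p;apply: contrapT => no;apply: npq;symmetry.
apply: (@pt_proportional k _ q p (val q 0 i)) => j;apply/eqP;rewrite -subr_eq0.
apply/eqP;apply: contrapT => /eqP ne;apply: no.
exists ('X_j - val p 0 j *: 'X_i);split.
- apply: rpredB;[|apply: dhomogZ];apply: homogX1.
- by rewrite pevB pevZ !pevX hi mulr1 subrr.
- by rewrite pevB pevZ !pevX mulrC.
Qed.

Lemma avoid_scalar (s : seq k) : exists c : k, c \notin s.
have : \prod_(a <- s) ('X - a%:P) != 0 :> {poly k}.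
 by apply: monic_neq0;rewrite monic_prod_XsubC.
move=> /closed_nonrootP [c];rewrite root_prod_XsubC => nc;by exists c.
Qed.

Lemma In_map (T : Type) (S : eqType) (f : T -> S) s x : List.In x s -> f x \in map f s.
elim: s => [//|a s IH] [->|/IH h];first exact: mem_head.
by rewrite inE h orbT.
Qed.

(** Two members are combined with a scalar outside a finite list of bad values, which exists because
    k is infinite. *)
Lemma linear_avoiding (V : form -> Prop) (s : seq pt) :
 (forall F G c, V F -> V G -> V (F + c *: G)) -> V 0 ->
 (forall q, List.In q s -> exists2 L, V L & peval L q != 0) ->
 exists2 L, V L & forall q, List.In q s -> peval L q != 0.
move=> VD V0;elim: s => [|q s IHs] h;first by exists 0.
have [|L VL hL] := IHs;first by move=> q' q's;apply: h;right.
have [M VM hM] := h q (or_introl erefl).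
have [c hc] := avoid_scalar (map (fun q' => - peval L q' / peval M q') (q :: s)).
exists (L + c *: M);first exact: VD.
have key q' : List.In q' (q :: s) -> peval M q' != 0 -> peval (L + c *: M) q' != 0.
 move=> q's nM;rewrite pevD pevZ;apply: contraNneq hc => e.
 have -> : c = - peval L q' / peval M q'.
  by apply: (mulIf nM);rewrite divfK//;apply/eqP;rewrite -addr_eq0 addrC e.
 exact: (In_map (fun q' => - peval L q' / peval M q')).
move=> q' q's;have [M0|nM] := eqVneq (peval M q') 0;last exact: key.
case: q's => [e|q's];first by move: hM;rewrite e M0 eqxx.
by rewrite pevD pevZ M0 mulr0 addr0;apply: hL.
Qed.

Definition closedX Z := Z `<=` Xpts /\ forall q, Xpts q ->
 (forall d F, F \is d.-homog -> van F Z -> peval F q = 0) -> Z q.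

Lemma closedX_cap Z d F : closedX Z -> F \is d.-homog ->
 closedX (Z `&` [set q | peval F q = 0]).
move=> [ZX cZ] hF;split=> [q [/ZX]//|q Xq h];split.
 by apply: cZ => // e G hG vG;apply: (h e) => // p [/vG].
by apply: (h d) => // p [].
Qed.
Lemma closedX_pts : closedX Xpts.
by split. Qed.

Definition vanishing Z d F := F \is d.-homog /\ van F Z.

Lemma vanishing_graded Z : graded_ideal (vanishing Z).
split.
- by move=> d F [].
- by move=> d;split;[rewrite rpred0|move=> p _;rewrite pev0].
- move=> d F G [hF vF] [hG vG];split;first by rewrite rpredD.
 by move=> p Zp;rewrite pevD vF// vG// addr0.
- move=> d e F G [hF vF] hG;split;first by rewrite addnC;apply: dhomogM.
 exact: vanMr.
Qed.

(** Noetherian induction: a counterexample with maximal homogeneous ideal is neither empty nor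
    prime, and a product of forms vanishing on it cuts it into two smaller closed sets, which do
    decompose. *)
Lemma decomposition Z : closedX Z -> exists s : seq (set pt),
 (forall Y, List.In Y s -> [/\ closedX Y, prime_set Y & Y `<=` Z]) /\
 (forall q, Z q -> exists2 Y, List.In Y s & Y q).
pose good Z := exists s : seq (set pt),
 (forall Y, List.In Y s -> [/\ closedX Y, prime_set Y & Y `<=` Z]) /\
 (forall q, Z q -> exists2 Y, List.In Y s & Y q).
move=> cZ;apply: contrapT => bZ.
pose P (I : set form) := exists Z', [/\ closedX Z', I = hspan (vanishing Z') & ~ good Z'].
have [|I [idI [Z0 [cZ0 eI bZ0]] maxI]] := noetherian_max (P := P) (@noetherian_mpoly k _).
 exists (hspan (vanishing Z));split;last by exists Z.
 exact: hspan_ideal (vanishing_graded _).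
have step d F : F \is d.-homog -> ~ van F Z0 -> good (Z0 `&` [set q | peval F q = 0]).
 move=> hF nF;apply: contrapT => nb;set Z1 := (X in ~ good X) in nb.
 have cZ1 : closedX Z1 by exact: closedX_cap hF.
 have h : hspan (vanishing Z1) `<=` I.
  apply: maxI;[exact: hspan_ideal (vanishing_graded _)|by exists Z1|].
  rewrite eI => G [s [hs ->]];exists s;split=> // x /hs [h v];split=> //.
  by move=> q [/v].
 apply: nF;have : I F by apply: h;apply: (@hspan_mem _ _ _ d);split=> // q [].
 by rewrite eI => /(hspan_homog (vanishing_graded _) hF) [].
have [Zp|nZ] := pselect (Z0 !=set0);last first.
 by apply: bZ0;exists [::];split=> // q Zq;case: nZ;exists q.
have [pr|npr] := pselect (prime_set Z0).
 apply: bZ0;exists [:: Z0];split;first by move=> Y [<-|[]];split.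
 by move=> q Zq;exists Z0 => //;left.
apply: npr;split=> //;first by case: cZ0.
move=> d e F G hF hG vFG;apply: contrapT => /not_orP [nF nG].
have [s [hs cs]] := step _ _ hF nF;have [t [ht ct]] := step _ _ hG nG.
apply: bZ0;exists (s ++ t);split.
 by move=> Y /(@List.in_app_or _ _ _ _) [/hs|/ht] [c1 c2 c3];split=> // q /c3 [].
move=> q Zq;have := vFG _ Zq;rewrite pevM => /eqP;rewrite mulf_eq0 => /orP [] /eqP e0.
 have [Y Ys Yq] := cs _ (conj Zq e0);exists Y => //.
 by apply: List.in_or_app;left.
have [Y Ys Yq] := ct _ (conj Zq e0);exists Y => //.
by apply: List.in_or_app;right.
Qed.

Lemma prime_finite_union Z (s : seq (set pt)) : prime_set Z ->
 (forall Y, List.In Y s -> closedX Y) -> (forall q, Z q -> exists2 Y, List.In Y s & Y q) ->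
 exists2 Y, List.In Y s & Z `<=` Y.
move=> pZ cs cov;apply: contrapT => no.
have [[q0 Zq0] ZX _] := pZ.
suff [d [F [hF nF vF]]] : exists d F, [/\ F \is d.-homog, ~ van F Z &
  forall Y, List.In Y s -> van F (Z `&` Y)].
 apply: nF => q Zq;have [Y Ys Yq] := cov _ Zq;exact: vF Y Ys q (conj Zq Yq).
elim: s cs no {cov} => [|Y s IHs] cs no.
 exists 0%N, 1;split=> //;[exact: dhomog1|exact: nvan1].
have [||d [F [hF nF vF]]] := IHs;first by move=> Y' Y's;apply: cs;right.
 by move=> [Y' Y's ZY'];apply: no;exists Y' => //;right.
have [e [G [hG vG nG]]] : exists e G, [/\ G \is e.-homog, van G Y & ~ van G Z].
 apply: contrapT => noG;apply: no;exists Y;first by left.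
 have [_ cY] := cs Y (or_introl erefl).
 move=> q Zq;apply: cY;first exact: ZX.
 move=> e G hG vG;apply: contrapT => nq;apply: noG;exists e, G;split=> // v.
 exact: nq (v _ Zq).
exists (d + e)%N, (F * G);split;[exact: dhomogM|exact: (nvanM pZ hF hG)|].
move=> Y' [<-|Y's] q [Zq Yq];first by rewrite pevM vG// mulr0.
by rewrite pevM (vF Y')// mul0r.
Qed.

Definition alg_free_mod Z n (t : 'I_n -> K) :=
 forall P : {mpoly k[n]}, mi Z (mmap cst t P) -> P = 0.

Definition snoc n (t : 'I_n -> K) (x : K) (i : 'I_n.+1) : K :=
 if unlift ord_max i is Some j then t j else x.

Lemma mmap_in Z n (t : 'I_n -> K) P : prime_set Z -> (forall i, lr Z (t i)) ->
 lr Z (mmap cst t P).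
move=> pZ ht;apply: lring_sum => // m _;apply: lringM => //;first exact: lring_cst.
apply: big_ind => [||i _];[exact: lring1|exact: lringM|exact: lringX].
Qed.

Lemma max_restrict Z Y z : prime_set Z -> prime_set Y -> Z `<=` Y ->
 lr Z z -> mi Y z -> mi Z z.
move=> pZ pY ZY [d [F [G [hF hG nG ->]]]].
have nG' : ~ van G Y by move=> v;apply: nG => p /ZY /v.
by move=> /(max_idealE pY hF hG nG') v;apply/(max_idealE pZ hF hG nG) => p /ZY /v.
Qed.

(** The constant term of a relation for x along Y vanishes on Z, because x does, so it is zero; x
    does not vanish on Y and can be divided out. Thus each strict inclusion in a chain of prime sets
    contributes one transcendental. *)
Lemma poly_free_step (R : comNzRingType) (ev : {rmorphism R -> K}) Z Y x :
 prime_set Z -> prime_set Y -> Z `<=` Y -> (forall r, lr Z (ev r)) ->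
 (forall r, mi Z (ev r) -> r = 0) ->
 mi Z x -> ~ mi Y x ->
 forall Q : {poly R}, mi Y (map_poly ev Q).[x] -> Q = 0.
move=> pZ pY ZY Oev ft mx nmx Q mQ;have Ox := max_sub mx.
apply: contrapT => /eqP nQ;move: nQ mQ.
elim/poly_ind: Q => [|Q c IHQ];first by rewrite eqxx.
move=> nQ;rewrite rmorphD rmorphM /= map_polyX map_polyC hornerD hornerM hornerX hornerC => h.
have OQ : lr Z (map_poly ev Q).[x].
 rewrite horner_coef;apply: lring_sum => // i _;apply: lringM => //;last exact: lringX.
 rewrite coef_map;apply: Oev.
have c0 : c = 0.
 apply: ft.
 have -> : ev c = ((map_poly ev Q).[x] * x + ev c) - (map_poly ev Q).[x] * x by rewrite addrC addKr.
 apply: maxB => //;last exact: maxM.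
 by apply: max_restrict h => //;apply: (lringD pZ);[apply: lringM|exact: Oev].
have nQ' : Q != 0 by apply: contraNneq nQ => ->;rewrite c0 mul0r addr0.
move: h;rewrite c0 !raddf0 !addr0.
move=> /(max_prime pY (lring_mono pY ZY OQ) (lring_mono pY ZY Ox)) []//;exact: IHQ nQ'.
Qed.

Lemma alg_free_snoc Z Y n (t : 'I_n -> K) x : prime_set Z -> prime_set Y -> Z `<=` Y ->
 (forall i, lr Z (t i)) -> alg_free_mod Z t ->
 mi Z x -> ~ mi Y x -> alg_free_mod Y (snoc t x).
move=> pZ pY ZY Ot ft mx nmx P mP;apply: contrapT => /eqP nP.
pose ev : {rmorphism {mpoly k[n]} -> K} := mmap cst t.
have evE : mmap cst (snoc t x) P = (map_poly ev (muni P)).[x].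
 rewrite mmap_muni {2}/snoc unlift_none;congr (_.[x]);apply: eq_map_poly => G.
 apply: eq_bigr => m _;congr (_ * _);apply: eq_bigr => i _ /=.
 have -> : widen_ord (leqnSn n) i = lift ord_max i.
  by apply: val_inj;rewrite /= /bump leqNgt ltn_ord.
 by rewrite /snoc liftK.
have nuP : muni P != 0.
 apply: contraNneq nP => uP.
 have := rmorph_mmap (idfun : {rmorphism {mpoly k[n.+1]} -> {mpoly k[n.+1]}}) P.
 by rewrite /= mmap_muni uP map_poly0 horner0 => ->.
move: mP;rewrite evE => /(poly_free_step pZ pY ZY _ _ mx nmx) u0.
move/eqP: nuP;apply;apply: u0 => [r|r];[exact: mmap_in|exact: ft].
Qed.
End Closed.

(** * The local rings have dimension two *)

Section Dimension.
Implicit Types (Z Y : set pt) (p q : pt) (F G : form).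

Lemma ospanD (F : fieldType) (O : set F) s f g : (forall x y, O x -> O y -> O (x + y)) ->
 ospan O s f -> ospan O s g -> ospan O s (f + g).
move=> OD;elim: s f g => [|b t IHt] f g;first by move=> -> ->;rewrite addr0.
move=> [c Oc hc] [d Od hd];exists (c + d);first exact: OD.
by rewrite mulrDl opprD addrACA;apply: IHt.
Qed.

Lemma ospanM (F : fieldType) (O : set F) s c f : (forall x y, O x -> O y -> O (x * y)) ->
 O c -> ospan O s f -> ospan O s (c * f).
move=> OM;elim: s f => [|b t IHt] f Oc;first by move=> ->;rewrite mulr0.
move=> [d Od hd];exists (c * d);first exact: OM.
by rewrite -mulrA -mulrBr;apply: IHt.
Qed.

(** Every element of the local ring is a polynomial in affine coordinates up to a unit, so
    generators are found among the numerators of S. *)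
Lemma noetherian_at p (S : set K) : Xpts p -> S `<=` O_at p ->
 exists s : seq K, (forall a, a \in s -> S a) /\ (forall f, S f -> ospan (O_at p) s f).
move=> Xp SO;have pp := prime_pt Xp.
have [i hi] := pt_linear p.
have gi : gev 'X_i != 0.
 by apply: (gev_neq0 pp (homogX1 _)) => /vanishes_pt /eqP;rewrite hi oner_eq0.
pose ev : {rmorphism form -> K} := mmap cst (fun j => gev 'X_j / gev 'X_i).
have evO F : O_at p (ev F).
 apply: lring_sum => // m _;apply: lringM => //;first exact: lring_cst.
 apply: big_ind => [||j _];[exact: lring1|exact: lringM|apply: lringX => //].
 apply/O_atP;exists 1%N, 'X_j, 'X_i;split;rewrite ?hi ?oner_eq0//;apply: homogX1.
have evH d F : F \is d.-homog -> gev F = gev 'X_i ^+ d * ev F.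
 move=> hF;rewrite -(homog_scale cst _ _ hF);apply: eq_bigr => m _;congr (_ * _).
 by apply: eq_bigr => j _;rewrite mulrC divfK// gevX.
have unit d G : G \is d.-homog -> peval G p != 0 -> ev G != 0 /\ O_at p (ev G)^-1.
 move=> hG nG;have nv : ~ van G [set p] by move/vanishes_pt => e;rewrite e eqxx in nG.
 have := gev_neq0 pp hG nv;rewrite (evH _ _ hG) mulf_eq0 negb_or => /andP [_ nz];split=> //.
 have -> : (ev G)^-1 = gev ('X_i ^+ d) / gev G.
  by rewrite (evH _ _ hG) gevXn invfM mulrA divff ?expf_neq0// mul1r.
 apply/O_atP;exists d, ('X_i ^+ d), G.
 by have := dhomogMn d (homogX1 i);rewrite mul1n.
pose T : set form := fun F => exists f d G, [/\ S f, G \is d.-homog, peval G p != 0 & ev F = f * ev G].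
have [s [hs gs]] := noetherian_set T (@noetherian_mpoly k _).
have [t [ht gt]] : exists t : seq K, (forall a, a \in t -> S a) /\
  forall F, inspan s F -> ospan (O_at p) t (ev F).
 elim: s hs {gs} => [|F0 s IHs] hs.
  by exists [::];split=> // F ->;rewrite rmorph0.
 have [|t [ht gt]] := IHs;first by move=> F Fs;apply: hs;rewrite inE Fs orbT.
 have [f [d [G [Sf hG nG e]]]] := hs F0 (mem_head _ _).
 exists (f :: t);split=> [a|F [c hc]];first by rewrite inE => /orP [/eqP ->|/ht].
 exists (ev c * ev G);first by apply: lringM => //;exact: evO.
 have -> : ev F - ev c * ev G * f = ev (F - c * F0).
  by rewrite rmorphB rmorphM e -mulrA (mulrC (ev G)).
 exact: gt.
exists t;split=> // f Sf;have [d [F [G [hF hG nG ef]]]] := (O_atP p f).1 (SO _ Sf).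
have [nz iO] := unit _ _ hG nG.
have efF : ev F = f * ev G.
 have := ef;rewrite (evH _ _ hF) (evH _ _ hG) => ->.
 by rewrite -mulf_div divff ?expf_neq0// mul1r divfK.
have -> : f = (ev G)^-1 * ev F by rewrite efF mulrCA mulVf// mulr1.
apply: ospanM => //;first by move=> x y;apply: lringM.
by apply: gt;apply: gs;exists f, d, G.
Qed.

(** By the Nullstellensatz a form vanishing at all points of X is zero in K, so X itself is a prime
    set; its maximal ideal is zero. *)
Lemma prime_pts : prime_set Xpts.
have h1 : (1 : form) \is 0.-homog by exact: dhomog1.
have [|p Xp _] := exists_pt h1;first by rewrite gev1 oner_eq0.
have van d F : F \is d.-homog -> van F Xpts -> gev F = 0.
 move=> hF vF;apply: contrapT => /eqP nF.
 by have [q Xq] := exists_pt hF nF;rewrite vF// eqxx.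
split=> //;first by exists p.
move=> d e F G hF hG /(van _ _ (dhomogM hF hG)) /eqP;rewrite gevM mulf_eq0.
case/orP => /eqP e0;[left|right] => q Xq;[exact: Xq hF e0|exact: Xq hG e0].
Qed.

Lemma max_pts f : mi Xpts f -> f = 0.
move=> [d [F [G [hF hG vF nG ->]]]];have [->|nF] := eqVneq (gev F) 0;first by rewrite mul0r.
by have [q Xq] := exists_pt hF nF;rewrite vF// eqxx.
Qed.

Lemma frac_in Z d F y : prime_set Z -> F \is d.-homog -> y \is 1.-homog ->
 ~ van y Z -> lr Z (fq y F d) /\
 (mi Z (fq y F d) <-> van F Z).
move=> pZ hF hy ny;have hyd : y ^+ d \is d.-homog by have := dhomogMn d hy;rewrite mul1n.
have nyd : ~ van (y ^+ d) Z.
 move=> v;apply: ny => q Zq;have /eqP := v q Zq;rewrite pevXn expf_eq0.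
 by case/andP => _ /eqP.
rewrite -gevXn;split;first by exists d, F, (y ^+ d).
exact: (max_idealE pZ hF hyd nyd).
Qed.

Lemma alg_free0 Z (t : 'I_0 -> K) : prime_set Z -> alg_free_mod Z t.
move=> pZ P;have -> : P = (P@_0%MM)%:MP.
 by apply/mpolyP => m;rewrite mcoeffC (_ : m = 0%MM) ?eqxx ?mulr1//;apply/mnmP;case.
rewrite mmapC;have [-> //|nc h] := eqVneq P@_0%MM 0.
case: (max_not1 pZ);rewrite -(rmorph1 cst) -(mulVf nc) rmorphM.
by apply: maxM => //;apply: lring_cst.
Qed.

Hypothesis dim_le2 : forall t : 'I_3 -> K, ~ alg_independent t.

(** Two distinct points in Z would extend the chain to p < Z < Y < X, and a linear form separating p
    from q together with A and B would give three algebraically independent functions. *)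
Lemma chain_pt p q Z Y c A b B : prime_set Z -> prime_set Y -> Z `<=` Y -> Z p -> Z q ->
 A \is c.-homog -> B \is b.-homog -> van A Z -> ~ van A Y ->
 van B Y -> gev B != 0 -> p = q.
move=> pZ pY ZY Zp Zq hA hB vA nA vB nB;apply: contrapT => npq.
have [L [hL Lp Lq]] := separate_points npq;have [i hi] := pt_linear p.
pose y : form := 'X_i;have hy : y \is 1.-homog by exact: homogX1.
have nyp : ~ van y [set p] by move/vanishes_pt => /eqP;rewrite hi oner_eq0.
have [_ ZX _] := pZ;have [_ YX _] := pY;have pp := prime_pt (ZX _ Zp).
have nyZ : ~ van y Z by move=> v;apply: nyp => _ ->;apply: v.
have nyY : ~ van y Y by move=> v;apply: nyZ => r /ZY;apply: v.
have nyX : ~ van y Xpts by move=> v;apply: nyY => r /YX;apply: v.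
have [Ol ml] := frac_in pZ hL hy nyZ;have [Oa ma] := frac_in pZ hA hy nyZ.
have [OaY maY] := frac_in pY hA hy nyY;have [OlY _] := frac_in pY hL hy nyY.
have [Ob mb] := frac_in pY hB hy nyY;have [ObX mbX] := frac_in prime_pts hB hy nyX.
apply: (dim_le2 (t := snoc (snoc (snoc (fun=> 0 : K) (fq y L 1) : 'I_1 -> K)
 (fq y A c)) (fq y B b))) => P e.
have fr : alg_free_mod Xpts (snoc (snoc (snoc (fun=> 0 : K) (fq y L 1) : 'I_1 -> K)
 (fq y A c)) (fq y B b));last by apply: fr;rewrite e;apply: max0 prime_pts.
apply: (@alg_free_snoc Y Xpts) => //;first exact: prime_pts.
- move=> j;rewrite /snoc;case: unliftP => [j' _|_//].
 by case: unliftP => [[]|_].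
- apply: (@alg_free_snoc Z Y) => //;last by move/maY.
 + by move=> j;rewrite /snoc;case: unliftP => [[]|_].
 + apply: (@alg_free_snoc [set p] Z) => //.
  * by move=> r ->.
  * by case.
  * exact: alg_free0.
  * by have [_ h] := frac_in pp hL hy nyp;apply/h/vanishes_pt.
  * by move/ml => /(_ _ Zq) /eqP;rewrite (negbTE Lq).
 + exact/ma.
- exact/mb.
- by move/mbX => v;have [r Xr] := exists_pt hB nB;rewrite v// eqxx.
Qed.
End Dimension.

(** * Growth of spaces of forms, and finite zero sets *)

Section Growth.
Implicit Types (Z Y : set pt) (p q : pt) (F G : form).

Definition kspan (P : set K) : set K := fun x => forall A, ksub A -> P `<=` A -> A x.

Lemma kspan_ksub P : ksub (kspan P).
split=> [A sA _|f g hf hg A sA PA|c f hf A sA PA];first exact: ksub0.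
- apply: ksubD => //;[exact: hf|exact: hg].
- apply: ksubZ;exact: hf.
Qed.
Lemma kspan_mem P x : P x -> kspan P x.
by move=> Px A _;apply. Qed.
Lemma kspan_ind P (A : set K) : ksub A -> P `<=` A -> kspan P `<=` A.
by move=> sA PA x;apply. Qed.

Lemma ksub_mull (A : set K) y : ksub A -> ksub [set x | A (y * x)].
move=> sA;split=> [|f g|c f] /=;first by rewrite mulr0;apply: ksub0.
 by rewrite mulrDr;apply: ksubD.
by rewrite mulrCA;apply: ksubZ.
Qed.

Lemma kspan_lcomb n (e : 'I_n -> K) x : kspan [set y | exists i, y = e i] x ->
 exists c, x = lcomb e c.
apply: (@kspan_ind _ [set x | exists c, x = lcomb e c]) => [|_ [i ->]];last first.
 by exists (delta_mx 0 i);rewrite lcomb_delta.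
split=> [|_ _ [c ->] [d ->]|a _ [c ->]];first by exists 0;rewrite lcomb0.
 by exists (c + d);rewrite lcombD.
by exists (a *: c);rewrite lcombZ.
Qed.

Lemma span_dependent n (e : 'I_n -> K) (I : finType) (f : I -> K) : (n < #|I|)%N ->
 (forall i, kspan [set y | exists j, y = e j] (f i)) ->
 exists c : I -> k, (exists i, c i != 0) /\ \sum_i cst (c i) * f i = 0.
move=> lt hf;have /choice [M hM] i : exists c, f i = lcomb e c by exact: kspan_lcomb.
pose N : 'M[k]_(#|I|, n) := \matrix_i M (enum_val i).
have : kermx N != 0.
 rewrite kermx_eq0;apply: contraTN lt => /eqP rN;rewrite -leqNgt -rN.
 exact: rank_leq_col.
move=> /rowV0Pn [v /sub_kermxP vN nv].
exists (fun i => v 0 (enum_rank i));split.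
 apply: contrapT => /forallNP no;case/eqP: nv;apply/rowP => i;rewrite mxE.
 by apply: contrapT => /eqP h;apply: (no (enum_val i));rewrite enum_valK.
transitivity (lcomb e (v *m N));last by rewrite vN lcomb0.
rewrite /lcomb;under [RHS]eq_bigr do rewrite mxE rmorph_sum mulr_suml.
rewrite exchange_big [RHS](reindex enum_rank);last exact/onW_bij/enum_rank_bij.
apply: eq_bigr => i _;rewrite hM mulr_sumr.
by apply: eq_bigr => j _;rewrite mxE enum_rankK rmorphM mulrA.
Qed.

Lemma prime_avoiding_list Y (s : seq pt) : prime_set Y -> (exists a b, [/\ Y a, Y b & a <> b]) ->
 exists2 q, Y q & forall x, List.In x s -> q <> x.
move=> pY [a [b [Ya Yb nab]]].
have [d [F [hF nF vF]]] : exists d F, [/\ F \is d.-homog, ~ van F Y &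
  forall x, List.In x s -> peval F x = 0].
 elim: s => [|x s [d [F [hF nF vF]]]].
  exists 0%N, 1;split=> //;[exact: dhomog1|exact: nvan1].
 have [L [hL Lx nL]] : exists L : form, [/\ L \is 1.-homog, peval L x = 0 & ~ van L Y].
  have [xa|nxa] := pselect (x = a).
  have [|L [hL Lx nL]] := separate_points (p := x) (q := b);first by rewrite xa.
  by exists L;split=> // v;rewrite v ?eqxx in nL.
  have [L [hL Lx nL]] := separate_points nxa.
  by exists L;split=> // v;rewrite v ?eqxx in nL.
 exists (d + 1)%N, (F * L);split;[exact: dhomogM|exact: (nvanM pY hF hL)|].
 by move=> y [<-|/vF e];rewrite pevM ?Lx ?mulr0// e mul0r.
apply: contrapT => no;apply: nF => q Yq;apply: contrapT => nq;apply: no.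
by exists q => // x /vF e eqx;apply: nq;rewrite eqx.
Qed.

Lemma linear_nonzero (s : seq pt) : exists2 M : form, M \is 1.-homog &
 forall q, List.In q s -> peval M q != 0.
apply: (linear_avoiding (V := fun M => M \is 1.-homog)) => [F G c hF hG||q _].
- by rewrite rpredD// dhomogZ.
- by rewrite rpred0.
- by have [i hi] := pt_linear q;exists 'X_i;[exact: homogX1|rewrite hi oner_neq0].
Qed.

Lemma linear_through p (s : seq pt) : (forall q, List.In q s -> q <> p) ->
 exists M : form, [/\ M \is 1.-homog, peval M p = 0 & forall q, List.In q s -> peval M q != 0].
move=> sp.
have [|||M [h1 h2] h3] := @linear_avoiding (fun M => M \is 1.-homog /\ peval M p = 0) s.
- move=> F G c [hF Fp] [hG Gp];split;first by rewrite rpredD// dhomogZ.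
 by rewrite pevD pevZ Gp mulr0 addr0.
- by split;[rewrite rpred0|rewrite pev0].
- move=> q /sp nqp;have [|L [hL Lp Lq]] := separate_points (p := p) (q := q).
  by move=> e;apply: nqp.
 by exists L.
by exists M.
Qed.
Lemma homogXn (M : form) d : M \is 1.-homog -> M ^+ d \is d.-homog.
by move=> hM;have := dhomogMn d hM;rewrite mul1n. Qed.

(* Forms generating the unit ideal in large degree; the family s plays the role of a
   system of parameters of the homogeneous coordinate ring. *)
Definition lin_ideal d (s : seq form) e G := G \is e.-homog /\
 exists A : nat -> form, [/\ forall i, A i \is (e - d).-homog,
  (e < d)%N -> forall i, A i = 0 & gev G = \sum_(i < size s) gev (s`_i * A i)].

Lemma lin_ideal_graded d (s : seq form) : (forall i, (i < size s)%N -> s`_i \is d.-homog) ->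
 graded_ideal (lin_ideal d s).
move=> hs;split.
- by move=> e F [].
- move=> e;split;first by rewrite rpred0.
 exists (fun=> 0);split=> //;first by rewrite rpred0.
 by rewrite gev0 big1// => i _;rewrite mulr0 gev0.
- move=> e F G [hF [A [hA A0 eF]]] [hG [B [hB B0 eG]]];split;first by rewrite rpredD.
 exists (fun i => A i + B i);split=> [i|lt i|];first by rewrite rpredD.
  by rewrite A0// B0// addr0.
 by rewrite gevD eF eG -big_split;apply: eq_bigr => i _;rewrite mulrDr gevD.
- move=> e e' F G [hF [A [hA A0 eF]]] hG;split;first by rewrite addnC;apply: dhomogM.
 have [lt|le] := ltnP e d.
  exists (fun=> 0);split=> //;first by rewrite rpred0.
  rewrite gevM eF big1 ?mulr0;last by move=> i _;rewrite A0// mulr0 gev0.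
  by rewrite big1// => i _;rewrite mulr0 gev0.
 exists (fun i => G * A i);split.
 + by move=> i;rewrite addnC -addnBA//;apply: dhomogM.
 + move=> lt;rewrite -addSn || lia.
 + by rewrite gevM eF mulr_sumr;apply: eq_bigr => i _;rewrite -gevM mulrCA.
Qed.

Lemma forms_in_lin_ideal d (s : seq form) : (forall i, (i < size s)%N -> s`_i \is d.-homog) ->
 (forall p, Xpts p -> exists2 i, (i < size s)%N & peval s`_i p != 0) ->
 exists N, forall e G, (N <= e)%N -> G \is e.-homog -> lin_ideal d s e G.
move=> hs noz;apply: forms_of_no_zero;first exact: lin_ideal_graded.
move=> p;have [Xp|nXp] := pselect (Xpts p).
 have [i si ni] := noz p Xp;exists d, s`_i;split=> //;split;first exact: hs.
 exists (fun j => if j == i then 1 else 0);split.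
 - by move=> j;rewrite subnn;case: ifP => _;[exact: dhomog1|rewrite rpred0].
 - by rewrite ltnn.
 - rewrite (bigD1 (Ordinal si))//= eqxx mulr1 big1 ?addr0// => j ne.
  case: eqP => [e|_];last by rewrite mulr0 gev0.
  by case/eqP: ne;apply: val_inj.
have : exists d F, [/\ F \is d.-homog, gev F = 0 & peval F p != 0].
 apply: contrapT => no;apply: nXp => e F hF F0;apply: contrapT => /eqP h.
 by apply: no;exists e, F.
move=> [e [F [hF F0 nF]]];exists e, F;split=> //;split=> //.
exists (fun=> 0);split=> //;first by rewrite rpred0.
by rewrite big1// => i _;rewrite mulr0 gev0.
Qed.

(** If F has finitely many zeros on X, a linear form M avoids them, and forms of degree e, divided
    by M^e, are spanned by powers of F/M^d times finitely many monomials. Their dimension grows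
    linearly in e, whereas two independent functions force quadratic growth. *)
Lemma finite_zero_growth d F (s : seq pt) (t : 'I_2 -> K) : (0 < d)%N -> F \is d.-homog ->
 (forall q, Xpts q -> peval F q = 0 -> List.In q s) -> ~ alg_independent t.
move=> d0 hF Fs ft;have pX := prime_pts;have [[p0 Xp0] _ _] := pX.
have [M hM nM] := linear_nonzero (p0 :: s).
have hMd := homogXn d hM.
have [||N0 hN0] := @forms_in_lin_ideal d [:: M ^+ d;F].
- by move=> [|[|[]]].
- move=> p Xp;have [Fp|nFp] := eqVneq (peval F p) 0;last by exists 1%N.
 by exists 0%N => //=;rewrite pevXn expf_neq0// nM//;right;apply: Fs.
pose N := (N0 + d)%N.
have nzM : gev M != 0.
 by apply: (gev_neq0 pX hM) => /(_ p0 Xp0) /eqP;rewrite (negbTE (nM _ (or_introl erefl))).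
pose y := fq M F d.
pose S e : set K := kspan [set z | exists i (m : 'X_{1..(pdim X).+1}),
 [/\ (mdeg m < N)%N, (i * d <= e)%N & z = y ^+ i * (gev 'X_[m] / gev M ^+ mdeg m)]].
have sS e : ksub (S e) by exact: kspan_ksub.
have Smono e e' : (e <= e')%N -> S e `<=` S e'.
 move=> le;apply: kspan_ind;first exact: kspan_ksub.
 by move=> _ [i [m [h1 h2 ->]]];apply: kspan_mem;exists i, m;split=> //;apply: leq_trans le.
have Sy e x : S e x -> S (e + d)%N (y * x).
 apply: (@kspan_ind _ [set x | S (e + d)%N (y * x)]).
  by apply: ksub_mull;apply: kspan_ksub.
 move=> _ [i [m [h1 h2 ->]]];apply: kspan_mem;exists i.+1, m;split=> //.
  by rewrite mulSn addnC leq_add2r.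
 by rewrite exprS mulrA.
have main e G : G \is e.-homog -> S e (fq M G e).
 elim/ltn_ind: e G => e IH G hG;have [lt|le] := ltnP e N.
  rewrite [G]mpolyE gev_sum mulr_suml big_seq.
  refine (@ksub_sum (S e) _ _ _ _ (sS e) _).
  move=> m mG;have md : mdeg m = e by move/dhomogP: hG => /(_ _ mG).
  rewrite gevZ -mulrA;apply: (ksubZ _ (sS e)).
  by apply: kspan_mem;exists 0%N, m;rewrite md expr0 mul1r.
 have [|_ [A [hA _ eG]]] := hN0 e G _ hG;first by apply: leq_trans le;rewrite leq_addr.
 have de : (d <= e)%N by apply: leq_trans le;rewrite leq_addl.
 have lte : (e - d < e)%N by rewrite ltn_subrL d0 (leq_trans d0 de).
 move: eG;rewrite !big_ord_recl big_ord0 addr0 /= => ->.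
 have e2 : gev M ^+ e = gev M ^+ d * gev M ^+ (e - d) by rewrite -exprD subnKC.
 have -> : (gev (M ^+ d * A 0%N) + gev (F * A (bump 0 0))) / gev M ^+ e =
  fq M (A 0%N) (e - d) + y * (fq M (A 1%N) (e - d)).
  by rewrite e2 !gevM gevXn mulrDl /y !mulf_div -mulf_div divff ?expf_neq0// mul1r.
 apply: (ksubD (sS e)).
  by apply: Smono (ltnW lte) _ _;apply: IH.
 by have := Sy _ _ (IH _ lte _ (hA 1%N));rewrite subnK.
have [h1 [F1 [G1 [hF1 hG1 nG1 et1]]]] := gen_pt_generates (t ord0).
have [h2 [F2 [G2 [hF2 hG2 nG2 et2]]]] := gen_pt_generates (t (lift ord0 ord0)).
pose h := (h1 + h2)%N;pose H := G1 * G2;pose T1 := F1 * G2;pose T2 := G1 * F2.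
have hH : H \is h.-homog by exact: dhomogM.
have hT1 : T1 \is h.-homog by exact: dhomogM.
have hT2 : T2 \is h.-homog by exact: dhomogM.
have nH : gev H != 0 by rewrite gevM mulf_neq0.
have eT1 : gev T1 = t ord0 * gev H by rewrite !gevM et1 mulrA divfK.
have eT2 : gev T2 = t (lift ord0 ord0) * gev H by rewrite !gevM et2 [RHS]mulrCA divfK.
pose c := #|{: 'X_{1..(pdim X).+1 < N}}|.
(* The m^2 monomials in [t] with exponents below m, cleared of denominators by [u], lie in a span of
   [J] c elements, and [J] is at most (2h+1)m; this choice of m makes m^2 larger. *)
pose m := ((2 * h + 1) * c).+1.
pose J := (2 * h * m).+1.
pose I := ('I_J * 'X_{1..(pdim X).+1 < N})%type.
pose u := (fq M H h) ^+ (2 * m).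
have nu : u != 0 by rewrite expf_neq0// mulf_neq0// invr_eq0 expf_neq0.
pose e (i : 'I_#|{: I}|) : K := let x := enum_val i in
 y ^+ x.1 * (gev 'X_[x.2] / gev M ^+ mdeg x.2).
pose f (x : 'I_m * 'I_m) : K := t ord0 ^+ x.1 * t (lift ord0 ord0) ^+ x.2 * u.
have [||co [[x0 nx0] dep]] := @span_dependent _ e _ f.
- rewrite !card_prod !card_ord -/c /J.
 have h3 : (J <= (2 * h + 1) * m)%N by rewrite /J -addn1 mulnDl mul1n leq_add2l.
 apply: (@leq_ltn_trans ((2 * h + 1) * m * c));first by rewrite leq_mul2r h3 orbT.
 by rewrite mulnAC ltn_mul2r /m ltnS leqnn.
- move=> [a b];rewrite /f /=.
 have hab : (a + b <= 2 * m)%N by rewrite mul2n -addnn leq_add// ltnW// ltn_ord.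
 have -> : t ord0 ^+ a * t (lift ord0 ord0) ^+ b * u =
  gev (T1 ^+ a * T2 ^+ b * H ^+ (2 * m - (a + b))) / gev M ^+ (2 * h * m).
  rewrite !gevM !gevXn eT1 eT2 /u expr_div_n -exprM.
  have -> : gev H ^+ (2 * m) = gev H ^+ a * gev H ^+ b * gev H ^+ (2 * m - (a + b)).
  by rewrite -!exprD subnKC.
  have -> : (h * (2 * m) = 2 * h * m)%N by rewrite mulnA (mulnC h).
  rewrite !exprMn !mulrA;congr (_ / _);ring.
 have hG : T1 ^+ a * T2 ^+ b * H ^+ (2 * m - (a + b)) \is (2 * h * m).-homog.
  have -> : (2 * h * m = h * a + h * b + h * (2 * m - (a + b)))%N.
  by rewrite -!mulnDr subnKC// mulnA (mulnC h).
  by do 2 (apply: dhomogM;last exact: dhomogMn);exact: dhomogMn.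
 have := main _ _ hG;apply: kspan_ind;first exact: kspan_ksub.
 move=> _ [i [mm [hm hi ->]]];apply: kspan_mem.
 have iJ : (i < J)%N.
  by rewrite /J ltnS;apply: leq_trans hi;rewrite leq_pmulr.
 exists (enum_rank ((Ordinal iJ, BMultinom hm) : I)).
 by rewrite /e enum_rankK.
pose mon (x : 'I_m * 'I_m) : 'X_{1..2} := [multinom [tuple x.1 : nat;x.2 : nat]].
have mon_inj : injective mon.
 move=> [a b] [a' b'] /mnmP eqm;have := eqm ord0;have := eqm (lift ord0 ord0).
 rewrite /mon !multinomE /= => e2 e1;congr (_, _);exact: val_inj.
pose P : {mpoly k[2]} := \sum_x co x *: 'X_[mon x].
have P0 : P = 0.
 apply: ft;rewrite /P rmorph_sum /=.
 apply: (mulIf nu);rewrite mul0r mulr_suml.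
 transitivity (\sum_i cst (co i) * f i);last exact: dep.
 apply: eq_bigr => x _.
 rewrite mmapZ mmapX /mmap1 !big_ord_recl big_ord0 mulr1 /f -mulrA.
 by rewrite /mon !multinomE /= !mulrA.
move: nx0;have : P@_(mon x0) = 0 by rewrite P0 mcoeff0.
rewrite /P raddf_sum /= (bigD1 x0)//= big1 ?addr0;last first.
 move=> x ne;rewrite mcoeffZ mcoeffX;case: eqP => [/mon_inj e'|];last by rewrite mulr0.
 by rewrite e' eqxx in ne.
by rewrite mcoeffZ mcoeffX eqxx mulr1 => ->;rewrite eqxx.
Qed.
End Growth.

(** * Noether normalisation over the plane, and powers of the maximal ideal *)

Section RegularityDim.
Local Notation B := {poly {poly k}}.
Implicit Types (Z Y : set pt) (p q : pt) (F G : form).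

Section TwoVar.
Variables (y1 y2 : K).
Definition ev2 : {rmorphism B -> K} :=
 horner_eval y1 \o map_poly (horner_eval y2 \o map_poly cst).

Lemma ev2X : ev2 'X = y1.
by rewrite /= map_polyX /horner_eval hornerX. Qed.
Lemma ev2Y : ev2 ('X)%:P = y2.
by rewrite /= map_polyC /horner_eval hornerC /= map_polyX /horner_eval hornerX. Qed.

Definition A0 : set K := [set x | exists P, x = ev2 P].
Lemma A0D x y : A0 x -> A0 y -> A0 (x + y).
by move=> [P ->] [Q ->];exists (P + Q);rewrite rmorphD. Qed.
Lemma A0M x y : A0 x -> A0 y -> A0 (x * y).
by move=> [P ->] [Q ->];exists (P * Q);rewrite rmorphM. Qed.
Lemma A0e P : A0 (ev2 P). by exists P. Qed.

Fixpoint aindep (b : seq K) : Prop :=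
 if b is a :: b' then (forall P, ospan A0 b' (ev2 P * a) -> P = 0) /\ aindep b' else True.

Lemma ospan0 b : ospan A0 b 0.
elim: b => [//|a IH];exists 0;first by exists 0;rewrite rmorph0.
by rewrite mul0r subr0.
Qed.

Lemma ospan_mem b a : a \in b -> ospan A0 b a.
elim: b => [//|c b IH];rewrite inE => /orP [/eqP ->|/IH h].
 by exists 1;[exists 1;rewrite rmorph1|rewrite mul1r subrr;exact: ospan0].
by exists 0;[exists 0;rewrite rmorph0|rewrite mul0r subr0].
Qed.

(** A generator that depends on those already kept is absorbed into the common denominator D. *)
Lemma free_part (r : seq K) : exists (b : seq K) (D : B), [/\ D != 0,
 forall x, x \in b -> x \in r, aindep b & forall x, ospan A0 r x -> ospan A0 b (ev2 D * x)].
elim: r => [|a r [b [D [nD br ib hb]]]].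
 by exists [::], 1;rewrite oner_neq0;split=> // x ->;rewrite mulr0.
have [[P [nP hP]]|no] := pselect (exists P, P != 0 /\ ospan A0 b (ev2 P * a)).
 exists b, (D * P);split;[by rewrite mulf_neq0| | by []|].
  by move=> x /br h;rewrite inE h orbT.
 move=> x [c Ac hx].
 have -> : ev2 (D * P) * x = ev2 D * c * (ev2 P * a) + ev2 P * (ev2 D * (x - c * a)).
  rewrite rmorphM;ring.
 apply: (ospanD A0D);apply: (ospanM A0M) => //;last exact: hb.
 - apply: A0M => //;exact: A0e.
 - exact: A0e.
exists (a :: b), D;split=> //.
- by move=> x;rewrite !inE => /orP [->//|/br ->];rewrite orbT.
- by split=> // P hP;apply: contrapT => /eqP nP;apply: no;exists P.
- move=> x [c Ac hx];exists (ev2 D * c);first by apply: A0M => //;exact: A0e.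
 by rewrite -mulrA -mulrBr;apply: hb.
Qed.

Lemma poly_coprime_XY (P Q : B) i j : ('X^j)%:P * P = 'X^i * Q -> exists P',
 P = 'X^i * P' /\ Q = ('X^j)%:P * P'.
move=> e;have tk : take_poly i P = 0.
 apply/polyP => l;rewrite coef_take_poly coef0;case: ltnP => // li.
 have := congr1 (fun R : B => R`_l) e;rewrite coefCM coefXnM li => /eqP.
 by rewrite mulf_eq0 -size_poly_eq0 size_polyXn => /eqP.
have eP : P = 'X^i * drop_poly i P.
 by rewrite -[LHS](poly_take_drop i) tk add0r mulrC.
exists (drop_poly i P);split=> //.
have nX : 'X^i != 0 :> B by rewrite -size_poly_eq0 size_polyXn.
by apply: (mulfI nX);rewrite -e {1}eP mulrCA.
Qed.

(** A free module over k[y1, y2] has depth two: comparing the coordinates of y1^i x and y2^j x,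
    coprimality of the two monomials lets each be divided. *)
Lemma ospan_saturated (b : seq K) i j x : injective ev2 -> aindep b ->
 ospan A0 b (y1 ^+ i * x) -> ospan A0 b (y2 ^+ j * x) -> ospan A0 b x.
move=> inj;have [y1n y2n] : y1 != 0 /\ y2 != 0.
 split;apply/eqP => e0.
  have : ev2 'X = ev2 0 by rewrite ev2X rmorph0.
  by move/inj/eqP;rewrite polyX_eq0.
 have : ev2 ('X)%:P = ev2 0 by rewrite ev2Y rmorph0.
 by move/inj/eqP;rewrite polyC_eq0 polyX_eq0.
elim: b x => [|a b IHb] x.
 by move=> _ /eqP;rewrite mulf_eq0 expf_eq0 (negbTE y1n) andbF => /eqP.
move=> [ha ib] [_ [P ->] hP] [_ [Q ->] hQ].
have e : ('X^j)%:P * P = 'X^i * Q.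
 apply/eqP;rewrite -subr_eq0;apply/eqP/ha.
 have -> : ev2 (('X^j)%:P * P - 'X^i * Q) * a =
  y1 ^+ i * (y2 ^+ j * x - ev2 Q * a) + ev2 (-1) * (y2 ^+ j * (y1 ^+ i * x - ev2 P * a)).
  rewrite rmorphB !rmorphM !rmorphXn ev2X ev2Y;ring.
 apply: (ospanD A0D);first by apply: (ospanM A0M) => //;exists ('X^i);rewrite rmorphXn ev2X.
 apply: (ospanM A0M);first exact: A0e.
 by apply: (ospanM A0M) => //;exists (('X)%:P ^+ j);rewrite rmorphXn ev2Y.
have [P' [eP eQ]] := poly_coprime_XY e.
exists (ev2 P');first exact: A0e.
apply: IHb => //.
 by move: hP;rewrite eP rmorphM rmorphXn ev2X -mulrA -mulrBr.
by move: hQ;rewrite eQ rmorphM polyC_exp rmorphXn ev2Y -mulrA -mulrBr.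
Qed.
End TwoVar.

Hypothesis hdim : has_dim X 2.

Lemma points_of_finite (s : seq (set pt)) : (forall Y, List.In Y s -> forall a b, Y a -> Y b -> a = b) ->
 exists l : seq pt, forall q, (exists2 Y, List.In Y s & Y q) -> List.In q l.
elim: s => [|Y s IHs] h;first by exists [::] => q [Y []].
have [|l hl] := IHs;first by move=> Y' Y's;apply: h;right.
have [[y Yy]|no] := pselect (exists y, Y y);last first.
 by exists l => q [Y' [<-|Y's] Yq];[case: no;exists q|apply: hl;exists Y'].
exists (y :: l) => q [Y' [<-|Y's] Yq];last by right;apply: hl;exists Y'.
by left;apply: h Yy Yq;left.
Qed.

Lemma homog0_const (F : form) : F \is 0.-homog -> F = (F@_0%MM)%:MP.
move=> /dhomogP hF;apply/mpolyP => m;rewrite mcoeffC.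
have [->|nm] := eqVneq m 0%MM;first by rewrite mulr1.
rewrite mulr0;apply: memN_msupp_eq0;apply: contraNN nm => /hF /eqP.
by rewrite mdeg_eq0.
Qed.

(** Otherwise f alone would cut out p. For suitable Noether parameters, y2^(2N) = c y1 in the local
    ring. Writing c = C1/C2, let e be the unit C2/M^h and w = e/y1: then y1 w and y2^(2N) w are
    regular forms over powers of M, so depth two bounds the denominators of all powers of w by one
    element [Dl]. A Noetherian relation among the [Dl] w^j shows that e^n is divisible by y1,
    although e is a unit. *)
Lemma max_pow_not_dvd p f N : Xpts p -> mx p f -> f != 0 ->
 exists z, mx p z /\ ~ odvd (O_at p) f (z ^+ N).
move=> Xp mf nf;apply: contrapT => noz.
have H z : mx p z -> odvd (O_at p) f (z ^+ N).
 by move=> mz;apply: contrapT => nz;apply: noz;exists z.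
have pp := prime_pt Xp;have pX := prime_pts.
have [d [F [G [hF hG Fp Gp ef]]]] := (m_atP p f).1 mf.
have nF : gev F != 0 by apply: contraNneq nf => e;rewrite ef e mul0r.
have d0 : (0 < d)%N.
 rewrite lt0n;apply: contraNneq nF => d0;rewrite d0 in hF.
 by move: Fp;rewrite (homog0_const hF) pevC => ->;rewrite gevC rmorph0.
have [s [hs cs]] := decomposition (closedX_cap (closedX_pts) hF).
have [Y0 [Y0s [a [b [Ya Yb nab]]]]] : exists Y, List.In Y s /\ exists a b, [/\ Y a, Y b & a <> b].
 apply: contrapT => no;have [t ft] := hdim.1.
 have [|l hl] := @points_of_finite s.
  by move=> Y Ys a b Ya Yb;apply: contrapT => nab;apply: no;exists Y;split=> //;exists a, b.
 apply: (finite_zero_growth (s := l) d0 hF _ ft) => q Xq Fq;apply: hl.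
 exact: cs.
have [cY0 pY0 Y0V] := hs _ Y0s;have [Xa Fa] := Y0V _ Ya.
(* Components of F = 0 inside {p, a} are harmless. On each other component a point different from p
   and a is marked; the quadric A = L L' passes through p and a but misses the marked points. Hence
   F = A = 0 is finite, while A does not vanish on [Y0]. *)
pose sm Y := forall q, Y q -> q = p \/ q = a.
have [l [hl1 hl2]] : exists l : seq pt, (forall q, List.In q l -> q <> p /\ q <> a) /\
  forall Y, List.In Y s -> sm Y \/ exists2 q, Y q & List.In q l.
 elim: s {hs cs Y0s} => [|Y s [l [h1 h2]]];first by exists [::].
 have [sY|nsY] := pselect (sm Y).
  by exists l;split=> // Y' [<-|/h2//];left.
 have [q [Yq nq]] : exists q, Y q /\ ~ (q = p \/ q = a).
  apply: contrapT => no;apply: nsY => q Yq;apply: contrapT => nq;apply: no;by exists q.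
 exists (q :: l);split.
  by move=> q' [<-|/h1//];split=> e;apply: nq;[left|right].
 move=> Y' [<-|/h2 [|[q' Yq' q'l]]];[right|left|right] => //.
  by exists q => //;left.
 by exists q' => //;right.
have [q0 Y0q0 q0l] : exists2 q, Y0 q & List.In q l.
 have [sY|//] := hl2 _ Y0s;have [|q Yq h] := prime_avoiding_list [:: p;a] pY0;first by exists a, b.
 by case: (sY _ Yq) => e;case: (h q) => //=;[left|right;left].
have [L [hL Lp Ll]] := @linear_through p l (fun q ql => (hl1 q ql).1).
have [L' [hL' L'a L'l]] := @linear_through a l (fun q ql => (hl1 q ql).2).
pose A := L * L';have hA : A \is (1 + 1).-homog by exact: dhomogM.
have Ap : peval A p = 0 by rewrite pevM Lp mul0r.
have Aa : peval A a = 0 by rewrite pevM L'a mulr0.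
have Al q : List.In q l -> peval A q != 0 by move=> ql;rewrite pevM mulf_neq0 ?Ll ?L'l.
have [ws hws] : exists ws : seq pt, forall q, Xpts q -> peval F q = 0 -> peval A q = 0 -> List.In q ws.
 have [s' [hs' cs']] := decomposition (closedX_cap (closedX_cap (closedX_pts) hF) hA).
 have [|ws h] := @points_of_finite s';last by exists ws => q Xq Fq Aq;apply/h/cs'.
 move=> W /hs' [cW pW WV] u v Wu Wv;apply: contrapT => nuv.
 have [||Y Ys WY] := @prime_finite_union W s pW.
 - by move=> Y /hs [].
 - by move=> q /WV [[Xq Fq] _];apply: cs.
 have [cY pY YV] := hs _ Ys.
 have [sY|[q Yq ql]] := hl2 _ Ys.
  have [|q Wq h] := prime_avoiding_list [:: p;a] pW;first by exists u, v.
  by case: (sY _ (WY _ Wq)) => e;case: (h q) => //=;[left|right;left].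
 apply: nuv;apply: (chain_pt hdim.2 pW pY WY Wu Wv hA hF) => //.
 - by move=> r /WV [].
 - by move=> vA;have := Al _ ql;rewrite vA// eqxx.
 - by move=> r /YV [].
have [M hM nM] := @linear_nonzero (p :: a :: ws).
have Mp : peval M p != 0 by apply: nM;left.
have Ma : peval M a != 0 by apply: nM;right;left.
have nM0 : gev M != 0 by apply: (gev_neq0 pp hM) => /vanishes_pt e;rewrite e eqxx in Mp.
(* F, of degree d, is squared and the quadric A is raised to the power d, to reach the common degree
   2d. *)
pose D := (2 * d)%N;have D0 : (0 < D)%N by rewrite muln_gt0.
pose F2 := F ^+ 2;have hF2 : F2 \is D.-homog by have := dhomogMn 2 hF;rewrite mulnC.
pose A2 := A ^+ d;have hA2 : A2 \is D.-homog by exact: dhomogMn.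
have hMD := homogXn D hM.
have [||N0 hN0] := @forms_in_lin_ideal D [:: M ^+ D;F2;A2].
- by move=> [|[|[|[]]]].
- move=> q Xq;have [Fq|nFq] := eqVneq (peval F q) 0;last by exists 1%N;rewrite//= pevXn expf_neq0.
 have [Aq|nAq] := eqVneq (peval A q) 0;last by exists 2%N;rewrite//= pevXn expf_neq0.
 by exists 0%N;rewrite//= pevXn expf_neq0// nM//;right;right;apply: hws.
pose y1 := fq M F2 D;pose y2 := fq M A2 D.
have nvM Z : Z a \/ Z p -> ~ van M Z.
 by case=> Zx v;[have /eqP := v _ Zx;rewrite (negbTE Ma)|have /eqP := v _ Zx;rewrite (negbTE Mp)].
(* The chain a < [Y0] < X makes y1 and y2 algebraically independent: y2 vanishes at a but not on
   [Y0], and y1 vanishes on [Y0] but not on X. *)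
have inj : injective (ev2 y1 y2).
 have pa := prime_pt Xa.
 have [O1 m1] := frac_in pY0 hF2 hM (nvM _ (or_introl Ya)).
 have [O2 m2] := frac_in pY0 hA2 hM (nvM _ (or_introl Ya)).
 have [O2a m2a] := frac_in pa hA2 hM (nvM [set a] (or_introl erefl)).
 have [_ m1X] := frac_in pX hF2 hM (nvM Xpts (or_introl Xa)).
 suff ker P : ev2 y1 y2 P = 0 -> P = 0.
  by move=> P Q e;apply/eqP;rewrite -subr_eq0;apply/eqP/ker;rewrite rmorphB e subrr.
 move=> e;have [_ Y0X _] := pY0.
 have step1 (Q : {poly k}) : mi Y0 (map_poly cst Q).[y2] -> Q = 0.
  apply: (poly_free_step pa pY0) => [q ->|r|r||]//.
  - exact: lring_cst.
  - move=> h;apply: contrapT => /eqP nr;apply: (max_not1 pa).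
  by rewrite -(rmorph1 cst) -(mulVf nr) rmorphM;apply: maxM => //;apply: lring_cst.
  - by apply/m2a/vanishes_pt;rewrite pevXn Aa expr0n gtn_eqF.
  - move/m2 => v;have := v _ Y0q0;rewrite pevXn => /eqP.
  by rewrite expf_eq0 (negbTE (Al _ q0l)) andbF.
 apply: (@poly_free_step {poly k} (horner_eval y2 \o map_poly cst) Y0 Xpts y1 pY0 pX Y0X _ step1) => [r|||].
 - rewrite /= /horner_eval horner_coef;apply: lring_sum => // i _;apply: lringM => //;last exact: lringX.
  by rewrite coef_map;apply: lring_cst.
 - by apply/m1 => q /Y0V [_ Fq];rewrite pevXn Fq expr0n.
 - by move/m1X => v;have [q Xq] := exists_pt hF nF;have := v q Xq;rewrite pevXn => /eqP;
  rewrite expf_eq0 /= => h;rewrite h.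
 - have -> := (e : (map_poly ((horner_eval y2 \o map_poly cst) :
  {rmorphism {poly k} -> K}) P).[y1] = 0).
  exact: max0 pX.
pose N1 := (N0 + D)%N.
pose rm (m : 'X_{1..(pdim X).+1 < N1}) : K := gev 'X_[m] / gev M ^+ mdeg m.
pose rs := [seq rm m | m <- enum {: 'X_{1..(pdim X).+1 < N1}}].
pose R := ospan (A0 y1 y2) rs.
have RD x y : R x -> R y -> R (x + y) by apply: ospanD;exact: A0D.
have RM c x : A0 y1 y2 c -> R x -> R (c * x) by apply: ospanM;exact: A0M.
have main e H' : H' \is e.-homog -> R (gev H' / gev M ^+ e).
 elim/ltn_ind: e H' => e IH H' hH';have [lt|le] := ltnP e N1.
  rewrite [H']mpolyE gev_sum mulr_suml big_seq;apply: big_ind => //;first exact: ospan0.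
  move=> m mH;have md : mdeg m = e by move/dhomogP: hH' => /(_ _ mH).
  rewrite gevZ -mulrA;apply: (RM);first by exists (H'@_m)%:P%:P;rewrite /= map_polyC /horner_eval hornerC /= map_polyC /horner_eval hornerC.
  apply: ospan_mem;have hm : (mdeg m < N1)%N by rewrite md.
  by apply/mapP;exists (BMultinom hm);rewrite ?mem_enum// /rm md.
 have [|_ [C [hC _ eH]]] := hN0 e H' _ hH';first by apply: leq_trans le;rewrite leq_addr.
 have De : (D <= e)%N by apply: leq_trans le;rewrite leq_addl.
 have lte : (e - D < e)%N by rewrite ltn_subrL D0 (leq_trans D0 De).
 move: eH;rewrite !big_ord_recl big_ord0 addr0 => ->.
 have e2 : gev M ^+ e = gev M ^+ D * gev M ^+ (e - D) by rewrite -exprD subnKC.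
 have -> : (gev (M ^+ D * C 0%N) + (gev (F2 * C (bump 0 0)) + gev (A2 * C (bump 0 (bump 0 0))))) / gev M ^+ e =
  fq M (C 0%N) (e - D) + (y1 * (fq M (C 1%N) (e - D)) +
  y2 * (fq M (C 2%N) (e - D))).
  rewrite e2 gevM gevM gevM gevXn /y1 /y2.
  have nu : gev M ^+ D != 0 by rewrite expf_neq0.
  have nv : gev M ^+ (e - D) != 0 by rewrite expf_neq0.
  by field;rewrite nv.
 apply: (RD);first exact: IH.
 apply: (RD);apply: (RM);try exact: IH.
  by exists 'X;rewrite ev2X.
 by exists ('X)%:P;rewrite ev2Y.
have [O1p m1p] := frac_in pp hF2 hM (nvM [set p] (or_intror erefl)).
have [O2p m2p] := frac_in pp hA2 hM (nvM [set p] (or_intror erefl)).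
have m1 : mx p y1 by apply/m1p/vanishes_pt;rewrite pevXn Fp expr0n.
have m2 : mx p y2 by apply/m2p/vanishes_pt;rewrite pevXn Ap expr0n gtn_eqF.
have ny1 : y1 != 0.
 by apply: contraNneq nF => /eqP;rewrite mulf_eq0 invr_eq0 !expf_eq0 (negbTE nM0) andbF orbF gevXn expf_eq0 /=.
(* By assumption y2^N is divisible by f. Its square is divisible by f^2, which is y1 times a unit at
   p. *)
have [c Oc ec] : exists2 c, O_at p c & y2 ^+ (N * 2) = c * y1.
 have [x Ox ex] := H _ m2;exists (x ^+ 2 * (gev (M ^+ D) / gev (G ^+ 2))).
  apply: lringM => //;first exact: lringX.
  apply/O_atP;exists D, (M ^+ D), (G ^+ 2);split=> //;last by rewrite pevXn expf_neq0.
  by have := dhomogMn 2 hG;rewrite mulnC.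
 have nG' : gev G != 0 by apply: (gev_neq0 pp hG) => /vanishes_pt e;rewrite e eqxx in Gp.
 rewrite exprM ex ef /y1 /F2 !gevXn;have nu : gev M ^+ D != 0 by rewrite expf_neq0.
 by move: (gev M ^+ D) nu => z nz;field;rewrite nG' nz.
have [h [C1 [C2 [hC1 hC2 nC2 ec']]]] := (O_atP p c).1 Oc.
have nvC2 : ~ van C2 [set p] by move/vanishes_pt => e;rewrite e eqxx in nC2.
have nC2' := gev_neq0 pp hC2 nvC2.
pose e := fq M C2 h;pose r := fq M C1 h.
have [Oe me] := frac_in pp hC2 hM (nvM [set p] (or_intror erefl)).
have ne : ~ mx p e by move/me.
have Rpow (H' : form) j : H' \is h.-homog -> R ((gev H' / gev M ^+ h) ^+ j).
 by move=> hH;have := main _ _ (dhomogMn j hH);rewrite gevXn exprM expr_div_n.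
have [w ew rw] : exists2 w, y1 * w = e & y2 ^+ (N * 2) * w = r.
 exists (e / y1);first by rewrite mulrC divfK.
 by rewrite ec ec' /e /r mulrACA mulfV// mulr1 mulrA divfK.
have [bs [Dl [nDl bin ib hb]]] := free_part y1 y2 rs.
have key j : ospan (A0 y1 y2) bs (ev2 y1 y2 Dl * w ^+ j).
 apply: (@ospan_saturated y1 y2 bs j (N * 2 * j)) => //.
  by rewrite mulrCA -exprMn ew;apply: hb;apply: Rpow.
 by rewrite mulrCA exprM -exprMn rw;apply: hb;apply: Rpow.
have Oev P : O_at p (ev2 y1 y2 P).
 change (O_at p (map_poly ((horner_eval y2 \o map_poly cst) : {rmorphism {poly k} -> K}) P).[y1]).
 rewrite horner_coef;apply: lring_sum => // i _;apply: lringM => //;last first.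
  exact: lringX => // //.
 rewrite coef_map /= /horner_eval horner_coef;apply: lring_sum => // j _.
 apply: lringM => //;first by rewrite coef_map;apply: lring_cst.
 exact: lringX => // //.
have Ob x : ospan (A0 y1 y2) bs x -> O_at p x.
 have : forall z, z \in bs -> O_at p z.
  move=> z /bin /mapP [m _ ->] => //.
  have hm : ('X_[m] : form) \is (mdeg m).-homog by rewrite dhomogX.
  exact: (frac_in pp hm hM (nvM [set p] (or_intror erefl))).1.
 elim: bs x {bin ib hb key} => [|z bs IHb] x hz /=;first by move=> ->;apply: lring0.
 case=> _ [P ->] /IHb h';rewrite -[x](subrK (ev2 y1 y2 P * z));apply: lringD => //.
  by apply: h' => z' z'b;apply: hz;rewrite inE z'b orbT.
 by apply: (lringM pp);[exact: Oev|apply: hz;rewrite mem_head].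
have nev : ev2 y1 y2 Dl != 0 by apply: contraNneq nDl => e0;apply/eqP/inj;rewrite rmorph0.
have [|S [hS gS]] := @noetherian_at p [set x | exists j, x = ev2 y1 y2 Dl * w ^+ j] Xp.
 by move=> _ [j ->];apply: Ob.
have [n hn] : exists n, forall x, x \in S -> exists2 j, (j < n)%N & x = ev2 y1 y2 Dl * w ^+ j.
 elim: S hS {gS} => [|x S IHS] hS;first by exists 0%N.
 have [|n hn] := IHS;first by move=> x' x'S;apply: hS;rewrite inE x'S orbT.
 have [j ej] := hS x (mem_head _ _);exists (maxn n j.+1) => x';rewrite inE => /orP [/eqP ->|].
  by exists j => //;rewrite leq_maxr.
 by move/hn => [j' lt ->];exists j' => //;apply: leq_trans lt _;rewrite leq_maxl.
have mS x : ospan (O_at p) S x -> mx p (x * y1 ^+ n / ev2 y1 y2 Dl).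
 elim: S x hn {hS gS} => [|z S IHS] x hn /=;first by move=> ->;rewrite !mul0r;apply: max0.
 case=> c' Oc' /IHS hx.
 have -> : x * y1 ^+ n / ev2 y1 y2 Dl = (x - c' * z) * y1 ^+ n / ev2 y1 y2 Dl +
  c' * (z * y1 ^+ n / ev2 y1 y2 Dl) by ring.
 apply: maxD => //;first by apply: hx => z' z'S;apply: hn;rewrite inE z'S orbT.
 apply: maxM => //;have [j jn ->] := hn z (mem_head _ _).
 have -> : ev2 y1 y2 Dl * w ^+ j * y1 ^+ n / ev2 y1 y2 Dl = (y1 ^+ (n - j.+1) * e ^+ j) * y1.
  have -> : y1 ^+ n = y1 ^+ (n - j.+1) * (y1 * y1 ^+ j) by rewrite -exprS -exprD subnK.
  rewrite -ew (exprMn j y1 w).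
  move: (w ^+ j) (y1 ^+ (n - j.+1)) (y1 ^+ j) ev2 nev => x1 x2 x3 x4 nx4.
  by field.
 apply: maxM => //;apply: (lringM pp);apply: lringX => //.
have := mS _ (gS _ (ex_intro _ n erefl)).
have -> : ev2 y1 y2 Dl * w ^+ n * y1 ^+ n / ev2 y1 y2 Dl = e ^+ n.
 rewrite -ew (exprMn n y1 w);move: ev2 nev => x nx;by field.
by move/(max_exp pp Oe).
Qed.
End RegularityDim.

(** * Prime divisors and local equations *)

Section PrimeDivisors.
Implicit Types (Z Y C : set pt) (p q : pt) (F G : form).

Lemma closed_closedX Z : zariski_closed Z -> Z `<=` Xpts -> closedX Z.
move=> cZ ZX;split=> // q Xq h;apply: contrapT => nZq.
have [d [H [hH nH sub]]] := cZ q nZq.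
case/eqP: nH;apply: (h d H hH) => r Zr;apply: contrapT => /eqP /sub;exact.
Qed.

Lemma closedX_closed Z : closedX Z -> zariski_closed Z.
move=> [ZX cZ] q nZq;have [Xq|nXq] := pselect (Xpts q);last first.
 have : exists d F, [/\ F \is d.-homog, gev F = 0 & peval F q != 0].
  apply: contrapT => no;apply: nXq => e F hF F0;apply: contrapT => /eqP h.
  by apply: no;exists e, F.
 move=> [d [F [hF F0 nF]]];exists d, F;split=> // r nr Zr.
 by have := ZX _ Zr _ _ hF F0;move/eqP;rewrite (negbTE nr).
have : exists d F, [/\ F \is d.-homog, van F Z & peval F q != 0].
 apply: contrapT => no;apply: nZq;apply: cZ => // e F hF vF;apply: contrapT => /eqP h.
 by apply: no;exists e, F.
move=> [d [F [hF vF nF]]];exists d, F;split=> // r nr Zr.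
by have := vF _ Zr;move/eqP;rewrite (negbTE nr).
Qed.

Lemma prime_closed_irreducible Z : prime_set Z -> closedX Z -> irreducible_closed Z.
move=> pZ cZ;have [nZ ZX hZ] := pZ;split=> //;first exact: closedX_closed.
move=> A B cA cB ZAB;apply: contrapT => /not_orP [nA nB].
have sep D : zariski_closed D -> ~ (Z `<=` D) -> exists d H, [/\ H \is d.-homog,
  ~ van H Z & van H D].
 move=> cD /existsNP [q /not_implyP [Zq nDq]];have [d [H [hH nH sub]]] := cD q nDq.
 exists d, H;split=> //;first by move=> v;rewrite v ?eqxx in nH.
 by move=> r Dr;apply: contrapT => /eqP /sub.
have [d [H [hH nH vH]]] := sep _ cA nA;have [e [H' [hH' nH' vH']]] := sep _ cB nB.
apply: (nvanM pZ hH hH' nH nH') => q Zq;rewrite pevM.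
by have [/vH ->|/vH' ->] := ZAB _ Zq;rewrite ?mul0r ?mulr0.
Qed.
Lemma pdiv_prime C : pdiv C -> prime_set C.
by move=> [irr [CX _] _];apply: prime_irreducible. Qed.
Coercion pdiv_prime : prime_divisor >-> prime_set.
Lemma pdiv_closed C : pdiv C -> closedX C.
by move=> [[cC _ _] [CX _] _];apply: closed_closedX. Qed.

Lemma proper_form Z : closedX Z -> Z `<` Xpts -> exists d F,
 [/\ F \is d.-homog, van F Z & gev F != 0].
move=> [ZX cZ] [_ nXZ];apply: contrapT => no;apply: nXZ => q Xq;apply: cZ => // d F hF vF.
apply: (Xq d) => //;apply: contrapT => /eqP h;apply: no;by exists d, F.
Qed.

Section AtPoint.
Variables (p : pt) (u v : K).
Hypothesis Xp : Xpts p.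
Hypothesis luv : local_params p u v.
Hypothesis hdim : has_dim X 2.
Local Notation O := (@O_at k X p).
Let pp := prime_pt Xp.

Lemma Ou_at : O u. have [mu _ _] := luv;apply: max_sub mu. Qed.
Lemma Ov_at : O v. have [_ mv _] := luv;apply: max_sub mv. Qed.
Let O1 : O 1 := lring1 pp.
Let OB f g : O f -> O g -> O (f - g) := @lringB _ pp f g.
Let OM f g : O f -> O g -> O (f * g) := @lringM _ pp f g.
Let OD f g : O f -> O g -> O (f + g) := @lringD _ pp f g.

Lemma mxi_max f : mxi O u v f <-> mx p f.
have [mu mv h] := luv;split=> [[a [b [Oa Ob ->]]]|/h//].
by apply: (maxD pp);apply: maxM.
Qed.

Let noeth := fun S SO => @noetherian_at p S Xp SO.
Let mx1 : ~ mxi O u v 1. by move/mxi_max;apply: max_not1. Qed.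
Let Oinv f : O f -> ~ mxi O u v f -> O f^-1.
by move=> Of nm;apply: (lring_inv pp Of _).1 => /mxi_max. Qed.
Lemma krull_at J x : oideal O J -> O x ->
 (forall n, exists2 w, mpow O u v n w & J (x - w)) -> J x.
exact: (krull O1 OB OM Ou_at Ov_at noeth mx1 Oinv). Qed.
Lemma oideal0 : oideal O [set 0].
split=> [_ ->|//|f g -> ->|a f _ ->];[exact: lring0 pp|by rewrite addr0|by rewrite mulr0].
Qed.

Lemma finite_order f : O f -> f != 0 -> exists n, ~ mpow O u v n f.
move=> Of nf;apply: contrapT => /forallNP h;case/eqP: nf.
apply: (krull_at oideal0 Of) => n;exists f;last by rewrite subrr.
exact: contrapT.
Qed.

(** Q misses u or v, since it does not contain the maximal ideal; the two cases are exchanged by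
    symmetry. *)
Lemma principal_at Q : oprime O Q -> (exists2 f, Q f & f != 0) -> ~ (mx p `<=` Q) ->
 exists2 t, Q t & Q `<=` odvd O t.
move=> pQ nz nm;have [[QO Q0 QD QM] Q1 prQ] := pQ.
have [Qu|nQu] := pselect (Q u);last first.
 apply: (prime_principal_aux O1 OB OM Ou_at Ov_at noeth mx1 Oinv pQ nz nQu).
 by [].
have [Qv|nQv] := pselect (Q v).
 case: nm => f mf;have [_ _ h] := luv.
 by have [a [b [Oa Ob ->]]] := h _ mf;apply: (QD);apply: (QM).
have sw f : mxi O v u f <-> mxi O u v f.
 by split=> -[a [b [Oa Ob ->]]];exists b, a;rewrite addrC.
have mx1' : ~ mxi O v u 1 by move/sw.
have Oinv' f : O f -> ~ mxi O v u f -> O f^-1.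
 by move=> Of nf;apply: Oinv => // /sw.
apply: (prime_principal_aux O1 OB OM Ov_at Ou_at noeth mx1' Oinv' pQ nz nQv).
by [].
Qed.

Lemma mpow_exp z n : mx p z -> mpow O u v n (z ^+ n).
move=> /mxi_max mz;elim: n => [|n IH];first by rewrite expr0.
by rewrite exprS;apply: (mpow_mul O1 OB OM Ou_at Ov_at).
Qed.

(** If u and v both had powers in (f), a fixed power of the whole maximal ideal would be divisible
    by f, against [max_pow_not_dvd]. So some z has no power in (f), and a prime over (f) avoids
    z. *)
Lemma prime_over f : mx p f -> f != 0 -> exists Q, [/\ oprime O Q, Q f & ~ (mx p `<=` Q)].
move=> mf nf;have Of := max_sub mf;have idf := oideal_dvd O1 OB OM Of.
have [z [mz hz]] : exists z, mx p z /\ forall n, ~ odvd O f (z ^+ n).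
 apply: contrapT => no;have [mu mv _] := luv.
 have [a ha] : exists a, odvd O f (u ^+ a).
  by apply: contrapT => /forallNP h;apply: no;exists u.
 have [b hb] : exists b, odvd O f (v ^+ b).
  by apply: contrapT => /forallNP h;apply: no;exists v.
 have [z [mz []]] := @max_pow_not_dvd hdim p f (a + b) Xp mf nf.
 by apply: (mpow_in O1 OM Ou_at Ov_at idf ha hb);apply: mpow_exp.
have [Q [pQ fQ nQ]] := oprime_avoiding O1 OB OM idf (max_sub mz) hz.
exists Q;split=> //;first by apply: fQ;exists 1;rewrite ?mul1r.
by move/(_ _ mz).
Qed.

Lemma prime_sub_max Q : oprime O Q -> Q `<=` mx p.
move=> [[QO Q0 QD QM] Q1 prQ] f Qf;apply: contrapT => nm.
have [Oi _] := lring_inv pp (QO _ Qf) nm;apply: Q1.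
have nf := lring_neq0 pp nm.
by rewrite -(mulVf nf);apply: QM.
Qed.

(* The subvariety with generic point Q. *)
Lemma variety_of_prime Q : oprime O Q -> exists Y, [/\ prime_set Y, closedX Y, Y p &
 forall f, O f -> (mi Y f <-> Q f)].
move=> pQ;have [[QO Q0 QD QM] Q1 prQ] := pQ.
have [i hi] := pt_linear p;pose y : form := 'X_i.
have hy : y \is 1.-homog by exact: homogX1.
have yp : peval y p != 0 by rewrite hi oner_neq0.
have nyp : ~ van y [set p] by move/vanishes_pt => e;rewrite e eqxx in yp.
have gy : gev y != 0 := gev_neq0 pp hy nyp.
pose ev : {rmorphism form -> K} := mmap cst (fun j => gev 'X_j / gev y).
have evO F : O (ev F).
 apply: lring_sum => // m _;apply: lringM => //;first exact: lring_cst.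
 apply: big_ind => [||j _];[exact: lring1|exact: lringM|apply: lringX => //].
 by have := (frac_in pp (homogX1 j) hy nyp).1.
have evH d F : F \is d.-homog -> ev F = fq y F d.
 move=> hF;apply: (mulIf (expf_neq0 d gy));rewrite divfK ?expf_neq0// mulrC.
 rewrite -(homog_scale cst _ _ hF);apply: eq_bigr => m _;congr (_ * _).
 by apply: eq_bigr => j _;rewrite mulrC divfK// gevX.
pose I : set form := fun F => Q (ev F).
have idI : isideal I.
 split;rewrite /I ?rmorph0// => f g;rewrite ?rmorphD ?rmorphM;[exact: QD|].
 exact: QM.
have I1 : ~ I 1 by rewrite /I rmorph1.
have prI F G : I (F * G) -> I F \/ I G by rewrite /I rmorphM;apply: prQ.
have [L [phi hphi]] := field_of_prime idI I1 prI.
have ni : phi 'X_i != 0.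
 apply/eqP => /hphi;rewrite /I (evH 1%N) ?divff//.
pose Y : set pt := [set q | Xpts q /\ forall d F, F \is d.-homog -> I F -> peval F q = 0].
have vY d F : F \is d.-homog -> (van F Y <-> I F).
 move=> hF;split=> [vF|IF q [_ h]];last exact: (h d).
 apply: contrapT => nI;have nphi : phi F != 0 by apply/eqP => /hphi.
 rewrite rmorph_mmap in nphi.
 have [q [hq nq]] := nullst_proj ni hF nphi.
 case/eqP: nq;apply: vF;split=> e G hG.
  by move=> G0;apply: (hq e) => //;rewrite -rmorph_mmap;apply/hphi;rewrite /I (evH _ _ hG) G0 mul0r.
 by move=> IG;apply: (hq e) => //;rewrite -rmorph_mmap;apply/hphi.
have pY : prime_set Y.
 split;last 1 first.
 - by move=> d e F G hF hG /(vY _ _ (dhomogM hF hG)) /prI [] h;[left|right];[apply/(vY d)|apply/(vY e)].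
 - have h1 : (1 : form) \is 0.-homog by exact: dhomog1.
  apply: contrapT => no;apply: I1;apply/(vY 0%N) => // q Yq;case: no;by exists q.
 - by move=> q [].
have Yp : Y p.
 split=> // d F hF IF;apply/vanishes_pt;have [_ h] := frac_in pp hF hy nyp.
 by apply/h/(prime_sub_max pQ);rewrite -evH.
exists Y;split=> //.
 split;first by case: pY.
 by move=> q Xq h;split=> // d F hF IF;apply: (h d) => //;apply/(vY d).
move=> f /O_atP [d [F [G [hF hG nG ->]]]].
have nGp : ~ van G [set p] by move/vanishes_pt => e;rewrite e eqxx in nG.
have -> : gev F / gev G = gev y ^+ d / gev G * ev F.
 by rewrite (evH _ _ hF) [RHS]mulrC mulrA divfK// expf_neq0.
have Oy : O (gev y ^+ d / gev G).
 apply/O_atP;exists d, (y ^+ d), G;split;rewrite ?gevXn//;exact: homogXn.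
have nyY : ~ van y Y by move=> vy;apply: nyp => _ ->;apply: vy.
have [_ hm] := frac_in pY hF hy nyY;rewrite (evH _ _ hF).
split=> [h|h].
 apply: (QM) => //;rewrite -(evH _ _ hF);apply/(vY d) => //;apply/hm.
 have -> : fq y F d = fq y G d * (gev y ^+ d / gev G * (fq y F d)).
  by move: (gev ^+ d) expf_neq0 (gev_neq0 pp hG nGp) => w nw nG';field;rewrite nw.
 apply: maxM => //;exact: (frac_in pY hG hy nyY).1.
apply: (maxM pY);first by apply: lring_mono Oy => // _ ->.
apply/hm/(vY d) => //;rewrite /I (evH _ _ hF).
have -> : fq y F d = fq y G d * (gev y ^+ d / gev G * (fq y F d)).
 by move: (gev ^+ d) expf_neq0 (gev_neq0 pp hG nGp) => w nw nG';field;rewrite nw.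
apply: (QM) => //;exact: (frac_in pp hG hy nyp).1.
Qed.

Lemma trace_prime Y : prime_set Y -> Y p -> oprime O [set f | O f /\ mi Y f].
move=> pY Yp;have pY' : [set p] `<=` Y by move=> _ ->.
have OY := lring_mono pY pY'.
split;first split.
- by move=> f [].
- split;[exact: lring0 pp|exact: max0].
- move=> f g [Of mf] [Og mg];split;[exact: OD|exact: maxD].
- by move=> a f Oa [Of mf];split;[exact: OM|apply: maxM => //;apply: OY].
- by move=> [_];apply: max_not1.
- move=> f g Of Og [_ /(max_prime pY (OY _ Of) (OY _ Og)) []];by [left|right].
Qed.

(** A larger subvariety Z through p has a smaller nonzero prime, and both primes are principal. If
    t' = a t with t' a generator of the smaller one, then t lies in it: the other possibility, a
    divisible by t', would make t invertible. Hence the primes agree. *)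
Lemma prime_divisor_of Q : oprime O Q -> (exists2 f, Q f & f != 0) -> ~ (mx p `<=` Q) ->
 exists C, [/\ pdiv C, C p & forall f, O f -> (mi C f <-> Q f)].
move=> pQ [f0 Qf0 nf0] nmQ;have [Y [pY cY Yp hY]] := variety_of_prime pQ.
exists Y;split=> //;have [[QO Q0 QD QM] Q1 prQ] := pQ.
split;first exact: prime_closed_irreducible.
 split;first by case: pY.
 move=> XY;case/eqP: nf0;apply: max_pts;have -> : Xpts = Y.
  by apply/seteqP;case: pY.
 by apply/hY => //;apply: QO.
move=> Z irrZ YZ ZX;have pZ := prime_irreducible irrZ ZX.1.
have Zp := YZ _ Yp;have cZ : closedX Z by have [c _ _] := irrZ;apply: closed_closedX => //;exact: ZX.1.
have pQZ := trace_prime pZ Zp;set QZ := [set f | _] in pQZ.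
have QZQ : QZ `<=` Q.
 by move=> f [Of mf];apply/hY => //;apply: max_restrict mf => //;apply: lring_mono Of => // _ ->.
have nzQZ : exists2 f, QZ f & f != 0.
 have [d [F [hF vF nF]]] := proper_form cZ ZX;have [i [hi hy nyp]] := pt_coordinate p.
 have nyZ : ~ van ('X_i : form) Z by move=> vy;apply: nyp => _ ->;apply: vy.
 exists (fq 'X_i F d).
  by split;[exact: (frac_in pp hF hy nyp).1|apply/(frac_in pZ hF hy nyZ).2].
 by rewrite mulf_neq0// invr_eq0 expf_neq0// (gev_neq0 pp hy nyp).
have nmQZ : ~ (mx p `<=` QZ) by move=> h;apply: nmQ => f /h /QZQ.
have [t Qt ht] := principal_at pQ (ex_intro2 _ _ f0 Qf0 nf0) nmQ.
have [t' Qt' ht'] := principal_at pQZ nzQZ nmQZ.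
have QQZ : Q `<=` QZ.
 have [[_ _ _ QZM] QZ1 prQZ] := pQZ;have nt' : t' != 0.
  by have [f Qf nf] := nzQZ;apply: contraNneq nf => e;have [a _ ->] := ht' _ Qf;rewrite e mulr0.
 have [a Oa ea] := ht _ (QZQ _ Qt').
 have [Qa|QZt] : QZ a \/ QZ t by apply: prQZ => //;[exact: QO|rewrite -ea].
  have [b Ob eb] := ht' _ Qa;exfalso;apply: Q1.
  have e1 : 1 = b * t by apply: (mulIf nt');rewrite mul1r {1}ea {1}eb mulrAC.
  by rewrite e1;apply: QM.
 by move=> f /ht [b Ob ->];apply: QZM.
apply/seteqP;split=> //;move=> q Zq;have [_ cYq] := cY;apply: cYq;first exact: ZX.1.
move=> d F hF vF;have [i [hi hy nyp]] := pt_coordinate p.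
have nyZ : ~ van ('X_i : form) Z by move=> vy;apply: nyp => _ ->;apply: vy.
have nyY : ~ van ('X_i : form) Y by move=> vy;apply: nyp => _ ->;apply: vy.
have Of := (frac_in pp hF hy nyp).1.
have /(hY _ Of)/QQZ [_] : mi Y (fq 'X_i F d).
 exact/(frac_in pY hF hy nyY).2.
by move/(frac_in pZ hF hy nyZ).2;apply.
Qed.

(** A prime divisor is not a point: if its trace were the maximal ideal, C would be {p}, and the
    prime divisor through p given by [prime_over] would contain C, hence equal it, although its
    prime is not maximal. *)
Lemma pdiv_trace C : pdiv C -> C p -> let Q := [set f | O f /\ mi C f] in
 [/\ oprime O Q, exists2 f, Q f & f != 0 & ~ (mx p `<=` Q)].
move=> dC Cp Q;have cC := pdiv_closed dC.
have [irrC CX maxC] := dC;have pQ := trace_prime dC Cp.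
have [i [hi hy nyp]] := pt_coordinate p.
have nyC : ~ van ('X_i : form) C by move=> vy;apply: nyp => _ ->;apply: vy.
have [f Qf nf] : exists2 f, Q f & f != 0.
 have [d [F [hF vF nF]]] := proper_form cC CX.
 exists (fq 'X_i F d).
  by split;[exact: (frac_in pp hF hy nyp).1|apply/(frac_in dC hF hy nyC).2].
 by rewrite mulf_neq0// invr_eq0 expf_neq0// (gev_neq0 pp hy nyp).
split=> //;first by exists f.
move=> mQ;have mf : mx p f by apply: (prime_sub_max pQ).
have [Q' [pQ' Q'f nQ']] := prime_over mf nf.
have [C' [dC' C'p hC']] := prime_divisor_of pQ' (ex_intro2 _ _ f Q'f nf) nQ'.
have C1 q : C q -> q = p.
 move=> Cq;apply: contrapT => nqp.
 have [|L [hL Lp Lq]] := separate_points (p := p) (q := q);first by move=> e;apply: nqp.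
 have [_] := mQ _ ((frac_in pp hL hy nyp).2.2 ((vanishes_pt _ _).2 Lp)).
 by move/(frac_in dC hL hy nyC).2 => /(_ _ Cq) /eqP;rewrite (negbTE Lq).
have CC' : C `<=` C' by move=> q /C1 ->.
have [irrC' C'X _] := dC'.
have eC := maxC _ irrC' CC' C'X.
by apply: nQ' => g mg;apply/(hC' _ (max_sub mg));rewrite eC;have [] := mQ _ mg.
Qed.

Lemma local_equation C : pdiv C -> C p -> exists t, [/\ O t, mi C t, t != 0 &
 forall f, O f -> mi C f -> odvd O t f].
move=> dC Cp;have [pQ nz nm] := pdiv_trace dC Cp.
have [t [Ot mt] ht] := principal_at pQ nz nm;exists t;split=> //.
 have [f Qf nf] := nz;apply: contraNneq nf => e;have [b _ ->] := ht _ Qf;by rewrite e mulr0.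
by move=> f Of mf;apply: ht.
Qed.
End AtPoint.
End PrimeDivisors.

Import Order.TTheory Num.Theory.

Hypothesis hX : smooth_surface X.

(** * Orders along prime divisors *)

Section Order.
Implicit Types (Z Y B C : set pt) (p q : pt) (F G : form) (f g t u : K).
Let hdim := hX.1.
Let hsm := hX.2.

Lemma frac_at p f : Xpts p -> exists a b, [/\ O_at p a, O_at p b, b != 0 & f = a / b].
move=> Xp;have [i [hi hy nyp]] := pt_coordinate p.
have gy := gev_neq0 Xp hy nyp.
have [d [F [G [hF hG nG ->]]]] := gen_pt_generates f.
exists (fq 'X_i F d), (fq 'X_i G d);split.
- exact: (frac_in Xp hF hy nyp).1.
- exact: (frac_in Xp hG hy nyp).1.
- by rewrite mulf_neq0// invr_eq0 expf_neq0.
by move: (gev ^+ d) expf_neq0 => w nw;field;rewrite nw.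
Qed.

Definition unit_at C u := lr C u /\ ~ mi C u.
Definition unif C t := [/\ t != 0, mi C t & forall g, mi C g -> exists2 a, lr C a & g = a * t].
Definition leq_at C p t := [/\ O_at p t, mi C t, t != 0 &
 forall f, O_at p f -> mi C f -> odvd (O_at p) t f].

Lemma pdiv_point C : pdiv C -> exists p, C p.
by move=> [[_ [p Cp] _] _ _];exists p. Qed.
Lemma pdiv_sub C : pdiv C -> C `<=` Xpts.
by move=> [_ [CX _] _]. Qed.

Lemma leq_ex C p : pdiv C -> C p -> exists t, leq_at C p t.
move=> dC Cp;have Xp := pdiv_sub dC Cp;have [u [v luv]] := hsm Xp.
exact: (local_equation Xp luv hdim dC Cp).
Qed.
Lemma lr_at C p f : pdiv C -> C p -> O_at p f -> lr C f.
by move=> dC Cp;apply: (lring_mono dC) => _ ->. Qed.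

Lemma mi_at C p f : pdiv C -> C p -> O_at p f -> mi C f -> mx p f.
move=> dC Cp Of;apply: max_restrict (pdiv_prime dC) _ Of => [|_ -> //].
by apply: prime_pt;apply: pdiv_sub Cp.
Qed.

Lemma leq_unif C p t : pdiv C -> C p -> leq_at C p t -> unif C t.
move=> dC Cp [Ot mt nt ht];split=> // g.
have Xp := pdiv_sub dC Cp;have [i [hi hy nyp]] := pt_coordinate p.
have nyC : ~ van ('X_i : form) C by move=> vy;apply: nyp => _ ->;apply: vy.
have gy := gev_neq0 Xp hy nyp.
move=> [d [F [G [hF hG vF nG ->]]]].
have [a Oa ea] := ht _ (frac_in Xp hF hy nyp).1 ((frac_in dC hF hy nyC).2.2 vF).
have [OG mG] := frac_in dC hG hy nyC.
have [Oi _] := lring_inv dC OG (fun h => nG (mG.1 h)).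
exists ((fq 'X_i G d)^-1 * a);first by apply: (lringM dC) => //;exact: lr_at Oa.
rewrite -mulrA -ea;move: (gev_neq0 dC hG nG) => nG'.
by move: (gev 'X_i ^+ d) (expf_neq0 d gy) => w nw;field;rewrite nw.
Qed.

Lemma unif_ex C : pdiv C -> exists t, unif C t.
move=> dC;have [p Cp] := pdiv_point dC;have [t ht] := leq_ex dC Cp.
by exists t;apply: leq_unif ht.
Qed.
Lemma unit1 C : pdiv C -> unit_at C 1.
move=> /pdiv_prime pC;split;[exact: lring1|exact: max_not1]. Qed.
Lemma unitM C u v : pdiv C -> unit_at C u -> unit_at C v -> unit_at C (u * v).
move=> /pdiv_prime pC [Ou mu] [Ov mv];split;first exact: lringM.
by move=> /max_prime [].
Qed.
Lemma unitV C u : pdiv C -> unit_at C u -> unit_at C u^-1.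
by move=> /pdiv_prime pC [Ou mu];apply: lring_inv. Qed.
Lemma unitX C u n : pdiv C -> unit_at C u -> unit_at C (u ^+ n).
move=> dC hu;elim: n => [|n IH];first by rewrite expr0;exact: unit1.
by rewrite exprS;apply: unitM.
Qed.
Lemma unitXz C u (m : int) : pdiv C -> unit_at C u -> unit_at C (u ^ m).
move=> dC hu;case: m => n;first exact: unitX.
by rewrite NegzE -exprnN;apply: unitV => //;apply: unitX.
Qed.
Lemma unit_cst C (c : k) : pdiv C -> c != 0 -> unit_at C (cst c).
move=> dC nc;have pC := pdiv_prime dC;split;first exact: lring_cst.
move=> mc;apply: (max_nunit pC mc);first by rewrite fmorph_eq0.
rewrite -fmorphV;exact: lring_cst.
Qed.
Lemma unit_neq0 C u : pdiv C -> unit_at C u -> u != 0.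
by move=> /pdiv_prime pC [_];apply: lring_neq0. Qed.

Lemma unif_unit C t t' : pdiv C -> unif C t -> unif C t' -> exists2 a, unit_at C a & t' = a * t.
move=> dC [nt mt ht] [nt' mt' ht'];have pC := pdiv_prime dC.
have [a Oa ea] := ht _ mt';have [b Ob eb] := ht' _ mt.
exists a => //;split=> // ma;apply: (max_not1 pC).
have -> : 1 = b * a by apply: (mulIf nt);rewrite mul1r -mulrA -ea.
exact: maxM.
Qed.

Lemma unif_pow C t (m : int) : pdiv C -> unif C t -> unit_at C (t ^ m) -> m = 0.
move=> dC [nt mt ht];have pC := pdiv_prime dC.
have Ot := max_sub mt.
have h n : ~ unit_at C (t ^+ n.+1).
 by move=> [_ []];rewrite exprSr;apply: maxM => //;apply: lringX.
case: m => [[|n]|n]//;first by move/h.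
by rewrite NegzE => /(unitV dC);rewrite invrK => /h.
Qed.

Lemma ord_eq C t u m f : pdiv C -> unif C t -> unit_at C u -> f = u * t ^ m -> ord C f = m.
move=> dC ht hu e;apply: xget_subset1.
 by have [nt mt h] := ht;exists t, u.
have main m1 : has_ord C f m1 -> m1 = m;last by move=> m1 m2 /main -> /main ->.
move=> [t' [u' [nt' mt' h' hu' e']]].
have [a ha et] := unif_unit dC ht (And3 nt' mt' h').
have [nt _ _] := ht;have nu' := unit_neq0 dC hu';have na := unit_neq0 dC ha.
apply/eqP;rewrite -subr_eq0;apply/eqP;apply: (unif_pow dC ht).
have -> : t ^ (m1 - m) = u * (u' * a ^ m1)^-1.
 rewrite expfzDr// -invr_expz.
 have : u * t ^ m = u' * a ^ m1 * t ^ m1 by rewrite -e e' et expfzMl mulrA.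
 move: (t ^ m) (t ^ m1) (a ^ m1) (expfz_neq0 m nt) (expfz_neq0 m1 na) => x y z nx nz e1.
 have e2 : y = u * x / (u' * z) by rewrite e1;field;rewrite nz.
 by rewrite e2;field;rewrite ?nz ?nu'.
by apply: unitM => //;apply: unitV => //;apply: unitM => //;apply: unitXz.
Qed.

(** The local equation can be divided out only finitely often, because f lies outside some power of
    the maximal ideal. *)
Lemma ord_at_pt C p t f : pdiv C -> C p -> leq_at C p t -> O_at p f -> f != 0 ->
 exists n a, [/\ O_at p a, ~ mi C a & f = a * t ^+ n].
move=> dC Cp lt Of nf;have Xp := pdiv_sub dC Cp.
have [u [v luv]] := hsm Xp;have [Ot mt nt ht] := lt.
have [N hN] := finite_order Xp luv Of nf.
have O1 : O_at p 1 := lring1 Xp.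
have OB a b : O_at p a -> O_at p b -> O_at p (a - b) := @lringB _ Xp a b.
have OM a b : O_at p a -> O_at p b -> O_at p (a * b) := @lringM _ Xp a b.
have Ou := Ou_at luv;have Ov := Ov_at luv.
have P0 : exists n, `[< ~ odvd (O_at p) (t ^+ n) f >].
 exists N;apply/asboolP => -[a Oa e];apply: hN;rewrite e.
 have [_ _ _] := mpow_ideal O1 OB OM Ou Ov N;apply => //.
 by apply: mpow_exp => //;apply: mi_at mt.
have [n /asboolP hn hmin] := ex_minnP P0.
case: n hn hmin => [[]|n hn hmin];first by exists f;rewrite ?mulr1.
have [a Oa ea] : odvd (O_at p) (t ^+ n) f.
 by apply: contrapT => h;have /asboolP/hmin := h;rewrite ltnn.
exists n, a;split=> // ma;apply: hn.
have [b Ob eb] := ht _ Oa ma;exists b => //.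
by rewrite ea eb exprS mulrA.
Qed.

Lemma ord_ex C f : pdiv C -> f != 0 -> exists t u m, [/\ unif C t, unit_at C u & f = u * t ^ m].
move=> dC nf;have [p Cp] := pdiv_point dC;have [t lt] := leq_ex dC Cp.
have ut := leq_unif dC Cp lt;have [nt _ _] := ut.
have [a [b [Oa Ob nb e]]] := frac_at f (pdiv_sub dC Cp).
have na : a != 0 by apply: contraNneq nf => e0;rewrite e e0 mul0r.
have [n [a' [Oa' ma' ea]]] := ord_at_pt dC Cp lt Oa na.
have [j [b' [Ob' mb' eb]]] := ord_at_pt dC Cp lt Ob nb.
have ua : unit_at C a' by split=> //;exact: lr_at Oa'.
have ub : unit_at C b' by split=> //;exact: lr_at Ob'.
exists t, (a' / b'), (n%:Z - j%:Z);split=> //;first by apply: unitM => //;apply: unitV.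
have nb' := unit_neq0 dC ub;rewrite expfzDr// -exprnN -exprnP e ea eb.
by move: (t ^+ n) (t ^+ j) (expf_neq0 j nt) => x y ny;field;rewrite ny.
Qed.

Lemma ordP C t f : pdiv C -> unif C t -> f != 0 -> exists2 u, unit_at C u & f = u * t ^ (ord C f).
move=> dC ht nf;have [t' [u [m [ht' hu e]]]] := ord_ex dC nf.
rewrite (ord_eq dC ht' hu e);have [a ha ea] := unif_unit dC ht ht'.
exists (u * a ^ m);last by rewrite e ea expfzMl mulrA.
by apply: unitM => //;apply: unitXz.
Qed.

(** Zero is never a unit times a power of a uniformizer, so [ord] takes its default value 0. *)
Lemma ord0 C : ord C (0 : K) = 0.
rewrite /ord;apply: xgetPN => m [t [u [nt mt _ [Ou mu] /esym/eqP]]].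
rewrite mulf_eq0 (negbTE (expfz_neq0 m nt)) orbF => /eqP u0;apply: mu;rewrite u0.
by have -> : 0 = t - t :> K;rewrite ?subrr//;move: mt => [d [F [G [hF hG vF nG _]]]];
 exists d, 0, G;split;rewrite ?dhomog0 ?gev0 ?mul0r// => q _;rewrite pev0.
Qed.

Lemma ordM C f g : pdiv C -> f != 0 -> g != 0 -> ord C (f * g) = ord C f + ord C g.
move=> dC nf ng;have [t ht] := unif_ex dC;have [nt _ _] := ht.
have [u hu e] := ordP dC ht nf;have [v hv e'] := ordP dC ht ng.
apply: (ord_eq dC ht (unitM dC hu hv)).
by rewrite expfzDr// {1}e {1}e';move: (t ^ _) (t ^ _) => x y;ring.
Qed.

Lemma unit_ord C u : pdiv C -> unit_at C u -> ord C u = 0.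
move=> dC hu;have [t ht] := unif_ex dC.
by apply: (ord_eq dC ht hu);rewrite mulr1.
Qed.
Lemma unif_ord C t : pdiv C -> unif C t -> ord C t = 1.
by move=> dC ht;apply: (ord_eq dC ht (unit1 dC));rewrite mul1r. Qed.
Lemma ord1 C : pdiv C -> ord C (1 : K) = 0.
by move=> dC;apply: unit_ord => //;apply: unit1. Qed.

Lemma ordV C f : pdiv C -> ord C f^-1 = - ord C f.
move=> dC;have [->|nf] := eqVneq f 0;first by rewrite invr0 ord0.
have nfi : f^-1 != 0 by rewrite invr_eq0.
have := ordM dC nfi nf;rewrite mulVf// ord1// => /esym/eqP.
by rewrite addr_eq0 => /eqP.
Qed.

Lemma ordXz C f (n : int) : pdiv C -> f != 0 -> ord C (f ^ n) = n * ord C f.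
move=> dC nf;have h j : ord C (f ^+ j) = j%:Z * ord C f.
 elim: j => [|j IH];first by rewrite ord1// mul0r.
 by rewrite exprS ordM ?expf_neq0// IH intS mulrDl mul1r.
case: n => j;first exact: h.
by rewrite NegzE ordV// h mulNr.
Qed.
Lemma ordX C f n : pdiv C -> f != 0 -> ord C (f ^+ n) = n%:Z * ord C f.
by move=> dC nf;rewrite -ordXz. Qed.

Lemma ord_cst C (c : k) : pdiv C -> ord C (cst c) = 0.
move=> dC;have [->|nc] := eqVneq c 0;first by rewrite rmorph0 ord0.
by apply: unit_ord => //;apply: unit_cst.
Qed.

(** The case f = 0 is separate because [ord C 0] is 0, not infinity. *)
Definition oge C (n : int) f := f = 0 \/ n <= ord C f.

Lemma ogeE C n f : f != 0 -> oge C n f <-> n <= ord C f.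
by move=> nf;split=> [[e|//]|h];[rewrite e eqxx in nf|right]. Qed.

Lemma oge_lr C n t f : pdiv C -> unif C t -> oge C n f <-> lr C (f * t ^ (- n)).
move=> dC ht;have pC := pdiv_prime dC;have [nt mt hT] := ht.
have [->|nf] := eqVneq f 0.
 by split=> [_|];[rewrite mul0r;exact: lring0|left].
rewrite (ogeE _ _ nf);have [u hu e] := ordP dC ht nf.
have -> : f * t ^ (- n) = u * t ^ (ord C f - n) by rewrite {1}e expfzDr// mulrA.
split=> [le|].
 apply: (lringM pC);first by case: hu.
 have -> : ord C f - n = `|ord C f - n|%N by rewrite gez0_abs// subr_ge0.
 by rewrite -exprnP;apply: (lringX pC);apply: max_sub.
move=> h;apply/negP => lt.
have [j ej] : exists j : nat, ord C f - n = - j.+1%:Z.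
 exists `|n - ord C f|.-1%N;lia.
apply: (max_not1 pC);have -> : 1 = u^-1 * (u * t ^ (ord C f - n)) * t ^+ j.+1.
 rewrite ej mulKf ?(unit_neq0 dC hu)// mulVf// expf_neq0//.
apply: (maxM pC);last by rewrite exprSr;apply: maxM => //;apply: (lringX pC);apply: max_sub.
by apply: lringM;have [] := unitV dC hu.
Qed.
Lemma oge0 C f : pdiv C -> oge C 0 f <-> lr C f.
by move=> dC;have [t ht] := unif_ex dC;rewrite (oge_lr _ _ dC ht) mulr1. Qed.

Lemma oge1 C f : pdiv C -> oge C 1 f <-> mi C f.
move=> dC;have [t ht] := unif_ex dC;have [nt mt h] := ht.
rewrite (oge_lr _ _ dC ht);split=> [h1|/h [a Oa ->]].
 have -> : f = f * t ^ (-1) * t by rewrite divfK.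
 exact: (maxM dC).
by rewrite mulfK.
Qed.

Lemma oge_ksub C n : pdiv C -> ksub (oge C n).
move=> dC;have [t ht] := unif_ex dC.
have kO := lring_ksub dC.
have e f : oge C n f <-> lr C (f * t ^ (- n)) := oge_lr n f dC ht.
split=> [|f g /e hf /e hg|c f /e hf];first by left.
 by apply/e;rewrite mulrDl;apply: ksubD.
by apply/e;rewrite -mulrA;apply: ksubZ.
Qed.
Lemma oge_mono C m n f : m <= n -> oge C n f -> oge C m f.
by move=> le [->|h];[left|right;apply: le_trans h]. Qed.

Lemma ogeM C m n f g : pdiv C -> oge C m f -> oge C n g -> oge C (m + n) (f * g).
move=> dC;have [->|nf] := eqVneq f 0;first by rewrite mul0r;left.
have [->|ng] := eqVneq g 0;first by rewrite mulr0;left.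
by move=> /(ogeE _ _ nf) hf /(ogeE _ _ ng) hg;right;rewrite ordM// lerD.
Qed.

Lemma oge_mulr C m f g : pdiv C -> g != 0 -> oge C m (f * g) <-> oge C (m - ord C g) f.
move=> dC ng;have [->|nf] := eqVneq f 0;first by rewrite mul0r;split;left.
by rewrite !ogeE ?mulf_neq0// ordM// lerBlDr.
Qed.
Lemma lr_ord C f : pdiv C -> f != 0 -> lr C f <-> 0 <= ord C f.
by move=> dC nf;rewrite -(oge0 f dC) ogeE. Qed.
Lemma mi_ord C f : pdiv C -> f != 0 -> mi C f <-> 1 <= ord C f.
by move=> dC nf;rewrite -(oge1 f dC) ogeE. Qed.

Lemma pdiv_eq B C p : pdiv B -> pdiv C -> B p -> C p ->
 (forall f, O_at p f -> mi C f -> mi B f) -> B = C.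
move=> dB dC Bp Cp h.
have Xp := pdiv_sub dB Bp.
have [i [hi hy nyp]] := pt_coordinate p.
have nyC : ~ van ('X_i : form) C by move=> vy;apply: nyp => _ ->;apply: vy.
have nyB : ~ van ('X_i : form) B by move=> vy;apply: nyp => _ ->;apply: vy.
have BC : B `<=` C.
 move=> q Bq;have [_ cC] := pdiv_closed dC;apply: cC;first exact: pdiv_sub Bq.
 move=> d F hF vF;apply: ((frac_in dB hF hy nyB).2.1 _ _ Bq).
 by apply: h;[exact: (frac_in Xp hF hy nyp).1|apply/(frac_in dC hF hy nyC).2].
by have [_ _ m] := dB;have [irr CX _] := dC;apply/esym/m.
Qed.

(** If t vanished on B as well, so would every function regular at p that vanishes on C, which
    forces B = C. *)
Lemma leq_ord B C p t : pdiv B -> pdiv C -> B p -> C p -> leq_at C p t ->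
 ord B t = ((B == C) : nat)%:Z.
move=> dB dC Bp Cp lt;have [Ot mt nt ht] := lt.
have [->|/eqP nBC] := eqVneq B C;first by apply: unif_ord => //;apply: leq_unif lt.
apply: unit_ord => //;split;first exact: lr_at Ot.
move=> mBt;apply: nBC;apply: (pdiv_eq dB dC Bp Cp) => f Of /(ht _ Of) [a Oa ->].
by apply: maxM (pdiv_prime dB) _ _ _ mBt;apply: lr_at Oa.
Qed.

(** Write f = a/b at p. If b vanishes at p, it vanishes on a prime divisor through p, and there a
    vanishes too, so the common local equation cancels. A power of the maximal ideal not containing
    b bounds the number of cancellations. *)
Lemma hartogs p f : Xpts p -> (forall C, pdiv C -> C p -> oge C 0 f) -> O_at p f.
move=> Xp hf;have [u [v luv]] := hsm Xp.
have O1 : O_at p 1 := lring1 Xp.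
have OB a b : O_at p a -> O_at p b -> O_at p (a - b) := @lringB _ Xp a b.
have OM a b : O_at p a -> O_at p b -> O_at p (a * b) := @lringM _ Xp a b.
have Ou := Ou_at luv;have Ov := Ov_at luv.
have [a [b [Oa Ob nb e]]] := frac_at f Xp.
have [n hn] := finite_order Xp luv Ob nb.
elim: n a b Oa Ob nb e hn => [|n IH] a b Oa Ob nb e hn;first by case: hn.
have [mb|nmb] := pselect (mx p b);last first.
 by rewrite e;apply: OM;have [] := lring_inv Xp Ob.
have [Q [pQ Qb nQ]] := prime_over Xp luv hdim mb nb.
have [C [dC Cp hC]] := prime_divisor_of Xp luv pQ (ex_intro2 _ _ b Qb nb) nQ.
have [t lt] := leq_ex dC Cp;have [Ot mt nt ht] := lt.
have mCb : mi C b by apply/hC.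
have mCa : mi C a.
 have -> : a = f * b by rewrite e divfK.
 by apply: (maxM dC) => //;apply/oge0 => //;apply: hf.
have [a' Oa' ea] := ht _ Oa mCa;have [b' Ob' eb] := ht _ Ob mCb.
have nb' : b' != 0 by apply: contraNneq nb => e0;rewrite eb e0 mul0r.
apply: (IH a' b') => //;first by rewrite e ea eb;field;rewrite ?nb'.
move=> h;apply: hn;rewrite eb mulrC.
by apply: mpow_mul => //;apply/(mxi_max Xp luv);apply: mi_at mt.
Qed.
Lemma oge_pt p f C : pdiv C -> C p -> O_at p f -> oge C 0 f.
by move=> dC Cp Of;apply/oge0 => //;apply: lr_at Of. Qed.

Lemma unit_pt p f : Xpts p -> f != 0 -> (forall C, pdiv C -> C p -> ord C f = 0) ->
 unit_at [set p] f.
move=> Xp nf h.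
have : O_at p f by apply: hartogs => // Cp;right;rewrite h.
have : O_at p f^-1 by apply: hartogs => // Cp;right;rewrite ordV// h.
by split=> // mf;apply: (max_nunit Xp mf nf).
Qed.

Lemma vanishing_curves d F : F \is d.-homog -> gev F != 0 ->
 exists s : seq (set pt), (forall C, pdiv C -> van F C -> List.In C s).
move=> hF nF;have [s [s1 s2]] := decomposition (closedX_cap (closedX_pts) hF).
exists s => C dC vF;have [Y Ys CY] : exists2 Y, List.In Y s & C `<=` Y.
 apply: prime_finite_union (pdiv_prime dC) _ _ => [Y /s1 []//|q Cq].
 apply: s2;split;[exact: pdiv_sub Cq|exact: vF].
have [cY pY YF] := s1 _ Ys;have [_ _ m] := dC.
rewrite -(m Y)//;first exact: prime_closed_irreducible.
split;first by move=> q /YF [].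
have [p Xp np] := exists_pt hF nF.
by move=> /(_ p Xp) /YF [_ /eqP];rewrite (negbTE np).
Qed.

Lemma ord_finite f : f != 0 -> exists s : seq (set pt),
 forall C, pdiv C -> ord C f != 0 -> List.In C s.
move=> nf;have [d [F [G [hF hG nG e]]]] := gen_pt_generates f.
rewrite -/(gev F) -/gev in e.
have nF : gev F != 0 by apply: contraNneq nf => e0;rewrite e e0 mul0r.
have [s1 h1] := vanishing_curves hF nF;have [s2 h2] := vanishing_curves hG nG.
exists (s1 ++ s2) => C dC;have pC := pdiv_prime dC => no.
apply: List.in_or_app;apply: contrapT => /not_orP [n1 n2].
have vF : ~ van F C by move/(h1 _ dC).
have vG : ~ van G C by move/(h2 _ dC).
case/eqP: no;apply: unit_ord => //;split;first by exists d, F, G.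
by rewrite e => /(max_idealE pC hF hG vG).
Qed.
End Order.

(** * Subquotients under intersection, sum and multiplication *)

Section QuotDimMore.
Implicit Types (A B J S : set K) (f g : K).

Lemma hqd_fin' n (e : 'I_n -> K) A J : ksub A -> ksub J ->
 (forall f, A f -> exists c, J (f - lcomb e c)) -> exists2 m, (m <= n)%N & hqd A (A `&` J) m.
move=> sA sJ h.
pose S : set K := [set f | exists2 a, A a & J (f - a)].
have sS : ksub S.
 split=> [|f g [a Aa Ja] [b Ab Jb]|c f [a Aa Ja]].
 - exists 0;[exact: ksub0|rewrite subr0;exact: ksub0].
 - exists (a + b);[exact: ksubD|rewrite opprD addrACA;exact: ksubD].
 - exists (cst c * a);[exact: ksubZ|rewrite -mulrBr;exact: ksubZ].
have JS : J `<=` S by move=> Jf;exists 0;[exact: ksub0|rewrite subr0].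
have hS f : S f -> exists c, J (f - lcomb e c).
 move=> [a /h [c Jc] Ja];exists c.
 by rewrite -[f](subrK a) -addrA;apply: ksubD.
have [m le hm] := hqd_fin sS sJ JS hS;exists m => //.
have sAJ : ksub (A `&` J).
 split=> [|f g [? ?] [? ?]|c f [? ?]];split;try exact: ksub0;try exact: ksubD;exact: ksubZ.
have [d [Sd gen fr]] := (hqdP _ sS sJ).1 hm.
have [a ha] := choice (fun i => (let: ex_intro2 a Aa Ja := Sd i in ex_intro _ a (conj Aa Ja))).
have Jd c : J (lcomb d c - lcomb a c).
 rewrite -sumrB;apply: ksub_sum => // i _;rewrite -mulrBr;apply: ksubZ => //.
 by have [_] := ha i.
have Aa i : A (a i) by have [] := ha i.
apply/(hqdP _ sA sAJ);exists a;split=> //.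
 move=> f Af;have [|c Jc] := gen f;first by exists f => //;rewrite subrr;exact: ksub0.
 exists c;split;first by apply: ksubB => //;apply: lcomb_in.
 by rewrite -[f](subrK (lcomb d c)) -addrA;apply: ksubD.
move=> c [_ Jc];apply: fr;rewrite -[lcomb d c](subrK (lcomb a c)).
exact: ksubD.
Qed.

Lemma ksubI A J : ksub A -> ksub J -> ksub (A `&` J).
move=> sA sJ;split=> [|f g [? ?] [? ?]|c f [? ?]];split;
 try exact: ksub0;try exact: ksubD;exact: ksubZ.
Qed.

Lemma hqd_sub A S J n : ksub A -> ksub S -> ksub J -> A `<=` S -> hqd S J n ->
 exists m, [/\ (m <= n)%N, hqd A (A `&` J) m & (forall f, S f -> exists2 a, A a & J (f - a)) -> m = n].
move=> sA sS sJ AS hn;have [e [Se gen fr]] := (hqdP _ sS sJ).1 hn.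
have [m le hm] := hqd_fin' sA sJ (fun f Af => gen f (AS _ Af)).
exists m;split=> // surj.
have sAJ := ksubI sA sJ.
apply: (hqd_uniq sS sJ) hn;have [d [Ad gd fd]] := (hqdP _ sA sAJ).1 hm.
apply/(hqdP _ sS sJ);exists d;split=> [i|f /surj [a Aa Ja]|c Jc];first exact/AS/Ad.
 have [c [_ Jc]] := gd _ Aa;exists c.
 by rewrite -[f](subrK a) -addrA;apply: ksubD.
by apply: fd;split=> //;apply: lcomb_in.
Qed.

Lemma hqd_sum A J n : ksub A -> ksub J -> hqd A (A `&` J) n ->
 hqd [set f | exists2 a, A a & J (f - a)] J n.
move=> sA sJ;have sAJ := ksubI sA sJ => /(hqdP _ sA sAJ) [d [Ad gd fd]].
apply/hqdP => //;first split.
- exists 0;[exact: ksub0|rewrite subr0;exact: ksub0].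
- move=> f g [a Aa Ja] [b Jb];exists (a + b);[exact: ksubD|rewrite opprD addrACA;exact: ksubD].
- move=> c f [a Ja];exists (cst c * a);[exact: ksubZ|rewrite -mulrBr;exact: ksubZ].
exists d;split=> [i|f [a /gd [c [_ Jc]] Ja]|c Jc].
- exists (d i) => //;rewrite subrr;exact: ksub0.
- by exists c;rewrite -[f](subrK a) -addrA;apply: ksubD.
- by apply: fd;split=> //;apply: lcomb_in.
Qed.

Lemma hqd_split A B J n : ksub A -> ksub B -> ksub J -> J `<=` B -> B `<=` A -> hqd A J n ->
 exists m m', [/\ hqd A B m, hqd B J m' & (m + m')%N = n].
move=> sA sB sJ JB BA hn;have [e [Ae gen fr]] := (hqdP _ sA sJ).1 hn.
have [m _ hm] := hqd_fin sA sB BA (fun f Af => let: ex_intro c h := gen f Af in ex_intro _ c (JB _ h)).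
have [m' [_ hm' _]] := hqd_sub sB sA sJ BA hn.
have eB : B `&` J = J by apply/seteqP;split=> [f []|f Jf]//;split=> //;apply: JB.
rewrite eB in hm';exists m, m';split=> //.
exact: hqd_uniq sA sJ (hqd_add sA sB sJ JB BA hm hm') hn.
Qed.

Lemma hqd_eq A J n : ksub A -> ksub J -> J `<=` A -> hqd A J n -> n = 0%N -> A `<=` J.
move=> sA sJ JA + e0;rewrite e0 => /(hqdP _ sA sJ) [e [_ gen _]] f /gen [c].
by rewrite /lcomb big_ord0 subr0.
Qed.

Lemma hqd_free A J n m (e : 'I_m -> K) : ksub A -> ksub J -> J `<=` A -> hqd A J n ->
 (forall i, A (e i)) -> (forall c, J (lcomb e c) -> c = 0) -> (m <= n)%N.
move=> sA sJ JA hn Ae fr;pose B : set K := [set f | exists c, J (f - lcomb e c)].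
have sB : ksub B.
 split=> [|f g [a Ja] [b Jb]|c f [a Ja]].
 - by exists 0;rewrite lcomb0 subr0;apply: ksub0.
 - by exists (a + b);rewrite lcombD opprD addrACA;apply: ksubD.
 - by exists (c *: a);rewrite lcombZ -mulrBr;apply: ksubZ.
have JB : J `<=` B by move=> Jf;exists 0;rewrite lcomb0 subr0.
have BA : B `<=` A.
 move=> f [c Jc];rewrite -[f](subrK (lcomb e c));apply: ksubD => //;first exact: JA.
 exact: lcomb_in.
have hB : hqd B J m.
 apply/(hqdP _ sB sJ);exists e;split=> // i;exists 'e_i.
 by rewrite lcomb_delta subrr;apply: ksub0.
have [m1 [m2 [_ h2 e2]]] := hqd_split sA sB sJ JB BA hn.
by rewrite -(hqd_uniq sB sJ h2 hB) -e2 leq_addl.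
Qed.
Lemma ksub_mulc A c : ksub A -> ksub [set f | A (f / c)].
move=> sA;split=> [|f g|a f] /=;rewrite ?mul0r ?mulrDl -?mulrA;[exact: ksub0|exact: ksubD|exact: ksubZ].
Qed.

Lemma hqd_mulc A J n c : ksub A -> ksub J -> c != 0 -> hqd A J n ->
 hqd [set f | A (f / c)] [set f | J (f / c)] n.
move=> sA sJ nc /(hqdP _ sA sJ) [e [Ae gen fr]].
have eq d : lcomb (fun i => e i * c) d / c = lcomb e d.
 by rewrite mulr_suml;apply: eq_bigr => i _;rewrite mulrA mulfK.
apply/hqdP;[exact: ksub_mulc|exact: ksub_mulc|].
exists (fun i => e i * c);split=> [i /=|f /gen [d Jd]|d /=];first by rewrite mulfK.
 by exists d;rewrite /= mulrBl eq.
by rewrite eq => /fr.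
Qed.
End QuotDimMore.

(** * Local lengths along a curve *)

Section LocalCurve.
Implicit Types (Z Y B C G : set pt) (p q : pt) (F H : form) (f g t u : K).
Let hdim := hX.1.
Let hsm := hX.2.

(** The ideal (b) + I_G of the local ring; [loclen] is thus the intersection multiplicity at p of b
    = 0 with G. *)
Definition curve_ideal G p b : set K :=
 [set f | exists g h, [/\ O_at p g, O_at p h, mi G h & f = g * b + h]].
Definition loclen G p b := quot_dim (O_at p) (curve_ideal G p b).

Lemma mpow_span p u v N : Xpts p -> local_params p u v -> exists n (e : 'I_n -> K),
 (forall i, O_at p (e i)) /\
 forall f, O_at p f -> exists c, mpow (O_at p) u v N (f - lcomb e c).
move=> Xp luv;have pp := prime_pt Xp;have Ou := Ou_at luv;have Ov := Ov_at luv.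
elim: N => [|N [n [e [Oe IH]]]].
 by exists 0%N, (fun=> 0);split=> [[]|f Of]//;exists 0;rewrite lcomb0 subr0.
exists (1 + (n + n))%N, (catfam (fun=> 1) (catfam (fun i => u * e i) (fun i => v * e i)));split.
 move=> i;rewrite /catfam;case: (fintype.split i) => [_|j];first exact: lring1.
 case: (fintype.split j) => a;apply: lringM => //;exact: Oe.
move=> f Of;have [c mc] := value_at Xp Of;have [_ _ h] := luv.
have [a [b [Oa Ob e1]]] := h _ mc.
have [ca ha] := IH _ Oa;have [cb hb] := IH _ Ob.
exists (row_mx (const_mx c) (row_mx ca cb));rewrite !lcomb_cat !row_mxKr !row_mxKl.
exists (a - lcomb e ca), (b - lcomb e cb);split=> //.
have eu x d : lcomb (fun i => x * e i) d = x * lcomb e d.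
 by rewrite mulr_sumr;apply: eq_bigr => i _;rewrite mulrCA.
rewrite !eu {1}/lcomb big_ord1 mxE.
have -> : f = a * u + b * v + cst c by rewrite -e1 subrK.
ring.
Qed.

Section OnCurve.
Variables (G : set pt) (p : pt).
Hypotheses (dG : pdiv G) (Gp : G p).
Local Notation O := (@O_at k X p).
Let pG := pdiv_prime dG.
Let Xp : Xpts p. exact: pdiv_sub Gp. Qed.
Let pp := prime_pt Xp.
Let OG f : O f -> lr G f. exact: lr_at. Qed.

Lemma curve_ideal_ideal b : O b -> oideal O (curve_ideal G p b).
move=> Ob;split.
- by move=> f [g [h [Og Oh mh ->]]];apply: lringD => //;apply: lringM.
- exists 0, 0;split;[exact: lring0|exact: lring0|exact: max0|by rewrite mul0r addr0].
- move=> f f' [g [h [Og Oh mh ->]]] [g' [h' [Og' Oh' mh' ->]]].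
 exists (g + g'), (h + h');split;[exact: lringD|exact: lringD|exact: maxD|ring].
- move=> a f Oa [g [h [Og Oh mh ->]]];exists (a * g), (a * h).
 by split;[exact: lringM|exact: lringM|apply: maxM => //;apply: OG|ring].
Qed.

(** Otherwise b and a local equation g of G lie in a common principal prime (t) that is not maximal.
    As g is itself prime, t vanishes on G, and so does b. *)
Lemma curve_ideal_pow b z : O b -> ~ mi G b -> mx p z -> exists N, curve_ideal G p b (z ^+ N).
move=> Ob nb mz;apply: contrapT => /forallNP no;have [u [v luv]] := hsm Xp.
have O1 : O 1 := lring1 pp.
have OB f g : O f -> O g -> O (f - g) := @lringB _ pp f g.
have OM f g : O f -> O g -> O (f * g) := @lringM _ pp f g.
have [Q [pQ JQ nQ]] := oprime_avoiding O1 OB OM (curve_ideal_ideal Ob) (max_sub mz) no.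
have [[QO Q0 QD QM] Q1 prQ] := pQ.
have Qb : Q b by apply: JQ;exists 1, 0;split=> //;[exact: lring0|exact: max0|rewrite mul1r addr0].
have nQm : ~ (mx p `<=` Q) by move/(_ _ mz).
have nb0 : b != 0 by exact: lring_neq0 nb.
have [t Qt ht] := principal_at Xp luv pQ (ex_intro2 _ _ b Qb nb0) nQm.
have [g [Og mg ng hg]] := leq_ex dG Gp.
have Qg : Q g by apply: JQ;exists 0, g;split=> //;[exact: lring0|rewrite mul0r add0r].
have [a Oa ea] := ht _ Qg.
have [ma|mt] : mi G a \/ mi G t by apply: max_prime;rewrite -?ea//;apply: OG => //;apply: QO.
 have [a' Oa' ea'] := hg _ Oa ma;apply: Q1.
 have -> : 1 = a' * t by apply: (mulIf ng);rewrite mul1r {1}ea {1}ea' mulrAC.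
 exact: QM.
have [c Oc ec] := ht _ Qb;apply: nb;rewrite ec;apply: maxM => //;exact: OG.
Qed.
Lemma oideal_ksub J : oideal O J -> ksub J.
move=> [JO J0 JD JM];split=> // c f Jf;apply: JM => //;exact: lring_cst.
Qed.

Lemma loclenP b : O b -> ~ mi G b -> hqd O (curve_ideal G p b) (loclen G p b).
move=> Ob nb;have [u [v luv]] := hsm Xp;have [mu mv _] := luv.
have iJ := curve_ideal_ideal Ob;have sJ := oideal_ksub iJ.
have [i hi] := curve_ideal_pow Ob nb mu;have [j hj] := curve_ideal_pow Ob nb mv.
have O1 : O 1 := lring1 pp.
have OM f g : O f -> O g -> O (f * g) := @lringM _ pp f g.
have sub := mpow_in O1 OM (max_sub mu) (max_sub mv) iJ hi hj.
have [n [e [Oe he]]] := mpow_span (i + j) Xp luv.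
have sO := lring_ksub pp;have JO : curve_ideal G p b `<=` O by case: iJ.
have h f : O f -> exists c, curve_ideal G p b (f - lcomb e c).
 by move=> /he [c /sub];exists c.
have [m _ hm] := hqd_fin sO sJ JO h.
by rewrite /loclen;apply: xgetPex;exists m.
Qed.

Lemma local_multE B b : pdiv B -> B p -> leq_at B p b -> local_mult B G p = loclen G p b.
move=> dB Bp [Ob mb nb hb];congr quot_dim.
have pB := pdiv_prime dB.
have sB : [set p] `<=` B by move=> _ ->.
have sG : [set p] `<=` G by move=> _ ->.
apply/seteqP;split=> f.
 move=> [g [h [/(local_idealE _ pB pp sB) [Og mg] /(local_idealE _ pG pp sG) [Oh mh] ->]]].
 by have [a Oa ->] := hb _ Og mg;exists a, h.
move=> [a [h [Oa Oh mh ->]]];exists (a * b), h;split=> //.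
 apply/(local_idealE _ pB pp sB);split;first exact: lringM.
 apply: maxM => //;exact: (lr_at dB Bp).
exact/local_idealE.
Qed.

(* Multiplying by the local generator [c], this is the skyscraper quotient at [p]. *)
Lemma sky b c m : O b -> ~ mi G b -> c != 0 -> ord G c = - m ->
 hqd [set f | exists2 a, O a & oge G (1 - m) (f - a * c)]
  [set f | exists2 a, O a & oge G (1 - m) (f - a * b * c)] (loclen G p b).
move=> Ob nb nc oc;have h := loclenP Ob nb;have sO := lring_ksub pp.
pose J : set K := [set f | exists2 a, O a & mi G (f - a * b)].
have sJ : ksub J.
 split=> [|f g [a Oa ma] [a' Oa' ma']|d f [a Oa ma]].
 - exists 0;[exact: lring0|rewrite mul0r subr0;exact: max0].
 - exists (a + a');first exact: lringD.
  have -> : f + g - (a + a') * b = f - a * b + (g - a' * b) by ring.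
  exact: maxD.
 - exists (cst d * a);first by apply: lringM => //;exact: lring_cst.
  have -> : cst d * f - cst d * a * b = cst d * (f - a * b) by ring.
  exact: (ksubZ _ (max_ksub pG)).
have eJ : curve_ideal G p b = O `&` J.
 apply/seteqP;split=> f.
  move=> [g [e [Og Oe me ->]]];split;first by apply: lringD => //;apply: lringM.
  by exists g => //;rewrite addrAC subrr add0r.
 move=> [Of [a ma]];exists a, (f - a * b);split=> //;last by rewrite addrC subrK.
 by apply: lringB => //;apply: lringM.
rewrite eJ in h;have := hqd_sum sO sJ h.
have sS : ksub [set f | exists2 a, O a & J (f - a)].
 split=> [|f g [a Oa ma] [a' Oa' ma']|d f [a Oa ma]].
 - exists 0;[exact: lring0|rewrite subr0;exact: ksub0].
 - exists (a + a');[exact: lringD|rewrite opprD addrACA;exact: ksubD].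
 - exists (cst d * a);first by apply: lringM => //;exact: lring_cst.
  by rewrite -mulrBr;apply: ksubZ.
move=> /(hqd_mulc sS sJ nc);congr hqd.
 apply/seteqP;split=> f.
  move=> [a Oa [a' Oa' /(oge1 _ dG)]].
  have -> : f / c - a - a' * b = (f - (a + a' * b) * c) / c by field.
  rewrite oge_mulr ?invr_eq0// ordV// oc opprK => h1.
  by exists (a + a' * b) => //;apply: lringD => //;apply: lringM.
 move=> [a Oa h1];exists a => //;exists 0;first exact: lring0.
 apply/oge1 => //;have -> : f / c - a - 0 * b = (f - a * c) / c by field.
 by rewrite oge_mulr ?invr_eq0// ordV// oc opprK.
apply/seteqP;split=> f -[a Oa h1];exists a => //;move: h1;rewrite -oge1//.
 have -> : f / c - a * b = (f - a * b * c) / c by field.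
 by rewrite oge_mulr ?invr_eq0// ordV// oc opprK.
have -> : f / c - a * b = (f - a * b * c) / c by field.
by rewrite oge_mulr ?invr_eq0// ordV// oc opprK.
Qed.
End OnCurve.

Lemma nonvanishing_form B G : pdiv B -> pdiv G -> B <> G ->
 exists d F, [/\ F \is d.-homog, van F B & ~ van F G].
move=> dB dG nBG;have nGB : ~ (G `<=` B).
 move=> GB;apply: nBG;have [_ _ m] := dG;have [irr BX _] := dB;exact: m.
apply: contrapT => no;apply: nGB => q Gq;have [_ cB] := pdiv_closed dB;apply: cB.
 exact: pdiv_sub Gq.
move=> d F hF vF;apply: contrapT => nF;apply: no;exists d, F;split=> // /(_ _ Gq).
exact: nF.
Qed.

Lemma zeros_on_curve G d F : pdiv G -> F \is d.-homog -> ~ van F G ->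
 exists s, forall q, G q -> peval F q = 0 -> List.In q s.
move=> dG hF nF;have cG := pdiv_closed dG.
have [s [s1 s2]] := decomposition (closedX_cap cG hF).
have [e [E [hE vE nE]]] := proper_form cG (let: And3 _ a _ := dG in a).
have h1 Y : List.In Y s -> exists q, Y = [set q].
 move=> /s1 [cY pY YF];have [[q Yq] _ _] := pY;exists q.
 apply/seteqP;split=> [r Yr|_ -> //].
 apply: (chain_pt hdim.2 pY dG _ Yr Yq hF hE) => //;first by move=> x /YF [].
 by move=> x /YF [].
have [f hf] : exists f : set pt -> pt, forall Y, List.In Y s -> Y = [set f Y].
 have [q0 _] : exists q, G q by exact: pdiv_point.
 have := choice (P := fun Y q => List.In Y s -> Y = [set q]);case.
  move=> Y;have [/h1 [q e1]|nY] := pselect (List.In Y s);first by exists q.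
  by exists q0.
 by move=> f hf;exists f.
exists (List.map f s) => q Gq Fq;have [Y Ys Yq] := s2 q (conj Gq Fq).
apply/List.in_map_iff;exists Y.
by have := Yq;rewrite {1}(hf _ Ys).
Qed.

Lemma curves_meet_finite B G : pdiv B -> pdiv G -> B <> G ->
 exists s, forall q, B q -> G q -> List.In q s.
move=> dB dG nBG;have [d [F [hF vF nF]]] := nonvanishing_form dB dG nBG.
have [s hs] := zeros_on_curve dG hF nF;exists s => q Bq Gq;apply: hs => //;exact: vF.
Qed.

Lemma curves_meet_finite_list (l : seq (set pt)) G : pdiv G ->
 exists s, forall B q, List.In B l -> pdiv B -> B <> G -> B q -> G q -> List.In q s.
move=> dG;elim: l => [|B l [s hs]];first by exists [::].
have [[dB nBG]|no] := pselect (pdiv B /\ B <> G);last first.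
 exists s => B' q [<-|h];last exact: hs.
 by move=> dB nBG;case: no.
have [s' hs'] := curves_meet_finite dB dG nBG.
exists (s' ++ s) => B' q [<-|h] dB' nB' Bq Gq;apply: List.in_or_app;[left|right].
 exact: hs'.
exact: hs h dB' nB' Bq Gq.
Qed.
End LocalCurve.

Lemma In_mem (T : eqType) (s : seq T) x : List.In x s <-> x \in s.
elim: s => //= y s IH;rewrite inE;split=> [[->|/IH ->]|/orP [/eqP ->|/IH h]];
 rewrite ?eqxx ?orbT//;by [left|right].
Qed.

(** * Sections of line bundles restricted to a curve *)

Section Restriction.
Implicit Types (Z Y B C G : set pt) (p q : pt) (F H : form) (f g t u s : K).
Implicit Types (D E : div) (M : pt -> div).
Let hdim := hX.1.
Let hsm := hX.2.

Definition fin_supp D := exists s : seq (set pt), forall B, D B != 0 -> B \in s.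

Lemma fin_suppD D E : fin_supp D -> fin_supp E -> fin_supp (fun B => D B + E B).
move=> [s hs] [s' hs'];exists (s ++ s') => B;rewrite mem_cat;apply: contraNT.
rewrite negb_or => /andP [n1 n2];have [->|/hs h] := eqVneq (D B) 0;last by rewrite h in n1.
by have [->|/hs' h] := eqVneq (E B) 0;rewrite//;rewrite h in n2.
Qed.
Lemma fin_suppN D : fin_supp D -> fin_supp (fun B => - D B).
move=> [s hs];exists s => B;rewrite oppr_eq0;apply: hs. Qed.
Lemma fin_suppZ (n : int) D : fin_supp D -> fin_supp (fun B => n * D B).
by move=> [s hs];exists s => B nB;apply: hs;apply: contraNneq nB => ->;rewrite mulr0. Qed.
Lemma fin_supp_curve B : fin_supp (cdiv B).
by exists [:: B] => C;rewrite /cdiv inE;case: (C == B). Qed.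

(* The principal divisor of [f], with junk value 0 off the prime divisors. *)
Definition pdv f : div := fun B => if `[< pdiv B >] then ord B f else 0.

Lemma pdv_if f B : pdv f B = if `[< pdiv B >] then ord B f else 0. by []. Qed.
Lemma pdvE f B : pdiv B -> pdv f B = ord B f.
by rewrite /pdv => /asboolT ->. Qed.

Lemma fin_supp_pdv f : f != 0 -> fin_supp (pdv f).
move=> nf;have [s hs] := ord_finite nf;exists s => B;rewrite /pdv.
by case: asboolP => dB nB;apply/In_mem;apply: hs.
Qed.

(* The stalk at [p] of O_X(D). *)
Definition osec D p s := forall B, pdiv B -> B p -> oge B (- D B) s.

Lemma osec_ksub D p : ksub (osec D p).
split=> [B dB Bp|f g hf hg B dB Bp|c f hf B dB Bp].
- exact: ksub0 (oge_ksub _ dB).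
- apply: (ksubD (oge_ksub _ dB));[exact: hf|exact: hg].
- apply: (ksubZ _ (oge_ksub _ dB));exact: hf.
Qed.
Lemma osec_mono D E p s : (forall B, pdiv B -> B p -> D B <= E B) -> osec D p s -> osec E p s.
by move=> h hs B dB Bp;apply: oge_mono (hs B dB Bp);rewrite lerN2;apply: h. Qed.
Lemma osecM D E p f s : osec D p f -> osec E p s -> osec (fun B => D B + E B) p (f * s).
move=> hf hs B dB Bp;rewrite opprD;apply: ogeM => //;[exact: hf|exact: hs]. Qed.
Lemma osec_mulr D p f s : f != 0 -> osec D p (s * f) <-> osec (fun B => D B + pdv f B) p s.
move=> nf;split=> h B dB Bp;have := h B dB Bp;rewrite oge_mulr// opprD pdvE//.
Qed.

Lemma osec0 p s : Xpts p -> osec (fun=> 0) p s <-> O_at p s.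
move=> Xp;split=> [h|Os B dB Bp];last by rewrite oppr0;apply: oge_pt Os.
apply: hartogs => // B dB Bp.
Qed.

Lemma local_gen D p : fin_supp D -> Xpts p ->
 exists2 g, g != 0 & forall B, pdiv B -> B p -> ord B g = - D B.
move=> [s hs] Xp.
have main (l : seq (set pt)) : uniq l -> exists2 g, g != 0 & forall B, pdiv B -> B p ->
  ord B g = if B \in l then - D B else 0.
 elim: l => [|C l IH].
  move=> _;exists 1;rewrite ?oner_neq0// => B dB _;exact: ord1.
 move=> /andP [nC /IH [g ng hg]].
 have [[dC Cp]|no] := pselect (pdiv C /\ C p);last first.
  exists g => // B dB Bp;rewrite inE hg//;case: eqP => // eB;case: no.
  by rewrite -eB.
 have [t lt] := leq_ex dC Cp;have [_ _ nt _] := lt.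
 exists (g * t ^ (- D C));first by rewrite mulf_neq0// expfz_neq0.
 move=> B dB Bp;rewrite ordM ?expfz_neq0// ordXz// hg// (leq_ord dB dC Bp Cp lt) inE.
 case: eqP => [->|_];last by rewrite mulr0 addr0.
 by rewrite (negbTE nC) add0r mulr1.
have [g ng hg] := main _ (undup_uniq s);exists g => // B dB Bp;rewrite hg// mem_undup.
case: ifP => // nB;have [->|/hs] := eqVneq (D B) 0;first by rewrite oppr0.
by rewrite nB.
Qed.

Lemma osec_gen D p g s : Xpts p -> g != 0 -> (forall B, pdiv B -> B p -> ord B g = - D B) ->
 osec D p s <-> O_at p (s / g).
move=> Xp ng hg;rewrite -osec0//;split=> h B dB Bp;have := h B dB Bp.
 by rewrite oge_mulr ?invr_eq0// ordV// opprK add0r hg.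
by rewrite oge_mulr ?invr_eq0// ordV// opprK add0r hg.
Qed.

(** Functions whose leading term along G, in order -m, is that of a section of D near p. For m the
    multiplicity of D along G this is the stalk at p of O(D) restricted to G, before dividing by
    what vanishes on G. *)
Definition locT G (m : int) D p : set K :=
 [set f | exists2 s, osec D p s & oge G (1 - m) (f - s)].
(* H^0(G, O(M)|_G) is the quotient of [Tsp G m M] by [oge G (1 - m)]; the divisor [M]
   may depend on the point, but has multiplicity [m] along G everywhere. *)
Definition Tsp G (m : int) M : set K := [set f | forall p, G p -> locT G m (M p) p f].

Section OnVariety.
Variable G : set pt.
Hypotheses (pG : prime_set G) (cG : closedX G).

Lemma poly_root_mod f (P : {poly k}) : P != 0 -> lr G f -> mi G (map_poly cst P).[f] ->
 exists c, mi G (f - cst c).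
move=> nP Of;have [r er] := closed_field_poly_normal P;rewrite er map_polyZ rmorph_prod hornerZ.
have nl : lead_coef P != 0 by rewrite lead_coef_eq0.
have Oc c : lr G (f - cst c) by apply: lringB => //;exact: lring_cst.
have e : (\prod_(z <- r) map_poly cst ('X - z%:P)).[f] = \prod_(z <- r) (f - cst z).
 rewrite horner_prod;apply: eq_bigr => z.
 by rewrite rmorphB /= map_polyX map_polyC hornerXsubC.
rewrite e {e er} => h.
have {h} : mi G (\prod_(z <- r) (f - cst z)).
 rewrite -[X in mi G X](mulKf (_ : cst (lead_coef P) != 0)) ?fmorph_eq0//.
 rewrite -fmorphV;apply: maxM => //;exact: lring_cst.
elim: r => [|z r IH];first by rewrite big_nil => /max_not1.
rewrite big_cons => /max_prime []//;last by exists z.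
apply: big_ind => //;[exact: lring1|exact: lringM].
Qed.

(* A regular function on a projective variety is constant: it multiplies the
   restrictions of the forms of a large degree into themselves. *)
Lemma regular_constant_on f : lr G f -> (forall p, G p -> exists2 s, O_at p s & mi G (f - s)) ->
 exists c, mi G (f - cst c).
move=> Of hf;have [[p0 Gp0] _ _] := pG.
have [i hi] := pt_linear p0;have hy := homogX1 i;set y : form := 'X_i in hy.
have nyG : ~ van y G by move/(_ _ Gp0)/eqP;rewrite hi oner_eq0.
have gy : gev y != 0 := gev_neq0 pG hy nyG.
(* [J d F] says that f F is again a form of degree d along G. Where f = A/B, the denominator B has
   this property, so there is no common zero. *)
pose J d (F : form) := F \is d.-homog /\ exists2 F' : form, F' \is d.-homog &
 mi G (fq y F d * f - gev F' / gev y ^+ d).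
have gJ : graded_ideal J.
 split=> [d F []//|d|d F H [hF [F' hF' m]] [hH [H' hH' m']]|d e F H [hF [F' hF' m]] hH].
 - split;[exact: dhomog0|exists 0;[exact: dhomog0|rewrite gev0 !mul0r subrr;exact: max0]].
 - split;first exact: dhomogD.
  exists (F' + H');first exact: dhomogD.
  rewrite !gevD.
  have -> : (gev F + gev H) / gev y ^+ d * f - (gev F' + gev H') / gev y ^+ d =
  fq y F d * f - gev F' / gev y ^+ d + (fq y H d * f - gev H' / gev y ^+ d) by ring.
  exact: maxD.
 - split;first by rewrite addnC;exact: dhomogM.
  exists (H * F');first by rewrite addnC;exact: dhomogM.
  have [OH _] := frac_in pG hH hy nyG;rewrite !gevM exprD.
  have -> : gev H * gev F / (gev y ^+ d * gev y ^+ e) * f - gev H * gev F' / (gev y ^+ d * gev y ^+ e)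
  = fq y H e * (fq y F d * f - gev F' / gev y ^+ d).
  move: gev gev (expf_neq0 d gy) (expf_neq0 e gy) => a b na nb.
  by field;rewrite na.
  exact: maxM.
have noz p : exists d F, J d F /\ peval F p != 0.
 have [Gp|nGp] := pselect (G p).
  have [s /O_atP [d [A [B [hA hB nB ->]]]] ms] := hf p Gp.
  exists d, B;split=> //;split=> //;exists A => //.
  have nBG : ~ van B G by move/(_ _ Gp)/eqP;rewrite (negbTE nB).
  have gB := gev_neq0 pG hB nBG;have [OB _] := frac_in pG hB hy nyG.
  have -> : fq y B d * f - fq y A d = fq y B d * (f - gev A / gev B).
  by move: (gev ^+ d) (expf_neq0 d gy) => a na;field;rewrite gB.
  exact: maxM.
 have [cl [d [F [hF vF nF]]]] : closedX G /\ exists d (F : form),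
  [/\ F \is d.-homog, mi G (fq y F d) & peval F p != 0];last first.
  exists d, F;split=> //;split=> //;exists 0;first exact: dhomog0.
  by rewrite gev0 mul0r subr0 mulrC;apply: maxM.
 split;first by [].
 have [d [F [hF vF nF]]] := (closedX_closed cG) p nGp.
 exists d, F;split=> //;apply/(frac_in pG hF hy nyG).2 => q Gq.
 by apply: contrapT => /eqP /nF.
have [N hN] := forms_of_no_zero gJ noz.
(* All forms of degree N are now mapped to forms of degree N, so the powers of f lie in one
   finite-dimensional space; f is algebraic over k along G, hence constant there. *)
have [F eF] : exists F : nat -> form, forall j, F j \is N.-homog /\
  mi G (f ^+ j - fq y (F j) N).
 suff : forall j, exists F : form, F \is N.-homog /\ mi G (f ^+ j - fq y F N) by move=> /choice [F hF];exists F.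
 elim=> [|j [F [hF mF]]].
  exists (y ^+ N);split;first exact: homogXn.
  rewrite gevXn divff ?expf_neq0// subrr;exact: max0.
 have [_ [F' hF' m']] := hN _ _ (leqnn N) hF;exists F';split=> //.
 have -> : f ^+ j.+1 - gev F' / gev y ^+ N = f * (f ^+ j - fq y F N) +
  (fq y F N * f - gev F' / gev y ^+ N) by rewrite exprS;ring.
 by apply: maxD => //;apply: maxM.
pose I := 'X_{1..(pdim X).+1 < N.+1}.
pose e (j : 'I_#|{: I}|) : K := gev 'X_[val (enum_val j)] / gev y ^+ N.
have [||c [[j0 nj0] hc]] := @span_dependent _ e 'I_(#|{: I}|).+1 (fun j => fq y (F j) N).
- by rewrite card_ord.
- move=> j;have [hF _] := eF j;rewrite (mpolyE (F j)) gev_sum mulr_suml big_seq.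
 refine (@ksub_sum _ _ _ _ _ (kspan_ksub _) _) => m hm;rewrite gevZ -mulrA;apply: (ksubZ _ (kspan_ksub _)).
 apply: kspan_mem;have lm : (mdeg m < N.+1)%N by move/dhomogP: hF => /(_ _ hm) ->.
 by exists (enum_rank (BMultinom lm : I));rewrite /e enum_rankK.
pose P : {poly k} := \poly_(j < (#|{: I}|).+1) (if insub j is Some j' then c j' else 0).
have cP (j : 'I_(#|{: I}|).+1) : P`_j = c j.
 by rewrite coef_poly ltn_ord valK.
apply: (@poly_root_mod f P) => //.
 by apply/eqP => P0;case/eqP: nj0;rewrite -cP P0 coef0.
have -> : (map_poly cst P).[f] = \sum_j cst (c j) * (f ^+ (j : 'I_(#|{: I}|).+1) - fq y (F j) N).
 rewrite (eq_bigr (fun j : 'I_ _ => cst (c j) * f ^+ j - cst (c j) * (fq y (F j) N)));last first.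
  by move=> j _;rewrite mulrBr.
 rewrite sumrB hc subr0 (horner_coef_wide (n := (#|{: I}|).+1));last first.
  by rewrite size_map_poly size_poly.
 by apply: eq_bigr => j _;rewrite coef_map cP.
refine (@ksub_sum _ _ _ _ _ (max_ksub pG) _) => j _;apply: (ksubZ _ (max_ksub pG)).
by have [] := eF j.
Qed.
End OnVariety.

Section OnG.
Variables (G : set pt).
Hypothesis (dG : pdiv G).
Let pG := pdiv_prime dG.

Lemma locT_ksub m D p : ksub (locT G m D p).
have sJ := oge_ksub (1 - m) dG;have sO := osec_ksub D p.
split=> [|f g [s hs h] [t ht h']|c f [s hs h]].
- exists 0;[exact: ksub0|rewrite subr0;exact: ksub0].
- exists (s + t);[exact: (ksubD sO)|rewrite opprD addrACA;exact: ksubD].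
- exists (cst c * s);[exact: (ksubZ _ sO)|rewrite -mulrBr;exact: ksubZ].
Qed.

Lemma Tsp_ksub m M : ksub (Tsp G m M).
split=> [p Gp|f g hf hg p Gp|c f hf p Gp].
- exact: ksub0 (locT_ksub _ _ _).
- apply: (ksubD (locT_ksub _ _ _));[exact: hf|exact: hg].
- apply: (ksubZ _ (locT_ksub _ _ _));exact: hf.
Qed.
Lemma J_locT m D p : oge G (1 - m) `<=` locT G m D p.
move=> hf;exists 0;rewrite ?subr0//;exact: ksub0 (osec_ksub _ _). Qed.
Lemma J_Tsp m M : oge G (1 - m) `<=` Tsp G m M.
by move=> f hf p Gp;apply: J_locT. Qed.
Lemma locT_mono m D E p : (forall B, pdiv B -> B p -> D B <= E B) -> locT G m D p `<=` locT G m E p.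
by move=> h f [s hs h'];exists s => //;apply: osec_mono hs. Qed.
Lemma Tsp_mono m M M' : (forall p B, pdiv B -> G p -> B p -> M p B <= M' p B) ->
 Tsp G m M `<=` Tsp G m M'.
by move=> h f hf p Gp;apply: locT_mono (hf p Gp) => B dB Bp;apply: h. Qed.

Lemma Tsp_oge m M f : (forall p, G p -> M p G = m) -> Tsp G m M f -> oge G (- m) f.
move=> hM hf;have [p Gp] := pdiv_point dG;have [s hs h] := hf p Gp.
have sJ := oge_ksub (- m) dG;rewrite -[f](subrK s);apply: (ksubD sJ).
 apply: oge_mono h;lia.
by have := hs G dG Gp;rewrite hM.
Qed.

(** Stands in for the vanishing of H^1: when germs at p come from global sections, the loss of
    dimension at p is the full local length. *)
Definition Surj m M D D' p := forall s, osec D p s -> exists2 a, Tsp G m M a & locT G m D' p (s - a).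

Lemma Tsp_step m M M' p b : G p -> fin_supp (M p) -> M p G = m -> O_at p b -> ~ mi G b ->
 (forall q f, G q -> q <> p -> locT G m (M q) q f <-> locT G m (M' q) q f) ->
 (forall B, pdiv B -> B p -> M' p B = M p B - ord B b) ->
 exists n, [/\ (n <= loclen G p b)%N, hqd (Tsp G m M) (Tsp G m M') n &
  Surj m M (M p) (M' p) p -> n = loclen G p b].
move=> Gp fM mG Ob nb hq hM';have Xp := pdiv_sub dG Gp.
have nb0 : b != 0 by exact: lring_neq0 nb.
have [c nc hc] := local_gen fM Xp.
have hS := sky dG Gp Ob nb nc (_ : ord G c = - m);rewrite hc// mG in hS.
have {}hS := hS erefl.
have nbc : b * c != 0 by rewrite mulf_neq0.
have hbc B : pdiv B -> B p -> ord B (b * c) = - M' p B.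
 by move=> dB Bp;rewrite ordM// hc// hM'// opprB.
have e1 : [set f | exists2 a, O_at p a & oge G (1 - m) (f - a * c)] = locT G m (M p) p.
 apply/seteqP;split=> f [a Oa h].
  by exists (a * c) => //;apply/(osec_gen _ Xp nc hc);rewrite mulfK.
 by exists (a / c);[apply/(osec_gen _ Xp nc hc)|rewrite divfK].
have e2 : [set f | exists2 a, O_at p a & oge G (1 - m) (f - a * b * c)] = locT G m (M' p) p.
 apply/seteqP;split=> f [a Oa h].
  by exists (a * b * c) => //;apply/(osec_gen _ Xp nbc hbc);rewrite -(mulrA a) mulfK.
 by exists (a / (b * c));[apply/(osec_gen _ Xp nbc hbc)|rewrite -mulrA divfK].
rewrite e1 e2 in hS.
have sub : locT G m (M' p) p `<=` locT G m (M p) p.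
 apply: locT_mono => B dB Bp;rewrite hM'// lerBlDr lerDl.
 apply/(ogeE _ _ nb0);exact: oge_pt Ob.
have eT : Tsp G m M `&` locT G m (M' p) p = Tsp G m M'.
 apply/seteqP;split=> f.
  move=> [hf hp] q Gq;have [->|/eqP nq] := eqVneq q p => //;apply/hq => //;exact: hf.
 move=> hf;split;last exact: hf.
 move=> q Gq;have [->|/eqP nq] := eqVneq q p;[apply: sub;exact: hf|apply/hq => //;exact: hf].
have AS : Tsp G m M `<=` locT G m (M p) p by move=> f;apply.
have [n [le hn hs]] := hqd_sub (Tsp_ksub m M) (locT_ksub m _ p) (locT_ksub m _ p) AS hS.
exists n;rewrite eT in hn;split=> // sj;apply: hs => f [s os h].
have [a Ta h'] := sj _ os;exists a => //.
have -> : f - a = f - s + (s - a) by rewrite addrA subrK.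
by apply: (ksubD (locT_ksub _ _ _)) => //;apply: J_locT.
Qed.

(** Divisors that vary with the point allow D to be replaced by D' at one point of G at a time. *)
Definition modp (l : seq pt) D' D : pt -> div := fun p => if p \in l then D' else D.

Lemma curve_interE B l : uniq l -> (forall p, p \in l <-> B p /\ G p) ->
 curve_inter B G = \sum_(p <- l) (local_mult B G p)%:Z.
move=> ul hl;rewrite /curve_inter;have -> : B `&` G = [set` l].
 by apply/seteqP;split=> p;[move=> [? ?];apply/hl|move/hl].
by rewrite -fsbig_seq.
Qed.

Lemma meet_list B : pdiv B -> B <> G -> exists2 l : seq pt, uniq l & forall p, p \in l <-> B p /\ G p.
move=> dB nBG;have [s hs] := curves_meet_finite dB dG nBG.
exists [seq p <- undup s | `[< B p /\ G p >]];first by rewrite filter_uniq// undup_uniq.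
move=> p;rewrite mem_filter mem_undup;split=> [/andP [/asboolP]//|[Bp Gp]].
by rewrite asboolT//=;apply/In_mem;apply: hs.
Qed.

Lemma Tsp_chain m D D' B l : pdiv B -> B <> G -> fin_supp D -> D G = m ->
 (forall C, pdiv C -> D' C = D C - cdiv B C) ->
 uniq l -> (forall p, p \in l <-> B p /\ G p) ->
 exists n, [/\ (n%:Z <= curve_inter B G),
  hqd (Tsp G m (fun=> D)) (Tsp G m (fun=> D')) n &
  (forall l1 p l2, l = l1 ++ p :: l2 -> Surj m (modp l2 D' D) D D' p) ->
  n%:Z = curve_inter B G].
move=> dB nBG fD DG hD' ul hl;rewrite (curve_interE ul hl).
suff [n [le hn hs]] : exists n, [/\ (n <= \sum_(p <- l) local_mult B G p)%N,
  hqd (Tsp G m (fun=> D)) (Tsp G m (modp l D' D)) n &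
  (forall l1 p l2, l = l1 ++ p :: l2 -> Surj m (modp l2 D' D) D D' p) ->
  n = (\sum_(p <- l) local_mult B G p)%N].
 have es : \sum_(p <- l) (local_mult B G p)%:Z = (\sum_(p <- l) local_mult B G p)%N.
  by rewrite (big_morph Posz PoszD (erefl : 0 = 0)).
 exists n;rewrite es;split;last by move=> /hs ->.
  by [].
 have -> : Tsp G m (fun=> D') = Tsp G m (modp l D' D);last by [].
 have e p C : G p -> pdiv C -> C p -> modp l D' D p C = D' C.
  move=> Gp dC Cp;rewrite /modp;case: ifP => np;rewrite hD'// /cdiv.
  case: eqP => [eC|_];last by rewrite subr0.
  by case/negP: np;apply/hl;rewrite -eC.
 by apply/seteqP;split;apply: Tsp_mono => p C dC Gp Cp;rewrite e.
have {}hl : forall p, p \in l -> B p /\ G p by move=> p /hl.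
elim: l ul hl => [|p l IH].
 move=> _;exists 0%N;rewrite big_nil;split=> //.
 by apply: hqd0;[exact: Tsp_ksub|exact: Tsp_ksub|].
move=> /andP [np ul] hl;have [n [le hn hs]] := IH ul (fun q hq => hl q (mem_behead (s := p :: l) hq)).
have [Bp Gp] := hl p (mem_head _ _);have [b lb] := leq_ex dB Bp.
have [Ob mb nb _] := lb.
have nmb : ~ mi G b.
 have oG := leq_ord dG dB Gp Bp lb;have ne : (G == B) = false by apply/eqP => /esym.
 by rewrite ne in oG;move/(mi_ord dG nb);rewrite oG.
have eD : modp l D' D p = D by rewrite /modp (negbTE np).
have eD' : modp (p :: l) D' D p = D' by rewrite /modp inE eqxx.
have [| | | |n' [le' hn' hs']] := @Tsp_step m (modp l D' D) (modp (p :: l) D' D) p b Gp _ _ Ob nmb.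
- by rewrite eD.
- by rewrite eD.
- by move=> q f Gq /eqP nq;rewrite /modp inE (negbTE nq).
- by move=> C dC Cp;rewrite eD eD' hD'// (leq_ord dC dB Cp Bp lb).
rewrite -(local_multE dG Gp dB Bp lb) in le' hs'.
exists (n + n')%N;rewrite big_cons;split.
- by rewrite addnC leq_add.
- apply: hqd_add hn hn';try exact: Tsp_ksub.
  apply: Tsp_mono => q C Cq;rewrite /modp inE;case: eqP => [->|_]//=.
  case: ifP => _;rewrite hD'// lerBlDr lerDl /cdiv;by case: (_ == _).
 apply: Tsp_mono => q C Cq;rewrite /modp;case: ifP => //.
 rewrite hD'// lerBlDr lerDl /cdiv;by case: (_ == _).
- move=> sj;rewrite hs 1?hs' 1?addnC//.
  by rewrite eD eD';apply: (sj [::]).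
 by move=> l1 q l2 el;apply: (sj (p :: l1));rewrite el.
Qed.

Lemma regular_constant f : lr G f -> (forall p, G p -> exists2 s, O_at p s & mi G (f - s)) ->
 exists c, mi G (f - cst c).
exact: (regular_constant_on pG (pdiv_closed dG)).
Qed.

Lemma Tsp0 : hqd (Tsp G 0 (fun _ _ => 0)) (oge G 1) 1.
have sT : ksub (Tsp G 0 (fun _ _ => 0)) := Tsp_ksub _ _.
have sJ := oge_ksub 1 dG.
have osec_c p c : G p -> osec (fun=> 0) p (cst c).
 move=> Gp;have Xp := pdiv_sub dG Gp;apply/(osec0 _ Xp).
 exact: lring_cst Xp c.
apply/(hqdP _ sT sJ);exists (fun=> 1);split.
- move=> _ p Gp;exists 1;last by rewrite subrr;exact: ksub0 (oge_ksub _ dG).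
 by have := osec_c p 1 Gp;rewrite rmorph1.
- move=> f hf;have [c mc] : exists c, mi G (f - cst c).
  apply: regular_constant.
  by apply/oge0;have := @Tsp_oge 0 (fun _ _ => 0) f (fun _ _ => erefl) hf.
  move=> p Gp;have [s os h] := hf p Gp;exists s;first exact/(osec0 _ (pdiv_sub dG Gp)).
  exact/oge1.
 by exists (const_mx c);rewrite /lcomb big_ord1 mxE mulr1;apply/oge1.
- move=> c;rewrite /lcomb big_ord1 mulr1 => /(oge1 _ dG) mc;apply/rowP => i.
 rewrite zmodp.ord1 mxE;apply: contrapT => /eqP nc.
 by have [_] := unit_cst dG nc.
Qed.

Lemma locT_mulr m D p f s : f != 0 -> locT G m D p (s * f) <->
 locT G (m + ord G f) (fun B => D B + pdv f B) p s.
move=> nf;split=> -[a os h].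
 exists (a / f);first by apply/(@osec_mulr D p f (a / f) nf);rewrite divfK.
 rewrite opprD addrA -oge_mulr//.
 by rewrite mulrBl divfK.
exists (a * f);first exact/osec_mulr.
by rewrite -mulrBl oge_mulr// -addrA -opprD.
Qed.
Lemma Tsp_mulr m D f s : f != 0 -> Tsp G m (fun=> D) (s * f) <->
 Tsp G (m + ord G f) (fun _ B => D B + pdv f B) s.
by move=> nf;split=> h p Gp;apply/locT_mulr => //;apply: h. Qed.

Lemma Tsp_equiv m D f n : f != 0 ->
 hqd (Tsp G (m + ord G f) (fun _ B => D B + pdv f B)) (oge G (1 - (m + ord G f))) n ->
 hqd (Tsp G m (fun=> D)) (oge G (1 - m)) n.
move=> nf h;have := hqd_mulc (Tsp_ksub _ _) (oge_ksub _ dG) nf h.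
congr hqd;apply/seteqP;split=> s /=.
- by move/(Tsp_mulr _ _ _ nf);rewrite divfK.
- by move=> hs;apply/(Tsp_mulr _ _ _ nf);rewrite divfK.
- by rewrite opprD addrA -oge_mulr// divfK.
- by move=> hs;rewrite opprD addrA -oge_mulr// divfK.
Qed.

Lemma Tsp_finite_seq (l : seq (set pt)) : (forall B, B \in l -> pdiv B /\ B <> G) ->
 exists n, hqd (Tsp G 0 (fun _ B => (count_mem B l)%:Z)) (oge G 1) n.
elim: l => [|B l IH] hl;first by exists 1%N;exact: Tsp0.
have [n hn] := IH (fun C hC => hl C (mem_behead (s := B :: l) hC)).
have [dB nBG] := hl B (mem_head _ _);have [lB ul hlB] := meet_list dB nBG.
have [||C dC|n' [_ hn' _]] := @Tsp_chain 0 (fun C => (count_mem C (B :: l))%:Z)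
  (fun C => (count_mem C l)%:Z) B lB dB nBG _ _ _ ul hlB.
- exists (B :: l) => C;apply: contraNT => /count_memPn -> //.
- by rewrite (count_memPn _)//;apply/negP => /hl [].
- by rewrite /= PoszD eq_sym addrAC subrr.
exists (n' + n)%N;apply: hqd_add hn' hn;try exact: Tsp_ksub;first exact: oge_ksub.
 exact: (J_Tsp (m := 0)).
by apply: Tsp_mono => p C _;rewrite lez_nat leq_addl.
Qed.

Lemma Tsp_finite0 D : fin_supp D -> D G = 0 -> exists n, hqd (Tsp G 0 (fun=> D)) (oge G 1) n.
move=> [s hs] DG;pose l := flatten [seq nseq `|D B|%N B | B <- s & `[< pdiv B /\ B <> G >]].
have hl B : B \in l -> pdiv B /\ B <> G.
 move=> /flatten_mapP [C];rewrite mem_filter => /andP [/asboolP hC _].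
 by move=> /nseqP [->].
have [n hn] := Tsp_finite_seq hl;have sT := Tsp_ksub 0 (fun=> D);have sJ := oge_ksub 1 dG.
have sub : Tsp G 0 (fun=> D) `<=` Tsp G 0 (fun _ B => (count_mem B l)%:Z).
 apply: Tsp_mono => p B dB _ _;have [->|nB] := eqVneq (D B) 0;first by [].
 have Bs := hs _ nB;have nBG : B <> G by move=> e;rewrite e DG in nB.
 apply: (@le_trans _ _ `|D B|%N%:Z);first by rewrite ler_norm.
 rewrite lez_nat count_flatten sumnE -map_comp big_map.
 have BF : B \in [seq B <- s | `[< pdiv B /\ B <> G >]] by rewrite mem_filter asboolT.
 rewrite (big_rem B BF) /= count_nseq /= eqxx mul1n leq_addr//.
have [m [m' [_ h _]]] := hqd_split (Tsp_ksub _ _) sT sJ (@J_Tsp 0 (fun=> D)) sub hn.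
by exists m'.
Qed.

(** A power of a uniformizer along G reduces to multiplicity zero, where D is dominated by an
    effective divisor not containing G; the curves of the latter are removed one by one. *)
Lemma Tsp_finite m D : fin_supp D -> D G = m -> exists n, hqd (Tsp G m (fun=> D)) (oge G (1 - m)) n.
move=> fD DG;have [t ht] := unif_ex dG;have [nt _ _] := ht.
have nf : t ^ (- m) != 0 by rewrite expfz_neq0.
have oG : ord G (t ^ (- m)) = - m by rewrite ordXz// unif_ord// mulr1.
have [||n hn] := @Tsp_finite0 (fun B => D B + pdv (t ^ (- m)) B).
- apply: fin_suppD => //;exact: fin_supp_pdv.
- by rewrite pdvE// oG DG subrr.
exists n;apply: (Tsp_equiv nf);rewrite oG subrr subr0//.
Qed.
End OnG.
End Restriction.

(** * Hyperplane sections and asymptotic surjectivity *)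

Section Hyperplane.
Implicit Types (Z Y B C G : set pt) (p q : pt) (F : form) (f g t u s : K).
Implicit Types (D E : div) (M : pt -> div).
Let hdim := hX.1.
Let hsm := hX.2.

Definition coord_on B : 'I_(pdim X).+1 := xget fintype.ord0 [set i | ~ van ('X_i : form) B].

Lemma coord_onP B : pdiv B -> ~ van ('X_(coord_on B) : form) B.
move=> dB;have [p Bp] := pdiv_point dB;have [i hi] := pt_linear p.
apply: (@xgetPex _ _ [set i | ~ van ('X_i : form) B]);exists i.
by move/(_ _ Bp)/eqP;rewrite hi oner_eq0.
Qed.

Definition hyp (y : form) : div := fun B =>
 if `[< pdiv B >] then ord B (gev y / gev 'X_(coord_on B)) else 0.

Section Fixed.
Variable y : form.
Hypotheses (hy : y \is 1.-homog) (ny : gev y != 0).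

Lemma linear_unit B w w' : pdiv B -> w \is 1.-homog -> w' \is 1.-homog ->
 ~ van w B -> ~ van w' B -> ord B (gev w / gev w') = 0.
move=> dB hw hw' nw nw';apply: unit_ord => //.
have [O m] := frac_in dB hw hw' nw'.
by split=> // /m.
Qed.

Lemma hypE B w : pdiv B -> w \is 1.-homog -> ~ van w B -> hyp y B = ord B (gev y / gev w).
move=> dB hw nw;rewrite /hyp asboolT//;have nc := coord_onP dB.
have gw := gev_neq0 dB hw nw.
have gc := gev_neq0 dB (homogX1 _) nc.
have -> : gev y / gev w = gev y / gev 'X_(coord_on B) * (gev 'X_(coord_on B) / gev w).
 by rewrite mulrA divfK.
rewrite [RHS]ordM ?mulf_neq0 ?invr_eq0//.
by rewrite (linear_unit dB (homogX1 _) hw nc nw) addr0.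
Qed.
Lemma hyp0 B : pdiv B -> ~ van y B -> hyp y B = 0.
by move=> dB nB;rewrite (hypE dB hy nB) divff// ord1. Qed.

Lemma hyp_ge0 B : 0 <= hyp y B.
rewrite /hyp;case: asboolP => // dB;have nc := coord_onP dB.
have gc := gev_neq0 dB (homogX1 _) nc.
apply/(lr_ord dB);first by rewrite mulf_neq0 ?invr_eq0.
by have [] := frac_in dB hy (homogX1 _) nc.
Qed.

Lemma hyp_supp B : hyp y B != 0 -> pdiv B /\ van y B.
rewrite {1}/hyp;case: asboolP => [dB nB|_];last by rewrite eqxx.
split=> //;apply: contrapT => nv;move: nB.
by have := hyp0 dB nv;rewrite /hyp asboolT// => ->.
Qed.

Lemma fin_supp_hyp : fin_supp (hyp y).
have [s hs] := vanishing_curves hy ny;exists s => B /hyp_supp [dB vB].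
by apply/In_mem;apply: hs.
Qed.
Lemma nvan_at p B w : B p -> peval w p != 0 -> ~ van w B.
by move=> Bp nw /(_ _ Bp) /eqP;rewrite (negbTE nw). Qed.

Definition twist D (n : nat) : div := fun B => D B + n%:Z * hyp y B.

Lemma fin_supp_twist D n : fin_supp D -> fin_supp (twist D n).
move=> fD;apply: fin_suppD => //;apply: fin_suppZ;apply: fin_supp_hyp. Qed.
Lemma frac_mul F H d e : fq y (F * H) (d + e) = fq y F d * (fq y H e).
by rewrite gevM exprD invfM mulrACA. Qed.

Lemma form_oge d F B : F \is d.-homog -> pdiv B -> oge B (- (d%:Z * hyp y B)) (fq y F d).
move=> hF dB;have nc := coord_onP dB;have hc := homogX1 (coord_on B).
have gc := gev_neq0 dB hc nc.
have nq : gev y / gev 'X_(coord_on B) != 0 by rewrite mulf_neq0 ?invr_eq0.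
have -> : fq y F d = gev F / gev 'X_(coord_on B) ^+ d / (gev y / gev 'X_(coord_on B)) ^+ d.
 rewrite exprMn exprVn;move: (gev ^+ d) (gev ^+ d) (expf_neq0 d ny) expf_neq0 => a b na nb.
 by field;rewrite nb.
rewrite oge_mulr ?invr_eq0 ?expf_neq0// ordV// ordX// opprK (hypE dB hc nc) addNr.
by apply/oge0;have [] := frac_in dB hF hc nc.
Qed.

Section OnG.
Variables (G : set pt).
Hypothesis (dG : pdiv G).
Let pG := pdiv_prime dG.

Lemma lr_frac p f : G p -> lr G f -> exists a b, [/\ O_at p a, O_at p b, ~ mi G b & f = a / b].
move=> Gp [d [A [B [hA hB nB ->]]]];have Xp := pdiv_sub dG Gp.
have [i [hi hi1 nyp]] := pt_coordinate p.
have nyG : ~ van ('X_i : form) G by apply: (nvan_at Gp);rewrite hi oner_eq0.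
have gi := gev_neq0 Xp hi1 nyp;have gB := gev_neq0 pG hB nB.
exists (fq 'X_i A d), (fq 'X_i B d);split.
- exact: (frac_in Xp hA hi1 nyp).1.
- exact: (frac_in Xp hB hi1 nyp).1.
- by have [_ h] := frac_in pG hB hi1 nyG => /h.
by move: (gev ^+ d) expf_neq0 => a na;field;rewrite na.
Qed.

Lemma locT_mul m D p f g : G p -> O_at p f -> locT G m D p g -> locT G m D p (f * g).
move=> Gp Of [s hs h];exists (f * s).
 move=> B dB Bp;have -> : - D B = 0 + - D B by rewrite add0r.
 apply: ogeM => //;[exact: oge_pt Of|exact: hs].
rewrite -mulrBr;have -> : 1 - m = 0 + (1 - m) by rewrite add0r.
apply: ogeM => //;exact: oge_pt Of.
Qed.

(** Relative to a local generator, s is a quotient a/b along G, and a power of z lies in the ideal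
    generated by b and the functions vanishing on G. *)
Lemma locT_pow m E q s z : G q -> fin_supp E -> E G = m -> oge G (- m) s -> mx q z ->
 exists N, locT G m E q (z ^+ N * s).
move=> Gq fE EG os mz;have Xq := pdiv_sub dG Gq.
have [c nc hc] := local_gen fE Xq.
have Osc : lr G (s / c).
 by apply/(oge0 _ dG);rewrite oge_mulr ?invr_eq0// ordV// hc// opprK EG add0r.
have [a [b [Oa Ob nb e]]] := lr_frac Gq Osc.
have [N [g [h [Og Oh mh ez]]]] := curve_ideal_pow dG Gq Ob nb mz.
have nb0 : b != 0 by exact: lring_neq0 nb.
exists N, (g * a * c).
 apply/(osec_gen _ Xq nc hc);rewrite mulfK//;exact: (lringM Xq).
have -> : z ^+ N * s - g * a * c = h * (a / b) * c.
 have es : s = a / b * c by rewrite -e divfK.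
 by rewrite ez es;field.
rewrite oge_mulr// hc// EG opprK subrK.
by apply/(oge1 _ dG);rewrite mulrC;apply: maxM => //;rewrite -e.
Qed.

Lemma locT_twist m D q d w f : G q -> w \is 1.-homog -> peval w q != 0 -> ~ van y G ->
 locT G m (twist D d) q f <-> locT G m D q (f * (gev y / gev w) ^+ d).
move=> Gq hw nw nyG;have gw : gev w != 0 by exact: (gev_neq0 pG hw (nvan_at Gq nw)).
have nf : (gev y / gev w) ^+ d != 0 by rewrite expf_neq0// mulf_neq0 ?invr_eq0.
have e B : pdiv B -> B q -> D B + pdv ((gev y / gev w) ^+ d) B = twist D d B.
 move=> dB Bq;rewrite pdvE// ordX ?mulf_neq0 ?invr_eq0// /twist (hypE dB hw)//.
 exact: nvan_at Bq nw.
have oG : ord G ((gev y / gev w) ^+ d) = 0.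
 rewrite ordX ?mulf_neq0 ?invr_eq0// linear_unit ?mulr0//;exact: nvan_at nw.
rewrite (locT_mulr dG _ _ _ _ nf) oG addr0.
by split;apply: locT_mono => B dB Bq;rewrite e.
Qed.

Lemma locT_form m D q d F f : G q -> ~ van y G -> F \is d.-homog -> locT G m D q f ->
 locT G m (twist D d) q (fq y F d * f).
move=> Gq nyG hF hf;have [i hi] := pt_linear q;have hi1 := homogX1 i.
have nw : peval ('X_i : form) q != 0 by rewrite hi oner_eq0.
have gw : gev 'X_i != 0 by exact: (gev_neq0 pG hi1 (nvan_at Gq nw)).
apply/(locT_twist m D d _ Gq hi1 nw nyG).
have -> : fq y F d * f * (gev y / gev 'X_i) ^+ d = fq 'X_i F d * f.
 rewrite exprMn exprVn;move: (gev ^+ d) (gev ^+ d) (expf_neq0 d ny) expf_neq0 => a b na nb.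
 by field;rewrite nb.
apply: locT_mul => //;have pq := prime_pt (pdiv_sub dG Gq).
by have [] := frac_in pq hF hi1 (fun h => negP nw (introT eqP ((vanishes_pt _ _).1 h))).
Qed.
Lemma twist_twist D a b : twist (twist D a) b = twist D (a + b)%N.
by apply/funext => B;rewrite /twist PoszD mulrDl addrA. Qed.

(** For each q in l, a power of a linear form vanishing at q but not at p clears the pole of s at q;
    multiplication by further forms does no harm at the points already treated. *)
Lemma clear_poles m p (l : seq pt) M s : ~ van y G -> G p -> oge G (- m) s ->
 (forall q, fin_supp (M q) /\ M q G = m) ->
 exists d F, [/\ F \is d.-homog, peval F p != 0 &
  forall q, q \in l -> G q -> q <> p -> locT G m (twist (M q) d) q (fq y F d * s)].
move=> nyG Gp os hM;elim: l => [|q l [d [F [hF nF IH]]]].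
 by exists 0%N, 1;split;[exact: dhomog1|rewrite pev1 oner_eq0|].
have [[Gq /eqP nq]|no] := pselect (G q /\ q <> p);last first.
 exists d, F;split=> // q';rewrite inE => /orP [/eqP ->|h] Gq' nq';last exact: IH.
 by case: no.
have [L [hL Lq nL]] := separate_points (elimN eqP nq).
have [i hi] := pt_linear q;have hi1 := homogX1 i.
have nw : peval ('X_i : form) q != 0 by rewrite hi oner_eq0.
have gw : gev 'X_i != 0 by exact: (gev_neq0 pG hi1 (nvan_at Gq nw)).
have pq := prime_pt (pdiv_sub dG Gq).
have nwq : ~ van ('X_i : form) [set q] by move/vanishes_pt/eqP;rewrite (negbTE nw).
have mz : mx q (gev L / gev 'X_i).
 by have [_ h] := frac_in pq hL hi1 nwq;apply/h/vanishes_pt.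
have [fM MG] := hM q;have [N hN] := locT_pow Gq fM MG os mz.
exists (d + N)%N, (F * L ^+ N);split.
- by apply: dhomogM => //;apply: homogXn.
- by rewrite pevM pevXn mulf_neq0// expf_neq0.
move=> q';have [->|nqq] := eqVneq q' q => [_ _ _|].
 apply/(locT_twist m _ _ _ Gq hi1 nw nyG).
 have -> : fq y (F * L ^+ N) (d + N) * s * (gev y / gev 'X_i) ^+ (d + N) =
  fq 'X_i F d * ((gev L / gev 'X_i) ^+ N * s).
  rewrite gevM gevXn !exprMn !exprVn !exprD.
  move: (gev y ^+ d) (gev y ^+ N) (expf_neq0 d ny) (expf_neq0 N ny) => a1 a2 n1 n2.
  move: gev gev (expf_neq0 d gw) (expf_neq0 N gw) => b1 b2 n3 n4.
  by field;rewrite n2 n3 n4.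
 by apply: locT_mul;have [] := frac_in pq hF hi1 nwq.
rewrite inE (negbTE nqq) => ql Gq' nq';have h := IH q' ql Gq' nq'.
have := locT_form Gq' nyG (homogXn N hL) h;rewrite twist_twist.
have -> // : fq y (L ^+ N) N * (fq y F d * s) = fq y (F * L ^+ N) (d + N) * s.
rewrite frac_mul;ring.
Qed.
Lemma osec_oge m D p s : G p -> D G = m -> osec D p s -> oge G (- m) s.
by move=> Gp <- h;apply: h. Qed.

Lemma bad_points m D s : fin_supp D -> D G = m -> oge G (- m) s ->
 exists l : seq pt, forall q, G q -> q \notin l -> osec D q s.
move=> [sD hD] DG os;have [->|ns] := eqVneq s 0;first by exists [::] => q _ _ B _ _;left.
have [ss hs] := ord_finite ns.
have [l hl] := curves_meet_finite_list (sD ++ ss) dG.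
exists l => q Gq nq B dB Bq;have [->|/eqP nBG] := eqVneq B G;first by rewrite DG.
have nl : ~ List.In B (sD ++ ss).
 move=> h;move/negP: nq;apply;apply/In_mem;exact: (hl B).
have [DB|/hD DB] := eqVneq (D B) 0;last by case: nl;apply: List.in_or_app;left;apply/In_mem.
have [sB|sB] := eqVneq (ord B s) 0;first by right;rewrite sB DB.
by case: nl;apply: List.in_or_app;right;apply: hs.
Qed.

Lemma not_on_G q : ~ G q -> exists d F, [/\ F \is d.-homog, mi G (fq y F d) \/ van y G & peval F q != 0].
move=> nGq;have [d [F [hF vF nF]]] := (closedX_closed (pdiv_closed dG)) q nGq.
exists d, F;split=> //;have [|nyG] := pselect (van y G);[by right|left].
apply/(frac_in pG hF hy nyG).2 => r Gr.
by apply: contrapT => /eqP /nF.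
Qed.

(** The forms F for which F s lifts have no common zero. Off G, take F vanishing on G; at a point of
    G other than p, take F that makes F s a section of D' at p, with lift zero; at p, take F that
    clears all other poles of s, so that F s is its own lift. *)
Lemma lift_local m D D' (l : seq pt) p s : ~ van y G -> G p -> p \notin l ->
 fin_supp D -> fin_supp D' -> D G = m -> D' G = m -> osec D p s ->
 exists N, forall d F, (N <= d)%N -> F \is d.-homog -> exists2 a,
  Tsp G m (modp l (twist D' d) (twist D d)) a & locT G m (twist D' d) p (fq y F d * s - a).
move=> nyG Gp npl fD fD' DG DG' os;have ogs := osec_oge Gp DG os.
have sT d D1 q := locT_ksub dG d D1 q.
pose J d (F : form) := F \is d.-homog /\ exists2 a,
  Tsp G m (modp l (twist D' d) (twist D d)) a & locT G m (twist D' d) p (fq y F d * s - a).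
have sTT d : ksub (Tsp G m (modp l (twist D' d) (twist D d))) := Tsp_ksub dG _ _.
have gJ : graded_ideal J.
 split=> [d F []//|d|d F H [hF [a Ta h]] [hH [b Tb h']]|d e F H [hF [a Ta h]] hH].
 - split;first exact: dhomog0;exists 0;first exact: ksub0.
  rewrite gev0 !mul0r subrr;exact: ksub0.
 - split;first exact: dhomogD;exists (a + b);first exact: (ksubD (sTT d)).
  rewrite gevD;have -> : (gev F + gev H) / gev y ^+ d * s - (a + b) =
  fq y F d * s - a + (fq y H d * s - b) by ring.
  exact: ksubD.
 - split;first by rewrite addnC;exact: dhomogM.
  exists (fq y H e * a).
  move=> q Gq;have := locT_form Gq nyG hH (Ta q Gq);rewrite /modp.
  by case: ifP => _;rewrite twist_twist.
  have := locT_form Gp nyG hH h;rewrite twist_twist mulrBr.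
  have -> // : fq y H e * (fq y F d * s) = fq y (H * F) (d + e) * s.
  rewrite frac_mul;ring.
have noz q : exists d F, J d F /\ peval F q != 0.
 have [Gq|nGq] := pselect (G q);last first.
  have [d [F [hF [mF|] nF]]] := not_on_G nGq;exists d, F;split=> //;split=> //.
  exists 0;first exact: ksub0;rewrite subr0;apply: (J_locT).
  by apply: ogeM => //;apply/oge1.
 have [->|nqp] := eqVneq q p;last first.
  have [d [F [hF nF h]]] := clear_poles [:: p] nyG Gq ogs (fun=> conj fD' DG').
  exists d, F;split=> //;split=> //;exists 0;first exact: ksub0.
  by rewrite subr0;apply: h => //;[rewrite inE|apply/eqP;rewrite eq_sym].
 have [lb hlb] := bad_points fD DG ogs.
 have hM q' : fin_supp (modp l D' D q') /\ modp l D' D q' G = m by rewrite /modp;case: ifP.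
 have [d [F [hF nF h]]] := clear_poles (l ++ lb) nyG Gp ogs hM.
 exists d, F;split=> //;split=> //;exists (fq y F d * s).
  move=> q' Gq';have e : modp l (twist D' d) (twist D d) q' = twist (modp l D' D q') d.
  by rewrite /modp;case: ifP.
  rewrite e;have [->|/eqP nq] := eqVneq q' p.
  apply: locT_form => //;rewrite /modp (negbTE npl);exists s => //.
  by rewrite subrr;left.
  have [qin|] := boolP (q' \in l ++ lb);first exact: h.
  rewrite mem_cat negb_or => /andP [n1 n2];apply: locT_form => //.
  rewrite /modp (negbTE n1);exists s;first exact: hlb.
  by rewrite subrr;left.
 rewrite subrr;exact: ksub0.
have [N hN] := forms_of_no_zero gJ noz;exists N => d F le hF.
by have [_] := hN d F le hF.
Qed.

(** The quotient of germs at p is finite-dimensional, so the bounds of [lift_local] for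
    representatives of a basis have a maximum. *)
Lemma Surj_asymp m D D' b (l : seq pt) p : ~ van y G -> G p -> p \notin l ->
 fin_supp D -> fin_supp D' -> D G = m -> D' G = m -> O_at p b -> ~ mi G b ->
 (forall B, pdiv B -> B p -> D' B = D B - ord B b) ->
 exists N0, forall N, (N0 <= N)%N ->
  Surj G m (modp l (twist D' N) (twist D N)) (twist D N) (twist D' N) p.
move=> nyG Gp npl fD fD' DG DG' Ob nb hD'.
have Xp := pdiv_sub dG Gp.
have sS := locT_ksub dG m D p;have sS' := locT_ksub dG m D' p.
have [c nc hc] := local_gen fD Xp.
have oc : ord G c = - m by rewrite hc// DG.
have nb0 : b != 0 by exact: lring_neq0 nb.
have hS := sky dG Gp Ob nb nc oc.
have nbc : b * c != 0 by rewrite mulf_neq0.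
have hbc B : pdiv B -> B p -> ord B (b * c) = - D' B.
 by move=> dB Bp;rewrite ordM// hc// hD'// opprB.
have e1 : [set f | exists2 a, O_at p a & oge G (1 - m) (f - a * c)] = locT G m D p.
 apply/seteqP;split=> f [a Oa h].
  by exists (a * c) => //;apply/(osec_gen _ Xp nc hc);rewrite mulfK.
 by exists (a / c);[apply/(osec_gen _ Xp nc hc)|rewrite divfK].
have e2 : [set f | exists2 a, O_at p a & oge G (1 - m) (f - a * b * c)] = locT G m D' p.
 apply/seteqP;split=> f [a Oa h].
  by exists (a * b * c) => //;apply/(osec_gen _ Xp nbc hbc);rewrite -(mulrA a) mulfK.
 by exists (a / (b * c));[apply/(osec_gen _ Xp nbc hbc)|rewrite -mulrA divfK].
rewrite e1 e2 in hS;have [e [Se gen _]] := (hqdP _ sS sS').1 hS.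
have [N hN] : exists N : 'I_(loclen G p b) -> nat, forall i, exists2 s, osec D p s /\ oge G (1 - m) (e i - s) &
  forall d F, (N i <= d)%N -> F \is d.-homog -> exists2 a,
  Tsp G m (modp l (twist D' d) (twist D d)) a & locT G m (twist D' d) p (fq y F d * s - a).
 suff : forall i, exists N, exists2 s, osec D p s /\ oge G (1 - m) (e i - s) &
  forall d F, (N <= d)%N -> F \is d.-homog -> exists2 a,
  Tsp G m (modp l (twist D' d) (twist D d)) a & locT G m (twist D' d) p (fq y F d * s - a).
  by move=> /choice [N hN];exists N.
 move=> i;have [s os h] := Se i.
 by have [N hN] := lift_local nyG Gp npl fD fD' DG DG' os;exists N, s.
exists (\max_i N i)%N => d le s os.
have [i hi] := pt_linear p;have hi1 := homogX1 i.
have nw : peval ('X_i : form) p != 0 by rewrite hi oner_eq0.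
have gw : gev 'X_i != 0 by exact: (gev_neq0 pG hi1 (nvan_at Gp nw)).
(* [r] trivialises the twist at p; it identifies germs of the twisted divisor with germs of the
   untwisted one. *)
pose r := (gev y / gev 'X_i) ^+ d.
have nr : r != 0 by rewrite expf_neq0// mulf_neq0 ?invr_eq0.
have hs : locT G m D p (s * r).
 by apply/(locT_twist m D d _ Gp hi1 nw nyG);exists s => //;rewrite subrr;left.
have [co hco] := gen _ hs.
have [a ha] : exists a : 'I_(loclen G p b) -> K, forall j, Tsp G m (modp l (twist D' d) (twist D d)) (a j) /\
  locT G m (twist D' d) p (e j / r - a j).
 suff : forall j, exists a, Tsp G m (modp l (twist D' d) (twist D d)) a /\
  locT G m (twist D' d) p (e j / r - a) by move=> /choice [a ha];exists a.
 move=> j;have [sj [osj hsj] hj] := hN j.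
 have [|aj Ta hl] := hj d ('X_i ^+ d) _ (homogXn d hi1).
  apply: leq_trans le;exact: leq_bigmax.
 exists aj;split=> //.
 have er : fq y ('X_i ^+ d) d = r^-1.
  by rewrite gevXn /r exprMn exprVn invfM invrK mulrC.
 rewrite er in hl;have -> : e j / r - aj = (e j - sj) / r + (r^-1 * sj - aj) by ring.
 apply: (ksubD (locT_ksub dG _ _ _)) => //;apply: (J_locT).
 rewrite oge_mulr ?invr_eq0// ordV// ordX ?mulf_neq0 ?invr_eq0// linear_unit ?mulr0 ?subr0//.
 exact: nvan_at Gp nw.
have sTT : ksub (Tsp G m (modp l (twist D' d) (twist D d))) := Tsp_ksub dG _ _.
exists (lcomb a co);first by apply: lcomb_in => // j;have [] := ha j.
have -> : s - lcomb a co = (s * r - lcomb e co) / r + (lcomb e co / r - lcomb a co).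
 by rewrite mulrBl mulfK// addrA subrK.
apply: (ksubD (locT_ksub dG _ _ _)).
 by apply/(locT_twist m D' d _ Gp hi1 nw nyG);rewrite divfK.
have -> : lcomb e co / r - lcomb a co = lcomb (fun j => e j / r - a j) co.
 by rewrite mulr_suml -sumrB;apply: eq_bigr => j _;rewrite mulrBr mulrA.
by apply: lcomb_in => [|j];[exact: locT_ksub|have [] := ha j].
Qed.
End OnG.
End Fixed.
End Hyperplane.

(** * Degrees and intersection numbers *)

Lemma fsumE (T : choiceType) (F : T -> int) (s : seq T) : uniq s ->
 (forall x, F x != 0 -> x \in s) -> \sum_(x \in [set: T]) F x = \sum_(x <- s) F x.
move=> us h;rewrite (@fsbigE _ _ _ T setT s F us)//;first by apply: eq_bigl => x;rewrite in_setT.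
move=> x _ nx;apply/eqP;apply: contraNT nx;apply: h.
Qed.

Section Degree.
Local Notation I B G := (@curve_inter k X B G).
Implicit Types (B C G : set pt) (p q : pt) (F y : form) (f g t u s : K).
Implicit Types (D E : div).

Definition tdim G D : nat := quot_dim (Tsp G (D G) (fun=> D)) (oge G (1 - D G)).

Lemma tdimP G D : pdiv G -> fin_supp D -> hqd (Tsp G (D G) (fun=> D)) (oge G (1 - D G)) (tdim G D).
move=> dG fD;have [n hn] := Tsp_finite dG fD erefl.
rewrite /tdim;apply: xgetPex;by exists n.
Qed.

Lemma tdim_eq G D n : pdiv G -> fin_supp D ->
 hqd (Tsp G (D G) (fun=> D)) (oge G (1 - D G)) n -> tdim G D = n.
move=> dG fD hn;apply: hqd_uniq (tdimP dG fD) hn;[exact: Tsp_ksub|exact: oge_ksub].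
Qed.
Lemma Tsp_ext G m D E : (forall B, pdiv B -> D B = E B) -> Tsp G m (fun=> D) = Tsp G m (fun=> E).
by move=> h;apply/seteqP;split;apply: Tsp_mono => p B dB _;rewrite h. Qed.
Lemma tdim_ext G D E : pdiv G -> (forall B, pdiv B -> D B = E B) -> tdim G D = tdim G E.
by move=> dG h;rewrite /tdim (h G dG) (Tsp_ext _ _ h). Qed.

Lemma tdim_equiv G D f : pdiv G -> fin_supp D -> f != 0 -> tdim G D = tdim G (fun B => D B + pdv f B).
move=> dG fD nf;apply: tdim_eq => //.
have fE : fin_supp (fun B => D B + pdv f B) by apply: fin_suppD => //;exact: fin_supp_pdv.
have := tdimP dG fE;rewrite pdvE//;exact: Tsp_equiv.
Qed.

Definition subB D B : div := fun C => D C - cdiv B C.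

Lemma fin_supp_subB D B : fin_supp D -> fin_supp (subB D B).
move=> fD;apply: fin_suppD => //;apply: fin_suppN;exact: fin_supp_curve. Qed.
Lemma subB_G D B G : B <> G -> subB D B G = D G.
by move=> n;rewrite /subB /cdiv;case: eqP => [/esym//|_];rewrite subr0. Qed.

Lemma I_sym B G : I B G = I G B.
rewrite /curve_inter setIC;apply: eq_fsbigr => p _.
rewrite /local_mult;congr quot_dim;apply/seteqP;split=> f [g [h [hg hh ->]]];
 by exists h, g;rewrite addrC.
Qed.

Lemma tdim_chain G D B : pdiv G -> pdiv B -> B <> G -> fin_supp D ->
 (tdim G (subB D B) <= tdim G D)%N /\ (tdim G D)%:Z <= (tdim G (subB D B))%:Z + I B G.
move=> dG dB nBG fD;have [l ul hl] := meet_list dG dB nBG.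
have [n [le hn _]] := Tsp_chain dG dB nBG fD erefl (fun C _ => erefl : subB D B C = _) ul hl.
have h := tdimP dG (fin_supp_subB B fD);rewrite (subB_G D nBG) in h.
have -> : tdim G D = (n + tdim G (subB D B))%N.
 apply: tdim_eq => //;apply: hqd_add hn h;try exact: Tsp_ksub;first exact: oge_ksub.
  exact: J_Tsp.
 apply: Tsp_mono => p C _;rewrite lerBlDr lerDl /cdiv;by case: (_ == _).
by rewrite leq_addl PoszD addrC;rewrite lerD2l.
Qed.

Section Asymptotic.
Variables (G : set pt) (y : form).
Hypotheses (dG : pdiv G) (hy : y \is 1.-homog) (nyG : ~ van y G).
Let pG := pdiv_prime dG.
Let ny : gev y != 0 := gev_neq0 pG hy nyG.
Local Notation twist := (@twist y).

Lemma twist_G D n : twist D n G = D G.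
by rewrite /twist (hyp0 hy ny dG nyG) mulr0 addr0. Qed.

Lemma asym_points D B (l : seq pt) : pdiv B -> B <> G -> fin_supp D -> uniq l ->
 (forall p, p \in l -> B p /\ G p) ->
 exists N0, forall N, (N0 <= N)%N -> forall l1 p l2, l = l1 ++ p :: l2 ->
  Surj G (D G) (modp l2 (twist (subB D B) N) (twist D N)) (twist D N) (twist (subB D B) N) p.
move=> dB nBG fD;elim: l => [|p l IH].
 by exists 0%N => N _ [|? ?].
move=> /andP [np ul] hl;have [N1 h1] := IH ul (fun q hq => hl q (mem_behead (s := p :: l) hq)).
have [Bp Gp] := hl p (mem_head _ _);have [b lb] := leq_ex dB Bp.
have [Ob mb nb _] := lb.
have nmb : ~ mi G b.
 have oG := leq_ord dG dB Gp Bp lb;have ne : (G == B) = false by apply/eqP => /esym.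
 by rewrite ne in oG;move/(mi_ord dG nb);rewrite oG.
have [|C dC Cp|N2 h2] := @Surj_asymp y hy ny G dG (D G) D (subB D B) b l p nyG Gp np fD (fin_supp_subB B fD) erefl _ Ob nmb.
- exact: subB_G.
- by rewrite (leq_ord dC dB Cp Bp lb).
exists (maxn N1 N2) => N;rewrite geq_max => /andP [le1 le2] [|q l1] p' l2 [e1 e2].
 by subst p' l2;apply: h2.
exact: (h1 N le1 l1).
Qed.

Lemma asym_curve D B : pdiv B -> B <> G -> fin_supp D -> exists N0, forall N, (N0 <= N)%N ->
 (tdim G (twist D N))%:Z = (tdim G (twist (subB D B) N))%:Z + I B G.
move=> dB nBG fD;have [l ul hl] := meet_list dG dB nBG.
have [N0 h0] := asym_points dB nBG fD ul (fun p hp => (hl p).1 hp).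
exists N0 => N le;have fDN : fin_supp (twist D N) := fin_supp_twist hy ny N fD.
have fEN : fin_supp (twist (subB D B) N) := fin_supp_twist hy ny N (fin_supp_subB B fD).
have [||n [_ hn hs]] := @Tsp_chain G dG (D G) (twist D N) (twist (subB D B) N) B l dB nBG fDN _ _ ul hl.
- exact: twist_G.
- by move=> dC;rewrite addrAC.
have h := tdimP dG fEN;rewrite twist_G (subB_G D nBG) in h.
have -> : tdim G (twist D N) = (n + tdim G (twist (subB D B) N))%N.
 apply: tdim_eq => //;rewrite twist_G;apply: hqd_add hn h;try exact: Tsp_ksub;first exact: oge_ksub.
  exact: J_Tsp.
 apply: Tsp_mono => p C _;rewrite lerD2r lerBlDr lerDl /cdiv;by case: (_ == _).
by rewrite PoszD addrC (hs (h0 N le)).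
Qed.

(** The degree of E on G, read off as the jump in the number of sections after large twists. *)
Definition asym E (n : int) := fin_supp E /\ forall D, fin_supp D -> exists N0, forall N, (N0 <= N)%N ->
 (tdim G (twist (fun B => D B + E B) N))%:Z = (tdim G (twist D N))%:Z + n.

Lemma asym_ext E E' n : fin_supp E' -> (forall B, pdiv B -> E B = E' B) -> asym E n -> asym E' n.
move=> fE' h [fE hE];split=> // D /hE [N0 h0];exists N0 => N /h0 <-;congr Posz.
by apply: tdim_ext => // B dB;rewrite /twist h.
Qed.

Lemma asym0 : asym (fun=> 0) 0.
split;first by exists [::] => B.
move=> fD;exists 0%N => N _;rewrite addr0;congr Posz.
by apply: tdim_ext => // dB;rewrite /twist addr0.
Qed.

Lemma asymD E E' n n' : asym E n -> asym E' n' -> asym (fun B => E B + E' B) (n + n').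
move=> [fE hE] [fE' hE'];split;first exact: fin_suppD.
move=> D fD;have [N1 h1] := hE _ fD;have [N2 h2] := hE' _ (fin_suppD fD fE).
exists (maxn N1 N2) => N;rewrite geq_max => /andP [/h1 e1 /h2 e2].
rewrite addrA -e1 -e2;congr Posz;apply: tdim_ext => // B.
by rewrite /twist addrA.
Qed.

Lemma asymN E n : asym E n -> asym (fun B => - E B) (- n).
move=> [fE hE];split;first exact: fin_suppN.
move=> D fD;have [N1 h1] := hE _ (fin_suppD fD (fin_suppN fE)).
exists N1 => N /h1;rewrite (_ : tdim G (twist (fun B => D B - E B + E B) N) = tdim G (twist D N)).
 by move=> ->;rewrite addrK.
by apply: tdim_ext => // dB;rewrite /twist subrK.
Qed.

Lemma asymZ E n (j : int) : asym E n -> asym (fun B => j * E B) (j * n).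
move=> hE;have h (i : nat) : asym (fun B => i%:Z * E B) (i%:Z * n).
 elim: i => [|i IH].
  by rewrite mul0r;apply: asym_ext asym0;[apply: fin_suppZ;case: hE|move=> B _;rewrite mul0r].
 rewrite intS mulrDl mul1r;apply: asym_ext (asymD hE IH);first by apply: fin_suppZ;case: hE.
 by move=> B _;rewrite mulrDl mul1r.
case: j => i;first exact: h.
rewrite NegzE mulNr;apply: asym_ext (asymN (h i.+1));first by apply: fin_suppZ;case: hE.
by move=> B _;rewrite mulNr.
Qed.

Lemma asym_B B : pdiv B -> B <> G -> asym (cdiv B) (I B G).
move=> dB nBG;split;first exact: fin_supp_curve.
move=> D fD;have [N0 h0] := asym_curve dB nBG (fin_suppD fD (fin_supp_curve B)).
exists N0 => N /h0 ->;congr (_%:Z + _);apply: tdim_ext => // C dC.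
by rewrite /twist /subB addrK.
Qed.

Lemma asym_sum E (s : seq (set pt)) : (forall B, B \in s -> pdiv B /\ B <> G) ->
 asym (fun C => \sum_(B <- s) E B * cdiv B C) (\sum_(B <- s) E B * I B G).
elim: s => [|B s IH] hs.
 rewrite big_nil;apply: asym_ext asym0 => [|C _];last by rewrite big_nil.
 by exists [::] => C;rewrite big_nil.
have [dB nB] := hs B (mem_head _ _).
have h := asymD (asymZ (E B) (asym_B dB nB)) (IH (fun C hC => hs C (mem_behead (s := B :: s) hC))).
rewrite big_cons;apply: asym_ext h => [|C _];last by rewrite big_cons.
have [f1 _] := asymD (asymZ (E B) (asym_B dB nB)) (IH (fun C hC => hs C (mem_behead (s := B :: s) hC))).
have [s1 h1] := f1;exists s1 => C;rewrite big_cons;apply: h1.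
Qed.

Lemma sum_curves E (s : seq (set pt)) C : uniq s -> (forall B, E B != 0 -> B \in s) ->
 \sum_(B <- s) E B * cdiv B C = E C.
move=> us h;have [Cs|nCs] := boolP (C \in s).
 rewrite (bigD1_seq C)//= big1 ?addr0 => [|B nB].
  by rewrite /cdiv eqxx mulr1.
 by rewrite /cdiv eq_sym (negbTE nB) mulr0.
rewrite big1_seq => [|B /= Bs].
 apply/esym/eqP;apply: contraNT nCs;apply: h.
rewrite /cdiv;case: eqP => [e|_];last by rewrite mulr0.
by rewrite e Bs in nCs.
Qed.

Lemma asym_div E (s : seq (set pt)) : uniq s -> (forall B, B \in s -> pdiv B /\ B <> G) ->
 (forall B, E B != 0 -> B \in s) -> asym E (\sum_(B <- s) E B * I B G).
move=> us hs h;have := asym_sum E hs;apply: asym_ext;first by exists s.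
by move=> C _;apply: sum_curves.
Qed.

(** Multiplication by f identifies the sections before and after adding div f, so the asymptotic
    jump, which computes the degree, is zero. *)
Lemma degree_zero f (s : seq (set pt)) : f != 0 -> ord G f = 0 -> uniq s ->
 (forall B, B \in s -> pdiv B /\ B <> G) -> (forall B, pdv f B != 0 -> B \in s) ->
 \sum_(B <- s) pdv f B * I B G = 0.
move=> nf oG us hs h;have [_ h1] := asym_div us hs h.
have f0 : @fin_supp (fun=> 0) by exists [::] => B.
have [N hN] := h1 _ f0;have := hN N (leqnn N).
have fT : fin_supp (twist (fun=> 0) N) by exact: fin_supp_twist.
rewrite (tdim_equiv dG fT nf) => e.
have e2 : tdim G (fun B => twist (fun=> 0) N B + pdv f B) = tdim G (twist (fun B => 0 + pdv f B) N).
 by apply: tdim_ext => // B _;rewrite addrAC.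
by move: e;rewrite e2 => /eqP;rewrite -{1}[X in X == _]addr0 (inj_eq (addrI _)) => /eqP <-.
Qed.
End Asymptotic.

Lemma good_linear G : pdiv G -> exists2 y : form, y \is 1.-homog & ~ van y G.
move=> dG;exists 'X_(coord_on G);[exact: homogX1|exact: coord_onP]. Qed.

Definition good_list (D : div) (s : seq (set pt)) := uniq s /\ forall B, D B != 0 -> B \in s.

Lemma good_listP D : fin_supp D -> exists s : seq (set pt), good_list D s.
by move=> [s hs];exists (undup s);split=> [|B /hs];[exact: undup_uniq|rewrite mem_undup].
Qed.

Definition unif_of G : K := xget 0 [set t | unif G t].
(** For a uniformizer t along G, the divisor G - div t is linearly equivalent to G and does not
    contain G; its degree on G is the self-intersection. *)
Definition self G : int := - \sum_(B \in [set: set pt]) (if B == G then 0 else pdv (unif_of G) B * I B G).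
Definition wt G B : int := if B == G then self G else I B G.
Lemma wt_if G B : wt G B = if B == G then self G else I B G. by []. Qed.
Definition dg G D : int := \sum_(B \in [set: set pt]) D B * wt G B.

Lemma unif_ofP G : pdiv G -> unif G (unif_of G).
move=> dG;apply: xgetPex;exact: unif_ex.
Qed.
Lemma wt_sym G B : wt G B = wt B G.
by rewrite /wt eq_sym;case: eqP => [->|_]//;rewrite I_sym. Qed.

Lemma dgE G D (s : seq (set pt)) : good_list D s -> dg G D = \sum_(B <- s) D B * wt G B.
move=> [us hs];apply: fsumE => // B nB;apply: hs.
by apply: contraNneq nB => ->;rewrite mul0r.
Qed.

Lemma dgD G D E : fin_supp D -> fin_supp E -> dg G (fun B => D B + E B) = dg G D + dg G E.
move=> [s hs] [s' hs'];pose l := undup (s ++ s').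
have gl (D1 : div) : (forall B, D1 B != 0 -> B \in s ++ s') -> good_list D1 l.
 by move=> h;split=> [|B /h];[exact: undup_uniq|rewrite mem_undup].
rewrite (@dgE G D l) ?(@dgE G E l) ?(@dgE G (fun B => D B + E B) l);try (apply: gl => B).
- by rewrite -big_split;apply: eq_bigr => B _;rewrite mulrDl.
- apply: contraNT;rewrite mem_cat negb_or => /andP [n1 n2].
 have [->|/hs h] := eqVneq (D B) 0;last by rewrite h in n1.
 by have [->|/hs' h] := eqVneq (E B) 0;rewrite//;rewrite h in n2.
- by move/hs';rewrite mem_cat orbC => ->.
- by move/hs;rewrite mem_cat => ->.
Qed.

Lemma dgZ G (n : int) D : fin_supp D -> dg G (fun B => n * D B) = n * dg G D.
move=> fD;have [s gs] := good_listP fD;have [us hs] := gs.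
have g2 : good_list (fun B => n * D B) s.
 by split=> // B nB;apply: hs;apply: contraNneq nB => ->;rewrite mulr0.
by rewrite (dgE _ gs) (dgE _ g2) mulr_sumr;apply: eq_bigr => B _;rewrite mulrA.
Qed.

Lemma dgN G D : fin_supp D -> dg G (fun B => - D B) = - dg G D.
move=> fD;rewrite -mulN1r -dgZ//;congr dg;apply/funext => B.
by rewrite mulN1r.
Qed.

Lemma dg_curve G B : dg G (cdiv B) = wt G B.
rewrite (@dgE G _ [:: B]);last first.
 by split=> // C;rewrite /cdiv inE;case: (C == B).
by rewrite big_seq1 /cdiv eqxx mul1r.
Qed.
Lemma dg_ext G D E : (forall B, D B = E B) -> dg G D = dg G E.
by move=> h;congr dg;apply/funext. Qed.
Lemma pdv_pdiv f B : pdv f B != 0 -> pdiv B.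
by rewrite !pdv_if;case: asboolP. Qed.

Lemma pdvM f g : f != 0 -> g != 0 -> pdv (f * g) = fun B => pdv f B + pdv g B.
move=> nf ng;apply/funext => B;rewrite !pdv_if;case: asboolP => dB;last by rewrite addr0.
exact: ordM.
Qed.

Lemma pdvXz f (n : int) : f != 0 -> pdv (f ^ n) = fun B => n * pdv f B.
move=> nf;apply/funext => B;rewrite !pdv_if;case: asboolP => dB;last by rewrite mulr0.
exact: ordXz.
Qed.

(** Up to a power of the uniformizer t, f has order zero along G; for t itself the degree vanishes
    by the choice of [self]. *)
Lemma dg_pdv G f : pdiv G -> f != 0 -> dg G (pdv f) = 0.
move=> dG nf;have [y hy nyG] := good_linear dG.
have [nt mt ht] := unif_ofP dG;set t := unif_of G in nt mt ht.
have ot : ord G t = 1 by apply: unif_ord.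
have zero g : g != 0 -> ord G g = 0 -> dg G (pdv g) = 0.
 move=> ng og;have [s [us hs]] := good_listP (fin_supp_pdv ng).
 pose l := [seq B <- s | `[< pdiv B /\ B <> G >]].
 have hl B : pdv g B != 0 -> B \in l.
  move=> nB;rewrite mem_filter hs// asboolT;split;first exact: pdv_pdiv nB.
  by move=> e;rewrite e pdvE// og in nB.
 have ul : uniq l by rewrite filter_uniq.
 rewrite (@dgE G _ l)//.
 have hl' B : B \in l -> pdiv B /\ B <> G by rewrite mem_filter => /andP [/asboolP].
 rewrite -[RHS](degree_zero dG hy nyG ng og ul hl' hl).
 rewrite big_seq [RHS]big_seq;apply: eq_bigr => B /hl' [_ /eqP nB].
 by rewrite /wt (negbTE nB).
have tz : dg G (pdv t) = 0.
 have [s [us hs]] := good_listP (fin_supp_pdv nt).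
 have Gs : G \in s by apply: hs;rewrite pdvE// ot.
 rewrite (@dgE G _ s)// (bigD1_seq G)//= pdvE// ot mul1r /wt /self -/t.
 rewrite (@fsumE _ _ s)//;last first.
  move=> B;case: (B =P G) => [_|_ nB];first by rewrite eqxx.
  by apply: hs;apply: contraNneq nB => e0;rewrite e0 mul0r.
 rewrite [X in - X](bigD1_seq G)//= eqxx add0r addrC.
 rewrite (eq_bigr (fun B => if B == G then 0 else pdv t B * I B G)) ?subrr//.
 by move=> B nB;rewrite (negbTE nB).
have e : f = f * t ^ (- ord G f) * t ^ (ord G f).
 by rewrite -mulrA -expfzDr// addNr mulr1.
have nz n : t ^ n != 0 by rewrite expfz_neq0.
rewrite e pdvM ?mulf_neq0// dgD;try (apply: fin_supp_pdv;rewrite ?mulf_neq0//).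
rewrite zero ?mulf_neq0 ?ordM ?ordXz ?ot ?mulr1 ?subrr//.
rewrite pdvXz// dgZ ?tz ?mulr0//;exact: fin_supp_pdv.
Qed.

Definition ip D E : int := \sum_(B \in [set: set pt]) E B * dg B D.

Lemma ipE D E (s : seq (set pt)) : good_list E s -> ip D E = \sum_(B <- s) E B * dg B D.
move=> [us hs];apply: fsumE => // B nB;apply: hs.
by apply: contraNneq nB => ->;rewrite mul0r.
Qed.

Lemma ip_sym D E : fin_supp D -> fin_supp E -> ip D E = ip E D.
move=> /good_listP [s gs] /good_listP [l gl];rewrite (ipE _ gl) (ipE _ gs).
under eq_bigr => B do rewrite (dgE _ gs) mulr_sumr.
rewrite exchange_big;apply: eq_bigr => C _;rewrite (dgE _ gl) mulr_sumr.
by apply: eq_bigr => B _;rewrite mulrCA wt_sym.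
Qed.

Lemma ip_curve D G : ip D (cdiv G) = dg G D.
rewrite (@ipE _ _ [:: G]);last by split=> // C;rewrite /cdiv inE;case: (C == G).
by rewrite big_seq1 /cdiv eqxx mul1r.
Qed.

Definition pdiv_supp D := forall B, D B != 0 -> pdiv B.

Lemma ip_equiv D D' f E : fin_supp D -> fin_supp D' -> fin_supp E -> pdiv_supp E -> f != 0 ->
 (forall B, D B = D' B + pdv f B) -> ip D E = ip D' E.
move=> fD fD' fE sE nf h;have [s gs] := good_listP fE;rewrite !(ipE _ gs);apply: eq_bigr => B.
have [->|/sE dB] := eqVneq (E B) 0;first by rewrite !mul0r.
rewrite (dg_ext _ h) dgD ?dg_pdv ?addr0//;exact: fin_supp_pdv.
Qed.

Lemma is_divisorP D : is_divisor D -> fin_supp D /\ pdiv_supp D.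
move=> [/finite_seqP [s es] h];split=> //;exists s => B nB.
by have : [set C | D C != 0] B by [];rewrite es.
Qed.

Lemma lin_equivP D E : pdiv_supp D -> pdiv_supp E -> lin_equiv D E ->
 exists2 f, f != 0 & forall B, D B = E B + pdv f B.
move=> sD sE [f nf h];exists f => // B;rewrite !pdv_if;case: asboolP => dB.
 by rewrite -(h B dB) addrC subrK.
have [->|/sE//] := eqVneq (E B) 0.
by have [->|/sD] := eqVneq (D B) 0.
Qed.

(** Whatever divisors are chosen to move D and D', they compute the bilinear form [ip], which is
    invariant under linear equivalence and needs no self-intersection when there is no common
    component. *)
Lemma has_interP D D' m : fin_supp D -> pdiv_supp D -> fin_supp D' -> pdiv_supp D' ->
 has_inter D D' m -> m = ip D D'.
move=> fD sD fD' sD' [E [E' [[dE lE] [dE' lE'] dis ->]]].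
have [fE sE] := is_divisorP dE;have [fE' sE'] := is_divisorP dE'.
have [f nf hf] := lin_equivP sD sE lE;have [f' nf' hf'] := lin_equivP sD' sE' lE'.
rewrite (ip_equiv fD fE fD' sD' nf hf) ip_sym// (ip_equiv fD' fE' fE sE nf' hf').
have [s gs] := good_listP fE;have [us hs] := gs;have [l gl] := good_listP fE';have [ul hl] := gl.
rewrite (ipE _ gs) (@fsumE _ _ s)//;last first.
 move=> C;apply: contraNT => nC;rewrite (_ : E C = 0);last by apply/eqP;apply: contraNT nC;apply: hs.
 rewrite (@fsumE _ _ [::]) ?big_nil// => x.
 by rewrite !mul0r.
apply: eq_bigr => C _;rewrite (dgE _ gl) mulr_sumr (@fsumE _ _ l)//;last first.
 move=> C';apply: contraNT => nC;rewrite (_ : E' C' = 0) ?mulr0 ?mul0r//;apply/eqP;apply: contraNT nC;apply: hl.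
apply: eq_bigr => C' _;rewrite /wt;case: eqP => [->|_].
 by have [->|->] := dis C;rewrite !(mul0r, mulr0).
by rewrite I_sym mulrA.
Qed.

(** [inter] defaults to 0, so a nonzero value certifies that a moving exists. *)
Lemma interP D D' m : fin_supp D -> pdiv_supp D -> fin_supp D' -> pdiv_supp D' ->
 inter D D' = m -> m != 0 -> ip D D' = m.
move=> fD sD fD' sD' e nm;apply/esym/has_interP => //.
apply: contrapT => no;case/eqP: nm;rewrite -e;apply: xgetPN => m' h.
apply: no;rewrite -e;exact: (@xgetPex _ 0 [set m | has_inter D D' m] (ex_intro _ m' h)).
Qed.
End Degree.

(** * Smooth rational curves *)

Section Rational.
Local Notation I B G := (@curve_inter k X B G).
Implicit Types (B C : set pt) (p q : pt) (f g t u s : K) (P Q : {poly k}).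
Implicit Types (D E : div).

Section OnG.
Variable G : set pt.
Hypotheses (dG : pdiv G) (sG : smooth_curve G).
Let pG := pdiv_prime dG.
Local Notation m := (mi G).

(* The image of O_{X,p} in the function field of [G]. *)
Definition regular_at p f := exists2 a, O_at p a & m (f - a).

Lemma miZ f g : lr G f -> m g -> m (f * g). exact: maxM. Qed.

(** A lift to the local ring of X of a uniformizer of G at p. *)
Definition curve_unif p g := [/\ O_at p g, mx p g, ~ m g &
 forall f, mx p f -> exists2 a, O_at p a & m (f - a * g)].

Lemma curve_unif_ex p : G p -> exists g, curve_unif p g.
move=> Gp;have Xp := pdiv_sub dG Gp.
have [g mg h] := sG Gp;have Og := max_sub mg.
have sub : [set p] `<=` G by move=> _ ->.
have h' f : mx p f -> exists2 a, O_at p a & m (f - a * g).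
 by move=> /h [a Oa /(local_idealE _ pG Xp sub) [_ mf]];exists a.
exists g;split=> // mGg;have [u [v luv]] := hX.2 p Xp.
have [_ _] := pdiv_trace Xp luv hX.1 dG Gp;apply=> f mf;split;first exact: max_sub mf.
have [a Oa ma] := h' f mf;rewrite -[f](subrK (a * g));apply: maxD => //.
apply: maxM => //;exact: lr_at Oa.
Qed.

Section AtP.
Variables (p : pt) (g : K).
Hypotheses (Gp : G p) (ug : curve_unif p g).
Let Xp : Xpts p. exact: pdiv_sub Gp. Qed.
Let pp := prime_pt Xp.
Let OG f : O_at p f -> lr G f. exact: lr_at. Qed.

Lemma pt_unit u : unit_at [set p] u -> [/\ O_at p u, O_at p u^-1 & ~ m u].
move=> [Ou nu];have [Oi _] := lring_inv pp Ou nu;split=> // mu.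
by apply: nu;apply: (mi_at dG Gp Ou).
Qed.
Lemma ug_exp n : ~ m (g ^+ n).
by have [Og _ nmg _] := ug;move/(max_exp pG (OG Og)). Qed.

Lemma dvr_uniq u u' a b : unit_at [set p] u -> unit_at [set p] u' -> m (u * g ^+ a - u' * g ^+ b) -> a = b.
have main u1 u2 i j : unit_at [set p] u1 -> O_at p u2 -> (i < j)%N -> ~ m (u1 * g ^+ i - u2 * g ^+ j).
 move=> hu Ou2 lt;have [Og mg nmg _] := ug.
 have -> : u1 * g ^+ i - u2 * g ^+ j = (u1 - u2 * g ^+ (j - i)) * g ^+ i.
  by rewrite mulrBl -mulrA -exprD subnK// ltnW.
 have Oe : O_at p (u2 * g ^+ (j - i)) by apply: lringM => //;apply: lringX.
 have Od : O_at p (u1 - u2 * g ^+ (j - i)) by apply: lringB;case: hu.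
 move/(max_prime pG (OG Od) (lringX pG _ (OG Og))) => [] md;last by case: (ug_exp md).
 have me : mx p (u2 * g ^+ (j - i)).
  by rewrite -(prednK (_ : 0 < j - i)%N) ?subn_gt0// exprSr mulrA;apply: maxM => //;apply: lringM => //;apply: lringX.
 case: hu => _;apply;rewrite -[u1](subrK (u2 * g ^+ (j - i)));apply: maxD => //.
 exact: (mi_at dG Gp Od).
move=> hu hu' h;case: (ltngtP a b) => // lt;exfalso;first by apply: main lt h;case: hu'.
by apply: (main u' u b a) => //;[case: hu|rewrite -opprB;apply: maxN].
Qed.

(** Repeated division by g stops because the ideal generated by r and the functions vanishing on G
    contains a power of g. *)
Lemma dvr r : O_at p r -> ~ m r -> exists n u, unit_at [set p] u /\ m (r - u * g ^+ n).
move=> Or nr;have [Og mg nmg hg] := ug;apply: contrapT => no.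
have step n : exists2 r', O_at p r' & m (r - r' * g ^+ n).
 elim: n => [|n [r' Or' mr]];first by exists r => //;rewrite mulr1 subrr;exact: max0.
 have [mr'|nmr'] := pselect (mx p r');last by case: no;exists n, r'.
 have [a Oa ma] := hg _ mr';exists a => //.
 have -> : r - a * g ^+ n.+1 = r - r' * g ^+ n + (r' - a * g) * g ^+ n by rewrite exprS;ring.
 apply: maxD => //;rewrite mulrC;apply: miZ => //;apply: (lringX pG);exact: OG.
have [N [a [h [Oa Oh mh e]]]] := curve_ideal_pow dG Gp Or nr mg.
have [r' Or' mr'] := step N.+1.
suff : ~ m (1 * g ^+ N - a * r' * g ^+ N.+1).
 apply;have -> : 1 * g ^+ N - a * r' * g ^+ N.+1 = a * (r - r' * g ^+ N.+1) + h by rewrite e;ring.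
 apply: maxD => //;apply: miZ => //;exact: OG.
have -> : 1 * g ^+ N - a * r' * g ^+ N.+1 = (1 - a * r' * g) * g ^+ N by rewrite exprS;ring.
have Oar : O_at p (a * r' * g) by do 2 (apply: lringM => //).
have Od : O_at p (1 - a * r' * g) by apply: lringB => //;exact: lring1.
move/(max_prime pG (OG Od) (lringX pG _ (OG Og))) => [] md;last by case: (ug_exp md).
apply: (max_not1 pp);rewrite -[1](subrK (a * r' * g));apply: (maxD pp);first exact: (mi_at dG Gp Od).
by apply: maxM => //;apply: lringM.
Qed.

Definition generator t := [/\ lr G t, forall P, P != 0 -> ~ m (map_poly cst P).[t] &
 forall f, lr G f -> exists P Q, Q != 0 /\ m ((map_poly cst Q).[t] * f - (map_poly cst P).[t])].

Lemma poly_lr t P : lr G t -> lr G (map_poly cst P).[t].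
move=> Ot;rewrite horner_coef;apply: (lring_sum pG) => i _;rewrite coef_map.
apply: (lringM pG);[exact: lring_cst|exact: lringX].
Qed.

(** Reversing P writes P(t) as t^(deg P) times a polynomial in 1/t with nonzero constant term, which
    is a unit at the pole. *)
Lemma poly_pole t P e w : lr G t -> t != 0 -> (0 < e)%N -> unit_at [set p] w -> m (t^-1 - w * g ^+ e) -> P != 0 ->
 exists2 u, unit_at [set p] u & m (t^-1 ^+ (size P).-1 * (map_poly cst P).[t] - u).
move=> Ot nt e0 [Ow nw] ms nP;have [Og mg nmg _] := ug.
set d := (size P).-1;have sP : (size P <= d.+1)%N by rewrite leqSpred.
have Owg : O_at p (w * g ^+ e) by apply: lringM => //;apply: lringX.
have mwg : mx p (w * g ^+ e).
 by rewrite -(prednK e0) exprSr mulrA;apply: maxM => //;apply: lringM => //;apply: lringX.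
have Os : lr G t^-1.
 rewrite -[t^-1](subrK (w * g ^+ e));apply: (lringD pG);[exact: max_sub|exact: OG].
have er := revp_horner cst (t := t^-1) (P := P) (d := d);rewrite invrK in er.
rewrite -er ?invr_eq0//;set R := revp d P.
exists (map_poly cst R).[w * g ^+ e].
 have : R`_0 != 0 by rewrite revp0 lead_coef_eq0.
 have -> : (map_poly cst R).[w * g ^+ e] = cst R`_0 +
  (\sum_(i < (size (map_poly cst R)).-1) (map_poly cst R)`_i.+1 * (w * g ^+ e) ^+ i) * (w * g ^+ e).
  rewrite (horner_coef_wide (n := (size (map_poly cst R)).-1.+1)) ?leqSpred// mulr_suml.
  rewrite big_ord_recl mulr1 coef_map /=;congr (_ + _).
  by apply: eq_bigr => i _;rewrite exprSr mulrA.
 set S := \sum_(i < _) _;have OS : O_at p S.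
  apply: (lring_sum pp) => i _;rewrite coef_map;apply: (lringM pp);first exact: lring_cst.
  exact: lringX.
 split;first by apply: (lringD pp);[exact: lring_cst|exact: lringM].
 move=> h;have : mx p (cst R`_0).
  by rewrite -[cst _](addrK (S * (w * g ^+ e)));apply: maxB => //;apply: maxM.
 move=> mc;apply: (max_nunit pp mc);rewrite ?fmorph_eq0// -fmorphV;exact: lring_cst.
rewrite !horner_coef -sumrB;refine (@ksub_sum _ _ _ _ _ (max_ksub pG) _) => i _.
rewrite -mulrBr;apply: miZ;first by rewrite coef_map;exact: lring_cst.
rewrite subrXX mulrC;apply: miZ => //;apply: (lring_sum pG) => j _.
apply: (lringM pG);apply: lringX => //;exact: OG.
Qed.

Lemma pole_form t : lr G t -> ~ regular_at p t -> exists e w,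
 [/\ (0 < e)%N, unit_at [set p] w, t != 0 & m (t^-1 - w * g ^+ e)].
move=> Ot nr;have nt : t != 0.
 apply/eqP => e;apply: nr;exists 0;[exact: lring0|rewrite e subrr;exact: max0].
have nmt : ~ m t by move=> mt;apply: nr;exists 0;[exact: lring0|rewrite subr0].
have [a [b [Oa Ob nb e]]] := lr_frac dG Gp Ot.
have nb0 := lring_neq0 pG nb.
have na : ~ m a.
 by move=> ma;apply: nmt;rewrite e mulrC;apply: miZ;have [] := lring_inv pG (OG Ob).
have na0 := lring_neq0 pG na.
have [i [u [hu mu]]] := dvr Oa na;have [j [u' [hu' mu']]] := dvr Ob nb.
have [Ou Oui nmu] := pt_unit hu;have [Ou' Oui' nmu'] := pt_unit hu'.
have nu0 := lring_neq0 pG nmu;have nu0' := lring_neq0 pG nmu'.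
have [Og mg nmg _] := ug.
have [Obi _] := lring_inv pG (OG Ob) nb;have [Oai _] := lring_inv pG (OG Oa) na.
have [le|lt] := leqP j i.
 case: nr;exists (u / u' * g ^+ (i - j)).
  apply: (lringM pp);[exact: lringM|exact: lringX].
 have -> : t - u / u' * g ^+ (i - j) = b^-1 * (a - u * g ^+ i - (b - u' * g ^+ j) * (u / u' * g ^+ (i - j))).
  have -> : g ^+ i = g ^+ j * g ^+ (i - j) by rewrite -exprD subnKC.
  rewrite e.
  by field;rewrite nu0'.
 apply: miZ => //;apply: maxB => //;rewrite mulrC;apply: miZ => //.
 apply: OG;apply: (lringM pp);[exact: lringM|exact: lringX].
exists (j - i)%N, (u' / u);split=> //;first by rewrite subn_gt0.
 split;first exact: lringM.
 case: hu' => _ n1 h;apply: n1;rewrite -[u'](divfK nu0) mulrC;exact: maxM.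
have -> : t^-1 - u' / u * g ^+ (j - i) = a^-1 * (b - u' * g ^+ j - (a - u * g ^+ i) * (u' / u * g ^+ (j - i))).
 have -> : g ^+ j = g ^+ i * g ^+ (j - i) by rewrite -exprD subnKC// ltnW.
 rewrite e.
 by field;rewrite na0 nu0.
apply: miZ => //;apply: maxB => //;rewrite mulrC;apply: miZ => //.
apply: OG;apply: (lringM pp);[exact: lringM|exact: lringX].
Qed.
End AtP.

Lemma rational_form t f : generator t -> lr G f -> ~ m f -> t != 0 -> exists P Q, [/\ P != 0, Q != 0 &
 m (t^-1 ^+ (size P).-1 * ((t^-1 ^+ (size Q).-1 * (map_poly cst Q).[t]) * f) -
  t^-1 ^+ (size Q).-1 * (t^-1 ^+ (size P).-1 * (map_poly cst P).[t])) \/ ~ lr G t^-1].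
move=> [Ot tr gen] Of nf nt;have [P [Q [nQ h]]] := gen f Of.
exists P, Q;split=> //.
 apply/eqP => P0;move: h;rewrite P0 rmorph0 horner0 subr0.
 move/(max_prime pG (poly_lr Q Ot) Of) => []//;exact: tr.
have [Os|ns] := pselect (lr G t^-1);last by right.
left;set a := t^-1 ^+ _;set b := t^-1 ^+ _;set x := horner _ _;set y := horner _ _.
have -> : a * (b * x * f) - b * (a * y) = a * b * (x * f - y) by ring.
apply: miZ => //;apply: (lringM pG);exact: lringX.
Qed.

Lemma pole_lr p g t e w : G p -> curve_unif p g -> unit_at [set p] w -> m (t^-1 - w * g ^+ e) -> lr G t^-1.
move=> Gp [Og _ _ _] [Ow _] h;rewrite -[t^-1](subrK (w * g ^+ e));apply: (lringD pG);first exact: max_sub.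
apply: (lr_at dG Gp);have pp := prime_pt (pdiv_sub dG Gp).
apply: lringM => //;exact: lringX.
Qed.

Lemma exp_congr f h n : lr G f -> lr G h -> m (f - h) -> m (f ^+ n - h ^+ n).
move=> Oh mf;rewrite subrXX mulrC;apply: miZ;apply: (lring_sum pG) => j _.
apply: (lringM pG);exact: lringX.
Qed.

Lemma mul_congr f f' h h' : lr G f -> lr G h' -> m (f - f') -> m (h - h') -> m (f * h - f' * h').
move=> Of Oh mf mh;have -> : f * h - f' * h' = f * (h - h') + h' * (f - f') by ring.
by apply: (maxD pG);apply: miZ.
Qed.

(** If t has a pole of order e at p, every P(t)/Q(t) has order divisible by e. A uniformizer has
    this form and order one, so e = 1. *)
Lemma simple_pole p t : G p -> generator t -> ~ regular_at p t -> exists2 g,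
 curve_unif p g & t != 0 /\ m (t^-1 - g).
move=> Gp gt nr;have [g ug] := curve_unif_ex Gp;have [Ot tr gen] := gt.
have Xp := pdiv_sub dG Gp.
have OG f : O_at p f -> lr G f by exact: lr_at.
have [e [w [e0 hw nt ms]]] := pole_form Gp ug Ot nr.
have Os := pole_lr Gp ug hw ms;have [Og mg nmg hg] := ug;have [Ow Owi nmw] := pt_unit Gp hw.
have Owg : lr G (w * g ^+ e) by apply: OG;apply: (lringM Xp) => //;exact: (lringX Xp).
have [P [Q [nP nQ [h|//]]]] := rational_form gt (OG _ Og) nmg nt.
have [uP hP mP] := poly_pole Gp ug Ot nt e0 hw ms nP.
have [uQ hQ mQ] := poly_pole Gp ug Ot nt e0 hw ms nQ.
set a := (size P).-1 in h mP;set b := (size Q).-1 in h mQ.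
have [OuP _ _] := pt_unit Gp hP;have [OuQ _ _] := pt_unit Gp hQ.
have e1 : e = 1%N.
 have Osn n : lr G (t^-1 ^+ n) by exact: lringX.
 have h1 : m (t^-1 ^+ a * (t^-1 ^+ b * (map_poly cst Q).[t] * g) - (w * g ^+ e) ^+ a * (uQ * g)).
  apply: mul_congr => //;first by apply: OG;exact: (lringM Xp).
  exact: exp_congr.
  rewrite -mulrBl mulrC;apply: miZ => //;exact: OG.
 have h2 : m (t^-1 ^+ b * (t^-1 ^+ a * (map_poly cst P).[t]) - (w * g ^+ e) ^+ b * uP).
  apply: mul_congr => //;[exact: OG|exact: exp_congr].
 have h3 : m (w ^+ a * uQ * g ^+ (e * a + 1) - w ^+ b * uP * g ^+ (e * b)).
  have := maxB pG (maxB pG h h1) (maxN pG h2).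
  congr m;rewrite !exprMn -!exprM exprD expr1;ring.
 have hwn n : unit_at [set p] (w ^+ n).
  by split;[exact: (lringX Xp)|move/(max_exp Xp Ow);case: hw].
 have hM x y : unit_at [set p] x -> unit_at [set p] y -> unit_at [set p] (x * y).
  move=> [Ox nx] [Oy ny];split;first exact: (lringM Xp).
  by move/(max_prime Xp Ox Oy) => [].
 have := dvr_uniq Gp ug (hM _ _ (hwn a) hQ) (hM _ _ (hwn b) hP) h3 => eq.
 have : (e %| 1)%N by rewrite -(dvdn_addr 1 (dvdn_mulr a (dvdnn e))) eq dvdn_mulr.
 by rewrite dvdn1 => /eqP.
exists (w * g);last by split;rewrite e1 in ms.
split;[exact: (lringM Xp)|exact: (maxM Xp)| |].
 by move/(max_prime pG (OG _ Ow) (OG _ Og)) => [].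
move=> f /hg [c Oc mc];exists (c / w);first exact: (lringM Xp).
by have -> : c / w * (w * g) = c * g by rewrite mulrA divfK// (lring_neq0 pG nmw).
Qed.

(** A function that vanishes at p but not at q is some P(t)/Q(t). Its order zero at the pole q shows
    deg P = deg Q, and then it cannot vanish at the pole p. *)
Lemma pole_unique p q t : G p -> G q -> generator t -> ~ regular_at p t -> ~ regular_at q t -> p = q.
move=> Gp Gq gt np nq;apply: contrapT => npq;have [Ot tr gen] := gt.
have [A [hA Ap nA]] := separate_points npq.
have [B hB nB] := linear_nonzero [:: p;q].
have nBp : peval B p != 0 by apply: nB;left.
have nBq : peval B q != 0 by apply: nB;right;left.
have Xp := pdiv_sub dG Gp.
have Xq := pdiv_sub dG Gq.
have OGp f : O_at p f -> lr G f by exact: lr_at.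
have OGq f : O_at q f -> lr G f by exact: lr_at.
pose f := gev A / gev B.
have [Op mp] := frac_in Xp hA hB (fun h => negP nBp (introT eqP ((vanishes_pt _ _).1 h))).
have [Oq mq] := frac_in Xq hA hB (fun h => negP nBq (introT eqP ((vanishes_pt _ _).1 h))).
rewrite -/f in Op.
have mpf : mx p f by apply/mp/vanishes_pt.
have ufq : unit_at [set q] f by split=> // /mq/vanishes_pt/eqP;rewrite (negbTE nA).
have [_ _ nmf] := pt_unit Gq ufq.
have [g ug] := curve_unif_ex Gp;have [g' ug'] := curve_unif_ex Gq.
have [e [w [e0 hw nt ms]]] := pole_form Gp ug Ot np.
have [e' [w' [e0' hw' _ ms']]] := pole_form Gq ug' Ot nq.
have Os := pole_lr Gp ug hw ms.
have [P [Q [nP nQ [h|//]]]] := rational_form gt (OGp _ Op) nmf nt.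
have [uP hP mP] := poly_pole Gp ug Ot nt e0 hw ms nP.
have [uQ hQ mQ] := poly_pole Gp ug Ot nt e0 hw ms nQ.
have [vP hvP mvP] := poly_pole Gq ug' Ot nt e0' hw' ms' nP.
have [vQ hvQ mvQ] := poly_pole Gq ug' Ot nt e0' hw' ms' nQ.
set a := (size P).-1 in h mP mvP;set b := (size Q).-1 in h mQ mvQ.
set yP := t^-1 ^+ a * (map_poly cst P).[t] in mP mvP h;set yQ := t^-1 ^+ b * (map_poly cst Q).[t] in mQ mvQ h.
have [OvP _ _] := pt_unit Gq hvP;have [OvQ _ _] := pt_unit Gq hvQ.
have [OuP _ _] := pt_unit Gp hP;have [OuQ _ _] := pt_unit Gp hQ.
have Osn n : lr G (t^-1 ^+ n) by exact: lringX.
have OyQ : lr G yQ by apply: lringM => //;exact: poly_lr.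
have OyP : lr G yP by apply: lringM => //;exact: poly_lr.
have [Ow' _ nmw'] := pt_unit Gq hw';have [Og' _ _ _] := ug'.
have Owg' : lr G (w' * g' ^+ e') by apply: OGq;apply: (lringM Xq) => //;exact: (lringX Xq).
have ab : a = b.
 have h1 : m (t^-1 ^+ a * (yQ * f) - (w' * g' ^+ e') ^+ a * (vQ * f)).
  apply: mul_congr => //;first by apply: OGq;exact: (lringM Xq).
  exact: exp_congr.
  rewrite -mulrBl mulrC;apply: miZ => //;exact: OGq.
 have h2 : m (t^-1 ^+ b * yP - (w' * g' ^+ e') ^+ b * vP).
  apply: mul_congr => //;[exact: OGq|exact: exp_congr].
 have h3 : m (w' ^+ a * (vQ * f) * g' ^+ (e' * a) - w' ^+ b * vP * g' ^+ (e' * b)).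
  have := maxB pG (maxB pG h h1) (maxN pG h2).
  congr m;rewrite !exprMn -!exprM;ring.
 have hwn n : unit_at [set q] (w' ^+ n).
  by split;[exact: (lringX Xq)|move/(max_exp Xq Ow');case: hw'].
 have hM x y : unit_at [set q] x -> unit_at [set q] y -> unit_at [set q] (x * y).
  move=> [Ox nx] [Oy ny];split;first exact: (lringM Xq).
  by move/(max_prime Xq Ox Oy) => [].
 have /eqP := dvr_uniq Gq ug' (hM _ _ (hwn a) (hM _ _ hvQ ufq)) (hM _ _ (hwn b) hvP) h3.
 by rewrite eqn_pmul2l// => /eqP.
have nms : ~ m t^-1.
 move=> ms1;apply: (max_nunit pG ms1);rewrite ?invr_eq0// invrK//.
have h4 : m (yQ * f - yP).
 move: h;rewrite -ab -mulrBr => /max_prime []//.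
  apply: lringB => //;apply: lringM => //;exact: OGp.
 by move/(max_exp pG Os).
case: hP => _;apply;have Od : O_at p (uQ * f - uP) by apply: (lringB Xp) => //;exact: (lringM Xp).
have mG : m (uQ * f - uP).
 have -> : uQ * f - uP = yQ * f - yP - f * (yQ - uQ) + (yP - uP) by ring.
 apply: maxD => //;apply: maxB => //;apply: miZ => //;exact: OGp.
rewrite -[uP](subKr (uQ * f));apply: (maxB Xp);first exact: (maxM Xp).
exact: mi_at dG Gp Od mG.
Qed.

(** If t is regular at p with value c, the generator 1/(t - c) has a pole there. *)
Lemma pole_generator p t : G p -> generator t -> exists2 t', generator t' & ~ regular_at p t'.
move=> Gp gt;have [[t0 Ot0 mt0]|nr] := pselect (regular_at p t);last by exists t.
have Xp := pdiv_sub dG Gp;have pp := prime_pt Xp;have [Ot tr gen] := gt.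
have OG f : O_at p f -> lr G f by exact: lr_at.
have [c mc] := value_at Xp Ot0;pose v := t - cst c.
have nmv : ~ m v.
 have := tr ('X - c%:P) (negbT (polyXsubC_eq0 c)).
 by rewrite rmorphB /= map_polyX map_polyC hornerXsubC.
have nv := lring_neq0 pG nmv.
have Ov : lr G v by apply: lringB => //;exact: lring_cst.
have [Ovi nmvi] := lring_inv pG Ov nmv.
have key P d : (size P <= d.+1)%N ->
  (map_poly cst (revp d (P \Po ('X + c%:P)))).[v^-1] = v^-1 ^+ d * (map_poly cst P).[t].
 move=> sP;rewrite revp_horner ?invr_eq0//;last by rewrite size_comp_poly2 ?size_XaddC.
 by rewrite invrK map_comp_poly horner_comp rmorphD /= map_polyX map_polyC !hornerE subrK.
have nzc P : P != 0 -> P \Po ('X + c%:P) != 0.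
 by move=> nP;rewrite -size_poly_eq0 size_comp_poly2 ?size_XaddC// size_poly_eq0.
exists v^-1;first split=> //.
- move=> P nP mP;set d := (size P).-1;have sP : (size P <= d.+1)%N by rewrite leqSpred.
 have nR : revp d P \Po ('X - c%:P) != 0.
  by rewrite -size_poly_eq0 size_comp_poly2 ?size_XsubC// size_poly_eq0 revp_neq0.
 apply: (tr _ nR);rewrite map_comp_poly horner_comp rmorphB /= map_polyX map_polyC hornerXsubC -/v.
 rewrite (revp_horner cst nv sP);apply: miZ => //;exact: lringX.
- move=> f /gen [P [Q [nQ h]]];set d := maxn (size P) (size Q).
 have : (size P <= d.+1)%N by rewrite ltnW// ltnS leq_maxl.
 have : (size Q <= d.+1)%N by rewrite ltnW// ltnS leq_maxr.
 exists (revp d (P \Po ('X + c%:P))), (revp d (Q \Po ('X + c%:P)));split.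
  by apply: revp_neq0;[exact: nzc|rewrite size_comp_poly2 ?size_XaddC].
 rewrite !key// -mulrA -mulrBr;apply: miZ => //;exact: lringX.
move=> [a Oa ma];apply: (max_not1 pp);have mtc : mx p (a * (t0 - cst c)) by apply: maxM.
rewrite -[1](subrK (a * (t0 - cst c)));apply: maxD => //.
apply: (mi_at dG Gp);first by apply: (lringB pp);[exact: lring1|exact: max_sub mtc].
have -> : 1 - a * (t0 - cst c) = v * (v^-1 - a) + a * (t - t0) by rewrite [v * _]mulrBr mulfV// /v;ring.
apply: (maxD pG);apply: miZ => //;exact: OG.
Qed.

Lemma poly_congr P f h : lr G f -> lr G h -> m (f - h) -> m ((map_poly cst P).[f] - (map_poly cst P).[h]).
move=> Of Oh mf;rewrite !horner_coef -sumrB.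
refine (@ksub_sum _ _ _ _ _ (max_ksub pG) _) => i _.
rewrite -mulrBr;apply: miZ;first by rewrite coef_map;exact: lring_cst.
exact: exp_congr.
Qed.
Lemma oge_m f : oge G (1 - 0) f <-> m f.
rewrite subr0;exact: oge1. Qed.
Lemma osec_eff D p a : Xpts p -> (forall B, pdiv B -> 0 <= D B) -> O_at p a -> osec D p a.
move=> Xp h /(osec0 _ Xp);apply: osec_mono => B dB _;exact: h. Qed.

(** H^1 of an effective divisor vanishes on a rational curve. Choose a generator th with its only
    pole at p: a germ at p is a polynomial in th plus a germ regular at p, and the polynomial is
    regular at all other points of G. *)
Lemma Surj_effective D D' (l : seq pt) p t : generator t -> G p -> p \notin l -> fin_supp D ->
 D G = 0 -> (forall B, pdiv B -> 0 <= D' B) -> (forall B, pdiv B -> D' B <= D B) ->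
 Surj G 0 (modp l D' D) D D' p.
move=> gt0 Gp npl fD DG D'0 DD' s os;have [th gt nr] := pole_generator Gp gt0.
have D0 B : pdiv B -> 0 <= D B by move=> dB;apply: le_trans (D'0 _ dB) (DD' _ dB).
have [g ug [nth mth]] := simple_pole Gp gt nr;have [Oth _ _] := gt.
have Xp := pdiv_sub dG Gp;have pp := prime_pt Xp;have [Og mg nmg hg] := ug.
have OG f : O_at p f -> lr G f by exact: lr_at.
have Othn n : lr G (th ^+ n) by exact: lringX.
have Oti : lr G th^-1 by rewrite -[th^-1](subrK g);apply: (lringD pG);[exact: max_sub|exact: OG].
have thg n : m (th ^+ n * g ^+ n - 1).
 have -> : th ^+ n * g ^+ n - 1 = - (th ^+ n * (th^-1 ^+ n - g ^+ n)).
  by rewrite [th ^+ n * (_ - _)]mulrBr exprVn mulfV ?expf_neq0// opprB.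
 apply: (maxN pG);apply: miZ => //;apply: exp_congr => //;exact: OG.
have [c nc hc] := local_gen fD Xp.
have Oa := (osec_gen s Xp nc hc).1 os;set a := s / c in Oa.
have Or : O_at p c^-1.
 by apply: (hartogs Xp) => Bp;right;rewrite ordV// hc// opprK D0.
have nmr : ~ m c^-1.
 by move/(oge1 _ dG)/(ogeE _ _ (_ : c^-1 != 0));rewrite invr_eq0 nc ordV// hc// DG => /(_ isT).
have [n [u [hu mu]]] := dvr Gp ug Or nmr;have [Ou Oui nmu] := pt_unit Gp hu.
have nu := lring_neq0 pG nmu.
have [Oc _] := lring_inv pG (OG _ Or) nmr;rewrite invrK in Oc.
(* On G the inverse of the local generator c is u g^n, and g is the inverse of th; so s = a c
   becomes (a/u) th^n. *)
have ms : m (s - a / u * th ^+ n).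
 have -> : s - a / u * th ^+ n = - (a * c * (u^-1 * th ^+ n * (c^-1 - u * g ^+ n) + (th ^+ n * g ^+ n - 1))).
  have -> : s = a * c by rewrite divfK.
  by move: (th ^+ n) (g ^+ n) => x y;field;rewrite nc.
 apply: (maxN pG);apply: miZ;first by apply: lringM => //;exact: OG.
 apply: maxD => //;apply: miZ => //;apply: lringM => //;exact: OG.
have expand j b : O_at p b -> exists P b', O_at p b' /\ m (b * th ^+ j - (map_poly cst P).[th] - b').
 elim: j b => [|j IH] b Ob.
  exists 0, b;rewrite rmorph0 horner0 subr0 mulr1 subrr;split=> //;exact: max0.
 have [c0 mc] := value_at Xp Ob;have [b1 Ob1 mb1] := hg _ mc.
 have [P [b' [Ob' mb']]] := IH b1 Ob1.
 exists (c0 *: 'X^(j.+1) + P), b';split=> //.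
 rewrite rmorphD /= map_polyZ map_polyXn hornerD hornerZ hornerXn.
 have -> : b * th ^+ j.+1 - (cst c0 * th ^+ j.+1 + (map_poly cst P).[th]) - b' =
  th ^+ j.+1 * (b - cst c0 - b1 * g) + b1 * th ^+ j * (th ^+ 1 * g ^+ 1 - 1) +
  (b1 * th ^+ j - (map_poly cst P).[th] - b') by rewrite exprS !expr1;ring.
 apply: maxD => //;apply: (maxD pG);apply: miZ => //.
 apply: lringM => //;exact: OG.
have Oau : O_at p (a / u) by exact: lringM.
have [P [b' [Ob' mb']]] := expand n _ Oau;pose b := (map_poly cst P).[th].
have msb : m (s - b - b').
 have -> : s - b - b' = s - a / u * th ^+ n + (a / u * th ^+ n - b - b') by ring.
 exact: maxD.
exists b;last by exists b';[exact: osec_eff|apply/oge_m].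
move=> q Gq;rewrite /modp;have [eq|/eqP nqp] := eqVneq q p.
 rewrite eq (negbTE npl);exists (s - b').
  apply: (ksubB (osec_ksub _ _)) => //;exact: osec_eff.
 apply/oge_m;have -> : b - (s - b') = - (s - b - b') by ring.
 exact: maxN.
have [r Or' mr] : regular_at q th.
 by apply: contrapT => nq;apply: nqp;apply: pole_unique gt nq nr.
have Xq := pdiv_sub dG Gq;have pq := prime_pt Xq.
exists (map_poly cst P).[r].
 apply: osec_eff => //;first by move=> B dB;case: ifP => _;[exact: D'0|exact: D0].
 rewrite horner_coef;apply: (lring_sum pq) => i _;rewrite coef_map.
 apply: (lringM pq);[exact: lring_cst|exact: lringX].
apply/oge_m;apply: poly_congr => //;exact: (lr_at dG Gq).
Qed.

Lemma rational_tdim t (l : seq (set pt)) : generator t -> (forall B, B \in l -> pdiv B /\ B <> G) ->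
 \sum_(B <- l) I B G + 1 <= (tdim G (fun B => (count_mem B l)%:Z))%:Z.
move=> gt;elim: l => [|B l IH] hl.
 rewrite big_nil (_ : tdim G _ = 1%N)//;apply: (tdim_eq dG);last by rewrite subr0;exact: Tsp0.
 by exists [::] => B.
have [dB nBG] := hl B (mem_head _ _);have hl' C (hC : C \in l) := hl C (mem_behead (s := B :: l) hC).
have [lB ul hlB] := meet_list dG dB nBG.
pose D C : int := (count_mem C (B :: l))%:Z;pose D' C : int := (count_mem C l)%:Z.
have fD : @fin_supp D by exists (B :: l) => C;rewrite /D;apply: contraNT => /count_memPn ->.
have fD' : @fin_supp D' by exists l => C;rewrite /D';apply: contraNT => /count_memPn ->.
have DG : D G = 0 by rewrite /D (count_memPn _)//;apply/negP => /hl [].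
have DG' : D' G = 0 by rewrite /D' (count_memPn _)//;apply/negP => /hl' [].
have hD' C : pdiv C -> D' C = D C - cdiv B C.
 by move=> _;rewrite /D /= PoszD eq_sym addrAC subrr.
have [n [_ hn hs]] := Tsp_chain dG dB nBG fD DG hD' ul hlB.
have -> : tdim G D = (n + tdim G D')%N.
 apply: (tdim_eq dG fD);rewrite DG.
 have h := tdimP dG fD';rewrite DG' in h.
 apply: hqd_add hn h;try exact: Tsp_ksub;first exact: oge_ksub.
  exact: J_Tsp.
 by apply: Tsp_mono => q C dC _;rewrite hD'// lerBlDr lerDl.
rewrite big_cons PoszD -addrA lerD//;last exact: IH.
rewrite hs// => l1 p l2 e;have [Bp Gp] : B p /\ G p by apply/hlB;rewrite e mem_cat mem_head orbT.
apply: (Surj_effective gt Gp) => //.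
- by move: ul;rewrite e cat_uniq => /and3P [_ _ /andP []].
- by move=> C dC;rewrite hD'// lerBlDr lerDl.
Qed.
End OnG.
End Rational.

(** * Global sections *)

Lemma bounded_nondecreasing (u : nat -> nat) c : (forall i, (u i <= u i.+1)%N) ->
 (forall i, (u i <= c)%N) -> exists n, forall i, (n <= i)%N -> u i.+1 = u i.
move=> mono bd;apply: contrapT => /forallNP no.
have [f hf] : exists f : nat -> nat, forall n, (n <= f n)%N /\ u (f n).+1 <> u (f n).
 suff : forall n, exists i, (n <= i)%N /\ u i.+1 <> u i by move=> /choice [f hf];exists f.
 by move=> n;have /existsNP [i /not_implyP h] := no n;exists i.
have homo i j : (i <= j)%N -> (u i <= u j)%N.
 by move=> /subnKC <-;elim: (j - i)%N => [|e IH];rewrite ?addn0// addnS (leq_trans IH).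
have main n : exists i, (n <= u i)%N.
 elim: n => [|n [i le]];first by exists 0%N.
 exists (f i).+1;have [h1 h2] := hf i;have := mono (f i);have := homo _ _ h1;lia.
have [i] := main c.+1;have := bd i;lia.
Qed.

Section Sections.
Local Notation I B G := (@curve_inter k X B G).
Implicit Types (B C G : set pt) (p q : pt) (F : form) (f g t u s : K).
Implicit Types (D E : div).

Lemma hqd_span A J n (e : 'I_n -> K) : ksub A -> ksub J -> J `<=` A -> hqd A J n ->
 (forall i, A (e i)) -> (forall c, J (lcomb e c) -> c = 0) -> forall f, A f -> exists c, J (f - lcomb e c).
move=> sA sJ JA hn Ae fr;pose B : set K := [set f | exists c, J (f - lcomb e c)].
have sB : ksub B.
 split=> [|f g [a Ja] [b Jb]|c f [a Ja]].
 - by exists 0;rewrite lcomb0 subr0;apply: ksub0.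
 - by exists (a + b);rewrite lcombD opprD addrACA;apply: ksubD.
 - by exists (c *: a);rewrite lcombZ -mulrBr;apply: ksubZ.
have JB : J `<=` B by move=> Jf;exists 0;rewrite lcomb0 subr0.
have BA : B `<=` A.
 move=> f [c Jc];rewrite -[f](subrK (lcomb e c));apply: ksubD => //;first exact: JA.
 exact: lcomb_in.
have hB : hqd B J n.
 apply/(hqdP _ sB sJ);exists e;split=> // i;exists 'e_i.
 by rewrite lcomb_delta subrr;apply: ksub0.
have [m1 [m2 [h1 h2 e2]]] := hqd_split sA sB sJ JB BA hn.
have e0 : m1 = 0%N by have := hqd_uniq sB sJ h2 hB;lia.
exact: hqd_eq sA sB BA h1 e0.
Qed.

(* H^0(X, O_X(D)). *)
Definition hs D : set K := [set f | forall B, pdiv B -> oge B (- D B) f].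

Lemma hs_ksub D : ksub (hs D).
split=> [B dB|f g hf hg B dB|c f hf B dB].
- exact: ksub0 (oge_ksub _ dB).
- apply: (ksubD (oge_ksub _ dB));[exact: hf|exact: hg].
- apply: (ksubZ _ (oge_ksub _ dB));exact: hf.
Qed.
Lemma hs_ext D E : (forall B, pdiv B -> D B = E B) -> hs D = hs E.
by move=> h;apply/seteqP;split=> f hf B dB;have := hf B dB;rewrite h. Qed.
Lemma hs_mono D E : (forall B, pdiv B -> D B <= E B) -> hs D `<=` hs E.
move=> h f hf B dB;apply: oge_mono (hf B dB);rewrite lerN2;exact: h. Qed.

Lemma hs_Tsp G D : pdiv G -> hs D `<=` Tsp G (D G) (fun=> D).
move=> dG f hf p Gp;exists f;first by move=> B dB _;exact: hf.
by rewrite subrr;left.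
Qed.

Lemma hs_cap G D : pdiv G -> hs D `&` oge G (1 - D G) = hs (subB D G).
move=> dG;apply/seteqP;split=> f.
 move=> [hf hG] dB;rewrite /subB /cdiv;case: eqP => [->|_].
  by rewrite opprB.
 rewrite subr0;exact: hf.
move=> hf;split;last by have := hf G dG;rewrite /subB /cdiv eqxx opprB.
apply: hs_mono hf => dB;rewrite lerBlDr lerDl//.
Qed.

Definition lifts G D := forall f, Tsp G (D G) (fun=> D) f -> exists2 a, hs D a & oge G (1 - D G) (f - a).

Lemma hs_step G D : pdiv G -> fin_supp D -> exists n, [/\ (n <= tdim G D)%N,
 hqd (hs D) (hs (subB D G)) n & lifts G D -> n = tdim G D].
move=> dG fD;have h := tdimP dG fD.
have [n [le hn s]] := hqd_sub (hs_ksub D) (Tsp_ksub dG _ _) (oge_ksub _ dG) (hs_Tsp dG) h.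
by exists n;rewrite hs_cap in hn.
Qed.

Section Twists.
Variables (G : set pt) (y : form).
Hypotheses (dG : pdiv G) (hy : y \is 1.-homog) (nyG : ~ van y G).
Let pG := pdiv_prime dG.
Let ny : gev y != 0 := gev_neq0 pG hy nyG.
Local Notation twist := (@twist y).

Lemma van_oge d F B : F \is d.-homog -> pdiv B -> van F B ->
 oge B (1 - d%:Z * hyp y B) (fq y F d).
move=> hF dB vF;have nc := coord_onP dB;have hc := homogX1 (coord_on B).
have gc := gev_neq0 dB hc nc.
have nq : gev y / gev 'X_(coord_on B) != 0 by rewrite mulf_neq0 ?invr_eq0.
have -> : fq y F d = gev F / gev 'X_(coord_on B) ^+ d / (gev y / gev 'X_(coord_on B)) ^+ d.
 rewrite exprMn exprVn;move: (gev ^+ d) (gev ^+ d) (expf_neq0 d ny) expf_neq0 => a b na nb.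
 by field;rewrite nb.
rewrite oge_mulr ?invr_eq0 ?expf_neq0// ordV// ordX// opprK (hypE ny dB hc nc) subrK.
by apply/oge1 => //;have [_ h] := frac_in dB hF hc nc;apply/h.
Qed.

(** Poles of s along curves that miss p are cancelled by powers of forms vanishing on these curves
    but not at p. *)
Lemma clear_global D p s : Xpts p -> fin_supp D -> osec D p s -> exists d F,
 [/\ F \is d.-homog, peval F p != 0 & hs (twist D d) (fq y F d * s)].
move=> Xp [sD hD] os;have [->|ns] := eqVneq s 0.
 exists 0%N, 1;split;[exact: dhomog1|by rewrite pev1 oner_eq0|rewrite mulr0].
 exact: ksub0 (hs_ksub _).
have [ss hs'] := ord_finite ns.
have main (l : seq (set pt)) : exists d F, [/\ F \is d.-homog, peval F p != 0 &
  forall B, pdiv B -> B \in l -> oge B (- twist D d B) (fq y F d * s)].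
 elim: l => [|B l [d [F [hF nF h]]]].
  by exists 0%N, 1;split;[exact: dhomog1|rewrite pev1 oner_eq0|].
 have extend e (H : form) C : H \is e.-homog -> pdiv C -> oge C (- twist D d C) (fq y F d * s) ->
  oge C (- twist D (d + e) C) (fq y (F * H) (d + e) * s).
  move=> hH dC hC;have -> : fq y (F * H) (d + e) * s = fq y H e * (fq y F d * s).
  rewrite frac_mul;ring.
  have -> : - twist D (d + e) C = - (e%:Z * hyp y C) + - twist D d C by rewrite /twist PoszD;ring.
  apply: ogeM => //;exact: form_oge.
 have [Bp|nBp] := pselect (pdiv B -> B p).
  exists d, F;split=> // C dC;rewrite inE => /orP [/eqP e|];last exact: h.
  subst C;have -> : - twist D d B = - (d%:Z * hyp y B) + - D B by rewrite /twist;ring.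
  apply: ogeM => //;[exact: form_oge|apply: os => //;exact: Bp].
 have [dB nB] : pdiv B /\ ~ B p by move/not_implyP: nBp.
 have [e [H [hH nH sub]]] := (closedX_closed (pdiv_closed dB)) p nB.
 have vH : van H B by move=> q Bq;apply: contrapT => /eqP /sub.
 have [N hN] : exists N : nat, - (D B) <= N%:Z + ord B s by exists (absz (D B + ord B s)%R);lia.
 have hHN : H ^+ N \is (e * N)%N.-homog by exact: dhomogMn.
 exists (d + e * N)%N, (F * H ^+ N);split;first exact: dhomogM.
  by rewrite pevM pevXn mulf_neq0// expf_neq0.
 move=> C dC;rewrite inE => /orP [/eqP eC|Cl];last by apply: extend => //;exact: h.
 subst C;have -> : fq y (F * H ^+ N) (d + e * N) * s =
  fq y F d * ((fq y H e) ^+ N * s).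
  rewrite gevM gevXn exprD exprM exprMn exprVn.
  move: gev gev (expf_neq0 d ny) (expf_neq0 N (expf_neq0 e ny)) => a1 a2 n1 n2.
  by field;rewrite n2.
 have hp : oge B (N%:Z * (1 - e%:Z * hyp y B)) ((fq y H e) ^+ N).
  elim: (N) => [|n IHn];first by rewrite mul0r expr0;apply/oge0 => //;exact: lring1 (pdiv_prime dB).
  rewrite exprS intS mulrDl mul1r;apply: ogeM => //;exact: van_oge.
 apply: (@oge_mono _ _ (- (d%:Z * hyp y B) + (N%:Z * (1 - e%:Z * hyp y B) + ord B s))).
  rewrite /twist mulrC;lia.
 by apply: ogeM => //;[exact: form_oge|apply: ogeM => //;right].
have [d [F [hF nF h]]] := main (sD ++ ss);exists d, F;split=> // B dB.
have [Bl|] := boolP (B \in sD ++ ss);first exact: h.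
rewrite mem_cat negb_or => /andP [n1 n2].
have DB : D B = 0 by apply/eqP;apply: contraNT n1;exact: hD.
have sB : ord B s = 0.
 apply/eqP;apply: contraNT n2 => nB;apply/In_mem;exact: hs'.
have -> : - twist D d B = - (d%:Z * hyp y B) + 0 by rewrite /twist DB add0r addr0.
by apply: ogeM => //;[exact: form_oge|right;rewrite sB].
Qed.

Definition liftable D (d : nat) f := exists2 a, hs (twist D d) a & oge G (1 - D G) (f - a).

Lemma liftable_ksub D d : ksub (liftable D d).
have sJ := oge_ksub (1 - D G) dG;have sH := hs_ksub (twist D d).
split=> [|f g [s h1 h2] [t h3 h4]|c f [s h1 h2]].
- exists 0;[exact: ksub0|rewrite subr0;exact: ksub0].
- exists (s + t);[exact: (ksubD sH)|rewrite opprD addrACA;exact: ksubD].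
- exists (cst c * s);[exact: (ksubZ _ sH)|rewrite -mulrBr;exact: ksubZ].
Qed.

(** Near each point of G, f is a local section, which some form nonvanishing at that point makes
    global by [clear_global]; off G, a form vanishing on G has lift zero. So the admissible forms
    have no common zero. *)
Lemma lift_forms D f : fin_supp D -> Tsp G (D G) (fun=> D) f -> exists N, forall d F, (N <= d)%N ->
 F \is d.-homog -> liftable D d (fq y F d * f).
move=> fD hf;have of_ : oge G (- D G) f by apply: Tsp_oge.
have sJ := oge_ksub (1 - D G) dG;have sL := liftable_ksub D.
have OF d F : F \is d.-homog -> oge G 0 (fq y F d).
 by move=> hF;have := form_oge ny hF dG;rewrite (hyp0 hy ny dG nyG) mulr0.
pose J d F := F \is d.-homog /\ liftable D d (fq y F d * f).
have gJ : graded_ideal J.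
 split=> [d F []//|d|d F H [hF h1] [hH h2]|d e F H [hF [a h1 h2]] hH].
 - split;[exact: dhomog0|rewrite gev0 !mul0r;exact: ksub0].
 - split;[exact: dhomogD|rewrite gevD !mulrDl;exact: ksubD].
 - split;first by rewrite addnC;exact: dhomogM.
  exists (fq y H e * a).
  move=> B dB;have -> : - twist D (d + e) B = - (e%:Z * hyp y B) + - twist D d B.
  rewrite /twist PoszD;ring.
  apply: ogeM => //;[exact: form_oge|exact: h1].
  have -> : fq y (H * F) (d + e) * f - fq y H e * a =
  fq y H e * (fq y F d * f - a).
  rewrite frac_mul;ring.
  rewrite -[1 - D G]add0r;apply: ogeM => //;exact: OF.
have noz q : exists d F, J d F /\ peval F q != 0.
 have [Gq|nGq] := pselect (G q);last first.
  have [d [F [hF [mF|] nF]]] := not_on_G hy dG nGq;exists d, F;split=> //;split=> //.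
  exists 0;first exact: ksub0 (hs_ksub _);rewrite subr0.
  by apply: ogeM => //;apply/oge1.
 have [s os h] := hf q Gq;have Xq := pdiv_sub dG Gq.
 have [d [F [hF nF hh]]] := clear_global Xq fD os;exists d, F;split=> //;split=> //.
 exists (fq y F d * s) => //;rewrite -mulrBr -[1 - D G]add0r.
 apply: ogeM => //;exact: OF.
have [N hN] := forms_of_no_zero gJ noz;exists N => d F le hF.
by have [_] := hN d F le hF.
Qed.

Lemma tdim_seq D (l : seq (set pt)) : (forall B, B \in l -> pdiv B /\ B <> G) -> fin_supp D ->
 (tdim G (fun B => (D B + (count_mem B l)%:Z)%R))%:Z <= (tdim G D)%:Z + \sum_(B <- l) I B G.
move=> + fD;elim: l => [|B l IH] hl.
 by rewrite big_nil addr0 (tdim_ext (E := D) dG)// => B _;rewrite addr0.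
have [dB nBG] := hl B (mem_head _ _);have hl' C (hC : C \in l) := hl C (mem_behead (s := B :: l) hC).
have fE : fin_supp (fun C => D C + (count_mem C (B :: l))%:Z).
 apply: fin_suppD => //;exists (B :: l) => C;apply: contraNT => /count_memPn -> //.
have [_ h] := tdim_chain dG dB nBG fE.
rewrite big_cons addrCA [X in _ <= X]addrC;apply: le_trans h _;rewrite lerD2r.
rewrite (tdim_ext (E := fun C => D C + (count_mem C l)%:Z) dG);first exact: IH.
move=> C _;rewrite /subB /= eq_sym;ring.
Qed.

Lemma effective_seq E : fin_supp E -> pdiv_supp E -> (forall B, 0 <= E B) ->
 exists l : seq (set pt), (forall B, B \in l -> pdiv B /\ E B != 0) /\ forall B, E B = (count_mem B l)%:Z.
move=> /good_listP [s [us hs']] sE E0.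
exists (flatten [seq nseq `|E B|%N B | B <- s]);split.
 move=> B /flatten_mapP [C Cs];rewrite mem_nseq => /andP [n0 /eqP ->].
 have : E C != 0 by rewrite absz_gt0 in n0.
 split=> //;exact: sE.
move=> B;rewrite count_flatten sumnE -map_comp big_map.
transitivity (\sum_(C <- s) (count_mem B (nseq `|E C| C))%:Z)%R;last first.
 by rewrite (big_morph Posz PoszD (erefl : 0 = 0)).
rewrite -[LHS](sum_curves (E := E) (s := s) B us hs').
apply: eq_bigr => C _;rewrite count_nseq /= eq_sym PoszM gez0_abs//.
by rewrite mulrC.
Qed.

Lemma hyp_seq : exists l : seq (set pt), (forall B, B \in l -> [/\ pdiv B, B <> G & van y B]) /\
 forall B, hyp y B = (count_mem B l)%:Z.
have sH : pdiv_supp (hyp y) by move=> B /hyp_supp [].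
have [l [hl he]] := effective_seq (fin_supp_hyp hy ny) sH (hyp_ge0 hy ny).
exists l;split=> // B /hl [dB /(hyp_supp hy ny) [_ vB]];split=> // e;apply: nyG;by rewrite -e.
Qed.

(** Let T(j) be the sections over G of the j-fold twist. As w and y have no common zero on G,
    multiplication by w/y is injective from T(j+1)/T(j) to T(j+2)/T(j+1). These dimensions are
    bounded by the degree of the hyperplane section, so they stabilise and the map becomes
    surjective. *)
Lemma Tsp_succ D : fin_supp D -> exists n1, forall j, (n1 <= j)%N -> forall w, w \is 1.-homog ->
 (forall q, G q -> peval y q = 0 -> peval w q != 0) ->
 forall f, Tsp G (D G) (fun=> twist D j.+1) f -> exists a b,
  [/\ Tsp G (D G) (fun=> twist D j) a, Tsp G (D G) (fun=> twist D j) b & f = gev w / gev y * a + b].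
move=> fD;pose T j := Tsp G (D G) (fun=> twist D j).
have sT j : ksub (T j) by exact: Tsp_ksub.
have TG j : twist D j G = D G by exact: twist_G.
have fT j : fin_supp (twist D j) by exact: fin_supp_twist.
have TS j : T j `<=` T j.+1.
 apply: Tsp_mono => p B _ _ _;rewrite /twist intS mulrDl mul1r lerD2l lerDr;exact: hyp_ge0.
have hT j : hqd (T j) (oge G (1 - D G)) (tdim G (twist D j)).
 by have := tdimP dG (fT j);rewrite TG.
have dT j : exists n, hqd (T j.+1) (T j) n /\ (n + tdim G (twist D j))%N = tdim G (twist D j.+1).
 have JT : oge G (1 - D G) `<=` T j by exact: J_Tsp.
 have [n [n' [h1 h2 e]]] := hqd_split (sT j.+1) (sT j) (oge_ksub _ dG) JT (TS j) (hT j.+1).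
 by exists n;rewrite -e (hqd_uniq (sT j) (oge_ksub _ dG) h2 (hT j)).
have [dl hd] : exists dl : nat -> nat, forall j, hqd (T j.+1) (T j) (dl j) /\
  (dl j + tdim G (twist D j))%N = tdim G (twist D j.+1).
 by move: dT => /choice [dl h];exists dl.
have mono_w j w : w \is 1.-homog -> (forall q, G q -> peval y q = 0 -> peval w q != 0) ->
  forall f, T j.+1 f -> T j.+1 (gev w / gev y * f) -> T j f.
 move=> hw nw f hf hwf p Gp;have := hf p Gp;have := hwf p Gp.
 have [yp|nyp] := eqVneq (peval y p) 0.
  have nwp := nw p Gp yp;have gw : gev w != 0 by apply: (gev_neq0 pG hw (nvan_at Gp nwp)).
  move=> h _;apply/(locT_twist hy ny dG _ _ _ _ Gp hw nwp nyG).
  move/(locT_twist hy ny dG _ _ _ _ Gp hw nwp nyG): h;congr locT.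
  by rewrite exprS;field;rewrite gw.
 move=> _ /(locT_twist hy ny dG _ _ _ _ Gp hy nyp nyG) h.
 apply/(locT_twist hy ny dG _ _ _ _ Gp hy nyp nyG).
 by move: h;rewrite divff// !expr1n.
have mul_w j w : w \is 1.-homog -> forall f, T j f -> T j.+1 (gev w / gev y * f).
 move=> hw f hf p Gp;have := locT_form hy ny dG Gp nyG hw (hf p Gp).
 by rewrite twist_twist addn1.
have inj j w : w \is 1.-homog -> (forall q, G q -> peval y q = 0 -> peval w q != 0) ->
  exists e : 'I_(dl j) -> K, [/\ forall i, T j.+1 (e i), forall i, T j.+2 (gev w / gev y * e i) &
  forall c, T j.+1 (lcomb (fun i => gev w / gev y * e i) c) -> c = 0].
 move=> hw nw;have [e [Te _ fr]] := (hqdP _ (sT _) (sT _)).1 (hd j).1.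
 exists e;split=> [//|i|c];first exact: mul_w.
 have -> : lcomb (fun i => gev w / gev y * e i) c = gev w / gev y * lcomb e c.
  by rewrite mulr_sumr;apply: eq_bigr => i _;rewrite mulrCA.
 move=> h;apply: fr;apply: (mono_w j w) => //;exact: lcomb_in.
have [s hs'] := zeros_on_curve dG hy nyG.
have [w0 hw0 nw0] := linear_nonzero s.
have nw0' q : G q -> peval y q = 0 -> peval w0 q != 0 by move=> Gq yq;apply: nw0;exact: hs'.
have [l [hl he]] := hyp_seq.
have bd j : (dl j)%:Z <= \sum_(B <- l) I B G.
 have h := tdim_seq (fun B hB => let: And3 a b _ := hl B hB in conj a b) (fT j).
 have e : tdim G (fun B => twist D j B + (count_mem B l)%:Z) = tdim G (twist D j.+1).
  apply: tdim_ext => // B _;rewrite -he /twist intS;ring.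
 by rewrite e -(hd j).2 PoszD addrC lerD2l in h.
have [n1 h1] : exists n, forall i, (n <= i)%N -> dl i.+1 = dl i.
 apply: (@bounded_nondecreasing dl (absz (\sum_(B <- l) I B G)%R)).
  move=> j;have [e [_ T2 fr]] := inj j w0 hw0 nw0'.
  exact: hqd_free (sT _) (sT _) (TS _) (hd j.+1).1 T2 fr.
 move=> j;have := bd j;lia.
exists n1.+1 => -[//|j] le w hw nw f Tf.
have [e [T1 T2 fr]] := inj j w hw nw;have hj := (hd j.+1).1;rewrite h1// in hj.
have [c hc] := hqd_span (sT _) (sT _) (TS _) hj T2 fr Tf.
exists (lcomb e c), (f - lcomb (fun i => gev w / gev y * e i) c);split=> //.
 exact: lcomb_in c (sT j.+1) T1.
have -> : lcomb (fun i => gev w / gev y * e i) c = gev w / gev y * lcomb e c.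
 by rewrite mulr_sumr;apply: eq_bigr => i _;rewrite mulrCA.
by rewrite addrC subrK.
Qed.

(* Serre vanishing, in the form: sections over [G] of a sufficiently positive twist lift to X. *)
Lemma lifts_asymp D : fin_supp D -> exists j1, forall j, (j1 <= j)%N -> lifts G (twist D j).
move=> fD;have [n1 hn1] := Tsp_succ fD.
have [s hs'] := zeros_on_curve dG hy nyG.
have [w hw nw] := linear_nonzero s.
have nw' q : G q -> peval y q = 0 -> peval w q != 0 by move=> Gq yq;apply: nw;exact: hs'.
have TG j : twist D j G = D G by exact: twist_G.
pose E := twist D n1;have fE : fin_supp E by exact: fin_supp_twist.
have EG : E G = D G by exact: TG.
have [e [Te gen _]] := (hqdP _ (Tsp_ksub dG _ _) (oge_ksub _ dG)).1 (tdimP dG fE).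
have [N hN] : exists N : 'I_(tdim G E) -> nat, forall i d F, (N i <= d)%N -> F \is d.-homog ->
  liftable E d (fq y F d * e i).
 suff : forall i, exists N, forall d F, (N <= d)%N -> F \is d.-homog ->
  liftable E d (fq y F d * e i) by move=> /choice [N h];exists N.
 move=> i;exact: lift_forms.
pose N0 := (\max_i N i)%N.
have OF d F : F \is d.-homog -> oge G 0 (fq y F d).
 by move=> hF;have := form_oge ny hF dG;rewrite (hyp0 hy ny dG nyG) mulr0.
(* By [Tsp_succ] a section of the twist by i is a combination, with coefficients w/y and 1 = y/y, of
   sections of the twist by i - 1; the degree of the accompanying form rises by one. At i = 0 only a
   finite basis is left, whose multiples by forms of large degree lift. *)
have main i f : Tsp G (D G) (fun=> twist E i) f -> forall r F, (N0 <= i + r)%N -> F \is r.-homog ->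
  liftable E (i + r) (fq y F r * f).
 elim: i f => [|i IH] f Tf r F le hF.
  have [|c hc] := gen f.
  have e0 : twist E 0 = E by apply/funext => B;rewrite /twist mul0r addr0.
  by rewrite e0 in Tf;rewrite EG.
  have -> : fq y F r * f = fq y F r * (f - lcomb e c) + fq y F r * lcomb e c.
  by rewrite -mulrDr subrK.
  apply: (ksubD (liftable_ksub E _)).
  exists 0;first exact: ksub0 (hs_ksub _).
  rewrite subr0 -[1 - E G]add0r;apply: ogeM => //;exact: OF.
  have -> : fq y F r * lcomb e c = lcomb (fun i => fq y F r * e i) c.
  by rewrite mulr_sumr;apply: eq_bigr => j _;rewrite mulrCA.
  apply: lcomb_in => [|j];first exact: liftable_ksub.
  apply: hN => //;apply: leq_trans le;exact: leq_bigmax.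
 have [|a [b [Ta Tb ->]]] := hn1 (n1 + i)%N (leq_addr _ _) w hw nw' f.
  by move: Tf;rewrite twist_twist addnS.
 rewrite mulrDr addSnnS;apply: (ksubD (liftable_ksub E _)).
  have -> : fq y F r * (gev w / gev y * a) = fq y (F * w) r.+1 * a.
  by rewrite exprSr;move: (gev ^+ r) (expf_neq0 r ny) => z nz;field;rewrite ny.
  apply: IH;[by rewrite twist_twist|by rewrite addnS -addSn|].
  by have := dhomogM hF hw;rewrite addn1.
 have -> : fq y F r * b = fq y (F * y) r.+1 * b.
  by rewrite exprSr;move: (gev ^+ r) (expf_neq0 r ny) => z nz;field;rewrite ny.
 apply: IH;[by rewrite twist_twist|by rewrite addnS -addSn|].
 by have := dhomogM hF hy;rewrite addn1.
exists (n1 + N0)%N => j le f;rewrite TG => Tf.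
have [||a ha h] := @main (j - n1)%N f _ 0%N 1 _ (dhomog1 _ _).
- rewrite twist_twist subnKC//;apply: leq_trans le;exact: leq_addr.
- by rewrite addn0 leq_subRL (leq_trans _ le)// leq_addr.
exists a.
 move: ha;rewrite addn0 twist_twist subnKC//;apply: leq_trans le;exact: leq_addr.
by move: h;rewrite EG gev1 invr1 mulr1 mul1r.
Qed.

(** The bound degree + 1 is known for the multiples of the hyperplane section, which are effective.
    The possibly noneffective D, moved off G, enters only through its asymptotic jump. *)
Lemma rational_asymp D t : smooth_curve G -> generator G t -> fin_supp D -> pdiv_supp D ->
 exists N0, forall N, (N0 <= N)%N -> dg G (twist D N) + 1 <= (tdim G (twist D N))%:Z.
move=> sG gt fD sD;have [nt mt ht] := unif_ofP dG;set ta := unif_of G in nt mt ht.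
have nf : ta ^ (- D G) != 0 by rewrite expfz_neq0.
pose D1 B := D B + pdv (ta ^ (- D G)) B.
have f2 := fin_supp_pdv nf.
have f1 : @fin_supp D1 by exact: fin_suppD.
have D1G : D1 G = 0.
 by rewrite /D1 pdvE// ordXz// (unif_ord dG (unif_ofP dG)) mulr1 subrr.
have [s [us hs']] := good_listP f1.
have [l [hl he]] := hyp_seq.
pose s1 := [seq B <- s | `[< pdiv B /\ B <> G >]].
have hs1 B : B \in s1 -> pdiv B /\ B <> G by rewrite mem_filter => /andP [/asboolP].
have hs2 B : D1 B != 0 -> B \in s1.
 move=> nB;rewrite mem_filter hs'// asboolT;split;last by move=> e;rewrite e D1G in nB.
 apply: contrapT => ndB;case/eqP: nB;rewrite /D1.
 have [->|/sD//] := eqVneq (D B) 0;rewrite add0r.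
 by apply: contrapT => /eqP /pdv_pdiv.
have us1 : uniq s1 by rewrite filter_uniq.
have [_ h] := asym_div dG hy nyG us1 hs1 hs2.
have f0 : @fin_supp (fun=> 0) by exists [::] => B.
have [N0 hN] := h _ f0;exists N0 => N le;have := hN N le.
have fT : fin_supp (twist D N) by exact: fin_supp_twist.
have e1 : tdim G (twist (fun B => 0 + D1 B) N) = tdim G (twist D N).
 rewrite (tdim_equiv dG fT nf);apply: tdim_ext => // B.
 by rewrite /twist add0r addrAC.
have wE B : B <> G -> wt G B = I B G by rewrite /wt;case: eqP.
have e2 : \sum_(B <- s1) D1 B * I B G = dg G D1.
 rewrite (@dgE G D1 s1)// big_seq [RHS]big_seq;apply: eq_bigr => B /hs1 [_ nB].
 by rewrite wE.
have e3 : dg G D1 = dg G D by rewrite dgD ?dg_pdv ?addr0.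
have fH := fin_supp_hyp hy ny.
have e4 : dg G (twist D N) = dg G D + N%:Z * dg G (hyp y).
 rewrite dgD ?dgZ//;exact: fin_suppZ.
have e5 : dg G (hyp y) = \sum_(B <- l) I B G.
 rewrite (@dgE G (hyp y) (undup l));last first.
  split;[exact: undup_uniq|move=> B;rewrite he mem_undup;apply: contraNT => /count_memPn ->//].
 rewrite -[RHS]big_undup_iterop_count /=.
 rewrite big_seq [RHS]big_seq;apply: eq_bigr => B;rewrite mem_undup => /hl [_ nB _].
 by rewrite wE// he -[RHS]/(I B G *+ count_mem B l) -natz mulr_natl.
pose ln := flatten (nseq N l).
have cn B : (count_mem B ln)%:Z = N%:Z * hyp y B.
 rewrite he /ln;elim: (N) => [|n IHn];first by rewrite mul0r.
 by rewrite count_cat PoszD IHn intS mulrDl mul1r.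
have sn : \sum_(B <- ln) I B G = N%:Z * dg G (hyp y).
 rewrite e5 /ln;elim: (N) => [|n IHn];first by rewrite big_nil mul0r.
 by rewrite big_cat IHn intS mulrDl mul1r.
have hln B : B \in ln -> pdiv B /\ B <> G.
 by move=> /flattenP [l' /nseqP [-> _]] /hl [].
have := rational_tdim dG sG gt hln.
rewrite (tdim_ext (E := twist (fun=> 0) N) dG);last by move=> B _;rewrite /twist add0r.
rewrite e1 => h1 ->;lia.
Qed.
End Twists.
End Sections.

(** * Chains of rational curves of type (-1, -2, -1) *)

Section Growth.
Local Notation I B G := (@curve_inter k X B G).
Implicit Types (B G : set pt) (p q : pt) (F : form) (f g t u s : K).
Implicit Types (D E : div) (l : seq (set pt)).

Definition cD l : div := fun B => (count_mem B l)%:Z.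
Definition addl D l : div := fun B => D B + cD l B.

Lemma fin_cD l : fin_supp (cD l).
by exists l => B;rewrite /cD;apply: contraNT => /count_memPn ->. Qed.
Lemma fin_addl D l : fin_supp D -> fin_supp (addl D l).
move=> fD;apply: fin_suppD => //;exact: fin_cD. Qed.
Lemma cD_cons B l C : cD (B :: l) C = cdiv B C + cD l C.
by rewrite /cD /= eq_sym. Qed.
Lemma cD_cat l l' B : cD (l ++ l') B = cD l B + cD l' B.
by rewrite /cD count_cat. Qed.

Lemma dg_cD G l : dg G (cD l) = \sum_(B <- l) wt G B.
elim: l => [|B l IH].
 by rewrite (@dgE G _ [::]) ?big_nil.
rewrite big_cons -IH -dg_curve -dgD;[|exact: fin_supp_curve|exact: fin_cD].
congr dg;apply/funext => C;exact: cD_cons.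
Qed.

(** Upper bound for the growth of H^0 when the curves of l are added to D from the tail of l
    upwards; it is attained when all sections over the curves lift. *)
Fixpoint tau D l : nat := if l is B :: l' then (tdim B (addl D l) + tau D l')%N else 0%N.

Lemma hs_chain D l : fin_supp D -> (forall B, B \in l -> pdiv B) -> exists n,
 [/\ (n <= tau D l)%N, hqd (hs (addl D l)) (hs D) n &
  (forall l1 B l2, l = l1 ++ B :: l2 -> lifts B (addl D (B :: l2))) -> n = tau D l].
move=> fD;elim: l => [|B l IH] hl.
 exists 0%N;split=> //;apply: hqd0;try exact: hs_ksub.
 by apply: hs_mono => dB;rewrite /addl addr0.
have [n [le hn hs1]] := IH (fun C hC => hl C (mem_behead (s := B :: l) hC)).
have dB := hl B (mem_head _ _);have [n' [le' hn' hs']] := hs_step dB (fin_addl (B :: l) fD).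
have e : hs (subB (addl D (B :: l)) B) = hs (addl D l).
 apply: hs_ext => C dC;rewrite /subB /addl cD_cons;ring.
rewrite e in hn';exists (n' + n)%N;split=> /=.
- exact: leq_add.
- apply: hqd_add hn' hn;try exact: hs_ksub;apply: hs_mono => dC;rewrite /addl.
  by rewrite lerDl.
 by rewrite cD_cons lerD2l lerDr.
- move=> hh;rewrite hs' ?hs1//;last exact: (hh [::]).
 by move=> l1 C l2 el;apply: (hh (B :: l1));rewrite el.
Qed.

Lemma tau_ext D E l : (forall B, B \in l -> pdiv B) -> (forall B, pdiv B -> D B = E B) -> tau D l = tau E l.
move=> + h;elim: l => [|B l IH]//= hl.
rewrite IH => [|C hC];last by apply: hl;rewrite inE hC orbT.
by congr addn;apply: tdim_ext;[apply: hl;exact: mem_head|move=> C dC;rewrite /addl h].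
Qed.

Lemma tau_cat D l l' : (forall B, B \in l -> pdiv B) -> tau D (l ++ l') = (tau (addl D l') l + tau D l')%N.
elim: l => [|B l IH]//= hl.
rewrite IH => [|C hC];last by apply: hl;rewrite inE hC orbT.
rewrite addnA;congr (_ + _ + _)%N;apply: tdim_ext;first by apply: hl;exact: mem_head.
move=> C dC;rewrite /addl -cat_cons cD_cat;ring.
Qed.

Lemma tau_le D l (r : seq (set pt)) : fin_supp D -> (forall B, B \in l -> pdiv B) ->
 (forall B C, B \in l -> C \in r -> pdiv C /\ C <> B) ->
 (tau (addl D r) l)%:Z <= (tau D l)%:Z + \sum_(B <- l) \sum_(C <- r) I C B.
move=> fD;elim: l => [|B l IH] hl hr;first by rewrite big_nil.
have {}IH := IH (fun C hC => hl C (mem_behead (s := B :: l) hC))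
 (fun C (M : set pt) hC => hr C M (mem_behead (s := B :: l) hC)).
have dB := hl B (mem_head _ _).
have h := tdim_seq dB (fun C hC => hr B C (mem_head _ _) hC) (fin_addl (B :: l) fD).
rewrite big_cons !PoszD.
have e : tdim B (addl (addl D r) (B :: l)) = tdim B (fun C => addl D (B :: l) C + (count_mem C r)%:Z).
 apply: tdim_ext => // C _;rewrite /addl;ring.
by rewrite e;apply: le_trans (lerD h IH) _;rewrite addrACA.
Qed.
Lemma lifts_ext G D E : pdiv G -> (forall B, pdiv B -> D B = E B) -> lifts G D -> lifts G E.
move=> dG h hD f;rewrite -(h G dG) -(Tsp_ext _ _ h) -(hs_ext h);exact: hD.
Qed.

Lemma lifts_equiv G D f : pdiv G -> f != 0 -> lifts G (fun B => D B + pdv f B) -> lifts G D.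
move=> dG nf h g hg.
have [|a ha h1] := h (g / f).
 by rewrite pdvE//;apply/(Tsp_mulr dG _ _ _ nf);rewrite divfK.
exists (a * f).
 by move=> B dB;rewrite oge_mulr;have := ha B dB;rewrite pdvE// opprD.
move: h1;rewrite pdvE// opprD addrA -oge_mulr// mulrBl divfK//.
Qed.

Lemma hyp_diff (y z : form) B : y \is 1.-homog -> z \is 1.-homog -> gev y != 0 -> gev z != 0 -> pdiv B ->
 hyp z B = hyp y B + ord B (gev z / gev y).
move=> hy hz ny nz dB;have nc := coord_onP dB;have hc := homogX1 (coord_on B).
have gc := gev_neq0 dB hc nc.
rewrite (hypE nz dB hc nc) (hypE ny dB hc nc) -ordM ?mulf_neq0 ?invr_eq0//.
by congr ord;field;rewrite ny.
Qed.

Lemma lifts_any (y : form) G D : y \is 1.-homog -> gev y != 0 -> pdiv G -> fin_supp D ->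
 exists j1, forall j, (j1 <= j)%N -> lifts G (twist y D j).
move=> hy ny dG fD;have [z hz nzG] := good_linear dG.
have nz := gev_neq0 dG hz nzG.
have [j1 h] := lifts_asymp dG hz nzG fD;exists j1 => j /h h1.
have nq : gev z / gev y != 0 by rewrite mulf_neq0 ?invr_eq0.
apply: (lifts_equiv (f := (gev z / gev y) ^+ j) dG);first by rewrite expf_neq0.
apply: lifts_ext h1 => // B dB;rewrite /twist pdvE// ordX// (hyp_diff hy hz ny nz dB);ring.
Qed.

Lemma lifts_list (y : form) l : y \is 1.-homog -> gev y != 0 -> (forall B, B \in l -> pdiv B) ->
 exists j1, forall j, (j1 <= j)%N -> forall l1 B l2, l = l1 ++ B :: l2 ->
  lifts B (twist y (cD (B :: l2)) j).
move=> hy ny;elim: l => [|B l IH] hl;first by exists 0%N => j _ [].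
have [j1 h1] := IH (fun C hC => hl C (mem_behead (s := B :: l) hC)).
have [j2 h2] := lifts_any hy ny (hl B (mem_head _ _)) (fin_cD (B :: l)).
exists (maxn j1 j2) => j;rewrite geq_max => /andP [le1 le2] [|C l1] B' l2 [e1 e2].
 by subst;apply: h2.
subst;exact: h1.
Qed.

Lemma cD_nseq n l B : cD (flatten (nseq n l)) B = n%:Z * cD l B.
elim: n => [|n IH];first by rewrite mul0r.
by rewrite cD_cat IH intS mulrDl mul1r.
Qed.

(** The Riemann-Roch value of the same filtration: degree + 1 for each rational curve. *)
Fixpoint sig l : int := if l is B :: l' then dg B (cD (B :: l')) + 1 + sig l' else 0.

Section Chain.
Variables (A C A' : set pt).
Hypotheses (dA : pdiv A) (dC : pdiv C) (dA' : pdiv A').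
Hypotheses (sA : smooth_curve A) (sC : smooth_curve C) (sA' : smooth_curve A').
Hypotheses (gA : exists t, generator A t) (gC : exists t, generator C t) (gA' : exists t, generator A' t).
Hypotheses (wA : wt A A = -1) (wC : wt C C = - 2) (wA' : wt A' A' = -1)
 (wAC : wt A C = 1) (wCA' : wt C A' = 1) (wAA' : wt A A' = 0).
Let wCA : wt C A = 1. by rewrite wt_sym. Qed.
Let wA'C : wt A' C = 1. by rewrite wt_sym. Qed.
Let wA'A : wt A' A = 0. by rewrite wt_sym. Qed.

Definition chainl := [:: A;C;A'].
Local Notation PL := chainl.

Lemma PL_pdiv B : B \in PL -> [/\ pdiv B, smooth_curve B & exists t, generator B t].
by rewrite !inE => /or3P [] /eqP ->. Qed.

Lemma dg_chain B n : B \in PL -> dg B (cD (flatten (nseq n PL))) = 0.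
move=> hB;have -> : cD (flatten (nseq n PL)) = fun M => n%:Z * cD PL M by apply/funext => M;rewrite cD_nseq.
rewrite dgZ;last exact: fin_cD.
rewrite dg_cD !big_cons big_nil;move: hB;rewrite !inE => /or3P [] /eqP ->.
- rewrite wA wAC wAA';ring.
- rewrite wCA wC wCA';ring.
- rewrite wA'A wA'C wA';ring.
Qed.

(** Earlier copies have degree 0 on each curve. Adding A', then C, then A, gives restrictions of
    degree -1, -1 and 0, so each copy contributes 0 + 0 + 1. *)
Lemma sig_chain n : sig (flatten (nseq n PL)) = n%:Z.
elim: n => [//|n IH] /=;rewrite IH !dg_cD !big_cons -!dg_cD !dg_chain ?inE ?eqxx ?orbT//.
rewrite wA wAC wAA' wC wCA' wA' intS;ring.
Qed.

Lemma tau_lower (y : form) l : y \is 1.-homog -> (forall B, B \in PL -> ~ van y B) ->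
 (forall B, B \in l -> B \in PL) -> exists j0, forall j, (j0 <= j)%N ->
 sig l + j%:Z * (\sum_(B <- l) dg B (hyp y)) <= (tau (fun B => j%:Z * hyp y B) l)%:Z.
move=> hy nv;elim: l => [|B l IH] hl;first by exists 0%N => j _;rewrite big_nil mulr0.
have [j0 h0] := IH (fun M hE => hl M (mem_behead (s := B :: l) hE)).
have BP := hl B (mem_head _ _);have [dB sB [t gt]] := PL_pdiv BP.
have pl : pdiv_supp (cD (B :: l)).
 move=> M nE;have : M \in B :: l by apply: contraNT nE => /count_memPn h;rewrite /cD h.
 by move/hl/PL_pdiv => [].
have [j1 h1] := rational_asymp dB hy (nv B BP) sB gt (fin_cD (B :: l)) pl.
exists (maxn j0 j1) => j;rewrite geq_max => /andP [/h0 {h0} + /h1 {h1}].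
have fH : fin_supp (hyp y) by apply: fin_supp_hyp => //;apply: (gev_neq0 dB hy (nv B BP)).
rewrite big_cons /= {1}/twist dgD;[|exact: fin_cD|exact: fin_suppZ].
rewrite dgZ// (tdim_ext (E := addl (fun B => j%:Z * hyp y B) (B :: l)) dB).
 rewrite mulrDr;lia.
by move=> M _;rewrite /addl addrC.
Qed.

(** With P the chain and H the hyperplane section, sections of nP + jH are counted in two orders.
    Adding the chains to jH, all sections lift and the count is at least n + nj(P.H). Adding jH to
    nP gains at most nj(P.H) more than adding jH to 0, a count that is sharp up to a bounded defect
    q. The terms in H cancel and leave at least n - q for nP. *)
Lemma hs_growth : exists q : nat, forall n, exists2 c, hqd (hs (fun B => n%:Z * cD PL B)) (hs (fun=> 0)) c &
 (n <= c + q)%N.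
have [[a Aa] [c Cc] [a' Aa']] := And3 (pdiv_point dA) (pdiv_point dC) (pdiv_point dA').
have [y hy ny0] := linear_nonzero [:: a;c;a'].
have nv B : B \in PL -> ~ van y B.
 rewrite !inE => /or3P [] /eqP -> h.
 - by have := ny0 a (or_introl erefl);rewrite (h a Aa) eqxx.
 - by have := ny0 c (or_intror (or_introl erefl));rewrite (h c Cc) eqxx.
 - by have := ny0 a' (or_intror (or_intror (or_introl erefl)));rewrite (h a' Aa') eqxx.
have ny : gev y != 0 by apply: (gev_neq0 dA hy);apply: nv;exact: mem_head.
have [l [hl he]] := hyp_seq dA hy (nv A (mem_head _ _)).
have hl1 B : B \in l -> pdiv B by move/hl => [].
have hl2 B M : B \in l -> M \in PL -> M <> B.
 by move=> /hl [_ _ vB] EP e;apply: (nv M EP);rewrite e.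
pose jl j := flatten (nseq j l).
have hjl j B : B \in jl j -> B \in l by move=> /flattenP [s /nseqP [-> _]].
have hjl1 j B : B \in jl j -> pdiv B by move/hjl/hl1.
have ejl j B : cD (jl j) B = j%:Z * hyp y B by rewrite cD_nseq /cD -he.
pose Z : div := fun=> 0;have fZ : fin_supp Z by exists [::] => B.
have [j1 hj1] := lifts_list hy ny hl1.
(* From [j1] on all restrictions lift, so the shortfall against [tau] stops growing. *)
have defect : exists q : nat, forall j, (j1 <= j)%N -> exists2 n, hqd (hs (cD (jl j))) (hs Z) n & (tau Z (jl j) <= n + q)%N.
 have eZ m : addl Z m = cD m by apply/funext => B.
 exists (tau Z (jl j1)) => j /subnKC <-;elim: (j - j1)%N => [|d [n hn IH]].
  rewrite addn0;have [n [_ hn _]] := hs_chain fZ (hjl1 j1);exists n;first by rewrite eZ in hn.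
  exact: leq_addl.
 have [n' [_ hn' e']] := hs_chain (fin_cD (jl (j1 + d)%N)) hl1.
 have eD : addl (cD (jl (j1 + d)%N)) l = cD (jl (j1 + d.+1)%N).
  by apply/funext => B;rewrite /addl !ejl addnS intS mulrDl mul1r [RHS]addrC;rewrite he.
 rewrite eD in hn';exists (n' + n)%N.
  apply: hqd_add hn' hn;try exact: hs_ksub;apply: hs_mono => dB;rewrite ?ejl.
  by rewrite mulr_ge0// hyp_ge0.
  by rewrite ler_wpM2r ?hyp_ge0// lez_nat leq_add2l.
 rewrite addnS tau_cat// e'.
  rewrite -addnA leq_add// tau_ext => B.
 move=> m1 B m2 em;have dB : pdiv B by apply: hl1;rewrite em mem_cat mem_head orbT.
 apply: lifts_ext (hj1 (j1 + d)%N (leq_addr _ _) m1 B m2 em) => // M _.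
 by rewrite /addl ejl addrC.
have [q hq] := defect;exists q => n.
pose Pn := flatten (nseq n PL).
have hPn B : B \in Pn -> B \in PL by move=> /flattenP [s /nseqP [-> _]].
have hPn1 B : B \in Pn -> pdiv B by move=> /hPn /PL_pdiv [].
have [j2 hj2] := lifts_list hy ny hPn1;have [j3 hj3] := tau_lower hy nv hPn.
pose j := maxn j1 (maxn j2 j3).
have [le1 le2 le3] : [/\ (j1 <= j)%N, (j2 <= j)%N & (j3 <= j)%N] by rewrite /j;split;lia.
have [n0 hn0 q0] := hq j le1.
have [c0 [_ hc0 _]] := hs_chain fZ hPn1.
have [n1 [le hn1 _]] := hs_chain (fin_addl Pn fZ) (hjl1 j).
have [m [_ hm em]] := hs_chain (fin_cD (jl j)) hPn1.
have e1 : addl (cD (jl j)) Pn = addl (addl Z Pn) (jl j).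
 by apply/funext => B;rewrite /addl addrC.
rewrite e1 in hm.
have PnE : addl Z Pn = fun B => n%:Z * cD PL B by apply/funext => B;rewrite /addl cD_nseq.
exists c0;first by rewrite PnE in hc0.
have tot : (n1 + c0 = m + n0)%N.
 apply: (hqd_uniq (hs_ksub _) (hs_ksub _)).
  apply: hqd_add hn1 hc0;try exact: hs_ksub;apply: hs_mono => dB;rewrite /addl.
  by [].
  by rewrite lerDl.
 apply: hqd_add hm hn0;try exact: hs_ksub;apply: hs_mono => B dB;first by [].
 by rewrite lerDr.
have em' : m = tau (cD (jl j)) Pn.
 apply: em => m1 B m2 e;have dB : pdiv B by apply: hPn1;rewrite e mem_cat mem_head orbT.
 apply: lifts_ext (hj2 j le2 m1 B m2 e) => // M _;by rewrite /addl ejl addrC.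
have low := hj3 j le3.
have em2 : tau (cD (jl j)) Pn = tau (fun B => j%:Z * hyp y B) Pn.
 apply: tau_ext => // B dB.
rewrite sig_chain in low.
have up := @tau_le Z (jl j) Pn fZ (hjl1 j) (fun B M hB hE => conj (hPn1 M hE) (@hl2 B M (hjl j B hB) (hPn M hE))).
have eS : \sum_(B <- jl j) \sum_(M <- Pn) I M B = j%:Z * \sum_(B <- Pn) dg B (hyp y).
 rewrite exchange_big mulr_sumr;rewrite big_seq [RHS]big_seq;apply: eq_bigr => M hE.
 have -> : hyp y = cD l by apply/funext => B.
 rewrite dg_cD;have -> : \sum_(B <- l) wt M B = \sum_(B <- l) I M B.
  rewrite big_seq [RHS]big_seq;apply: eq_bigr => B hB;rewrite /wt.
  by case: eqP => [e|_];[case: (hl2 B M hB (hPn _ hE))|exact: I_sym].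
 rewrite /jl;elim: (j) => [|i IHi];first by rewrite big_nil mul0r.
 by rewrite big_cat IHi intS mulrDl mul1r.
move: low up;lia.
Qed.
End Chain.
End Growth.

(** * The pencil of a chain of curves *)

Section Pencil.
Local Notation I B G := (@curve_inter k X B G).
Implicit Types (B : set pt) (p q : pt) (F f g t u s : K).
Implicit Types (D : div) (P Q : {poly k}).

Lemma I_ge0 B B' : pdiv B -> pdiv B' -> B <> B' -> 0 <= I B B'.
move=> dB dB' n;have [l ul hl] := meet_list dB' dB n.
by rewrite (curve_interE ul hl);apply: sumr_ge0.
Qed.

Lemma I_gt0 B B' p : pdiv B -> pdiv B' -> B <> B' -> B p -> B' p -> 1 <= I B B'.
move=> dB dB' n Bp B'p;have [l ul hl] := meet_list dB' dB n.
have pl : p \in l by apply/hl.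
rewrite (curve_interE ul hl) (bigD1_seq p)//=.
have [b lb] := leq_ex dB Bp;have [Ob mb nb _] := lb.
have nmb : ~ mi B' b.
 have oG := leq_ord dB' dB B'p Bp lb;have ne : (B' == B) = false by apply/eqP => /esym.
 by rewrite ne in oG;move/(mi_ord dB' nb);rewrite oG.
have Xp := pdiv_sub dB Bp.
have h := loclenP dB' B'p Ob nmb.
have : (0 < loclen B' p b)%N.
 rewrite lt0n;apply/eqP => e.
 have iJ := curve_ideal_ideal dB' B'p Ob;have [JO _ _ _] := iJ.
 have := hqd_eq (lring_ksub Xp) (oideal_ksub dB' B'p iJ) JO h e (lring1 Xp).
 move=> [g [r [Og Or mr e1]]];apply: (max_not1 Xp);rewrite e1;apply: (maxD Xp).
  apply: (maxM Xp) => //;exact: (mi_at dB Bp Ob).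
 exact: (mi_at dB' B'p Or).
rewrite -(local_multE dB' B'p dB Bp lb) => h1.
apply: (@le_trans _ _ ((local_mult B B' p)%:Z));first by rewrite lez_nat.
by rewrite lerDl;apply: sumr_ge0.
Qed.
Lemma I_disjoint B B' p : pdiv B -> pdiv B' -> B <> B' -> I B B' = 0 -> B p -> B' p -> False.
by move=> dB dB' n e Bp B'p;have := I_gt0 dB dB' n Bp B'p;rewrite e. Qed.

Lemma I_meet B B' : pdiv B -> pdiv B' -> B <> B' -> I B B' != 0 -> exists2 p, B p & B' p.
move=> dB dB' n;have [[|p l] ul hl] := meet_list dB' dB n.
 by rewrite (curve_interE ul hl) big_nil.
by move=> _;have [] := (hl p).1 (mem_head _ _);exists p.
Qed.
Lemma wtE B B' : B <> B' -> wt B B' = I B B'.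
rewrite !wt_if;case: eqP => [-> //|_ _];exact: I_sym. Qed.

Lemma effective_dg B D : pdiv B -> fin_supp D -> pdiv_supp D -> (forall B', pdiv B' -> 0 <= D B') ->
 D B = 0 -> 0 <= dg B D.
move=> dB [l gl] sD D0 DB.
apply: sumr_ge0 => B' _;have [->|nD] := eqVneq (D B') 0;first by rewrite mul0r.
have dB' := sD _ nD;have n : B <> B' by move=> e;rewrite e in DB;rewrite DB in nD.
by rewrite wtE// mulr_ge0 ?D0 ?I_ge0.
Qed.

Lemma effective_dg1 B D C p : pdiv B -> fin_supp D -> pdiv_supp D -> (forall B', pdiv B' -> 0 <= D B') ->
 D B = 0 -> B <> C -> 1 <= D C -> B p -> C p -> 1 <= dg B D.
move=> dB fD sD D0 DB nBC DC Bp Cp.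
have dC : pdiv C by apply: sD;rewrite gt_eqF// lt_le_trans.
have fC := fin_supp_curve C.
have e : D = fun B' => subB D C B' + cdiv C B' by apply/funext => B';rewrite subrK.
rewrite e dgD//;last exact: fin_supp_subB.
rewrite dg_curve wtE//.
suff h0 : 0 <= dg B (subB D C) by have := I_gt0 dB dC nBC Bp Cp;lia.
apply: effective_dg => //;first exact: fin_supp_subB.
- move=> B';rewrite /subB /cdiv;case: (B' =P C) => [-> //|_];rewrite subr0;exact: sD.
- move=> B' dB';rewrite /subB /cdiv;case: (B' =P C) => [->|_];first by rewrite subr_ge0.
 by rewrite subr0 D0.
- by rewrite /subB DB /cdiv;case: eqP.
Qed.

(** D + div s is effective and has the same degree on B as D. If B were not a component of it, this
    degree would be nonnegative, and positive if some component meets B. *)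
Lemma section_component B D s : pdiv B -> fin_supp D -> pdiv_supp D -> s != 0 -> hs D s ->
 dg B D < 0 \/ (dg B D <= 0 /\ exists C p, [/\ B <> C, 1 <= D C + pdv s C, B p & C p]) ->
 hs (subB D B) s.
move=> dB fD sD ns hs_ h;pose M C := D C + pdv s C.
have fM : fin_supp M by apply: fin_suppD => //;exact: fin_supp_pdv.
have sM : pdiv_supp M.
 move=> C nC;apply: contrapT => ndC;case/eqP: nC;rewrite /M.
 have [->|/sD//] := eqVneq (D C) 0;rewrite add0r;apply: contrapT => /eqP /pdv_pdiv//.
have M0 C : pdiv C -> 0 <= M C.
 move=> dC;rewrite /M pdvE//;have /ogeE := hs_ C dC;lia.
have eM : dg B M = dg B D by rewrite dgD ?dg_pdv ?addr0//;exact: fin_supp_pdv.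
have nMB : M B <> 0.
 move=> MB;case: h => [lt|[le [C [p [nBC h1 Bp Cp]]]]].
  have := effective_dg dB fM sM M0 MB;lia.
 have := effective_dg1 dB fM sM M0 MB nBC h1 Bp Cp;lia.
have MB1 : 1 <= M B by have := M0 B dB;lia.
move=> dC;rewrite /subB /cdiv;case: eqP => [->|_];last by rewrite subr0;exact: hs_.
right;move: MB1;rewrite /M pdvE//=;lia.
Qed.

Lemma hs_neg B D : pdiv B -> fin_supp D -> pdiv_supp D -> dg B D < 0 -> hs D `<=` hs (subB D B).
move=> dB fD sD lt s h;have [->|ns] := eqVneq s 0;first by move=> C _;left.
by apply: section_component => //;left.
Qed.

Lemma hs0_const f : hs (fun=> 0) f -> exists c, f = cst c.
move=> h;have hp p : Xpts p -> O_at p f.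
 by move=> Xp;apply: hartogs => // B dB _;have := h B dB.
have [|p Xp|c /max_pts /eqP] := regular_constant_on (prime_pts) (closedX_pts) (f := f).
- have [[p Xp] _ _] := prime_pts.
 by apply: (lring_mono (prime_pts) _ (hp p Xp)) => _ ->.
- exists f;[exact: hp|rewrite subrr;exact: max0 (prime_pts)].
by rewrite subr_eq0 => /eqP ->;exists c.
Qed.
Lemma cst_hs0 c : hs (fun=> 0) (cst c).
move=> B dB;apply/oge0 => //;exact: lring_cst dB c.
Qed.

Section Chain.
Variables (A C A' G : set pt).
Hypotheses (dA : pdiv A) (dC : pdiv C) (dA' : pdiv A') (dG : pdiv G).
Hypotheses (sA : smooth_curve A) (sC : smooth_curve C) (sA' : smooth_curve A').
Hypotheses (gA : exists t, generator A t) (gC : exists t, generator C t) (gA' : exists t, generator A' t).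
Hypotheses (sG : smooth_curve G) (gG : exists t, generator G t).
Hypotheses (wA : wt A A = -1) (wC : wt C C = - 2) (wA' : wt A' A' = -1)
 (wAC : wt A C = 1) (wCA' : wt C A' = 1) (wAA' : wt A A' = 0).
Hypotheses (wGA : wt G A = 0) (wGC : wt G C = 0) (wGA' : wt G A' = 1).
Let wCA : wt C A = 1. by rewrite wt_sym. Qed.
Let wA'C : wt A' C = 1. by rewrite wt_sym. Qed.
Let wA'A : wt A' A = 0. by rewrite wt_sym. Qed.
Let wAG : wt A G = 0. by rewrite wt_sym. Qed.
Let wCG : wt C G = 0. by rewrite wt_sym. Qed.
Let wA'G : wt A' G = 1. by rewrite wt_sym. Qed.
Local Notation PL := (chainl A C A').
Local Notation m := (mi G).
Let pG := pdiv_prime dG.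

Let nAC : A <> C. by move=> e;move: wAC;rewrite -e wA. Qed.
Let nAA' : A <> A'. by move=> e;move: wAA';rewrite -e wA. Qed.
Let nCA' : C <> A'. by move=> e;move: wCA';rewrite -e wC. Qed.
Let nGA : G <> A. by move=> e;move: wGA;rewrite e wA. Qed.
Let nGC : G <> C. by move=> e;move: wGC;rewrite e wC. Qed.
Let nGA' : G <> A'. by move=> e;move: wGA';rewrite e wA'. Qed.

Definition nP (n : nat) : div := fun B => n%:Z * cD PL B.

Lemma PLE B : cD PL B = cdiv A B + (cdiv C B + cdiv A' B).
by rewrite !cD_cons [cD [::] B]/(0 : int) addr0. Qed.
Lemma PL_G : cD PL G = 0.
by rewrite PLE /cdiv (introF eqP nGA) (introF eqP nGC) (introF eqP nGA'). Qed.
Lemma PL_A' : cD PL A' = 1.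
by rewrite PLE /cdiv eqxx eq_sym (eq_sym A' C) (introF eqP nAA') (introF eqP nCA').
Qed.
Lemma PL_ge0 B : 0 <= cD PL B. by []. Qed.
Lemma fin_nP n : fin_supp (nP n).
apply: fin_suppZ;exact: fin_cD. Qed.

Lemma PL_supp : pdiv_supp (cD PL).
move=> B nB;have : B \in PL by apply: contraNT nB => /count_memPn h;rewrite /cD h.
by rewrite !inE => /or3P [] /eqP ->.
Qed.
Lemma supp_nP n : pdiv_supp (nP n).
by move=> B nB;apply: PL_supp;apply: contraNneq nB => e;rewrite /nP e mulr0. Qed.
Lemma supp_subB D B : pdiv B -> pdiv_supp D -> pdiv_supp (subB D B).
move=> dB sD B';rewrite /subB /cdiv;case: (B' =P B) => [-> //|_];rewrite subr0;exact: sD.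
Qed.

Lemma dg_subB D B B' : fin_supp D -> dg B' (subB D B) = dg B' D - wt B' B.
move=> fD;rewrite dgD//;last by apply: fin_suppN;exact: fin_supp_curve.
rewrite dgN ?dg_curve//;exact: fin_supp_curve.
Qed.
Lemma dg_nP B n : dg B (nP n) = n%:Z * (wt B A + (wt B C + wt B A')).
rewrite dgZ ?dg_cD ?big_cons ?big_nil ?addr0//;exact: fin_cD. Qed.

(** Vanishing on A' makes the degree on C negative, and vanishing on C then makes the degree on A
    negative; so a whole copy of the chain splits off. *)
Lemma strip D : fin_supp D -> pdiv_supp D -> dg C D = 0 -> dg A D = 0 ->
 hs (subB D A') `<=` hs (fun B => D B - cD PL B).
move=> fD sD eC eA s h.
have h1 : hs (subB (subB D A') C) s.
 apply: hs_neg h => //;[exact: fin_supp_subB|exact: supp_subB|].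
 by rewrite dg_subB// eC wCA'.
have h2 : hs (subB (subB (subB D A') C) A) s.
 apply: hs_neg h1 => //;[by do 2 apply: fin_supp_subB|do 2 apply: supp_subB => //|].
 by rewrite !dg_subB//;[rewrite eA wAA' wAC|exact: fin_supp_subB].
move: h2;congr hs;apply/funext => B;rewrite /subB PLE;ring.
Qed.
Lemma nP_step n : (fun B => nP n.+1 B - cD PL B) = nP n.
by apply/funext => B;rewrite /nP intS mulrDl mul1r addrAC subrr. Qed.
Lemma nP_mono n j : (n <= j)%N -> hs (nP n) `<=` hs (nP j).
move=> le;apply: hs_mono => dB;rewrite ler_wpM2r//. Qed.

Lemma nPM n j f g : hs (nP n) f -> hs (nP j) g -> hs (nP (n + j)) (f * g).
move=> hf hg B dB;have -> : - nP (n + j) B = - nP n B + - nP j B by rewrite /nP PoszD;ring.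
apply: ogeM => //;[exact: hf|exact: hg].
Qed.

(** The chain has degree 0 on A', and G meets A' once. So a section vanishing on G has degree -1 on
    A', and a whole copy of the chain splits off; after n copies a constant vanishing on G
    remains. *)
Lemma restrict_inj n s : hs (nP n) s -> m s -> s = 0.
move=> h ms;apply: contrapT => /eqP ns.
have {h} : hs (subB (nP n) G) s.
 rewrite -(hs_cap _ dG);split=> //;rewrite /nP PL_G mulr0.
 exact/oge1.
elim: n => [|n IH] h.
 have [c ec] : exists c, s = cst c.
  apply: hs0_const;apply: hs_mono h => B _;rewrite /subB.
  by rewrite /cdiv;case: (_ == _).
 have nc : c != 0 by apply: contraNneq ns => e;rewrite ec e rmorph0.
 by have [_] := unit_cst dG nc;rewrite -ec.
apply: IH.
have fD : fin_supp (subB (nP n.+1) G) by apply: fin_supp_subB;exact: fin_nP.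
have sD : pdiv_supp (subB (nP n.+1) G) by apply: supp_subB => //;exact: supp_nP.
have fN := fin_nP n.+1.
have h1 : hs (subB (subB (nP n.+1) G) A') s.
 apply: hs_neg => //;rewrite dg_subB// dg_nP wA'G;lia.
have := strip fD sD _ _ h1;rewrite !dg_subB// !dg_nP wCA wC wCA' wCG wA wAC wAA' wAG.
move=> /(_ (ltac:(by rewrite (_ : 1 + (-2 + 1) = 0 :> int)// mulr0)) (ltac:(by rewrite (_ : -1 + (1 + 0) = 0 :> int)// mulr0))).
congr hs;apply/funext => B;rewrite /subB;ring.
Qed.

(** G is rational and meets the chain once, so modulo functions vanishing on G these are the
    polynomials of degree at most n in a coordinate. *)
Definition T n : set K := Tsp G 0 (fun=> nP n).

Lemma nP_G n : nP n G = 0. by rewrite /nP PL_G mulr0. Qed.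

Lemma T_dim n : hqd (T n) (oge G 1) n.+1.
have h := tdimP dG (fin_nP n);rewrite nP_G in h.
suff <- : tdim G (nP n) = n.+1 by [].
pose l := flatten (nseq n PL).
have hl B : B \in l -> pdiv B /\ B <> G.
 by move=> /flattenP [l' /nseqP [-> _]];rewrite !inE => /or3P [] /eqP ->;split=> //;apply/nesym.
have el : tdim G (nP n) = tdim G (fun B => (count_mem B l)%:Z).
 by apply: tdim_ext => // B _;rewrite -[RHS]/(cD l B) cD_nseq.
have sl : \sum_(B <- l) I B G = n%:Z.
 rewrite /l;elim: (n) => [|i IHi];first by rewrite big_nil.
 rewrite !big_cons IHi -!(I_sym G) -!wtE// intS;lia.
have [t gt] := gG.
have low := rational_tdim dG sG gt hl.
pose Z : div := fun=> 0;have fZ : fin_supp Z by exists [::] => B.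
have up := tdim_seq dG hl fZ.
have t0 : tdim G Z = 1%N by apply: (tdim_eq dG fZ);exact: Tsp0.
rewrite sl in low;rewrite -el in up;lia.
Qed.
Lemma T_ksub n : ksub (T n). exact: Tsp_ksub. Qed.
Lemma T_m n f : m f -> T n f.
by move=> mf;apply: J_Tsp;apply/oge1. Qed.
Lemma T_sub_m n : oge G 1 `<=` T n.
move=> f /(oge1 _ dG);exact: T_m. Qed.
Lemma hs_T n : hs (nP n) `<=` T n.
by have := hs_Tsp (D := nP n) dG;rewrite nP_G. Qed.
Lemma T_lr n f : T n f -> lr G f.
move=> h;apply/(oge0 _ dG).
apply: (Tsp_oge dG _ h) => p _;exact: nP_G.
Qed.

Lemma T_mul n j f g : T n f -> T j g -> T (n + j) (f * g).
move=> hf hg p Gp;have [s os ms] := hf p Gp;have [r or_ mr] := hg p Gp.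
exists (s * r).
 have -> : nP (n + j) = fun B => nP n B + nP j B by apply/funext => B;rewrite /nP PoszD mulrDl.
 exact: osecM.
have -> : f * g - s * r = f * (g - r) + r * (f - s) by ring.
have Or : oge G 0 r by have := or_ G dG Gp;rewrite nP_G.
have Of : oge G 0 f by apply/(oge0 _ dG);exact: T_lr hf.
have sJ := oge_ksub (1 - 0) dG.
by apply: (ksubD sJ);rewrite -[1 - 0]add0r;apply: ogeM.
Qed.

Lemma T_cst c : T 0 (cst c).
move=> Gp;exists (cst c);last by rewrite subrr;left.
by move=> B dB _;have := cst_hs0 c dB.
Qed.
Lemma T_mono n j : (n <= j)%N -> T n `<=` T j.
move=> le;apply: Tsp_mono => p B _;rewrite ler_wpM2r//. Qed.

Lemma nonconstant_T1 : exists2 th, T 1 th & forall c, ~ m (th - cst c).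
apply: contrapT => no;have sJ := oge_ksub 1 dG.
have [|j le hj] := hqd_fin (e := fun _ : 'I_1 => 1) (T_ksub 1) sJ (@T_sub_m 1).
 move=> f Tf;apply: contrapT => h;apply: no;exists f => // c mc;apply: h.
 by exists (const_mx c);rewrite /lcomb big_ord1 mxE mulr1;apply/oge1.
have := hqd_uniq (T_ksub 1) sJ (T_dim 1) hj;lia.
Qed.

Section Coordinate.
Variable th : K.
Hypotheses (Tth : T 1 th) (nth : forall c, ~ m (th - cst c)).
Local Notation ev P := (map_poly cst P).[th].
Let Oth : lr G th := T_lr Tth.

Lemma ev_neq0 P : P != 0 -> ~ m (ev P).
by move=> nP' /(poly_root_mod pG nP' Oth) [c /nth]. Qed.

Lemma T_exp i : T i (th ^+ i).
elim: i => [|i IH];first by rewrite expr0 -(rmorph1 cst);exact: T_cst.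
rewrite exprS -add1n;exact: T_mul.
Qed.

Lemma T_poly n P : (size P <= n.+1)%N -> T n (ev P).
move=> sP;rewrite (horner_coef_wide (n := n.+1)) ?size_map_poly//.
refine (@ksub_sum _ _ _ _ _ (T_ksub n) _) => i _;rewrite coef_map.
apply: (ksubZ _ (T_ksub n));apply: T_mono (T_exp i);exact: ltn_ord i.
Qed.

Lemma ev_lr P : lr G (ev P). exact: T_lr (T_poly (leqSpred _)). Qed.

(* Polynomials in [th] which are restrictions of functions with poles on the chain only. *)
Definition extends P := exists n F, hs (nP n) F /\ m (ev P - F).

Lemma evD P Q : ev (P + Q) = ev P + ev Q. by rewrite rmorphD hornerD. Qed.
Lemma evM P Q : ev (P * Q) = ev P * ev Q. by rewrite rmorphM hornerM. Qed.
Lemma evZ c P : ev (c *: P) = cst c * ev P. by rewrite map_polyZ hornerZ. Qed.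

Lemma nP_lr n F : hs (nP n) F -> lr G F. by move/hs_T/T_lr. Qed.

Lemma extendsD P Q : extends P -> extends Q -> extends (P + Q).
move=> [n [F [hF mF]]] [n' [F' [hF' mF']]];exists (maxn n n'), (F + F');split.
 apply: (ksubD (hs_ksub _));[apply: nP_mono hF|apply: nP_mono hF'];[exact: leq_maxl|exact: leq_maxr].
rewrite evD opprD addrACA;exact: maxD.
Qed.

Lemma extendsM P Q : extends P -> extends Q -> extends (P * Q).
move=> [n [F [hF mF]]] [n' [F' [hF' mF']]];exists (n + n')%N, (F * F');split;first exact: nPM.
rewrite evM;have -> : ev P * ev Q - F * F' = ev P * (ev Q - F') + F' * (ev P - F) by ring.
apply: (maxD pG);apply: maxM => //;[exact: ev_lr|exact: nP_lr hF'].
Qed.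

Lemma extendsC c : extends c%:P.
exists 0%N, (cst c);split;last by rewrite map_polyC hornerC subrr;exact: max0.
by move=> B dB;have := cst_hs0 c dB.
Qed.
Lemma extendsZ c P : extends P -> extends (c *: P).
move=> h;rewrite -mul_polyC;apply: extendsM => //;exact: extendsC. Qed.

Lemma extends_comp P Q : extends Q -> extends (P \Po Q).
move=> hQ;rewrite comp_polyE;apply: big_ind => [||i _];[|exact: extendsD|].
 rewrite -polyC0;exact: extendsC.
apply: extendsZ;elim: nat_of_ord => [|j IH];first by rewrite expr0 -polyC1;exact: extendsC.
rewrite exprS;exact: extendsM.
Qed.

(** By [hs_growth] and injectivity, the restrictions from X have codimension at most q in every
    [T n], so q + 1 polynomials are dependent modulo them. *)
Lemma extends_dependent : exists q : nat, forall h : 'I_q.+1 -> {poly k}, exists2 c : 'I_q.+1 -> k,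
 exists i, c i != 0 & extends (\sum_i c i *: h i).
have [q hq] := hs_growth dA dC dA' sA sC sA' gA gC gA' wA wC wA' wAC wCA' wAA'.
exists q => h;pose n := (\max_i size (h i))%N.
have sh i : (size (h i) <= n.+1)%N by apply: leqW;exact: leq_bigmax.
have [c hc le] := hq n.
have sJ := oge_ksub 1 dG;have sH := hs_ksub (nP n).
have s0 : ksub [set 0].
 by split=> [|_ _ -> ->|a _ ->];rewrite ?addr0 ?mulr0.
have h01 : hqd (hs (fun=> 0)) [set 0] 1.
 apply/(hqdP _ (hs_ksub _) s0);exists (fun=> 1);split.
 - move=> _;rewrite -(rmorph1 cst);exact: cst_hs0.
 - move=> f /hs0_const [a ->];exists (const_mx a);rewrite /lcomb big_ord1 mxE mulr1.
  by rewrite subrr.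
 - move=> a;rewrite /lcomb big_ord1 mulr1 => /eqP;rewrite fmorph_eq0 => /eqP e.
  by apply/rowP => i;rewrite zmodp.ord1 mxE.
have hn : hqd (hs (nP n)) (hs (nP n) `&` oge G 1) (c + 1).
 have -> : hs (nP n) `&` oge G 1 = [set 0].
  apply/seteqP;split=> f;last by move=> ->;split;[exact: ksub0|left].
  move=> [hf /(oge1 _ dG) mf];exact: restrict_inj hf mf.
 apply: hqd_add hc h01;try exact: hs_ksub;first exact: s0.
  move=> f ->;exact: ksub0 (hs_ksub _).
 exact: hs_mono => B dB.
have hS := hqd_sum sH sJ hn;set S := [set f | _] in hS.
have sS : ksub S.
 split=> [|f g [a Aa Ja] [b Ab Jb]|c1 f [a Aa Ja]].
 - exists 0;[exact: ksub0|rewrite subr0;exact: ksub0].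
 - exists (a + b);[exact: (ksubD sH)|rewrite opprD addrACA;exact: ksubD].
 - exists (cst c1 * a);[exact: (ksubZ _ sH)|rewrite -mulrBr;exact: ksubZ].
have JS : oge G 1 `<=` S by move=> Jf;exists 0;[exact: ksub0|rewrite subr0].
have ST : S `<=` T n.
 move=> f [a /hs_T Ta Ja];rewrite -[f](subrK a);apply: (ksubD (T_ksub n)) => //;exact: T_sub_m.
have [m1 [m2 [h1 h2 e]]] := hqd_split (T_ksub n) sS sJ JS ST (T_dim n).
have em2 := hqd_uniq sS sJ h2 hS.
pose e' i := ev (h i).
have : ~ (forall c : 'rV[k]_q.+1, S (lcomb e' c) -> c = 0).
 move=> fr;have := hqd_free (T_ksub n) sS ST h1 (fun i => T_poly (sh i)) fr;lia.
move=> /existsNP [c1 /not_implyP [[F hF mF] nc]];exists (fun i => c1 0 i).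
 apply: contrapT => no;apply: nc;apply/rowP => i;rewrite mxE;apply: contrapT => /eqP nz.
 by apply: no;exists i.
exists n, F;split=> //;apply/(oge1 _ dG);move: mF;congr (oge G 1 (_ - F)).
rewrite rmorph_sum horner_sum;apply: eq_bigr => i _;by rewrite evZ.
Qed.

(* The conductor of the ring of extendable polynomials. *)
Lemma conductor : exists2 f : {poly k}, f != 0 & forall P, extends (f * P).
have [q hq] := extends_dependent.
(* Some nonconstant g extends. Over k[g] all polynomials are generated by the X^i with i below d =
   deg g, and each of these has a nonzero multiplier r_i(g) for which the product extends. The
   product of the multipliers is the conductor element. *)
have [g [hg sg]] : exists g : {poly k}, extends g /\ (1 < size g)%N.
 have [c [i0 ni] h] := hq (fun i => 'X^(i.+1));exists (\sum_i c i *: 'X^(i.+1));split=> //.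
 rewrite ltnNge;apply/negP => /size1_polyC e;case/eqP: ni.
 have := congr1 (fun r : {poly k} => r`_i0.+1) e;rewrite coefC coef_sum (bigD1 i0)//= big1 ?addr0.
  by rewrite coefZ coefXn eqxx mulr1.
 move=> i ni;rewrite coefZ coefXn eqSS [(i0 : nat) == i]eq_sym;have -> : (i == i0 :> nat) = false by apply: negbTE.
 by rewrite mulr0.
pose d := (size g).-1;have sgd : size g = d.+1 by rewrite prednK// ltnW.
have : g != 0 by rewrite -size_poly_gt0 ltnW.
have exi (i : nat) : exists2 r : {poly k}, r != 0 & extends ((r \Po g) * 'X^i).
 have [c [i0 ni] h] := hq (fun j => g ^+ j * 'X^i).
 exists (\poly_(j < q.+1) c (inord j)).
  apply: contraNneq ni => e;have : (\poly_(j < q.+1) c (inord j))`_i0 = 0 by rewrite e coef0.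
  by rewrite coef_poly ltn_ord inord_val => ->.
 move: h;congr extends;rewrite poly_def raddf_sum /= mulr_suml.
 by apply: eq_bigr => j _;rewrite comp_polyZ comp_Xn_poly inord_val scalerAl.
have [r hr] : exists r : nat -> {poly k}, forall i, r i != 0 /\ extends ((r i \Po g) * 'X^i).
 suff : forall i, exists r : {poly k}, r != 0 /\ extends ((r \Po g) * 'X^i) by move=> /choice [r h];exists r.
 by move=> i;have [r n h] := exi i;exists r.
pose f := \prod_(i < d) (r i \Po g).
have ncomp i : r i \Po g != 0.
 by have [n _] := hr i;rewrite comp_poly_eq0.
exists f;first by rewrite /f;apply/prodf_neq0 => i.
have fX (i : 'I_d) : extends (f * 'X^i).
 rewrite /f (bigD1 i)//= mulrAC;apply: extendsM;first by have [] := hr i.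
 apply: big_ind => [||j _];[|exact: extendsM|exact: extends_comp].
 rewrite -polyC1;exact: extendsC.
move=> P;have [N] := ubnP (size P);elim: N P => // N IH P lt.
have [le|gt] := leqP (size P) d.
 rewrite -[P]coefK poly_def mulr_sumr;apply: big_ind => [||i _];[|exact: extendsD|].
  rewrite -polyC0;exact: extendsC.
 rewrite -scalerAr;apply: extendsZ;exact: (fX (Ordinal (leq_trans (ltn_ord i) le))).
pose Q := (lead_coef P / lead_coef g) *: 'X^((size P).-1 - d).
have nlg : lead_coef g != 0 by rewrite lead_coef_eq0.
have nP' : P != 0 by rewrite -size_poly_gt0;apply: leq_ltn_trans gt.
have -> : f * P = g * (f * Q) + f * (P - Q * g) by ring.
have sQ : (size Q <= ((size P).-1 - d).+1)%N.
 by apply: leq_trans (size_scale_leq _ _) _;rewrite size_polyXn.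
apply: extendsD;first by apply: extendsM => //;apply: IH;lia.
apply: IH;have sQg : (size (Q * g)%R <= size P)%N.
 apply: leq_trans (size_polyMleq _ _) _;lia.
apply: (@leq_trans (size P)) => //.
have le2 : (size (P - Q * g)%R <= size P)%N.
 by apply: leq_trans (size_polyD _ _) _;rewrite geq_max leqnn size_polyN.
rewrite ltn_neqAle le2 andbT;apply/eqP => e.
have : lead_coef (P - Q * g) = 0.
 rewrite lead_coefE e coefB -scalerAl coefZ coefXnM.
 have -> : ((size P).-1 < (size P).-1 - d)%N = false by lia.
 have -> : ((size P).-1 - ((size P).-1 - d))%N = (size g).-1 by lia.
 by rewrite divfK// subrr.
by move/eqP;rewrite lead_coef_eq0 -size_poly_eq0 e size_poly_eq0 (negbTE nP').
Qed.

(** The pole order on the chain is governed by the degree of the restriction to G: a drop of the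
    latter is detected at the point where G meets A', and then propagates along the chain by
    [strip]. *)
Lemma degree_step n F : hs (nP n.+1) F -> T n F -> hs (nP n) F.
move=> hF TF;have [->|nF] := eqVneq F 0;first exact: ksub0 (hs_ksub _).
have fN := fin_nP n.+1;have sN : pdiv_supp (nP n.+1) := @supp_nP n.+1.
suff h : hs (subB (nP n.+1) A') F.
 have := strip fN sN _ _ h;rewrite !dg_nP nP_step;apply;lia.
have [le|gt] := leP (- n%:Z) (ord A' F).
 rewrite -(hs_cap _ dA');split=> //;right;rewrite /nP PL_A' mulr1;lia.
have [p A'p Gp] : exists2 p, A' p & G p.
 apply: I_meet => //;[exact/nesym|rewrite -wtE ?wA'G//;exact/nesym].
have nAp : ~ A p by move=> Ap;apply: I_disjoint dA dG _ _ Ap Gp;[exact/nesym|rewrite -wtE//;exact/nesym].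
have nCp : ~ C p by move=> Cp;apply: I_disjoint dC dG _ _ Cp Gp;[exact/nesym|rewrite -wtE//;exact/nesym].
have Xp := pdiv_sub dG Gp.
have [u lu] := leq_ex dA' A'p;have [Ou mu nu _] := lu.
have PLp B : B p -> cD PL B = ((B == A') : nat)%:Z.
 move=> Bp;rewrite PLE /cdiv.
 by case: (B =P A) Bp => [-> //|_];case: (B =P C) => [->|_].
have ou B : pdiv B -> B p -> ord B u = ((B == A') : nat)%:Z by move=> dB Bp;exact: leq_ord dB dA' Bp A'p lu.
(* [phi] clears the pole of F of order n + 1 along A'. The smaller pole on G makes it vanish at p,
   on some curve other than A'. The divisor (n+1)P + div F has degree 0 on A' and contains a curve
   meeting A', so it contains A'. *)
pose phi := F * u ^+ n.+1.
have nphi : phi != 0 by rewrite mulf_neq0// expf_neq0.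
have ophi B : pdiv B -> B p -> ord B phi = ord B F + nP n.+1 B.
 by move=> dB Bp;rewrite ordM ?expf_neq0// ordX// ou// /nP PLp.
have Ophi : O_at p phi.
 apply: hartogs => // B dB Bp;right;rewrite ophi//;have /ogeE := hF B dB;lia.
have [s os ms] := TF p Gp.
have Osu : O_at p (s * u ^+ n).
 apply: hartogs => // B dB Bp;have := os B dB Bp;rewrite oge_mulr ?expf_neq0// ordX// ou//.
 by rewrite /nP PLp// sub0r.
have mphi : mx p phi.
 have Od : O_at p (phi - u * (s * u ^+ n)) by apply: (lringB Xp) => //;exact: (lringM Xp).
 rewrite -[phi](subrK (u * (s * u ^+ n)));apply: (maxD Xp);last first.
  rewrite mulrC;apply: (maxM Xp) => //;exact: (mi_at dA' A'p Ou).
 apply: (mi_at dG Gp Od);move/(oge1 _ dG): ms => ms.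
 have -> : phi - u * (s * u ^+ n) = u ^+ n.+1 * (F - s) by rewrite /phi exprS;ring.
 apply: maxM => //;apply: (lringX pG);exact: (lr_at dG Gp).
have [x1 [x2 lx]] := hX.2 p Xp.
have [Q [pQ Qphi nQ]] := prime_over Xp lx hX.1 mphi nphi.
have [B [dB Bp hB]] := prime_divisor_of Xp lx pQ (ex_intro2 _ _ phi Qphi nphi) nQ.
have o1 : 1 <= ord B phi by apply/mi_ord/hB.
have nA'B : A' <> B.
 move=> e;subst B;move: o1;rewrite ophi// /nP PL_A' mulr1;lia.
apply: section_component => //;right;split.
 rewrite dg_nP wA';lia.
by exists B, p;rewrite pdvE// addrC -ophi.
Qed.

Lemma degree_bound n d P F : (size P <= d.+1)%N -> hs (nP n) F -> m (ev P - F) -> hs (nP d) F.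
move=> sP;have [le hF _|lt] := leqP n d;first exact: nP_mono hF.
move: lt => /ltnW /subnKC <-;elim: (n - d)%N => [|i IH] hF mF;first by rewrite addn0 in hF.
apply: IH => //;apply: degree_step;first by rewrite addnS in hF.
apply: (T_mono (leq_addr i d));have -> : F = ev P - (ev P - F) by rewrite subKr.
apply: (ksubB (T_ksub d));[exact: T_poly|exact: T_m].
Qed.
End Coordinate.

(** [H i] extends th^i f with poles on at most i + e chains, and x = [H 1] / [H 0] satisfies x^i
    [H 0] = [H i] because both sides agree on G. A pole of x worse than one chain would violate the
    bound i + e for large i. *)
Lemma pencil : exists2 x, hs (cD PL) x & ~ hs (fun=> 0) x.
have [th Tth nth] := nonconstant_T1;pose ev P := (map_poly cst P).[th].
have [f nf hf] := conductor Tth.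
have Oth := T_lr Tth.
pose e := (size f).-1;have sf : size f = e.+1 by rewrite prednK// size_poly_gt0.
have [H hH] : exists H : nat -> K, forall i, hs (nP (i + e)) (H i) /\ m (th ^+ i * ev f - H i).
 suff : forall i, exists Hi, hs (nP (i + e)) Hi /\ m (th ^+ i * ev f - Hi) by move=> /choice [H h];exists H.
 move=> i;have [n [Hi [hHi mHi]]] := hf 'X^i;exists Hi.
 have e1 : (map_poly cst (f * 'X^i)).[th] = th ^+ i * ev f.
  by rewrite rmorphM /= map_polyXn hornerM hornerXn mulrC.
 split;last by rewrite -e1.
 apply: (@degree_bound th Tth n (i + e)%N (f * 'X^i) Hi _ hHi mHi).
 apply: leq_trans (size_polyMleq _ _) _;rewrite size_polyXn sf;lia.
have nH0 : H 0%N <> 0.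
 move=> e0;have [_] := hH 0%N;rewrite mul1r e0 subr0.
 exact: ev_neq0.
have /eqP nH0' := nH0;pose x := H 1%N / H 0%N.
have OH i : lr G (H i) by have [/nP_lr] := hH i.
have Oef : lr G (ev f) by exact: ev_lr.
have Othi i : lr G (th ^+ i) by exact: lringX.
have key i : x ^+ i * H 0%N = H i.
 elim: i => [|i IH];first by rewrite mul1r.
 have e1 : H 1%N * H i = H i.+1 * H 0%N.
  apply/eqP;rewrite -subr_eq0;apply/eqP;apply: (@restrict_inj ((1 + e) + (i + e))).
  apply: (ksubB (hs_ksub _));first by apply: nPM;[have [] := hH 1%N|have [] := hH i].
  have -> : ((1 + e) + (i + e) = (i.+1 + e) + (0 + e))%N by lia.
  by apply: nPM;[have [] := hH i.+1|have [] := hH 0%N].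
  have [[_ m1] [_ mi']] := (hH 1%N, hH i);have [[_ mS] [_ m0]] := (hH i.+1, hH 0%N).
  have -> : H 1%N * H i - H i.+1 * H 0%N =
  (- (H i * (th ^+ 1 * ev f - H 1%N)) - th ^+ 1 * ev f * (th ^+ i * ev f - H i)) +
  (H 0%N * (th ^+ i.+1 * ev f - H i.+1) + th ^+ i.+1 * ev f * (th ^+ 0 * ev f - H 0%N)).
  rewrite (exprS th i) expr1 expr0;ring.
  apply: (maxD pG);[apply: (maxB pG);[apply: (maxN pG)|]|apply: (maxD pG)];
  apply: maxM => //;exact: lringM.
 by rewrite exprS -mulrA IH mulrAC e1 mulfK.
have nx : x != 0.
 have [_ m1] := hH 1%N;apply/eqP => x0;have := key 1%N;rewrite x0 mul0r => e0.
 rewrite -e0 subr0 in m1;have [m2|] := max_prime pG Oth Oef m1;last exact: ev_neq0.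
 by apply: (nth 0);rewrite rmorph0 subr0.
exists x.
 move=> B dB;right;rewrite -[cD PL B]mul1r -/nP leNgt;apply/negP => lt.
 (* Large enough to outweigh the fixed order of [H 0] and the e extra chains. *)
 pose j := (absz (ord B (H 0%N)) + e * absz (cD PL B)).+1%N.
 have [hj _] := hH j;have nHj : H j != 0 by rewrite -key mulf_neq0// expf_neq0.
 have /(ogeE _ _ nHj) := hj B dB;rewrite -key ordM ?expf_neq0// ordX// /nP.
 have : 1 <= - cD PL B - ord B x by move: lt;rewrite /nP mul1r;lia.
 have jge : ord B (H 0%N) + e%:Z * cD PL B < j%:Z by have := PL_ge0 B;lia.
 have := PL_ge0 B;move: jge;move: (cD PL B) (ord B x) (ord B (H 0%N)) (j) => c o o0 i lt1 c0 r1.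
 rewrite PoszD => h.
 have jr : i%:Z <= i%:Z * (- c - o) by rewrite ler_peMr.
 move: h jr;lia.
move=> /hs0_const [c ec];have [_ m1] := hH 1%N;have [_ m0] := hH 0%N.
have : m ((th - cst c) * ev f).
 have -> : (th - cst c) * ev f = (th ^+ 1 * ev f - H 1%N) - cst c * (th ^+ 0 * ev f - H 0%N).
  rewrite -key -ec expr0;ring.
 apply: maxB => //;apply: maxM => //;exact: lring_cst.
move/(max_prime pG (lringB pG Oth (lring_cst pG c)) Oef) => [].
 exact: nth.
exact: ev_neq0.
Qed.
End Chain.
End Pencil.

(** * The cycle of negative curves *)

Local Notation I B G := (@curve_inter k X B G).

Section Intersections.
Implicit Types (B : set pt) (p q : pt) (f g t u : K) (D : div).

(** Transversality makes the sum of the two ideals the maximal ideal, which has colength one. *)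
Lemma meet_once B B' : pdiv B -> pdiv B' -> meet_transversally_once B B' -> I B B' = 1.
move=> dB dB' [p [e h]];have [Bp B'p] : (B `&` B') p by rewrite e.
have Xp := pdiv_sub dB Bp;have pp := prime_pt Xp.
have sub (E : set pt) : E p -> [set p] `<=` E by move=> h1 _ ->.
have es : sum_local_ideals B B' p = mx p.
 apply/seteqP;split=> f;last exact: h.
 move=> [g [g' [hg hg' ->]]].
 have [Og mg] := (local_idealE g (pdiv_prime dB) pp (sub _ Bp)).1 hg.
 have [Og' mg'] := (local_idealE g' (pdiv_prime dB') pp (sub _ B'p)).1 hg'.
 apply: (maxD pp);[exact: (mi_at dB Bp)|exact: (mi_at dB' B'p)].
have sO := lring_ksub pp;have sM := max_ksub pp.
have h1 : hqd (O_at p) (mx p) 1.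
 apply/(hqdP _ sO sM);exists (fun=> 1);split.
 - move=> _;exact: lring1.
 - move=> f Of;have [c mc] := value_at Xp Of;exists (const_mx c).
  by rewrite /lcomb big_ord1 mxE mulr1.
 - move=> c;rewrite /lcomb big_ord1 mulr1 => mc;apply/rowP => i;rewrite zmodp.ord1 mxE.
  apply: contrapT => /eqP nc;apply: (max_nunit pp mc);rewrite ?fmorph_eq0//.
  rewrite -fmorphV;exact: lring_cst.
have e1 : local_mult B B' p = 1%N.
 rewrite /local_mult es;apply: (hqd_uniq sO sM _ h1).
 by apply: xgetPex;exists 1%N.
rewrite (@curve_interE B' B [:: p])//;first by rewrite big_seq1 e1.
move=> q;rewrite inE;split=> [/eqP -> //|[Bq B'q]].
by have : (B `&` B') q by [];rewrite e => ->.
Qed.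
Lemma disjoint_I B B' : B `&` B' = set0 -> I B B' = 0.
by move=> e;rewrite /curve_inter e fsbig_set0. Qed.

Lemma neg_curve_facts n B : (0 < n)%N -> neg_curve n B ->
 [/\ pdiv B, smooth_curve B, exists t, generator B t & wt B B = - n%:Z].
move=> n0 [dB sB [t [Ot tr gen]] e];split=> //;first by exists t.
rewrite -dg_curve -ip_curve;apply: (interP) => //;try exact: fin_supp_curve.
- by move=> C;rewrite /cdiv;case: (C =P B) => [->|].
- by move=> C;rewrite /cdiv;case: (C =P B) => [->|].
- by rewrite oppr_eq0;case: n n0 {e}.
Qed.
End Intersections.

(** * Derivations *)

Section Derivations.
Implicit Types (p : pt) (f g t u v : K) (D E : K -> K).

Section One.
Variable D : K -> K.
Hypothesis hD : der D.
Let DD f g : D (f + g) = D f + D g. by have [h _ _] := hD. Qed.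
Let DM f g : D (f * g) = D f * g + f * D g. by have [_ h _] := hD. Qed.
Let DC c : D (cst c) = 0. by have [_ _ h] := hD. Qed.
Lemma der0 : D 0 = 0. by have := DC 0;rewrite rmorph0. Qed.
Lemma der1 : D 1 = 0. by have := DC 1;rewrite rmorph1. Qed.
Lemma derN f : D (- f) = - D f.
by apply/eqP;rewrite -subr_eq0 opprK -DD addNr der0. Qed.
Lemma derB f g : D (f - g) = D f - D g. by rewrite DD derN. Qed.
Lemma der_sum (I : Type) (r : seq I) (P : pred I) (F : I -> K) :
 D (\sum_(i <- r | P i) F i) = \sum_(i <- r | P i) D (F i).
exact: (big_morph D DD der0). Qed.
Lemma derV f : f != 0 -> D f^-1 = - D f / f ^+ 2.
move=> nf;have : D (f * f^-1) = 0 by rewrite mulfV// der1.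
rewrite DM => /eqP;rewrite addrC addr_eq0 => /eqP e.
by apply: (mulfI nf);rewrite e;field.
Qed.
Lemma der_div f g : g != 0 -> D (f / g) = (D f - f / g * D g) / g.
by move=> ng;rewrite DM derV//;field. Qed.
End One.

Lemma der_add D E : der D -> der E -> der (fun f => D f + E f).
move=> [a b c] [a' b' c'];split=> [f g|f g|x];rewrite ?a ?a' ?b ?b' ?c ?c';ring.
Qed.
Lemma der_scale D a : der D -> der (fun f => a * D f).
move=> [h1 h2 h3];split=> [f g|f g|x];rewrite ?h1 ?h2 ?h3;ring.
Qed.

Section AtPoint.
Variables (p : pt) (u v : K).
Hypotheses (Xp : Xpts p) (luv : local_params p u v).
Local Notation O := (@O_at k X p).
Let pp := prime_pt Xp.
Let Ou := Ou_at luv.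
Let Ov := Ov_at luv.

(* The coordinate functions generate O_p up to units, so their derivatives have a common denominator. *)
Lemma der_denominator D : der D -> exists h, [/\ O h, h != 0 & forall f, O f -> O (h * D f)].
move=> hD;have [DD DM DC] := hD;have [i [hi hy nyp]] := pt_coordinate p.
have gy := gev_neq0 pp hy nyp;pose z j := gev 'X_j / gev 'X_i.
have Oz j : O (z j) by have [h _] := frac_in pp (homogX1 j) hy nyp.
have [b hb] : exists b : 'I_(pdim X).+1 -> K, forall j, [/\ O (b j), b j != 0 & O (b j * D (z j))].
 suff : forall j, exists b, [/\ O b, b != 0 & O (b * D (z j))] by move=> /choice [b h];exists b.
 move=> j;have [a [b [Oa Ob nb e]]] := frac_at (D (z j)) Xp;exists b.
 by rewrite e mulrC divfK.
pose h := \prod_j b j.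
have Oprod (P : pred 'I_(pdim X).+1) : O (\prod_(j | P j) b j).
 by apply: big_ind => [||j _];[exact: lring1|exact: lringM|have [] := hb j].
have Oh : O h by exact: Oprod.
have nh : h != 0 by apply/prodf_neq0 => j _;have [] := hb j.
exists h;split=> //.
have hz j : O (h * D (z j)).
 rewrite /h (bigD1 j)//= mulrAC;apply: (lringM pp);last exact: Oprod.
 by have [] := hb j.
pose A : set K := [set f | O f /\ O (h * D f)].
have A1 : A 1 by split;[exact: lring1|rewrite der1// mulr0;exact: lring0].
have AM f g : A f -> A g -> A (f * g).
 move=> [Of hf] [Og hg];split;first exact: lringM.
 rewrite DM mulrDr mulrA mulrCA;apply: (lringD pp);apply: lringM => //.
have AD f g : A f -> A g -> A (f + g).
 move=> [Of hf] [Og hg];split;[exact: lringD|rewrite DD mulrDr;exact: lringD].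
have AC c : A (cst c) by split;[exact: lring_cst|rewrite DC mulr0;exact: lring0].
have Aform d (F : form) : F \is d.-homog -> A (fq 'X_i F d).
 move=> hF;rewrite (mpolyE F) gev_sum mulr_suml big_seq.
 apply: big_ind => [||mm hm];[by rewrite -(rmorph0 cst)|exact: AD|].
 rewrite gevZ -mulrA;apply: (AM) => //.
 have -> : gev 'X_[mm] / gev 'X_i ^+ d = \prod_j z j ^+ mm j.
  move/dhomogP: hF => /(_ _ hm) <-.
  rewrite mpolyXE_id /geval rmorph_prod /= mdegE -prodrXr -prodf_div.
  apply: eq_bigr => j _;rewrite rmorphXn expr_div_n;congr (_ ^+ _ / _).
 apply: big_ind => [||j _];[exact: A1|exact: AM|elim: (mm j) => [|n IH];first by rewrite expr0].
 by rewrite exprS;apply: (AM).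
move=> f /O_atP [d [F [G [hF hG nG ->]]]].
have nGp : ~ van G [set p] by move/vanishes_pt/eqP;rewrite (negbTE nG).
have gG := gev_neq0 pp hG nGp.
have [OF hF1] := Aform d F hF;have [OG hG1] := Aform d G hG.
have [_ mG] := frac_in pp hG hy nyp.
have [OGi _] := lring_inv pp OG (fun m => nGp (mG.1 m)).
set a := gev F / _ in OF hF1;set b0 := gev G / _ in OG hG1 OGi.
have nb0 : b0 != 0 by rewrite mulf_neq0// invr_eq0 expf_neq0.
have -> : gev F / gev G = a / b0.
 by rewrite /a /b0;move: (gev 'X_i ^+ d) (expf_neq0 d gy) => w nw;field;rewrite nw.
rewrite der_div// mulrA mulrBr;apply: lringM => //;apply: lringB => //.
rewrite mulrCA;apply: lringM => //;exact: lringM.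
Qed.

Lemma expand f : O f -> exists c a b, [/\ O a, O b & f = cst c + a * u + b * v].
move=> Of;have [c mc] := value_at Xp Of;have [_ _ h] := luv.
have [a [b [Oa Ob e]]] := h _ mc;exists c, a, b.
by rewrite -addrA -e addrC subrK.
Qed.

(** Let h be a common denominator of D. Expanding f to first order in u, v shows inductively that h
    D f lies in (h) + m^n for every n, hence in (h) by Krull. *)
Lemma der_tangent D : der D -> O (D u) -> O (D v) -> tangent p D.
move=> hD ODu ODv;split=> // f0 Of0;have [DD DM DC] := hD.
have [h [Oh nh hh]] := der_denominator hD.
have O1 : O 1 := lring1 pp.
have OB a b : O a -> O b -> O (a - b) := @lringB _ pp a b.
have OM a b : O a -> O b -> O (a * b) := @lringM _ pp a b.
have [b Ob eb] : odvd O h (h * D f0).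
 apply: (krull_at Xp luv (oideal_dvd O1 OB OM Oh)) => [|n];first exact: hh.
 elim: n f0 Of0 => [|n IH] f Of.
  exists (h * D f);first exact: hh.
  exists 0;rewrite ?subrr ?mul0r//;exact: lring0.
 have [c [a [b [Oa Ob ->]]]] := expand Of.
 have [w1 hw1 [d1 Od1 e1]] := IH _ Oa;have [w2 hw2 [d2 Od2 e2]] := IH _ Ob.
 exists (u * w1 + v * w2);first by exists w1, w2.
 exists (a * D u + b * D v + u * d1 + v * d2).
  do 3 (apply: (lringD pp);last exact: OM);exact: OM.
 have E1 : h * D a = d1 * h + w1 by rewrite -e1 subrK.
 have E2 : h * D b = d2 * h + w2 by rewrite -e2 subrK.
 rewrite !DD !DM DC.
 have -> : h * (0 + (D a * u + a * D u) + (D b * v + b * D v)) =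
  (h * D a) * u + (h * D b) * v + h * (a * D u + b * D v) by ring.
 rewrite E1 E2;ring.
by have -> : D f0 = b by apply: (mulfI nh);rewrite eb mulrC.
Qed.

(** By the same expansion, h D f lies in every power of the maximal ideal. *)
Lemma der_zero D : der D -> D u = 0 -> D v = 0 -> forall f, D f = 0.
move=> hD Du Dv;have [DD DM DC] := hD.
have [h [Oh nh hh]] := der_denominator hD.
have main f : O f -> D f = 0.
 move=> Of;apply: contrapT => /eqP nz.
 have nhD : h * D f != 0 by rewrite mulf_neq0.
 have [n []] := finite_order Xp luv (hh f Of) nhD.
 elim: n f Of {nz nhD} => [|n IH] f Of;first exact: hh.
 have [c [a [b [Oa Ob ->]]]] := expand Of.
 exists (h * D a), (h * D b);split;[exact: IH|exact: IH|].
 rewrite !DD !DM DC Du Dv;ring.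
move=> f;have [a [b [Oa Ob nb ->]]] := frac_at f Xp.
by rewrite der_div// !main// mulr0 subr0 mul0r.
Qed.

Lemma der_eq D E : der D -> der E -> D u = E u -> D v = E v -> forall f, D f = E f.
move=> hD hE eu ev f;apply/eqP;rewrite -subr_eq0;apply/eqP.
have hF : der (fun f => D f + -1 * E f) by apply: der_add => //;exact: der_scale.
have h := der_zero hF (etrans (congr1 (+%R _) (mulN1r _)) (etrans (congr1 (fun z => z - E u) eu) (subrr _))) (etrans (congr1 (+%R _) (mulN1r _)) (etrans (congr1 (fun z => z - E v) ev) (subrr _))) f.
by rewrite mulN1r in h.
Qed.

(** If the determinant in u, v vanished, combinations of D and E would kill both u and v, hence
    every function. *)
Lemma det_neq0 D E a b : der D -> der E -> D a * E b - E a * D b != 0 -> D u * E v - E u * D v != 0.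
move=> hD hE;apply: contraNneq => e0.
have dcomb (x y : K) : der (fun f => x * D f + (- y) * E f) by apply: der_add;exact: der_scale.
have e1 f : E v * D f = D v * E f.
 apply/eqP;rewrite -subr_eq0;apply/eqP;rewrite -mulNr.
 apply: (der_zero (dcomb (E v) (D v)));last by ring.
 rewrite -[RHS]e0;ring.
have e2 f : E u * D f = D u * E f.
 apply/eqP;rewrite -subr_eq0;apply/eqP;rewrite -mulNr.
 apply: (der_zero (dcomb (E u) (D u)));first by ring.
 rewrite -[RHS]oppr0 -e0;ring.
set del := D a * E b - E a * D b.
have h1 : E v * del = 0.
 have -> : E v * del = E v * D a * E b - E v * D b * E a by rewrite /del;ring.
 rewrite !e1;ring.
have h2 : E u * del = 0.
 have -> : E u * del = E u * D a * E b - E u * D b * E a by rewrite /del;ring.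
 rewrite !e2;ring.
apply/eqP;apply: contrapT => /eqP/negP nd.
have nd' : del != 0 by apply/negP.
have Ev : E v = 0 by apply/eqP;move/eqP: h1;rewrite mulf_eq0 (negbTE nd') orbF.
have Eu : E u = 0 by apply/eqP;move/eqP: h2;rewrite mulf_eq0 (negbTE nd') orbF.
by case/eqP: nd';rewrite /del !(der_zero hE Eu Ev) mulr0 mul0r subrr.
Qed.

Definition partials Du Dv := [/\ tangent p Du, tangent p Dv & [/\ Du u = 1, Du v = 0, Dv u = 0 & Dv v = 1]].

Lemma partials_ex D E a b : der D -> der E -> D a * E b - E a * D b != 0 -> exists Du Dv, partials Du Dv.
move=> hD hE h;have nd := det_neq0 hD hE h;set del := D u * E v - E u * D v in nd.
have dcomb (x y : K) : der (fun f => x * D f + y * E f) by apply: der_add;exact: der_scale.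
exists (fun f => E v / del * D f + - D v / del * E f), (fun f => - E u / del * D f + D u / del * E f).
have e1 : E v / del * D u + - D v / del * E u = 1.
 by rewrite /del in nd *;field.
have e2 : E v / del * D v + - D v / del * E v = 0 by field.
have e3 : - E u / del * D u + D u / del * E u = 0 by field.
have e4 : - E u / del * D v + D u / del * E v = 1.
 by rewrite /del in nd *;field.
have O1 : O 1 := lring1 pp;have O0 : O 0 := lring0 pp.
split=> //;apply: der_tangent;rewrite ?e1 ?e2 ?e3 ?e4//.
Qed.

Section Partials.
Variables Du Dv : K -> K.
Hypothesis hp : partials Du Dv.

Lemma der_partials D f : der D -> D f = D u * Du f + D v * Dv f.
move=> hD;have [[hu _] [hv _] [e1 e2 e3 e4]] := hp.
have hE : der (fun f => D u * Du f + D v * Dv f) by apply: der_add;exact: der_scale.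
apply: (der_eq hD hE);rewrite ?e1 ?e2 ?e3 ?e4;ring.
Qed.

Lemma jacobian f g : mx p f -> mx p g -> unit_at [set p] (Du f * Dv g - Dv f * Du g) -> local_params p f g.
move=> mf mg [OJ nJ];have [[hu tu] [hv tv] [e1 e2 e3 e4]] := hp;have [mu mv hm] := luv.
have [DuD DuM _] := hu;have [DvD DvM _] := hv.
have [a1 [b1 [Oa1 Ob1 ef]]] := hm f mf;have [a2 [b2 [Oa2 Ob2 eg]]] := hm g mg.
have cf a b (Oa : O a) (Ob : O b) : mx p (Du (a * u + b * v) - a) /\ mx p (Dv (a * u + b * v) - b).
 rewrite DuD DvD !DuM !DvM e1 e2 e3 e4;split.
  have -> : Du a * u + a * 1 + (Du b * v + b * 0) - a = Du a * u + Du b * v by ring.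
  apply: (maxD pp);apply: (maxM pp) => //;exact: tu.
 have -> : Dv a * u + a * 0 + (Dv b * v + b * 1) - b = Dv a * u + Dv b * v by ring.
 apply: (maxD pp);apply: (maxM pp) => //;exact: tv.
have [cf1 cf2] := cf _ _ Oa1 Ob1;have [cg1 cg2] := cf _ _ Oa2 Ob2.
rewrite -ef in cf1 cf2;rewrite -eg in cg1 cg2.
have Of := max_sub mf;have Og := max_sub mg.
pose del := a1 * b2 - b1 * a2.
have Odel : O del by apply: (lringB pp);exact: lringM.
have ndel : ~ mx p del.
 move=> md;apply: nJ.
 have -> : Du f * Dv g - Dv f * Du g = Dv g * (Du f - a1) + a1 * (Dv g - b2) - (Du g * (Dv f - b1) + b1 * (Du g - a2)) + del.
  rewrite /del;ring.
 apply: (maxD pp) => //;apply: (maxB pp);apply: (maxD pp);apply: (maxM pp) => //;[exact: tv|exact: tu].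
have [Odi _] := lring_inv pp Odel ndel;have nd := lring_neq0 pp ndel.
have eu : u = b2 / del * f - b1 / del * g.
 rewrite ef eg;apply: (mulIf nd);rewrite {1}/del;field;exact: nd.
have ev : v = a1 / del * g - a2 / del * f.
 rewrite ef eg;apply: (mulIf nd);rewrite {1}/del;field;exact: nd.
split=> // w /hm [a [b [Oa Ob ->]]].
exists (a * (b2 / del) - b * (a2 / del)), (b * (a1 / del) - a * (b1 / del)).
have Od x : O x -> O (x / del) by move=> Ox;exact: lringM.
split;[apply: (lringB pp);apply: (lringM pp) => //;exact: Od|apply: (lringB pp);apply: (lringM pp) => //;exact: Od|].
rewrite {1}eu {1}ev;ring.
Qed.
End Partials.
End AtPoint.

(* The canonical divisor is a genuine one: the junk value 0 would have degree 0. *)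
Lemma canonical_exists (n : int) : degree X = n -> n != 0 -> exists W, is_canonical W /\ ip W W = n.
rewrite /degree => e nn;have [[W hW]|no] := pselect (exists W : set (ppoint k (pdim X)) -> int, is_canonical W).
 have hC : is_canonical (canonical_divisor (X := X)).
  by apply: (@xgetPex _ (fun=> 0) [set W | is_canonical W]);exists W.
 exists (canonical_divisor (X := X));split=> //;have [dW _] := hC.
 have [fW sW] := is_divisorP dW;exact: (interP).
have eW : canonical_divisor (X := X) = fun=> 0.
 by apply: xgetPN => W hW;apply: no;exists W.
exfalso;move: e;rewrite eW => e.
have f0 : @fin_supp (fun=> 0) by exists [::] => B.
have s0 : @pdiv_supp (fun=> 0) by move=> B.
have := interP f0 s0 f0 s0 e nn;rewrite (@ipE _ _ [::]) ?big_nil.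
 by move=> e0;rewrite -e0 in nn.
split=> // B.
Qed.
End Derivations.

(** * Local coordinates along the cycle *)

Local Notation O p := (@O_at k X p).

Section Charts.
Implicit Types (B : set pt) (p q : pt) (f g t u v w : K) (D : div).

Lemma O_ord p f : Xpts p -> f != 0 -> (forall B, pdiv B -> B p -> 0 <= ord B f) -> O p f.
move=> Xp nf h;apply: (hartogs Xp) => B dB Bp;right;exact: h. Qed.
Lemma mx_ord p f B : Xpts p -> f != 0 -> (forall B, pdiv B -> B p -> 0 <= ord B f) ->
 pdiv B -> B p -> 1 <= ord B f -> mx p f.
by move=> Xp nf h dB Bp o1;apply: (mi_at dB Bp (O_ord Xp nf h));apply/(mi_ord dB nf). Qed.

(** Intersection number one bounds the colength of (b) + I_B' by one, so this ideal is the maximal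
    one; u and v differ from the local equations by units. *)
Lemma params_of p B B' u v : pdiv B -> pdiv B' -> B <> B' -> B p -> B' p -> I B B' = 1 ->
 u != 0 -> v != 0 -> (forall G, pdiv G -> G p -> ord G u = ((G == B) : nat)%:Z) ->
 (forall G, pdiv G -> G p -> ord G v = ((G == B') : nat)%:Z) -> local_params p u v.
move=> dB dB' nB Bp B'p I1 nu nv ou ov.
have Xp := pdiv_sub dB Bp;have pp := prime_pt Xp.
have [b lb] := leq_ex dB Bp;have [b' lb'] := leq_ex dB' B'p.
have [Ob mb nb _] := lb;have [Ob' mb' nb' hb'] := lb'.
have asc x y (G : set pt) : pdiv G -> G p -> leq_at G p y -> x != 0 ->
  (forall H, pdiv H -> H p -> ord H x = ((H == G) : nat)%:Z) -> unit_at [set p] (x / y).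
 move=> dG Gp ly nx ox;have [_ _ ny _] := ly.
 apply: (unit_pt Xp);first by rewrite mulf_neq0 ?invr_eq0.
 move=> H dH Hp;rewrite (ordM dH) ?invr_eq0// (ordV)// ox// (leq_ord dH dG Hp Gp ly) subrr.
 by [].
have [Oe ne] := asc _ _ _ dB Bp lb nu ou;have [Oe' ne'] := asc _ _ _ dB' B'p lb' nv ov.
have [Oi _] := lring_inv pp Oe ne;have [Oi' _] := lring_inv pp Oe' ne'.
have mb0 := mi_at dB Bp Ob mb;have mb0' := mi_at dB' B'p Ob' mb'.
have mem x y : mx p y -> y != 0 -> O p (x / y) -> mx p x.
 move=> my ny Oxy;rewrite -(divfK ny x);exact: (maxM pp).
split;[exact: mem Oe|exact: mem Oe'|].
have nB'b : ~ mi B' b.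
 rewrite (mi_ord dB' nb) (leq_ord dB' dB B'p Bp lb).
 by case: (B' =P B) => // e;case: nB.
have hl := loclenP dB' B'p Ob nB'b;set n := loclen _ _ _ in hl.
have sJ : curve_ideal B' p b `<=` mx p.
 move=> f [g [h [Og Oh mh ->]]];apply: (maxD pp);first exact: (maxM pp).
 exact: (mi_at dB' B'p).
have sO := lring_ksub pp;have sM := max_ksub pp.
have sJk : ksub (curve_ideal B' p b) := oideal_ksub dB' B'p (curve_ideal_ideal dB' B'p Ob).
have n1 : (n <= 1)%N.
 have [l ul hl'] := meet_list dB' dB nB.
 have pl : p \in l by apply/hl'.
 have := curve_interE ul hl';rewrite I1 (bigD1_seq p)//= (local_multE dB' B'p dB Bp lb) -/n => e.
 have : n%:Z <= 1 by rewrite e lerDl;exact: sumr_ge0.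
 lia.
have [m [m' [h1 h2 e]]] := hqd_split sO sM sJk sJ (@max_sub _) hl.
have m0 : m != 0%N.
 apply/eqP => e0;apply: (max_not1 pp);apply: (hqd_eq sO sM (@max_sub _) h1 e0);exact: lring1.
have m'0 : m' = 0%N by lia.
move=> f /(hqd_eq sM sJk sJ h2 m'0) [g [h [Og Oh mh ->]]];have [a Oa ->] := hb' h Oh mh.
exists (g * (u / b)^-1), (a * (v / b')^-1);split;[exact: (lringM pp)|exact: (lringM pp)|].
by field;rewrite nv nb nb'.
Qed.

Lemma sum_one (s : seq (set pt)) (F : set pt -> int) B : uniq s -> (forall G, G \in s -> 0 <= F G) ->
 \sum_(G <- s) F G = 1 -> B \in s -> 1 <= F B -> F B = 1 /\ forall G, G \in s -> G != B -> F G = 0.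
move=> us F0;rewrite big_seq => e Bs FB.
move: e;rewrite -big_seq (bigD1_seq B)//= => e.
have h0 : 0 <= \sum_(i <- s | i != B) F i.
 rewrite big_seq_cond;apply: sumr_ge0 => G /andP [Gs _];exact: F0.
have FB1 : F B <= 1 by rewrite -e lerDl.
have eB : F B = 1 by lia.
split=> // G Gs nG;have e0 : \sum_(i <- s | i != B) F i = 0 by apply: (addrI (F B));rewrite e eB.
have FG : F G <= 0.
 rewrite -e0 big_mkcond (bigD1_seq G)//= nG lerDl big_seq_cond;apply: sumr_ge0 => H /andP [Hs _].
 case: ifP => // _;exact: F0.
have := F0 G Gs;lia.
Qed.

(* w restricts to a function of degree one on B, with zero on N1 and pole on N2, so w - w(p) cuts B transversally in p. *)
Lemma one_curve B N1 N2 w p u : pdiv B -> pdiv N1 -> pdiv N2 -> B <> N1 -> B <> N2 -> N1 `&` N2 = set0 ->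
 wt B N1 = 1 -> wt B N2 = 1 -> w != 0 -> ord N1 w = 1 -> ord N2 w = -1 ->
 (forall G q, pdiv G -> G <> N1 -> G <> N2 -> G q -> B q -> ord G w = 0) ->
 B p -> ~ N1 p -> ~ N2 p -> u != 0 -> (forall G, pdiv G -> G p -> ord G u = ((G == B) : nat)%:Z) ->
 exists2 c, c != 0 & local_params p u (w - cst c).
move=> dB d1 d2 n1 n2 d12 w1 w2 nw o1 o2 ow Bp N1p N2p nu ou.
have Xp := pdiv_sub dB Bp.
have owp G : pdiv G -> G p -> ord G w = 0.
 by move=> dG Gp;apply: (ow G p) => // e;[apply: N1p|apply: N2p];rewrite -e.
have [Ow nmw] := unit_pt Xp nw owp;have [c mc] := value_at Xp Ow.
have nc : c != 0 by apply: contra_notN nmw => /eqP e;rewrite e rmorph0 subr0 in mc.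
exists c => //;set f := w - cst c in mc *.
have nf : f != 0.
 by rewrite subr_eq0;apply/eqP => e;rewrite e (ord_cst _ d1) in o1.
have oc G : pdiv G -> oge G 0 (cst c) by move=> dG;right;rewrite (ord_cst).
have fge G m : pdiv G -> m <= 0 -> oge G m w -> m <= ord G f.
 move=> dG m0 h;have h' : oge G m f by apply: (ksubB (oge_ksub m dG) h);exact: oge_mono (oc G dG).
 exact/(ogeE _ _ nf).
have ordB : ord B f = 0.
 have h0 : 0 <= ord B f by apply: fge => //;right;rewrite (ow B p).
 have [//|h1] : ord B f = 0 \/ 1 <= ord B f by lia.
 have [q Bq N1q] : exists2 q, B q & N1 q by apply: (I_meet dB d1 n1);rewrite -wtE// w1.
 have Xq := pdiv_sub dB Bq;have pq := prime_pt Xq.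
 have Owq : O q w.
  apply: (hartogs Xq) => G Gq;right;have [->|/eqP g1] := eqVneq G N1;first by rewrite o1.
  rewrite (ow G q)// => e;have : (N1 `&` N2) q by split=> //;rewrite -e.
  by rewrite d12.
 have Oc : O q (cst c) := lring_cst pq c.
 have mw : mx q w by apply: (mi_at d1 N1q Owq);apply/(mi_ord d1 nw);rewrite o1.
 have mf : mx q f by apply: (mi_at dB Bq);[exact: (lringB pq)|apply/(mi_ord dB nf)].
 have : mx q (cst c) by have -> : cst c = w - f;[rewrite /f;ring|exact: (maxB pq)].
 move/(max_nunit pq);rewrite fmorph_eq0 => /(_ nc);rewrite -fmorphV;case;exact: lring_cst.
(* Near B this divisor is effective, and its degree on B is that of [N2], namely 1. So only one of
   its curves meets B, with intersection number and multiplicity one; it is the curve of zeros of f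
   through p. *)
pose T : div := fun G => pdv f G + cdiv N2 G.
have fT : fin_supp T by apply: fin_suppD;[exact: fin_supp_pdv|exact: fin_supp_curve].
have T0 G q : pdiv G -> G q -> B q -> 0 <= T G.
 move=> dG Gq Bq;rewrite /T pdvE// /cdiv;case: (G =P N2) => [->|nG2].
  have := fge N2 (-1) d2 erefl;rewrite /oge o2 => /(_ (or_intror erefl));lia.
 rewrite addr0;apply: fge => //;have [->|/eqP g1] := eqVneq G N1;first by right;rewrite o1.
 by right;rewrite (ow G q).
have TB : T B = 0 by rewrite /T pdvE// ordB /cdiv;case: (B =P N2).
have dT : dg B T = 1.
 rewrite dgD ?dg_pdv ?dg_curve ?w2//;[exact: fin_supp_pdv|exact: fin_supp_curve].
have [s gs] := good_listP fT;have [us hs] := gs.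
have sT G : T G != 0 -> pdiv G.
 rewrite /T /cdiv;case: (G =P N2) => [-> //|_];rewrite addr0;exact: pdv_pdiv.
have F0 G : G \in s -> 0 <= T G * wt B G.
 move=> _;have [->|/sT dG] := eqVneq (T G) 0;first by rewrite mul0r.
 have [->|/eqP nG] := eqVneq G B;first by rewrite TB mul0r.
 have [e|ne] := eqVneq (I B G) 0;first by rewrite wtE ?e ?mulr0//;exact/nesym.
 have [q Bq Gq] := I_meet dB dG (nesym nG) ne.
 rewrite wtE;[apply: mulr_ge0;[exact: (T0 G q)|exact: (I_ge0 dB dG (nesym nG))]|exact/nesym].
have [B1 [dB1 B1p oB1]] : exists B1, [/\ pdiv B1, B1 p & ord B1 f != 0].
 apply: contrapT => no;have [|_ nm] := unit_pt Xp nf;last exact: nm.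
 move=> G dG Gp;apply: contrapT => /eqP h;by apply: no;exists G.
have nB1 : B <> B1 by move=> e;rewrite -e ordB in oB1.
have nB12 (G : set pt) : G p -> (G == N2) = false by move=> Gp;apply/eqP => e;apply: N2p;rewrite -e.
have TE G : pdiv G -> G p -> T G = ord G f.
 by move=> dG Gp;rewrite /T pdvE// /cdiv nB12// addr0.
have T1 : 1 <= T B1 by have := T0 B1 p dB1 B1p Bp;rewrite TE//;lia.
have s1 : B1 \in s by apply: hs;lia.
have i1 := I_gt0 dB dB1 nB1 Bp B1p.
have F1 : 1 <= T B1 * wt B B1 by rewrite wtE//;nia.
have [eF hF] := sum_one us F0 (etrans (esym (@dgE B T s gs)) dT) s1 F1.
rewrite wtE// in eF.
have I1 : I B B1 = 1 by nia.
have e1 : ord B1 f = 1 by rewrite -TE//;nia.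
apply: (params_of dB dB1 nB1 Bp B1p I1 nu nf ou) => G dG Gp.
have [->|nG] := eqVneq G B1;first exact: e1.
have [->|/eqP nGB] := eqVneq G B;first exact: ordB.
rewrite -TE//;apply: contrapT => /eqP nT.
have := hF G (hs _ nT) nG;rewrite wtE;last exact/nesym.
have := I_gt0 dB dG (nesym nGB) Bp Gp;have := T0 G p dG Gp Bp;move/eqP: nT;nia.
Qed.
End Charts.

(** * The canonical divisor *)

Section CanonicalForm.
Implicit Types (B : set pt) (p q : pt) (f g t u v w x y : K).

(** The given form h da db is rewritten as psi dx dy with one psi for all points, by evaluating both
    on a fixed pair of derivations on which they do not vanish. *)
Lemma canonical_form (n : int) x y p0 u0 v0 : degree X = n -> n != 0 -> Xpts p0 -> local_params p0 u0 v0 ->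
 (forall Du Dv, partials p0 u0 v0 Du Dv -> Du x * Dv y - Dv x * Du y != 0) ->
 exists (W : div) psi, [/\ is_divisor W, ip W W = n, psi != 0 &
  forall p u v, Xpts p -> local_params p u v -> exists Du Dv, [/\ partials p u v Du Dv,
  Du x * Dv y - Dv x * Du y != 0 &
  forall B, pdiv B -> B p -> W B = ord B (psi * (Du x * Dv y - Dv x * Du y))]].
move=> hn n0 Xp0 lp0 h0;have [W [[dW [h [a [b [nz hW]]]]] eW]] := canonical_exists hn n0.
have [D [E [hD hE nDE]]] : exists D E : K -> K, [/\ der D, der E & two_form h a b D E != 0].
 apply: contrapT => no;apply: nz => D E hD hE;apply: contrapT => /eqP ne.
 by apply: no;exists D, E.
move: nDE;rewrite mulf_eq0 negb_or => /andP [nh nmu].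
set mu := D a * E b - E a * D b in nmu.
have tr p u v Du Dv f g : Xpts p -> local_params p u v -> partials p u v Du Dv ->
  forall D' E', der D' -> der E' ->
  D' f * E' g - E' f * D' g = (D' u * E' v - E' u * D' v) * (Du f * Dv g - Dv f * Du g).
 move=> Xp lp hp D' E' hD' hE'.
 rewrite (der_partials Xp lp hp f hD') (der_partials Xp lp hp g hD') (der_partials Xp lp hp f hE') (der_partials Xp lp hp g hE');ring.
pose ka := D x * E y - E x * D y.
have nka : ka != 0.
 have [Du [Dv hp]] := partials_ex Xp0 lp0 hD hE nmu.
 rewrite /ka (tr _ _ _ _ _ _ _ Xp0 lp0 hp)// mulf_neq0 ?h0//;exact: (det_neq0 Xp0 lp0 hD hE nmu).
exists W, (h * mu / ka);split=> //;first by rewrite !mulf_neq0 ?invr_eq0.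
move=> p u v Xp lp;have [Du [Dv hp]] := partials_ex Xp lp hD hE nmu.
have nd := det_neq0 Xp lp hD hE nmu;set de := D u * E v - E u * D v in nd.
have eka : ka = de * (Du x * Dv y - Dv x * Du y) := tr p u v Du Dv x y Xp lp hp D E hD hE.
have emu : mu = de * (Du a * Dv b - Dv a * Du b) := tr p u v Du Dv a b Xp lp hp D E hD hE.
exists Du, Dv;split=> //;first by move: nka;rewrite eka mulf_eq0 negb_or => /andP [].
move=> B dB Bp;apply: (hW B p u v _ dB Bp lp) => D' E' hD' hE'.
rewrite /two_form (tr _ _ _ _ _ a b Xp lp hp _ _ hD' hE') emu.
have nJ : Du x * Dv y - Dv x * Du y != 0 by move: nka;rewrite eka mulf_eq0 negb_or => /andP [].
by rewrite eka;move: nJ;set J := - _ => nJ;field;rewrite nJ.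
Qed.

Lemma curve_two_points B p : pdiv B -> B p -> exists2 q, B q & q <> p.
move=> dB Bp;have Xp := pdiv_sub dB Bp;apply: contrapT => no.
have e : B = [set p].
 by apply/seteqP;split=> q;[move=> Bq;apply: contrapT => n;apply: no;exists q|move=> ->].
have [u [v lp]] := hX.2 p Xp;have [_ _] := pdiv_trace Xp lp hX.1 dB Bp.
by apply=> f mf;split;[exact: max_sub mf|rewrite e].
Qed.

(** On each curve of l through p a second point is marked. A linear form through p that avoids the
    marked points vanishes on a curve through p, which is therefore not in l. *)
Lemma curve_through p (l : seq (set pt)) B0 : B0 \in l -> B0 p -> (forall B, B \in l -> pdiv B) ->
 exists A, [/\ pdiv A, A p & A \notin l].
move=> hB0 B0p hl;have Xp := pdiv_sub (hl _ hB0) B0p.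
have [s [hs hs']] : exists s : seq pt, (forall q, List.In q s -> q <> p) /\
  forall B, B \in l -> B p -> exists2 q, B q & List.In q s.
 elim: l hl {hB0} => [|B l IH] hl;first by exists [::].
 have [|s [h1 h2]] := IH;first by move=> B' h;apply: hl;rewrite inE h orbT.
 have [Bp|nBp] := pselect (B p);last first.
  by exists s;split=> // B';rewrite inE => /predU1P [->|/h2].
 have dB : pdiv B by apply: hl;rewrite mem_head.
 have [q Bq nq] := curve_two_points dB Bp.
 exists (q :: s);split=> [q' [<-//|/h1//]|B'];rewrite inE => /predU1P [->|h] B'p.
  by exists q => //;left.
 by have [q' hq' ?] := h2 _ h B'p;exists q' => //;right.
have [M [hM Mp hM']] := linear_through hs.
have [i [hi hy nyp]] := pt_coordinate p.
pose f := fq 'X_i M 1.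
have [Of mf] := frac_in Xp hM hy nyp.
have mpf : mx p f by apply/mf/vanishes_pt.
have [u [v lp]] := hX.2 p Xp.
have f0 : f != 0.
 rewrite mulf_neq0 ?invr_eq0 ?(gev_neq0 Xp hy nyp)//.
 have [q B0q /hM' Mq] := hs' B0 hB0 B0p;apply/eqP => e.
 move/eqP: Mq;apply;have Xq := pdiv_sub (hl _ hB0) B0q;exact: (Xq _ _ hM e).
have [Q [pQ Qf nQ]] := prime_over Xp lp hX.1 mpf f0.
have [A [dA Ap hA]] := prime_divisor_of Xp lp pQ (ex_intro2 _ _ f Qf f0) nQ.
exists A;split=> //;apply/negP => hAl;have [q Aq qs] := hs' A hAl Ap.
have nyA : ~ van ('X_i : form) A by move=> vy;apply: nyp => _ ->;apply: vy.
have [_ mfA] := frac_in dA hM hy nyA.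
by have /eqP := hM' q qs;apply;apply: (mfA.1 _ q Aq);apply/hA.
Qed.

(* p < B1 < X makes u and w algebraically independent; as dim X = 2, some nonzero polynomial in u, w vanishes on B. *)
Lemma plane_ideal p B1 u w : pdiv B1 -> B1 p -> mx p w -> ~ mi B1 w -> mi B1 u -> u != 0 ->
 forall B, pdiv B -> lr B u -> lr B w ->
 exists f, [/\ f != 0, mi B f & forall G, pdiv G -> lr G u -> lr G w -> lr G f].
move=> d1 B1p mw nw mu nu B dB lu lw;have Xp := pdiv_sub d1 B1p;have pp := prime_pt Xp.
pose t : 'I_2 -> K := snoc (snoc (fun=> 0 : K) w : 'I_1 -> K) u.
have lt (Z : set pt) : lr Z u -> lr Z w -> forall i, lr Z (t i).
 by move=> hu hw i;rewrite /t /snoc;case: unliftP => [a _|_//];case: unliftP => [[]|_].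
have ft : alg_free_mod Xpts t.
 apply: (@alg_free_snoc B1 Xpts) => //;[exact: pdiv_prime|exact: prime_pts|exact: pdiv_sub| | |].
 - move=> i;rewrite /snoc;case: unliftP => [[]//|_];apply: (lr_at d1 B1p);exact: max_sub.
 - apply: (@alg_free_snoc [set p] B1) => //;first exact: pdiv_prime.
  + by move=> q ->.
  + by case.
  + exact: alg_free0.
 - by move/max_pts/eqP;rewrite (negbTE nu).
have pB := pdiv_prime dB.
have [P [nP mP]] : exists P, P != 0 /\ mi B (mmap cst t P).
 apply: contrapT => no;have fB : alg_free_mod B t.
  by move=> P mP;apply: contrapT => /eqP nP;apply: no;exists P.
 have [b [mb nb _]] := (fun z : exists b, [/\ mi B b, b != 0 & True] => z)
  (let: ex_intro b h := unif_ex dB in ex_intro _ b (let: And3 nb mb _ := h in And3 mb nb Logic.I)).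
 have fX : alg_free_mod Xpts (snoc t b).
  apply: (@alg_free_snoc B Xpts) => //;[exact: prime_pts|exact: pdiv_sub|exact: lt|].
  by move/max_pts/eqP;rewrite (negbTE nb).
 apply: (hX.1.2 (snoc t b)) => Q e;apply: fX;rewrite e;exact: (max0 (@prime_pts)).
exists (mmap cst t P);split=> //.
- apply: contra_neq nP => e;apply: ft;rewrite e;exact: (max0 (@prime_pts)).
- move=> G dG hu hw;apply: mmap_in;[exact: pdiv_prime|exact: lt].
Qed.

(** Zariski's lemma. Off the diagonal w_ij is nonnegative, so 2 n_i n_j w_ij is at most n_i^2 m_j
    w_ij / m_i plus the same with i and j exchanged; hence the form is at most the sum of
    (n_i^2/m_i) (w m)_i, where no term is positive and the one at i0 is negative. *)
Lemma negative_form (T : eqType) (s : seq T) (w : T -> T -> rat) (n m : T -> rat) i0 :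
 (forall i, i \in s -> 0 < m i) -> (forall i j, w i j = w j i) ->
 (forall i j, i != j -> i \in s -> j \in s -> 0 <= w i j) -> uniq s ->
 (forall i, i \in s -> \sum_(j <- s) m j * w i j <= 0) -> i0 \in s -> n i0 != 0 ->
 \sum_(j <- s) m j * w i0 j < 0 -> \sum_(i <- s) \sum_(j <- s) n i * n j * w i j < 0.
move=> m0 ws w0 us hm is0 n0 h0.
pose a i j := n i ^+ 2 / m i * (m j * w i j).
have le : \sum_(i <- s) \sum_(j <- s) (n i * n j * w i j) *+ 2 <= \sum_(i <- s) \sum_(j <- s) (a i j + a j i).
 rewrite big_seq [leRHS]big_seq;apply: ler_sum => i hi;rewrite big_seq [leRHS]big_seq;apply: ler_sum => j hj.
 have mi := m0 i hi;have mj := m0 j hj;have nmi := lt0r_neq0 mi;have nmj := lt0r_neq0 mj.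
 have [e|nij] := eqVneq i j.
  by rewrite /a -e (_ : n i ^+ 2 / m i * (m i * w i i) = n i * n i * w i i)//;field.
 rewrite /a (ws j i) -subr_ge0.
 have -> : n i ^+ 2 / m i * (m j * w i j) + n j ^+ 2 / m j * (m i * w i j) - n i * n j * w i j *+ 2 =
  w i j * (n i * m j - n j * m i) ^+ 2 / (m i * m j) by rewrite mulr2n;field;rewrite nmj.
 apply: mulr_ge0;[apply: mulr_ge0;[exact: w0|exact: sqr_ge0]|rewrite invr_ge0;apply: mulr_ge0;exact: ltW].
have e : \sum_(i <- s) \sum_(j <- s) (a i j + a j i) = (\sum_(i <- s) n i ^+ 2 / m i * \sum_(j <- s) m j * w i j) *+ 2.
 rewrite mulr2n;have e1 : \sum_(i <- s) \sum_(j <- s) a i j = \sum_(i <- s) n i ^+ 2 / m i * \sum_(j <- s) m j * w i j.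
  by apply: eq_bigr => i _;rewrite mulr_sumr.
 rewrite -{1}e1 -e1 [X in _ + X]exchange_big -big_split;apply: eq_bigr => i _;exact: big_split.
have lt0 : \sum_(i <- s) n i ^+ 2 / m i * \sum_(j <- s) m j * w i j < 0.
 rewrite (bigD1_seq i0)//=;apply: (@lt_le_trans _ _ (0 + 0));last by rewrite addr0.
 apply: ltr_leD.
  by rewrite nmulr_llt0// mulr_gt0 ?invr_gt0 ?m0// exprn_even_gt0.
 rewrite big_seq_cond;apply: sumr_le0 => i /andP [hi _].
 by apply: mulr_ge0_le0;[rewrite mulr_ge0 ?sqr_ge0// invr_ge0 ltW ?m0|exact: hm].
rewrite e in le;have e2 : \sum_(i <- s) \sum_(j <- s) (n i * n j * w i j) *+ 2 =
 (\sum_(i <- s) \sum_(j <- s) n i * n j * w i j) *+ 2.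
 by rewrite -sumrMnl;apply: eq_bigr => i _;rewrite sumrMnl.
rewrite e2 in le;rewrite -(pmulrn_llt0 _ (isT : (0 < 2)%N));apply: (le_lt_trans le).
by rewrite pmulrn_llt0.
Qed.

Lemma negative_form_int (T : eqType) (s : seq T) (w : T -> T -> int) (n m : T -> int) i0 :
 (forall i, i \in s -> 0 < m i) -> (forall i j, w i j = w j i) ->
 (forall i j, i != j -> i \in s -> j \in s -> 0 <= w i j) -> uniq s ->
 (forall i, i \in s -> \sum_(j <- s) m j * w i j <= 0) -> i0 \in s -> n i0 != 0 ->
 \sum_(j <- s) m j * w i0 j < 0 -> \sum_(i <- s) \sum_(j <- s) n i * n j * w i j < 0.
move=> m0 ws w0 us hm is0 n0 h0;pose r (z : int) : rat := z%:~R.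
have rs (F : T -> int) : \sum_(j <- s) r (F j) = r (\sum_(j <- s) F j) by rewrite /r rmorph_sum.
have := @negative_form T s (fun i j => r (w i j)) (r \o n) (r \o m) i0.
have e i : \sum_(j <- s) (r \o m) j * r (w i j) = r (\sum_(j <- s) m j * w i j).
 by rewrite -rs;apply: eq_bigr => j _;rewrite /r intrM.
have e' : \sum_(i <- s) \sum_(j <- s) (r \o n) i * (r \o n) j * r (w i j) =
  r (\sum_(i <- s) \sum_(j <- s) n i * n j * w i j).
 by rewrite -rs;apply: eq_bigr => i _;rewrite -rs;apply: eq_bigr => j _;rewrite /r !intrM.
rewrite e e' !ltrz0;apply=> //.
- move=> hi;rewrite ltr0z;exact: m0.
- by move=> i j;rewrite ws.
- move=> j hj;rewrite ler0z;exact: w0.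
- by move=> i hi;have := hm i hi;rewrite -(lerz0 rat) -/(r _) -e.
- by rewrite intr_eq0.
Qed.
End CanonicalForm.

(** * Cyclic indices, the functions x_i and charts along the cycle *)

Local Notation s := (@ordS 4).

Lemma ordS4 (i : 'I_4) : s (s (s (s i))) = i.
by apply/val_inj;case: i => [[|[|[|[|]]]]]. Qed.

Lemma I4_ind (P : 'I_4 -> Prop) : P 0 -> P (s 0) -> P (s (s 0)) -> P (s (s (s 0))) -> forall i, P i.
have e (a b : 'I_4) : a = b :> nat -> P a -> P b by move/val_inj ->.
move=> h0 h1 h2 h3 [[|[|[|[|]]]]]// hi;[exact: e h0|exact: e h1|exact: e h2|exact: e h3].
Qed.

Lemma sum4 (f : 'I_4 -> K) : \sum_i f i = f 0 + f (s 0) + f (s (s 0)) + f (s (s (s 0))).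
rewrite !big_ord_recl big_ord0 addr0 !addrA.
by congr (f _ + f _ + f _ + f _);apply/val_inj.
Qed.
Lemma sne (i : 'I_4) : ((s i == i) = false) * ((s (s i) == i) = false) * ((s (s (s i)) == i) = false).
by case: i => [[|[|[|[|]]]]]. Qed.
Lemma seq4 (i j : 'I_4) : (s i == s j) = (i == j).
by case: i j => [[|[|[|[|]]]]]// ? [[|[|[|[|]]]]]. Qed.
Lemma sne' (i : 'I_4) : ((i == s i) = false) * ((i == s (s i)) = false) * ((i == s (s (s i))) = false).
by case: i => [[|[|[|[|]]]]]. Qed.
Definition s4 := (seq4, sne, sne', ordS4, eqxx, andbF, andFb, andTb).

Section Cycle.
Implicit Types (B G : set pt) (p q : pt) (f g u v w : K) (D E : K -> K).
Hypotheses (hk : 2%N \in [pchar k]) (hdeg : degree X = 4%:Z).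
Variables (C L : 'I_4 -> set pt).
Hypotheses (hC : forall i, neg_curve 2 (C i)) (hL : forall i, neg_curve 1 (L i)).
Hypotheses (hCC : forall i j, i != j -> C i `&` C j = set0) (hLL : forall i j, i != j -> L i `&` L j = set0).
Hypotheses (hLC : forall i j, (j == i) || (j == ordS i) -> meet_transversally_once (L i) (C j))
 (hLC0 : forall i j, ~~ ((j == i) || (j == ordS i)) -> L i `&` C j = set0).

Lemma C_facts i : [/\ pdiv (C i), smooth_curve (C i), exists t, generator (C i) t & wt (C i) (C i) = -2].
exact: neg_curve_facts (hC i). Qed.
Lemma L_facts i : [/\ pdiv (L i), smooth_curve (L i), exists t, generator (L i) t & wt (L i) (L i) = -1].
exact: neg_curve_facts (hL i). Qed.
Lemma dC i : pdiv (C i). by have [] := C_facts i. Qed.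
Lemma dL i : pdiv (L i). by have [] := L_facts i. Qed.
#[local] Hint Resolve dC dL : core.

Lemma wCC i j : wt (C i) (C j) = if i == j then -2 else 0.
case: eqP => [->|/eqP n];first by have [] := C_facts j.
rewrite wtE;first by rewrite disjoint_I// hCC.
move=> e;have [p Cp] := pdiv_point (dC i).
have : (C i `&` C j) p by split=> //;rewrite -e.
by rewrite hCC.
Qed.

Lemma wLL i j : wt (L i) (L j) = if i == j then -1 else 0.
case: eqP => [->|/eqP n];first by have [] := L_facts j.
rewrite wtE;first by rewrite disjoint_I// hLL.
move=> e;have [p Lp] := pdiv_point (dL i).
have : (L i `&` L j) p by split=> //;rewrite -e.
by rewrite hLL.
Qed.

Lemma neq_LC i j : L i <> C j.
move=> e;have [_ _ _ w1] := L_facts i;have [_ _ _ w2] := C_facts j.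
by rewrite e w2 in w1.
Qed.
Lemma nLC i j : (L i == C j) = false. exact/eqP/neq_LC. Qed.
Lemma nCL i j : (C i == L j) = false. by rewrite eq_sym nLC. Qed.

Lemma wLC i j : wt (L i) (C j) = (((j == i) || (j == ordS i)) : nat)%:Z.
rewrite wtE;last exact: neq_LC.
case hh : ((j == i) || (j == ordS i)).
 by rewrite (meet_once (dL i) (dC j) (hLC hh)).
by rewrite disjoint_I// hLC0// hh.
Qed.
Lemma wCL i j : wt (C j) (L i) = (((j == i) || (j == ordS i)) : nat)%:Z.
by rewrite wt_sym wLC. Qed.

(** [s (s (s i))] is the predecessor of i, so the chain is L_(i-1), C_i, L_i. *)
Definition chain i := chainl (L (s (s (s i)))) (C i) (L i).

(** C_(i+1) serves as the auxiliary curve: it meets L_i once and is disjoint from L_(i-1) and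
    C_i. *)
Lemma chain_pencil i : exists2 x, hs (cD (chain i)) x & ~ hs (fun=> 0) x.
have [dC1 sC1 gC1 w1] := C_facts i;have [dC2 sC2 gC2 w2] := C_facts (s i).
have [dL1 sL1 gL1 w3] := L_facts (s (s (s i)));have [dL2 sL2 gL2 w4] := L_facts i.
apply: (@pencil (L (s (s (s i)))) (C i) (L i) (C (s i))) => //.
- by rewrite wLC ordS4 eqxx orbT.
- by rewrite wCL eqxx.
- by rewrite wLL;case: (i) => [[|[|[|[|]]]]].
- by rewrite wCL ordS4;case: (i) => [[|[|[|[|]]]]].
- by rewrite wCC;case: (i) => [[|[|[|[|]]]]].
- by rewrite wCL eqxx orbT.
Qed.
Lemma chainE i B : cD (chain i) B = cdiv (L (s (s (s i)))) B + (cdiv (C i) B + cdiv (L i) B).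
exact: PLE. Qed.

Lemma chain_supp i : pdiv_supp (cD (chain i)).
move=> B nB;have : B \in chain i by apply: contraNT nB => /count_memPn h;rewrite /cD h.
by rewrite !inE => /or3P [] /eqP ->.
Qed.
Lemma chain_dg i G : dg G (cD (chain i)) = wt G (L (s (s (s i)))) + (wt G (C i) + wt G (L i)).
by rewrite dg_cD !big_cons big_nil addr0. Qed.

Lemma chain_off i q : L (s i) q -> C (s i) q -> forall B, B q -> cD (chain i) B = 0.
move=> Lq Cq B Bq;rewrite chainE /cdiv.
have nL j : j != s i -> (B == L j) = false.
 move=> n;apply/eqP => e;have : (L j `&` L (s i)) q by split=> //;rewrite -e.
 by rewrite hLL.
have nC j : j != s i -> (B == C j) = false.
 move=> n;apply/eqP => e;have : (C j `&` C (s i)) q by split=> //;rewrite -e.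
 by rewrite hCC.
by rewrite !nL ?nC;case: (i) => [[|[|[|[|]]]]].
Qed.

(** The point q of L_(i+1) and C_(i+1) lies off the chain, so the value at q can be subtracted. The
    chain has degree 0 on L_(i+1), so vanishing at q spreads over L_(i+1), and then, by negative
    degrees, over C_(i+2) and L_(i+2), the rest of the opposite chain. *)
Lemma chain_zero i : exists2 x, x != 0 & hs (fun B => cD (chain i) B - cD (chain (s (s i))) B) x.
have [x0 hx0 nx0] := chain_pencil i.
have [q Lq Cq] : exists2 q, L (s i) q & C (s i) q.
 by apply: (I_meet (dL _) (dC _));[exact: neq_LC|rewrite -wtE;[rewrite wLC eqxx|exact: neq_LC]].
have off := chain_off Lq Cq.
have Xq := pdiv_sub (dL _) Lq.
have Ox : O_at q x0.
 apply: (hartogs Xq) => B dB Bq;have := hx0 B dB;rewrite off//.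
have [c mc] := value_at Xq Ox;pose x := x0 - cst c.
have hs0c a : hs (cD (chain i)) (cst a).
 by apply: hs_mono (cst_hs0 a) => B dB.
have hx : hs (cD (chain i)) x by apply: (ksubB (hs_ksub _)).
have nx : x != 0 by apply/eqP => /eqP;rewrite subr_eq0 => /eqP e;apply: nx0;rewrite e;exact: cst_hs0.
exists x => //.
have fD := fin_cD (chain i);have sD := chain_supp (i := i).
have [x1 [x2 lx]] := hX.2 q Xq.
have [Q [pQ Qx nQ]] := prime_over Xq lx hX.1 mc nx.
have [B [dB Bq hB]] := prime_divisor_of Xq lx pQ (ex_intro2 _ _ x Qx nx) nQ.
have o1 : 1 <= ord B x by apply/(mi_ord dB nx)/hB => //;exact: max_sub mc.
have h1 : hs (subB (cD (chain i)) (L (s i))) x.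
 have [e|nB] := eqVneq B (L (s i)).
  rewrite -(hs_cap _ (dL _));split=> //;rewrite -e off// subr0;by right.
 apply: section_component => //.
 right;split;last by exists B, q;split=> //;[exact/nesym/eqP|rewrite off// add0r pdvE].
 rewrite chain_dg !wLL wLC;by case: (i) => [[|[|[|[|]]]]].
have h2 : hs (subB (subB (cD (chain i)) (L (s i))) (C (s (s i)))) x.
 apply: (hs_neg _ _ _ _ h1);[exact: dC|exact: fin_supp_subB|by apply: supp_subB|].
 rewrite dg_subB// chain_dg !wCL wCC;by case: (i) => [[|[|[|[|]]]]].
have h3 : hs (subB (subB (subB (cD (chain i)) (L (s i))) (C (s (s i)))) (L (s (s i)))) x.
 apply: (hs_neg _ _ _ _ h2);[exact: dL|by do 2 apply: fin_supp_subB| |].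
  by apply: supp_subB;[exact: dC|apply: supp_subB].
 rewrite !dg_subB//;last exact: fin_supp_subB.
 rewrite chain_dg !wLL !wLC;by case: (i) => [[|[|[|[|]]]]].
move: h3;congr (hs _ x);apply/funext => B';rewrite /subB !chainE ordS4;ring.
Qed.

(** The functions for the chain and for its opposite have a product without poles, hence constant;
    so neither has zeros beyond the prescribed ones. *)
Lemma exact_divisor i : exists2 x, x != 0 & forall B, pdiv B ->
 ord B x = cD (chain (s (s i))) B - cD (chain i) B.
have [x nx hx] := chain_zero i;have [y ny hy] := chain_zero (s (s i)).
rewrite ordS4 in hy;exists x => // B dB.
have [c ec] : exists c, x * y = cst c.
 apply: (hs0_const) => B' dB'.
 have -> : - 0 = - (cD (chain i) B' - cD (chain (s (s i))) B') +
  - (cD (chain (s (s i))) B' - cD (chain i) B') :> int by ring.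
 apply: ogeM => //;[exact: hx|exact: hy].
have := ord_cst c dB;rewrite -ec ordM//.
have /(ogeE _ _ nx) := hx B dB;have /(ogeE _ _ ny) := hy B dB;lia.
Qed.

Variable xx : 'I_4 -> K.
Hypotheses (nxx : forall i, xx i != 0) (xxV : forall i, xx (s (s i)) = (xx i)^-1)
 (oxx : forall i B, pdiv B -> ord B (xx i) = cD (chain (s (s i))) B - cD (chain i) B).
Local Notation x := (xx 0).
Local Notation y := (xx (s 0)).

Lemma addKK (f : K) : f + f = 0.
have e : (1 + 1 : K) = 0 by rewrite -(rmorph1 cst) -rmorphD -(rmorph0 cst) -mulr2n (eqP (proj2 (andP hk))).
by rewrite -[f]mulr1 -mulrDr e mulr0.
Qed.
Lemma oppKK (f : K) : - f = f.
by apply/eqP;rewrite -subr_eq0 -opprD addKK oppr0. Qed.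
Lemma sameC p i j : C i p -> C j p -> i = j.
by move=> hi hj;apply/eqP;apply: contraT => /hCC e;have : (C i `&` C j) p by [];rewrite e.
Qed.
Lemma sameL p i j : L i p -> L j p -> i = j.
by move=> hi hj;apply/eqP;apply: contraT => /hLL e;have : (L i `&` L j) p by [];rewrite e.
Qed.
Lemma meetLC p i j : L i p -> C j p -> j = i \/ j = s i.
move=> hi hj;case: (j =P i) => [|/eqP n1];first by left.
case: (j =P s i) => [|/eqP n2];first by right.
by have : (L i `&` C j) p by [];rewrite hLC0// negb_or n1.
Qed.
Lemma eq_LL i j : (L i == L j) = (i == j).
by apply/eqP/eqP => [e|-> //];have [p Lp] := pdiv_point (dL i);apply: (sameL Lp);rewrite -e.
Qed.
Lemma eq_CC i j : (C i == C j) = (i == j).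
by apply/eqP/eqP => [e|-> //];have [p Cp] := pdiv_point (dC i);apply: (sameC Cp);rewrite -e.
Qed.

Lemma eqC_at p j a B : C j p -> B p -> (B == C a) = (a == j) && (B == C j).
move=> Cp Bp;case: (a =P j) => [->//|n];apply/eqP => e;apply: n;apply: (sameC (p := p)) Cp.
by rewrite -e.
Qed.
Lemma eqL_at p j a B : L j p -> B p -> (B == L a) = (a == j) && (B == L j).
move=> Lp Bp;case: (a =P j) => [->//|n];apply/eqP => e;apply: n;apply: (sameL (p := p)) Lp.
by rewrite -e.
Qed.

Lemma ordxx i B : pdiv B -> ord B (xx i) =
 ((B == C (s (s i)) : nat)%:Z + (B == L (s i) : nat)%:Z + (B == L (s (s i)) : nat)%:Z)
 - ((B == C i : nat)%:Z + (B == L i : nat)%:Z + (B == L (s (s (s i))) : nat)%:Z).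
move=> dB;rewrite oxx// !chainE !ordS4;ring. Qed.

Definition ell D i := D (xx i) / xx i.
(** The form dlog x dlog y evaluated on D and E. *)
Definition omega D E := ell D 0 * ell E (s 0) - ell E 0 * ell D (s 0).

(** dlog(1/x) = -dlog x, and signs disappear in characteristic 2. *)
Lemma ellSS D i : der D -> ell D (s (s i)) = ell D i.
move=> hD;rewrite /ell xxV (derV hD)//.
have n := i;rewrite invrK invfM !mulrA divfK// mulNr.
by apply/eqP;rewrite -subr_eq0 -opprD addKK oppr0.
Qed.

(** Another pair of neighbouring functions changes the form at most by a sign, which is trivial
    here. *)
Lemma omegaE D E i : der D -> der E -> ell D i * ell E (s i) - ell E i * ell D (s i) = omega D E.
move=> hD hE;have sw : ell D (s 0) * ell E 0 - ell E (s 0) * ell D 0 = omega D E.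
 apply/eqP;rewrite -subr_eq0 /omega;apply/eqP;rewrite -[RHS](addKK (ell D (s 0) * ell E 0 - ell E (s 0) * ell D 0));ring.
by elim/I4_ind: i;rewrite ?ellSS.
Qed.

Section Field.
Variables (al ga : 'I_4 -> k) (v : K -> K).
Let g := \sum_m cst (ga m) * xx m.
Hypotheses (hv : der v) (alSS : forall i, al (s (s i)) = al i)
 (vxx : forall i, v (xx i) = (cst (al i) + g) * xx i).

(** g occurs twice and cancels. Ratios of neighbouring functions are such products, which keeps v
    free of poles along the L_i. *)
Lemma v_prod i j : v (xx i * xx j) = cst (al i + al j) * (xx i * xx j).
have [_ vM _] := hv;rewrite vM !vxx rmorphD.
have -> : (cst (al i) + g) * xx i * xx j + xx i * ((cst (al j) + g) * xx j) =
 (cst (al i) + cst (al j)) * (xx i * xx j) + (g * xx i * xx j + g * xx i * xx j) by ring.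
by rewrite addKK addr0.
Qed.

Lemma gE j : g = cst (ga j) * xx j + cst (ga (s j)) * xx (s j)
  + cst (ga (s (s j))) * xx (s (s j)) + cst (ga (s (s (s j)))) * xx (s (s (s j))).
rewrite /g sum4;elim/I4_ind: j;rewrite ?ordS4;ring.
Qed.

(** [xx (s (s j))] is the inverse of [xx j] and vanishes on C_j. It clears the pole of g there and
    leaves the constant [ga j], the source of nonvanishing in the charts that meet C_j. *)
Lemma zg j : xx (s (s j)) * g = cst (ga j) + cst (ga (s j)) * (xx (s (s j)) * xx (s j))
 + cst (ga (s (s j))) * (xx (s (s j)) * xx (s (s j))) + cst (ga (s (s (s j)))) * (xx (s (s j)) * xx (s (s (s j)))).
have e : xx (s (s j)) * xx j = 1 by rewrite xxV mulVf.
by rewrite (gE j) !mulrDr [xx (s (s j)) * (cst (ga j) * _)]mulrCA e mulr1 !(mulrCA (xx (s (s j)))).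
Qed.

Lemma zg_O p j : Xpts p -> O p (xx (s (s j))) -> O p (xx (s (s j)) * xx (s j)) ->
 O p (xx (s (s j)) * xx (s (s (s j)))) -> O p (xx (s (s j)) * g).
move=> Xp h1 h2 h3;have pp := prime_pt Xp;have Oc := lring_cst pp;rewrite zg.
by do 3 (apply: (lringD pp);last by apply: (lringM pp) => //;exact: lringM).
Qed.

Lemma zg_m p j : Xpts p -> mx p (xx (s (s j))) -> mx p (xx (s (s j)) * xx (s j)) ->
 mx p (xx (s (s j)) * xx (s (s (s j)))) -> mx p (xx (s (s j)) * g) -> ga j = 0.
move=> Xp h1 h2 h3;have pp := prime_pt Xp;have Oc := lring_cst pp;rewrite zg => h.
have mm c f : mx p f -> mx p (cst c * f) by move=> mf;exact: (maxM pp).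
apply/eqP;apply: contraT => n.
have : mx p (cst (ga j)).
 have h4 := maxM pp (max_sub h1) h1.
 have := maxB pp (maxB pp (maxB pp h (mm (ga (s (s (s j)))) _ h3)) (mm (ga (s (s j))) _ h4)) (mm (ga (s j)) _ h2).
 by rewrite !addrK.
move/(max_nunit pp);rewrite fmorph_eq0 => /(_ n);rewrite -fmorphV;case;exact: lring_cst.
Qed.
End Field.

Definition isC B := [exists j, B == C j].
Definition isL B := [exists j, B == L j].

(* h is a local equation of the sum of the C_j, and v is a vector field as in the section Field. *)
Definition chart p h u w c := [/\ local_params p u (w - cst c), [/\ h != 0, u != 0 & w != 0],
 forall B, pdiv B -> B p -> ord B h = (isC B : nat)%:Z /\ ord B (u * w) = (isC B || isL B : nat)%:Z,
 forall D E : K -> K, der D -> der E -> D u * E w - E u * D w = u * w * omega D E &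
 forall (al ga : 'I_4 -> k) (v : K -> K), der v -> (forall i, al (s (s i)) = al i) ->
  (forall i, v (xx i) = (cst (al i) + \sum_m cst (ga m) * xx m) * xx i) ->
  [/\ O p (h * v u), O p (h * v w) &
  al 0 + al (s 0) != 0 -> (forall i, ga i != 0) -> ~ (mx p (h * v u) /\ mx p (h * v w))]].

Lemma isC_at p j B : C j p -> B p -> isC B = (B == C j).
move=> Cp Bp;apply/existsP/eqP => [[i /eqP e]|->];last by exists j.
by rewrite e;congr C;apply: (sameC (p := p)) Cp;rewrite -e.
Qed.
Lemma isL_at p j B : L j p -> B p -> isL B = (B == L j).
move=> Lp Bp;apply/existsP/eqP => [[i /eqP e]|->];last by exists j.
by rewrite e;congr L;apply: (sameL (p := p)) Lp;rewrite -e.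
Qed.
Lemma isC_off p B : (forall j, ~ C j p) -> B p -> isC B = false.
by move=> h Bp;apply/existsP => -[i /eqP e];apply: (h i);rewrite -e. Qed.
Lemma isL_off p B : (forall j, ~ L j p) -> B p -> isL B = false.
by move=> h Bp;apply/existsP => -[i /eqP e];apply: (h i);rewrite -e. Qed.
Lemma eqC_off p a B : (forall j, ~ C j p) -> B p -> (B == C a) = false.
by move=> h Bp;apply/eqP => e;apply: (h a);rewrite -e. Qed.
Lemma eqL_off p a B : (forall j, ~ L j p) -> B p -> (B == L a) = false.
by move=> h Bp;apply/eqP => e;apply: (h a);rewrite -e. Qed.
Lemma dlogM D i j : der D -> D (xx i * xx j) = (ell D i + ell D j) * (xx i * xx j).
by move=> [_ DM _];rewrite DM /ell;have n := nxx i;have n' := nxx j;field;rewrite n'.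
Qed.
Lemma dlog1 D i : D (xx i) = ell D i * xx i.
by rewrite divfK. Qed.

Lemma unit_nm p f : Xpts p -> unit_at [set p] f -> forall c, c != 0 -> ~ mx p (cst c * f).
move=> Xp uf c nc;have pp := prime_pt Xp;have [Of nf] := uf.
move/(max_prime pp (lring_cst pp c) Of) => [|//] /(max_nunit pp);rewrite fmorph_eq0 => /(_ nc).
rewrite -fmorphV;case;exact: lring_cst.
Qed.

Lemma al_sum (al : 'I_4 -> k) j : (forall i, al (s (s i)) = al i) -> al j + al (s j) = al 0 + al (s 0).
move=> h;have : al (s 0) + al 0 = al 0 + al (s 0) by rewrite addrC.
by elim/I4_ind: j;rewrite ?h.
Qed.
Lemma ordMxx i i' B : pdiv B -> ord B (xx i * xx i') = ord B (xx i) + ord B (xx i').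
by move=> dB;rewrite ordM. Qed.
Lemma nxxM i i' : xx i * xx i' != 0. by rewrite mulf_neq0. Qed.

(** Coordinates: 1/x_j is a local equation of C_j, and x_(j+1) restricts to C_j with one zero and
    one pole, on the two neighbouring L's. With h = 1/x_j, the second component of h v at p is
    [ga j] times a unit. *)
Lemma chart_C p j : C j p -> (forall i, ~ L i p) -> exists h u w c, chart p h u w c.
move=> Cp Lp;have Xp := pdiv_sub (dC j) Cp;have pp := prime_pt Xp.
have o i B : pdiv B -> B p -> ord B (xx i) =
  ((s (s i) == j) && (B == C j) : nat)%:Z - ((i == j) && (B == C j) : nat)%:Z.
 by move=> dB Bp;rewrite ordxx// (eqC_at i Cp Bp) (eqC_at (s (s i)) Cp Bp) !(eqL_off _ Lp Bp) !addr0.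
set u := xx (s (s j));set w := xx (s j).
have [c nc lp] : exists2 c, c != 0 & local_params p u (w - cst c).
 apply: (@one_curve (C j) (L (s (s (s j)))) (L j)) => //.
 - exact/nesym/neq_LC.
 - exact/nesym/neq_LC.
 - by apply: hLL;rewrite s4.
 - by rewrite (wCL) !s4.
 - by rewrite (wCL) !s4.
 - exact: nxx.
 - by rewrite ordxx// !nLC !eq_LL !s4.
 - by rewrite ordxx// !nLC !eq_LL !s4.
 - move=> G q dG g1 g2 Gq Cq;rewrite ordxx// (eqC_at (s j) Cq Gq) (eqC_at (s (s (s j))) Cq Gq) !s4.
  have hL0 a : (G == L a) = false.
  apply/eqP => e;have Lq : L a q by rewrite -e.
  by have [ea|ea] := meetLC Lq Cq;[apply: g2;rewrite ea|apply: g1;rewrite ea ordS4].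
  by rewrite !hL0.
 - exact: nxx.
 - by move=> G dG Gp;rewrite o// !s4;case: (G == C j).
have nb B : B p -> isL B = false by exact: isL_off.
have [Ow nw] : unit_at [set p] w by apply: (unit_pt Xp (nxx _)) => B dB Bp;rewrite o// !s4.
have mu : mx p u.
 by apply: (mx_ord Xp (nxx _) _ (dC j) Cp) => [B dB Bp|];rewrite o// !s4.
have mz a : a = s j \/ a = s (s (s j)) -> mx p (u * xx a).
 move=> ha;have e B : pdiv B -> B p -> ord B (xx a) = 0.
  by move=> dB Bp;rewrite o//;case: ha => ->;rewrite !s4.
 apply: (mx_ord Xp (nxxM _ _) _ (dC j) Cp) => [B dB Bp|];rewrite ordMxx// e// o// !s4//.
have m1 := mz _ (or_introl erefl);have m2 := mz _ (or_intror erefl).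
exists u, u, w, c;split=> //;first by split;exact: nxx.
- move=> B dB Bp;rewrite (isC_at Cp Bp) nb// ordMxx// !o// !s4;by case: (B == C j).
- move=> D E hD hE;rewrite /u /w !(dlog1 D) !(dlog1 E) !ellSS// -(omegaE j hD hE);ring.
move=> al ga v hv alSS vxx;set g := \sum_m _ in vxx.
have Og : O p (u * g) by apply: zg_O => //;exact: max_sub.
have Oc a : O p (cst a) := lring_cst pp a;have Ou := max_sub mu.
have e1 : u * v u = (cst (al j) * u + u * g) * u by rewrite /u vxx alSS;ring.
have e2 : u * v w = (cst (al (s j)) * u + u * g) * w by rewrite /w vxx;ring.
have Oa a : O p (cst a * u + u * g) by apply: (lringD pp) => //;exact: (lringM pp (Oc _) Ou).
split;rewrite ?e1 ?e2;[exact: (lringM pp (Oa _) Ou)|exact: (lringM pp (Oa _) Ow)|move=> _ nga [_]].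
move/(max_prime pp (Oa _) Ow) => [h|//];case/eqP: (nga j).
have m3 : mx p (cst (al (s j)) * u) by exact: (maxM pp (Oc _) mu).
by apply: (@zg_m ga p j);have := maxB pp h m3;rewrite addrAC subrr add0r.
Qed.

(** Coordinates: 1/x_j is a local equation of L_j, and x_(j+1)/x_j restricts to L_j with one zero
    and one pole, on C_j and C_(j+1). By [v_prod] the field multiplies the latter by the constant a
    + b, so h = 1 suffices. *)
Lemma chart_L p j : L j p -> (forall i, ~ C i p) -> exists h u w c, chart p h u w c.
move=> Lp Cp;have Xp := pdiv_sub (dL j) Lp;have pp := prime_pt Xp.
have o i B : pdiv B -> B p -> ord B (xx i) =
  ((s i == j) && (B == L j) : nat)%:Z + ((s (s i) == j) && (B == L j) : nat)%:Z
  - (((i == j) && (B == L j) : nat)%:Z + ((s (s (s i)) == j) && (B == L j) : nat)%:Z).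
 move=> dB Bp;have eL a := eqL_at a Lp Bp;rewrite ordxx// (eL i) (eL (s i)) (eL (s (s i))) (eL (s (s (s i)))).
 by rewrite !(eqC_off _ Cp Bp).
set u := xx (s (s j));set w := xx (s (s j)) * xx (s j).
have [c nc lp] : exists2 c, c != 0 & local_params p u (w - cst c).
 apply: (@one_curve (L j) (C j) (C (s j))) => //.
 - exact: neq_LC.
 - exact: neq_LC.
 - by apply: hCC;rewrite s4.
 - by rewrite (wLC) !s4.
 - by rewrite (wLC) !s4.
 - exact: nxxM.
 - by rewrite ordMxx// !ordxx// !nCL !eq_CC !s4.
 - by rewrite ordMxx// !ordxx// !nCL !eq_CC !s4.
 - move=> G q dG g1 g2 Gq Lq.
  have hC0 a : (G == C a) = false.
  apply/eqP => e;have Cq : C a q by rewrite -e.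
  by have [ea|ea] := meetLC Lq Cq;[apply: g1;rewrite -ea|apply: g2;rewrite -ea].
  rewrite ordMxx// !ordxx// !hC0 !ordS4 (eqL_at j Lq Gq) (eqL_at (s j) Lq Gq) (eqL_at (s (s j)) Lq Gq) (eqL_at (s (s (s j))) Lq Gq) !s4.
  by case: (G == L j).
 - exact: nxx.
 - by move=> G dG Gp;rewrite o// !s4;case: (G == L j).
have nb B : B p -> isC B = false by exact: isC_off.
have uw : unit_at [set p] w.
 by apply: (unit_pt Xp (nxxM _ _)) => B dB Bp;rewrite ordMxx// !o// !s4;case: (B == L j).
have [Ow nw] := uw.
have Ou : O p u by apply: (O_ord Xp (nxx _)) => B dB Bp;rewrite o// !s4.
have Oz : O p (u * xx (s (s (s j)))).
 by apply: (O_ord Xp (nxxM _ _)) => B dB Bp;rewrite ordMxx// !o// !s4.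
exists 1, u, w, c;split=> //;first by split;[exact: oner_neq0|exact: nxx|exact: nxxM].
- move=> B dB Bp;rewrite nb// (isL_at Lp Bp) ord1// ordM//;[|exact: nxx|exact: nxxM].
 by rewrite ordMxx// !o// !s4;case: (B == L j).
- move=> D E hD hE;rewrite /u /w !(dlogM _ _ hD) !(dlogM _ _ hE) !(dlog1 D) !(dlog1 E) !ellSS// -(omegaE j hD hE);ring.
move=> al ga v hv alSS vxx;set g := \sum_m _ in vxx.
have Og : O p (u * g) by exact: zg_O.
have Oc a : O p (cst a) := lring_cst pp a.
have e1 : 1 * v u = cst (al j) * u + u * g by rewrite /u vxx alSS;ring.
have e2 : 1 * v w = cst (al j + al (s j)) * w by rewrite mul1r (v_prod hv vxx) alSS.
split;rewrite ?e1 ?e2;first by apply: (lringD pp) => //;exact: (lringM pp (Oc _) Ou).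
 exact: (lringM pp (Oc _) Ow).
by move=> na _ [_];apply: unit_nm => //;rewrite al_sum.
Qed.

(** At the corner of L_j and C_m, with C_t the other C that meets L_j, 1/x_t is a local equation of
    L_j and x_t/x_m one of C_m; h is the latter, and the first component of h v has the value [ga m]
    at p. *)
Lemma chart_LC p j m t : (m = j /\ t = s j) \/ (m = s j /\ t = j) -> L j p -> C m p ->
 exists h u w c, chart p h u w c.
move=> hm Lp Cp;have Xp := pdiv_sub (dL j) Lp;have pp := prime_pt Xp.
have o i B : pdiv B -> B p -> ord B (xx i) =
  ((s (s i) == m) && (B == C m) : nat)%:Z + ((s i == j) && (B == L j) : nat)%:Z + ((s (s i) == j) && (B == L j) : nat)%:Z
  - (((i == m) && (B == C m) : nat)%:Z + ((i == j) && (B == L j) : nat)%:Z + ((s (s (s i)) == j) && (B == L j) : nat)%:Z).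
 move=> dB Bp;have eL a := eqL_at a Lp Bp;rewrite ordxx// (eL i) (eL (s i)) (eL (s (s i))) (eL (s (s (s i)))).
 by rewrite (eqC_at i Cp Bp) (eqC_at (s (s i)) Cp Bp).
set u := xx (s (s t));set w := xx (s (s m)) * xx t;set z := xx (s (s m)).
have ewu : w * u = z by rewrite /u xxV mulfK.
have lp : local_params p u (w - cst 0).
 rewrite rmorph0 subr0;apply: (params_of (dL j) (dC m) _ Lp Cp).
 - exact: neq_LC.
 - by apply: (meet_once (dL j) (dC m));apply: hLC;case: hm => -[-> _];rewrite eqxx ?orbT.
 - exact: nxx.
 - exact: nxxM.
 - by move=> G dG Gp;rewrite o//;case: hm => -[-> ->];rewrite !s4;case: (G == L j).
 - by move=> G dG Gp;rewrite ordMxx// !o//;case: hm => -[-> ->];rewrite !s4;case: (G == L j);case: (G == _).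
have Ow : O p w.
 apply: (O_ord Xp (nxxM _ _)) => B dB Bp;rewrite ordMxx// !o//.
 by case: hm => -[-> ->];rewrite !s4;case: (B == L j);case: (B == _).
have mz : mx p z.
 by apply: (mx_ord Xp (nxx _) _ (dC m) Cp) => [B dB Bp|];rewrite !o//;case: hm => -[-> _];rewrite !s4.
have mzz i : i = s m \/ i = s (s (s m)) -> mx p (z * xx i).
 by move=> hi;apply: (mx_ord Xp (nxxM _ _) _ (dC m) Cp) => [B dB Bp|];rewrite ordMxx// !o// ?nCL;case: hi => ->;case: hm => -[-> _];rewrite !s4//;case: (B == L j);case: (B == C _).
exists w, u, w, 0;split=> //;first by split;[exact: nxxM|exact: nxx|exact: nxxM].
- move=> B dB Bp;rewrite (isL_at Lp Bp) (isC_at Cp Bp) ordM//;[|exact: nxx|exact: nxxM].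
 have := nLC j m;rewrite ordMxx// !o//.
 by case: hm => -[-> ->];rewrite !s4;case eL: (B == L j);case eC: (B == C _);rewrite// -(eqP eL) eC.
- move=> D E hD hE;rewrite /u /w !(dlogM _ _ hD) !(dlogM _ _ hE) !(dlog1 D) !(dlog1 E) !ellSS//.
 by case: hm => -[-> ->];[rewrite -[RHS]oppKK|];rewrite -(omegaE j hD hE);ring.
move=> al ga v hv alSS vxx;set g := \sum_m _ in vxx.
have Oc a : O p (cst a) := lring_cst pp a.
have Og : O p (z * g) by apply: zg_O;try apply: max_sub;auto.
have e : w * v u = cst (al (s (s t))) * z + z * g.
 by have -> : v u = (cst (al (s (s t))) + g) * u := vxx _;rewrite -ewu;ring.
have m3 : mx p (cst (al (s (s t))) * z) by exact: (maxM pp (Oc _) mz).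
split.
- by rewrite e;apply: (lringD pp) => //;exact: max_sub.
- by rewrite (v_prod hv vxx);apply: (lringM pp) => //;exact: (lringM pp (Oc _) Ow).
move=> _ nga [h _];case/eqP: (nga m);apply: (@zg_m ga p m) => //;[by auto|by auto|].
by rewrite e in h;have := maxB pp h m3;rewrite addrAC subrr add0r.
Qed.

Lemma boundary_chart p : (exists j, C j p \/ L j p) -> exists h u w c, chart p h u w c.
move=> [j [Cp|Lp]].
- have [[i Lp]|no] := pselect (exists i, L i p);last by apply: (chart_C Cp) => i Lp;apply: no;exists i.
 by have [e|e] := meetLC Lp Cp;[apply: (chart_LC (t := s i)) Lp Cp;left|apply: (chart_LC (t := i)) Lp Cp;right].
- have [[i Cp]|no] := pselect (exists i, C i p);last by apply: (chart_L Lp) => i Cp;apply: no;exists i.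
 by have [e|e] := meetLC Lp Cp;[apply: (chart_LC (t := s j)) Lp Cp;left|apply: (chart_LC (t := j)) Lp Cp;right].
Qed.

(** * The boundary divisor Z and the form dlog x dlog y *)

Definition on_cycle p := exists j, C j p \/ L j p.
Definition isZ B := isC B || isL B.

Lemma isZ_cycle B p : isZ B -> B p -> on_cycle p.
by case/orP => /existsP [j /eqP ->] h;exists j;[left|right]. Qed.
Lemma off_isZ B : pdiv B -> (forall p, B p -> ~ on_cycle p) -> isZ B = false.
move=> /pdiv_point [p Bp] h;apply/negP => /isZ_cycle /(_ Bp);exact: h. Qed.
Lemma isZ_ord B i : pdiv B -> isZ B = false -> ord B (xx i) = 0.
move=> dB /negbT;rewrite negb_or => /andP [/existsPn nC /existsPn nL].
by rewrite (ordxx i dB) !(negbTE (nC _)) !(negbTE (nL _)).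
Qed.
Lemma jac_omega D E : D x * E y - E x * D y = x * y * omega D E.
by rewrite /omega /ell;field;rewrite !nxx. Qed.

Lemma chart_omega p h u w c Du Dv : chart p h u w c -> partials p u (w - cst c) Du Dv ->
 u * w * omega Du Dv = 1.
move=> [_ _ _ hJ _] [[hu _] [hv _] [e1 e2 e3 e4]];rewrite -hJ//.
have e D : der D -> D (w - cst c) = D w by move=> hD;rewrite derB//;have [_ _ ->] := hD;rewrite subr0.
by rewrite e in e2;rewrite e// in e4;rewrite e2 e4 mulr0 subr0 mulr1.
Qed.

Let indices : seq 'I_4 := [:: 0;s 0;s (s 0);s (s (s 0))].
Let zl : seq (set pt) := map C indices ++ map L indices.
Let Z : div := cD zl.

Let all_indices i : i \in indices. by case: i => [[|[|[|[|]]]]]. Qed.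

Let mem_zl B : (B \in zl) = isZ B.
rewrite mem_cat;congr (_ || _);apply/mapP/existsP.
- by move=> [i _ ->];exists i.
- by move=> [i /eqP ->];exists i.
- by move=> [i _ ->];exists i.
- by move=> [i /eqP ->];exists i.
Qed.

Let uniq_zl : uniq zl.
rewrite cat_uniq !map_inj_uniq//;last first.
- by move=> i j /eqP;rewrite eq_CC => /eqP.
- by move=> i j /eqP;rewrite eq_LL => /eqP.
apply/and3P;split=> //;apply/hasPn => B /mapP [i _ ->];apply/mapP => -[j _ /eqP];by rewrite nLC.
Qed.

Let ZE B : Z B = (isZ B : nat)%:Z.
by rewrite /Z /cD count_uniq_mem// mem_zl. Qed.

Let dgZ_C j : dg (C j) Z = 0.
rewrite dg_cD big_cat !big_map !big_cons !big_nil !(wCC) !(wCL).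
by case: j => [[|[|[|[|]]]]].
Qed.

Let dgZ_L j : dg (L j) Z = 1.
rewrite dg_cD big_cat !big_map !big_cons !big_nil !(wLL) !(wLC).
by case: j => [[|[|[|[|]]]]].
Qed.

Let goodZ : good_list Z zl.
by split=> // B;rewrite ZE mem_zl;case: (isZ B). Qed.

(** Each L contributes 1 and each C contributes 0. The value agrees with that of the canonical
    divisor, the numerical input of [coordinates]. *)
Let ipZ : ip Z Z = 4.
rewrite (ipE _ goodZ) big_seq (eq_bigr (fun B => dg B Z));last first.
 by move=> B;rewrite mem_zl ZE => ->;rewrite mul1r.
by rewrite -big_seq big_cat !big_map !big_cons !big_nil !dgZ_C !dgZ_L.
Qed.

(** The functions x_i are regular off the cycle, and two of them are algebraically independent on X.
    On any curve off the cycle some nonzero polynomial in them vanishes; a product treats all curves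
    of t. *)
Lemma exists_vanishing (t : seq (set pt)) : (forall B, B \in t -> pdiv B /\ isZ B = false) ->
 exists F, [/\ F != 0, forall B, B \in t -> 1 <= ord B F & forall G, pdiv G -> isZ G = false -> 0 <= ord G F].
have [p Lp Cp] : exists2 p, L 0 p & C 0 p.
 apply: (I_meet (dL _) (dC _));first exact: neq_LC.
 by rewrite (meet_once (dL _) (dC _))//;apply: hLC.
have Xp := pdiv_sub (dL 0) Lp.
set u := xx (s (s 0));set w := xx (s (s (s 0))).
have mw : mx p w.
 apply: (mx_ord Xp (nxx _) _ (dL 0) Lp) => [B dB Bp|].
  rewrite (ordxx _ dB) (eqC_at (s (s (s 0))) Cp Bp) (eqC_at (s (s (s (s (s 0))))) Cp Bp).
  rewrite (eqL_at (s (s (s 0))) Lp Bp) (eqL_at (s (s (s (s (s (s 0)))))) Lp Bp).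
  by case: (B == C 0).
 by rewrite (ordxx _ (dL 0)) !nLC !eq_LL.
have nw : ~ mi (C 0) w.
 by rewrite (mi_ord (dC 0) (nxx _)) (ordxx _ (dC 0)) !nCL !eq_CC.
have mu : mi (C 0) u.
 by apply/(mi_ord (dC 0) (nxx _));rewrite (ordxx _ (dC 0)) !nCL !eq_CC.
have lrz B i : pdiv B -> isZ B = false -> lr B (xx i).
 by move=> dB nz;apply/(lr_ord dB (nxx _));rewrite isZ_ord.
elim: t => [|B t IH] ht;first by exists 1;split=> //;[exact: oner_neq0|move=> G dG _;rewrite ord1].
have [|F [nF hF1 hF2]] := IH;first by move=> B' h;apply: ht;rewrite inE h orbT.
have [dB zB] := ht B (mem_head _ _).
have [f [nf mf hf]] := plane_ideal (dC 0) Cp mw nw mu (nxx _) dB (lrz _ _ dB zB) (lrz _ _ dB zB).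
have o1 : 1 <= ord B f by apply/(mi_ord dB nf).
have o0 G : pdiv G -> isZ G = false -> 0 <= ord G f.
 move=> dG zG;apply/(lr_ord dG nf);apply: hf => //;exact: lrz.
exists (F * f);split=> [|G|G dG zG];first by rewrite mulf_neq0.
- rewrite inE => /predU1P [->|hG];first by rewrite ordM//;have := hF2 B dB zB;lia.
 have [|dG zG] := ht G;first by rewrite inE hG orbT.
 rewrite ordM//;have := hF1 G hG;have := o0 G dG zG;lia.
- by rewrite ordM//;have := hF2 G dG zG;have := o0 G dG zG;lia.
Qed.

(* If D != 0, a function vanishing on its support and on a further curve meeting it makes the intersection form negative at D. *)
Lemma effective_off_cycle (Q : div) : fin_supp Q -> (forall B, Q B != 0 -> pdiv B) ->
 (forall B, pdiv B -> 0 <= Q B) -> (forall B p, Q B != 0 -> B p -> ~ on_cycle p) -> ip Q Q = 0 -> forall B, Q B = 0.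
move=> fQ sQ Q0 oQ e0 B0;apply: contrapT => /eqP n0.
have [l gl] := good_listP fQ;have [ul hl] := gl.
pose t := [seq B <- l | Q B != 0];have ut : uniq t by rewrite filter_uniq.
have mt B : (B \in t) = (Q B != 0).
 by rewrite mem_filter andb_idr// => /hl.
have gt : good_list Q t by split=> // B;rewrite mt.
have [p0 B0p] := pdiv_point (sQ _ n0).
have dt B : B \in t -> pdiv B by rewrite mt;exact: sQ.
have zt B : B \in t -> isZ B = false.
 by move=> h;apply: off_isZ;[exact: dt|move=> p;apply: oQ;rewrite -mt].
have B0t : B0 \in t by rewrite mt.
have [A [dA Ap nAt]] := curve_through B0t B0p dt.
have zA : isZ A = false.
 by apply/negP => /isZ_cycle /(_ Ap);exact: oQ B0p.
have [|F [nF F1 F0]] := @exists_vanishing (A :: t).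
 by move=> B;rewrite inE => /predU1P [-> //|h];split;[exact: dt|exact: zt].
(* div F is split into the part U on the support of Q, the part V on the cycle and the rest T, which
   is effective. The curves of Q miss the cycle, so on them U and -T have equal degree; A
   contributes to T and meets [B0], which makes the inequality strict there. *)
pose U : div := fun G => if G \in t then pdv F G else 0.
pose V : div := fun G => if isZ G then pdv F G else 0.
pose T : div := fun G => if (G \in t) || isZ G then 0 else pdv F G.
have [lF hlF] := fin_supp_pdv nF.
have fU : fin_supp U by exists lF => G;rewrite /U;case: ifP => // _;exact: hlF.
have fV : fin_supp V by exists lF => G;rewrite /V;case: ifP => // _;exact: hlF.
have fT : fin_supp T by exists lF => G;rewrite /T;case: ifP => // _;exact: hlF.
have sT : pdiv_supp T by move=> G;rewrite /T;case: ifP => // _;exact: pdv_pdiv.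
have T0 G : pdiv G -> 0 <= T G.
 by move=> dG;rewrite /T;case: ifP => // /negbT;rewrite negb_or => /andP [_ /negbTE zG];rewrite pdvE// F0.
have dV i : i \in t -> dg i V = 0.
 move=> hi;have [lV gV] := good_listP fV;rewrite (dgE _ gV) big1// => G _;rewrite /V.
 case: ifP => [zG|];last by rewrite mul0r.
 rewrite wtE;last by move=> e;rewrite -e zt in zG.
 rewrite disjoint_I ?mulr0//;apply/seteqP;split=> // p [ip' Gp].
 by apply: (oQ i p _ ip');[rewrite -mt|exact: isZ_cycle zG Gp].
have split3 i : i \in t -> dg i U = - dg i T.
 move=> hi;have := dg_pdv (dt _ hi) nF.
 have -> : dg i (pdv F) = dg i (fun G => (U G + V G) + T G).
  apply: dg_ext => G;rewrite /U /V /T;case hG : (G \in t);first by rewrite zt// !addr0.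
  by case: (isZ G);rewrite ?addr0 ?add0r.
 rewrite dgD//;last exact: fin_suppD.
 by rewrite dgD// dV// addr0 => /eqP;rewrite addr_eq0 => /eqP.
have TI i : i \in t -> T i = 0 by rewrite /T => ->.
have dT0 i : i \in t -> 0 <= dg i T by move=> hi;apply: effective_dg => //;[exact: dt|exact: TI].
have dT1 : 1 <= dg B0 T.
 apply: (@effective_dg1 B0 T A p0) => //;[exact: dt|exact: TI| |].
 - by move=> e;rewrite e (negbTE nAt) in B0t.
 - by rewrite /T (negbTE nAt) zA pdvE//;apply: F1;exact: mem_head.
have gU : good_list U t by split=> // G;rewrite /U;case: ifP.
have UE i : dg i U = \sum_(j <- t) ord j F * wt i j.
 by rewrite (dgE _ gU) big_seq [RHS]big_seq;apply: eq_bigr => j hj;rewrite /U hj pdvE//;exact: dt.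
have := @negative_form_int _ t (fun i j => wt i j) Q (fun i => ord i F) B0.
have -> : \sum_(i <- t) \sum_(j <- t) Q i * Q j * wt i j = ip Q Q.
 rewrite (ipE _ gt);apply: eq_bigr => i _;rewrite (dgE _ gt) mulr_sumr;apply: eq_bigr => j _;ring.
rewrite e0 ltxx => h;suff : false by [];apply: h => //.
- by move=> i hi;have := F1 i;rewrite inE hi orbT => /(_ isT);lia.
- by move=> i j;rewrite wt_sym.
- move=> i j nij hi hj;rewrite wtE;last exact/eqP.
 by apply: (I_ge0);[exact: dt|exact: dt|exact/eqP].
- by move=> i hi;rewrite -UE split3// oppr_le0 dT0.
- by rewrite -UE split3// oppr_lt0;lia.
Qed.

Lemma off_unit p i : Xpts p -> ~ on_cycle p -> unit_at [set p] (xx i).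
move=> Xp off;apply: (unit_pt Xp (nxx i)) => B dB Bp;apply: isZ_ord => //.
by apply/negP => zB;exact: off (isZ_cycle zB Bp).
Qed.

(** W' is the divisor of dlog x dlog y. In the boundary charts this form is du dw/(u w), so W' is -Z
    on the curves that meet the cycle; elsewhere it is effective because x and y are units. Hence Q
    = W' + Z is effective and disjoint from the cycle, with Q^2 = W'^2 - Z^2 = 4 - 4. *)
Lemma coordinates :
 (exists D1 D2 : K -> K, [/\ der D1, der D2 & [/\ D1 x = x, D1 y = 0, D2 x = 0 & D2 y = y]]) /\
 forall p, Xpts p -> ~ on_cycle p -> exists a b, local_params p (x - cst a) (y - cst b).
have bc p : on_cycle p -> exists h u w c, chart p h u w c.
 by move=> h;exact: (boundary_chart h).
have [p0 Cp0] := pdiv_point (dC 0);have Xp0 := pdiv_sub (dC 0) Cp0.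
have [h0 [u0 [w0 [c0 ch0]]]] := bc p0 (ex_intro _ 0 (or_introl Cp0)).
have lp0 : local_params p0 u0 (w0 - cst c0) by case: ch0.
have [|W [psi [dW eW npsi hW]]] := @canonical_form _ x y _ _ _ hdeg isT Xp0 lp0.
 move=> Du Dv hp;have [[hu _] [hv _] _] := hp.
 have e := chart_omega ch0 hp;have -> : Du x * Dv y - Dv x * Du y = x * y * omega Du Dv.
  by rewrite -jac_omega.
 rewrite !mulf_neq0//;apply/eqP => e';move/eqP: e;rewrite e' mulr0 eq_sym oner_eq0//.
have [fW sW] := is_divisorP dW.
pose phi := psi * (x * y);have nphi : phi != 0 by rewrite !mulf_neq0.
pose W' : div := fun B => W B - pdv phi B.
have fphi := fin_supp_pdv nphi.
have fW' : fin_supp W' by apply: fin_suppD => //;exact: fin_suppN.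
have sW' : pdiv_supp W'.
 move=> B;rewrite /W';have [e|/sW//] := eqVneq (W B) 0;rewrite e sub0r oppr_eq0;exact: pdv_pdiv.
have eWW' B : W B = W' B + pdv phi B by rewrite subrK.
have ipW' : ip W' W' = 4.
 apply: etrans _ eW;rewrite (ip_equiv fW fW' fW sW nphi eWW') (ip_sym fW' fW).
 by rewrite (ip_equiv fW fW' fW' sW' nphi eWW').
have hW' p u v : Xpts p -> local_params p u v -> exists Du Dv, [/\ partials p u v Du Dv, omega Du Dv != 0 &
  forall B, pdiv B -> B p -> W' B = ord B (omega Du Dv)].
 move=> Xp lp;have [Du [Dv [hp nJ hB]]] := hW p u v Xp lp;exists Du, Dv.
 have eJ : Du x * Dv y - Dv x * Du y = x * y * omega Du Dv by rewrite -jac_omega.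
 rewrite eJ in nJ hB;have no : omega Du Dv != 0 by move: nJ;rewrite mulf_eq0 negb_or => /andP [].
 split=> // B dB Bp;rewrite /W' pdvE// (hB B dB Bp) mulrA ordM// -/phi;ring.
pose Q : div := fun B => W' B + Z B.
have fZ : fin_supp Z := fin_cD zl.
have fQ : fin_supp Q by exact: fin_suppD.
have dz B : isZ B -> pdiv B by case/orP => /existsP [j /eqP ->].
have sQ B : Q B != 0 -> pdiv B.
 rewrite /Q ZE;have [e|/sW'//] := eqVneq (W' B) 0;rewrite e add0r.
 by case h : (isZ B) => // _;exact: dz.
have Qon B p : pdiv B -> B p -> on_cycle p -> Q B = 0.
 move=> dB Bp onp;have Xp := pdiv_sub dB Bp;have [h [u [w [c ch]]]] := bc p onp.
 have [lp [_ nu nw] oB _ _] := ch;have [Du [Dv [hp no hB]]] := hW' p _ _ Xp lp.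
 have [_ o2] := oB B dB Bp;have e1 := chart_omega ch hp.
 have nuw : u * w != 0 by rewrite mulf_neq0.
 have e := ordM dB nuw no;rewrite e1 (ord1 dB) o2 in e.
 by rewrite /Q ZE (hB B dB Bp) addrC -e.
have Qoff B : pdiv B -> (forall q, B q -> ~ on_cycle q) -> Q B = W' B.
 by move=> dB off;rewrite /Q ZE (off_isZ dB off) addr0.
have Q0 B : pdiv B -> 0 <= Q B.
 move=> dB;have [[p [Bp onp]]|no] := pselect (exists p, B p /\ on_cycle p);first by rewrite (Qon B p).
 have off q : B q -> ~ on_cycle q by move=> Bq onq;apply: no;exists q.
 have [p Bp] := pdiv_point dB;have Xp := pdiv_sub dB Bp.
 rewrite Qoff//;have [u [v lp]] := hX.2 p Xp.
 have [Du [Dv [hp nom hB]]] := hW' p u v Xp lp;rewrite (hB B dB Bp).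
 have zB := off_isZ dB off.
 have nJ : x * y * omega Du Dv != 0 by rewrite !mulf_neq0.
 have -> : ord B (omega Du Dv) = ord B (x * y * omega Du Dv).
  by rewrite !ordM ?mulf_neq0// !isZ_ord// !add0r.
 apply/(lr_ord dB nJ);apply: (lr_at dB Bp);rewrite -jac_omega.
 have [[_ tu] [_ tv] _] := hp;have [Ox _] := off_unit 0 Xp (off p Bp);have [Oy _] := off_unit (s 0) Xp (off p Bp).
 by apply: (lringB Xp);apply: (lringM Xp);(apply: tu => //;fail) || (apply: tv => //;fail).
have offQ B p : Q B != 0 -> B p -> ~ on_cycle p.
 by move=> nQ Bp onp;have e := Qon B p (sQ B nQ) Bp onp;rewrite e eqxx in nQ.
have ipQ : ip Q Q = 0.
 have [l [ul hl]] := good_listP fW'.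
 pose l' := undup (l ++ zl).
 have gW : good_list W' l' by split=> [|B /hl h];rewrite ?undup_uniq// mem_undup mem_cat h.
 have gZ : good_list Z l'.
  by split=> [|B];rewrite ?undup_uniq// mem_undup mem_cat ZE mem_zl;case: (isZ B);rewrite ?orbT.
 have gQ : good_list Q l'.
  split=> [|B];first exact: undup_uniq;rewrite /Q;have [->|/gZ.2 -> //] := eqVneq (Z B) 0.
  by rewrite addr0;exact: gW.2.
 have eD G : dg G W' = dg G Q - dg G Z by rewrite (dgD G fW' fZ) addrK.
 have e1 B : Q B * dg B Z = 0.
  have [->|nQ] := eqVneq (Q B) 0;first by rewrite mul0r.
  rewrite dg_cD big_seq big1 ?mulr0// => G;rewrite mem_zl => zG.
  rewrite wtE;last by move=> e;have [q Bq] := pdiv_point (sQ B nQ);apply: (offQ B q nQ Bq);apply: (isZ_cycle (B := B)) => //;rewrite e.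
  by apply: disjoint_I;apply/seteqP;split=> // q [Bq Gq];apply: (offQ B q nQ Bq);exact: isZ_cycle zG Gq.
 have e2 B : Z B * dg B Q = 0.
  rewrite ZE;case zB : (isZ B);last by rewrite mul0r.
  rewrite (dgE _ gQ) big1// => G _;have [->|nQ] := eqVneq (Q G) 0;first by rewrite mul0r.
  have off q : G q -> B q -> False by move=> Gq Bq;apply: (offQ G q nQ Gq);exact: isZ_cycle zB Bq.
  rewrite wtE;last by move=> e;have [q Bq] := pdiv_point (dz B zB);apply: (off q) => //;rewrite -e.
  by rewrite disjoint_I ?mulr0//;apply/seteqP;split=> // q [Bq Gq];exact: (off q).
 have : ip W' W' = ip Q Q + ip Z Z.
  rewrite (ipE _ gW) (ipE _ gQ) (ipE _ gZ) -big_split;apply: eq_bigr => B _ /=.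
  have -> : W' B = Q B - Z B by rewrite addrK.
  rewrite eD mulrBl !mulrBr e1 e2;ring.
 by rewrite ipW' ipZ;lia.
have Qz := effective_off_cycle fQ sQ Q0 offQ ipQ.
split.
 have [Du [Dv [[[hu _] [hv _] _] nom _]]] := hW' _ _ _ Xp0 lp0.
 have nJ : x * y * omega Du Dv != 0 by rewrite !mulf_neq0.
 rewrite -jac_omega in nJ;set J := _ - _ in nJ.
 exists (fun f => x / J * Dv y * Du f + - (x / J * Du y) * Dv f), (fun f => - (y / J * Dv x) * Du f + y / J * Du x * Dv f).
 have dcomb (a b : K) : der (fun f => a * Du f + b * Dv f) by apply: der_add;exact: der_scale.
 by split;[exact: dcomb|exact: dcomb|split;rewrite /J in nJ *;field].
move=> p Xp off.
have [Ox nx] := off_unit 0 Xp off;have [Oy ny] := off_unit (s 0) Xp off.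
have [a ma] := value_at Xp Ox;have [b mb] := value_at Xp Oy;exists a, b.
have [u [v lp]] := hX.2 p Xp;have [Du [Dv [hp nom hB]]] := hW' p u v Xp lp.
apply: (jacobian Xp lp hp ma mb).
have [[hu _] [hv _] _] := hp.
have e (D : K -> K) f c : der D -> D (f - cst c) = D f by move=> hD;rewrite derB//;have [_ _ ->] := hD;rewrite subr0.
have -> : Du (x - cst a) * Dv (y - cst b) - Dv (x - cst a) * Du (y - cst b) = x * y * omega Du Dv.
 by rewrite !e// -jac_omega.
apply: (unit_pt Xp);first by rewrite !mulf_neq0.
move=> B dB Bp;have zB : isZ B = false by apply/negP => zB;exact: off (isZ_cycle zB Bp).
rewrite !ordM ?mulf_neq0// !isZ_ord// !add0r -(hB B dB Bp).
by have := Qz B;rewrite /Q ZE zB addr0.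
Qed.

(** What charts on and off the cycle have in common: h is a local equation of the sum of the C_i,
    and h times the field is regular and, for generic coefficients, nowhere zero. *)
Definition global_chart p h u v := [/\ local_params p u v, h != 0,
 forall B, pdiv B -> B p -> ord B h = (isC B : nat)%:Z &
 forall (al ga : 'I_4 -> k) (D : K -> K), der D -> (forall i, al (s (s i)) = al i) ->
  (forall i, D (xx i) = (cst (al i) + \sum_m cst (ga m) * xx m) * xx i) ->
  [/\ O p (h * D u), O p (h * D v) &
  al 0 + al (s 0) != 0 -> (forall i, ga i != 0) -> ~ (mx p (h * D u) /\ mx p (h * D v))]].

Lemma global_chart_ex p : Xpts p -> exists h u v, global_chart p h u v.
move=> Xp;have pp := prime_pt Xp;have [onp|off] := pselect (on_cycle p).
 have [h [u [w [c [lp [nh _ _] oh _ hf]]]]] := boundary_chart onp.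
 exists h, u, (w - cst c);split=> // [B dB Bp|al ga D hD alSS hxx];first by have [] := oh B dB Bp.
 have -> : D (w - cst c) = D w by rewrite derB//;have [_ _ ->] := hD;rewrite subr0.
 exact: (hf al ga D).
have [a [b lp]] := coordinates.2 p Xp off;exists 1, (x - cst a), (y - cst b).
split=> // [|B dB Bp|al ga D hD alSS hxx];first exact: oner_neq0.
- rewrite ord1;case h : (isC B) => //;case: off;apply: (isZ_cycle (B := B)) => //.
 by rewrite /isZ h.
set g := \sum_m _ in hxx.
have Oc z : O p (cst z) := lring_cst pp z.
have Oxx i : O p (xx i) by have [] := off_unit i Xp off.
have Og : O p g by apply: lring_sum => // m _;exact: (lringM pp (Oc _) (Oxx _)).
have e i c : 1 * D (xx i - cst c) = (cst (al i) + g) * xx i.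
 by rewrite mul1r derB//;have [_ _ ->] := hD;rewrite subr0 hxx.
have Oa i : O p (cst (al i) + g) by exact: (lringD pp (Oc _) Og).
rewrite !e;split;[exact: (lringM pp (Oa _) (Oxx _))|exact: (lringM pp (Oa _) (Oxx _))|].
(* If both components vanished at p, so would a + g and b + g, hence their sum a + b, since 2g =
   0. *)
move=> na _ [/(max_prime pp (Oa _) (Oxx _)) h1 /(max_prime pp (Oa _) (Oxx _)) h2].
have nx i : ~ mx p (xx i) by have [] := off_unit i Xp off.
case: h1 => [h1|/nx//];case: h2 => [h2|/nx//];have := maxD pp h1 h2.
have -> : cst (al 0) + g + (cst (al (s 0)) + g) = cst (al 0 + al (s 0)) + (g + g) by rewrite rmorphD;ring.
rewrite addKK addr0 => /(max_nunit pp);rewrite fmorph_eq0 => /(_ na).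
by rewrite -fmorphV;case;exact: lring_cst.
Qed.
End Cycle.

(** * The family of foliations *)

Section Family.
Implicit Types (B : set pt) (p q : pt) (f g h u v : K) (D E w : K -> K).

Hypothesis hk : 2%N \in [pchar k].
Variable C : 'I_4 -> set pt.
Variable xx : 'I_4 -> K.
Hypotheses (dC : forall i, pdiv (C i)) (nxx : forall i, xx i != 0) (xxV : forall i, xx (s (s i)) = (xx i)^-1).
Hypotheses (oxx : forall j, ord (C j) (xx j) = -1) (oxx0 : forall i j, i != j -> 0 <= ord (C j) (xx i)).
Local Notation isC B := (isC C B).
Local Notation x := (xx 0).
Local Notation y := (xx (s 0)).
Variables D1 D2 : K -> K.
Hypotheses (hD1 : der D1) (hD2 : der D2) (D1x : D1 x = x) (D1y : D1 y = 0) (D2x : D2 x = 0) (D2y : D2 y = y).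
Hypothesis charts : forall p, Xpts p -> exists h u v, global_chart C xx p h u v.

Implicit Types (mu : 'I_6 -> k).
Definition ga mu (m : 'I_4) : k := mu (rshift 2 m).
(** The constants a and b, repeated with period two because x_i and its inverse have the same
    logarithmic derivative. *)
Definition al mu (i : 'I_4) : k := mu (lshift 4 (inord (odd i) : 'I_2)).
Definition bas (j : 'I_6) : K -> K :=
 match fintype.split (j : 'I_(2 + 4)) with
 | inl i => if i == 0 :> nat then D1 else D2
 | inr m => fun f => xx m * (D1 f + D2 f)
 end.
Definition vf mu : K -> K := fun f => \sum_j cst (mu j) * bas j f.
Definition gg mu := \sum_m cst (ga mu m) * xx m.
Definition generic mu := al mu 0 + al mu (s 0) != 0 /\ forall i, ga mu i != 0.

Lemma vfE mu f : vf mu f = (cst (al mu 0) + gg mu) * D1 f + (cst (al mu (s 0)) + gg mu) * D2 f.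
rewrite /vf (@big_split_ord _ _ _ 2 4) /=.
rewrite [X in X + _]big_ord_recl [X in (_ + X) + _]big_ord_recl [X in (_ + (_ + X)) + _]big_ord0 addr0.
have e0 : bas (lshift 4 (fintype.ord0 : 'I_2)) = D1 by rewrite /bas (unsplitK (inl (fintype.ord0 : 'I_2))).
have e1 : bas (lshift 4 (lift fintype.ord0 fintype.ord0 : 'I_2)) = D2.
 by rewrite /bas (unsplitK (inl (lift fintype.ord0 fintype.ord0 : 'I_2))).
have em (m : 'I_4) : bas (rshift 2 m) f = xx m * (D1 f + D2 f) by rewrite /bas (unsplitK (inr m)).
rewrite e0 e1.
have -> : al mu 0 = mu (lshift 4 (fintype.ord0 : 'I_2)) by congr mu;apply/val_inj;rewrite /= inordK.
have -> : al mu (s 0) = mu (lshift 4 (lift fintype.ord0 fintype.ord0 : 'I_2)) by congr mu;apply/val_inj;rewrite /= inordK.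
have -> : \sum_(i < 4) cst (mu (rshift 2 i)) * bas (rshift 2 i) f = gg mu * (D1 f + D2 f).
 by rewrite mulr_suml;apply: eq_bigr => m _;rewrite em mulrA.
ring.
Qed.

Lemma der_vf mu : der (vf mu).
have h : der (fun f => (cst (al mu 0) + gg mu) * D1 f + (cst (al mu (s 0)) + gg mu) * D2 f).
 by apply: der_add;exact: der_scale.
by rewrite (_ : vf mu = fun f => (cst (al mu 0) + gg mu) * D1 f + (cst (al mu (s 0)) + gg mu) * D2 f)//;apply/funext => f;exact: vfE.
Qed.
Lemma al_ss mu i : al mu (s (s i)) = al mu i.
by have e : odd (s (s i)) = odd i;[case: i => [[|[|[|[|]]]]]|rewrite /al e]. Qed.

Lemma vf_xx mu i : vf mu (xx i) = (cst (al mu i) + gg mu) * xx i.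
have e0 : vf mu x = (cst (al mu 0) + gg mu) * x by rewrite vfE D1x D2x mulr0 addr0.
have e1 : vf mu y = (cst (al mu (s 0)) + gg mu) * y by rewrite vfE D1y D2y mulr0 add0r.
have inv j : vf mu (xx j) = (cst (al mu j) + gg mu) * xx j ->
  vf mu (xx (s (s j))) = (cst (al mu (s (s j))) + gg mu) * xx (s (s j)).
 move=> e;have nj := nxx j;rewrite xxV al_ss (derV (der_vf mu))// e -[LHS](oppKK hk);field;exact: nj.
by elim/I4_ind: i => //;exact: inv.
Qed.

(** The sheaf O(-C_1 - C_2 - C_3 - C_4) v; the twist compensates the simple poles of v. *)
Definition fol mu p : set (K -> K) :=
 [set w | exists f, (forall B, pdiv B -> B p -> oge B (isC B : nat)%:Z f) /\ w = fun z => f * vf mu z].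

Definition equation p h := h != 0 /\ forall B, pdiv B -> B p -> ord B h = (isC B : nat)%:Z.

Lemma fol_gen mu p h w : Xpts p -> equation p h ->
 fol mu p w <-> exists a, O p a /\ w = fun z => a * (h * vf mu z).
move=> Xp [nh oh];split.
 move=> [f [hf ->]];exists (f / h);split;last by apply/funext => z;rewrite mulrA divfK.
 apply: (hartogs Xp) => B dB Bp;apply/(oge_mulr) => //;first by rewrite invr_eq0.
 by rewrite ordV// oh// sub0r opprK;exact: hf.
move=> [a [Oa ->]];exists (a * h);split;last by apply/funext => z;rewrite mulrA.
move=> B dB Bp;apply/(oge_mulr) => //;rewrite oh// subrr;exact: (oge_pt (p := p)).
Qed.
Lemma chart_eq p h u v : global_chart C xx p h u v -> equation p h.
by case. Qed.

Lemma hvf_tangent mu p h : Xpts p -> equation p h -> tangent p (fun z => h * vf mu z).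
move=> Xp [nh oh];have [h' [u [v [lp nh' oh' hf]]]] := charts Xp.
have [Ou Ov _] := hf (al mu) (ga mu) _ (der_vf mu) (al_ss mu) (vf_xx mu).
have t' : tangent p (fun z => h' * vf mu z).
 by apply: (der_tangent Xp lp) => //;apply: der_scale;exact: der_vf.
have Oe : O p (h / h').
 apply: (O_ord Xp);first by rewrite mulf_neq0 ?invr_eq0.
 by move=> B dB Bp;rewrite ordM ?invr_eq0// ordV// oh// oh'// subrr.
split=> [|f Of];first by apply: der_scale;exact: der_vf.
have -> : h * vf mu f = h / h' * (h' * vf mu f) by rewrite mulrA divfK.
by apply: (lringM Xp) => //;apply: t'.2.
Qed.

Let delta (j i : 'I_6) : k := (i == j)%:R.
Lemma vf_delta j : vf (delta j) = bas j.
apply/funext => f;rewrite /vf (bigD1 j)//= /delta eqxx rmorph1 mul1r big1 ?addr0// => i /negbTE ->.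
by rewrite rmorph0 mul0r.
Qed.

Definition eq_locus h : set pt := [set q | forall B, pdiv B -> B q -> ord B h = (isC B : nat)%:Z].

Lemma open_locus p h : h != 0 -> eq_locus h p ->
 exists d (H : {mpoly k[(pdim X).+1]}), [/\ H \is d.-homog, peval H p != 0 & forall q, peval H q != 0 -> eq_locus h q].
move=> nh hp;have [l hl] := ord_finite nh.
have [d [H [hH nH hB]]] : exists d (H : {mpoly k[(pdim X).+1]}), [/\ H \is d.-homog, peval H p != 0 &
  forall B q, B \in l ++ [seq C i | i : 'I_4] -> pdiv B -> ~ B p -> B q -> peval H q = 0].
 elim: (l ++ _) => [|B l' [d [H [hH nH hB]]]].
  by exists 0%N, 1;split=> //;[exact: dhomog1|rewrite pev1 oner_eq0].
 have [[dB nB]|no] := pselect (pdiv B /\ ~ B p);last first.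
  by exists d, H;split=> // B' q;rewrite inE => /predU1P [-> dB nB|];[case: no|exact: hB].
 have [[cB _ _] _ _] := dB;have [e [G [hG nG hGB]]] := cB p nB.
 exists (d + e)%N, (H * G);split;[exact: dhomogM|by rewrite pevM mulf_neq0|].
 move=> B' q;rewrite inE pevM => /predU1P [->|h'] dB' nB' B'q.
  suff -> : peval G q = 0 by rewrite mulr0.
  by apply/eqP;apply: contraT => /hGB;case.
 by rewrite (hB B')// mul0r.
exists d, H;split=> // q nq B dB Bq;apply: contrapT => ne.
have hBl : B \in l ++ [seq C i | i : 'I_4].
 rewrite mem_cat;case hC : (isC B);move: hC ne.
  by move/existsP => [i /eqP ->] _;apply/orP;right;apply/mapP;exists i;rewrite ?mem_enum.
 move=> -> ne;apply/orP;left;apply/In_mem;apply: hl => //;exact/eqP.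
by move/eqP: nq;apply;apply: (hB B q) => // Bp;apply: ne;exact: hp.
Qed.

Section Generic.
Variable mu : 'I_6 -> k.
Hypothesis gen : generic mu.
Let v := vf mu.
Let hv : der v := der_vf mu.

(** One of the two components of h v is a unit at p; the coordinates are exchanged if it is the
    second. *)
Lemma chart_unit p : Xpts p -> exists h u u', [/\ local_params p u u', equation p h, O p (h * v u), O p (h * v u') &
 unit_at [set p] (h * v u)].
move=> Xp;have [h [u [u' ch]]] := charts Xp;have [lp nh oh hf] := ch.
have [Ou Ou' nb] := hf (al mu) (ga mu) _ hv (al_ss mu) (vf_xx mu).
have {}nb := nb gen.1 gen.2.
have [mu0|nmu] := pselect (mx p (h * v u));last by exists h, u, u'.
exists h, u', u;split=> //;last by split=> // m';apply: nb.
have [m1 m2 h12] := lp;split=> // f /h12 [a [b [Oa Ob ->]]];exists b, a;split=> //;exact: addrC.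
Qed.

Lemma vf_neq0 p : Xpts p -> exists f, v f != 0.
move=> Xp;have [h [u [u' [_ _ _ _ uu]]]] := chart_unit Xp;exists u.
by apply/eqP => e;have := lring_neq0 Xp uu.2;rewrite e mulr0 eqxx.
Qed.

Lemma fol_rank_one p0 : Xpts p0 -> rank_one (fol mu).
move=> Xp0;exists v;split=> [//||p Xp];first exact: vf_neq0 Xp0.
split=> [D [f [_ ->]]|];first by exists f.
have [h [u [u' [_ eh _ _ uu]]]] := chart_unit Xp;exists (fun z => h * v z).
 apply/(fol_gen _ _ Xp eh);exists 1;split;first exact: (lring1 Xp).
 by apply/funext => z;rewrite mul1r.
by exists u;exact: (lring_neq0 Xp uu.2).
Qed.

Lemma fol_coherent : coherent_subsheaf (fol mu).
move=> p Xp;have [h [u [u' ch]]] := charts Xp;have [nh oh] := chart_eq ch.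
exists (eq_locus h), 1%N, (fun _ z => h * v z);split=> //.
 by move=> q hq;exact: open_locus.
move=> q Xq hq;have eh : equation q h by [].
split=> [_|];first exact: hvf_tangent.
apply/seteqP;split=> w.
 move/(fol_gen _ _ Xq eh) => [a [Oa ->]];exists (fun=> a);split=> //.
 by apply/funext => z;rewrite big_ord1.
move=> [a [Oa ->]];apply/(fol_gen _ _ Xq eh);exists (a 0);split=> //.
by apply/funext => z;rewrite big_ord1.
Qed.

(** If a D = b h v, the coefficient b/a equals D u / (h v u), which is regular because h v u is a
    unit. *)
Lemma fol_saturated : saturated (fol mu).
move=> p D a Xp tD Oa na hF.
have [h [u [u' [lp eh Ou Ou' [_ nu]]]]] := chart_unit Xp.
move/(fol_gen _ _ Xp eh): hF => [b [Ob e]];apply/(fol_gen _ _ Xp eh).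
have eD z : D z = b / a * (h * v z) by have := congr1 (fun F => F z) e => ez;rewrite mulrAC -ez mulrAC mulfV ?mul1r.
exists (b / a);split;last by apply/funext.
have nhv := lring_neq0 Xp nu;have [Oi _] := lring_inv Xp Ou nu.
have -> : b / a = D u * (h * v u)^-1 by rewrite eD mulfK.
by apply: (lringM Xp) => //;apply: tD.2;have [m1 _ _] := lp;exact: max_sub m1.
Qed.

Lemma fol_bracket : bracket_closed (fol mu).
move=> p D E Xp;have [h [u [u' [lp eh Ou Ou' _]]]] := chart_unit Xp.
have t := hvf_tangent mu Xp eh;pose w z := h * v z.
have [_ wM _] := t.1.
move=> /(fol_gen _ _ Xp eh) [a [Oa ->]] /(fol_gen _ _ Xp eh) [b [Ob ->]].
apply/(fol_gen _ _ Xp eh);exists (a * w b - b * w a);split.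
 by apply: (lringB Xp);apply: (lringM Xp) => //;exact: t.2.
apply/funext => z;rewrite -/(w z).
have e1 c : h * v (c * w z) = w c * w z + c * w (w z) by exact: wM.
by rewrite (e1 a) (e1 b);ring.
Qed.

Lemma fol_regular : regular_foliation (fol mu).
move=> p Xp;have [h [u [u' [lp eh Ou Ou' [Ow nw]]]]] := chart_unit Xp.
have nhv := lring_neq0 Xp nw;have [Oi _] := lring_inv Xp Ow nw.
pose w z := h * v z;have tw : tangent p w := hvf_tangent mu Xp eh.
have gw a : O p a -> fol mu p (fun z => a * w z) by move=> Oa;apply/(fol_gen _ _ Xp eh);exists a.
have O1 : O p 1 := lring1 Xp.
split.
 exists 1%N, (fun _ => w);split=> [_|D].
  by have := gw 1 O1;congr (fol mu p _);apply/funext => z;rewrite mul1r.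
 move/(fol_gen _ _ Xp eh) => [a [Oa ->]];exists (const_mx a);split.
  by split=> [i|];[rewrite mxE|apply/funext => z;rewrite big_ord1 mxE subrr].
 move=> c [Oc /(congr1 (fun F => F u))];rewrite big_ord1 => /eqP;rewrite subr_eq0 => /eqP e.
 apply/rowP => i;rewrite mxE zmodp.ord1;exact: (mulIf nhv).
have nJ : D1 x * D2 y - D2 x * D1 y != 0 by rewrite D1x D2y D2x mul0r subr0 mulf_neq0.
have [Du [Dv hp]] := partials_ex Xp lp hD1 hD2 nJ.
have [tu tv [e1 e2 e3 e4]] := hp.
exists 1%N, (fun _ => Dv);split=> // D tD.
have [mu1 mu2 _] := lp;have Ouu := max_sub mu1;have Ouu' := max_sub mu2.
(* Since w u is a unit, D - c w kills u and is a regular multiple of [Dv]; so [Dv] is a basis of the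
   quotient. *)
pose c := D u / w u;have Oc : O p c by apply: (lringM Xp) => //;exact: tD.2.
pose a := D u' - c * w u'.
have Oa : O p a by apply: (lringB Xp);[exact: tD.2|apply: (lringM Xp) => //;exact: tw.2].
exists (const_mx a);split.
 split=> [i|];first by rewrite mxE.
 have -> : (fun f => D f - \sum_i (const_mx a : 'rV_1) 0 i * Dv f) = fun f => c * w f;last exact: gw.
 apply/funext => f;rewrite big_ord1 mxE (der_partials Xp lp hp f tD.1) (der_partials Xp lp hp f tw.1) /a /c.
 by field;exact: nhv.
move=> b [Ob];rewrite (_ : (fun f => D f - \sum_i b 0 i * Dv f) = fun f => D f - b 0 0 * Dv f);last first.
 by apply/funext => f;rewrite big_ord1.
move/(fol_gen _ _ Xp eh) => [d [Od e]].
have := congr1 (fun F => F u) e;have := congr1 (fun F => F u') e;rewrite e3 e4 mulr0 subr0 mulr1 -!/(w _) => f2 f1.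
apply/rowP => i;rewrite mxE zmodp.ord1 /a /c f1 mulfK// -f2;ring.
Qed.
End Generic.

(** Only [xx j] has a pole along C_j, so its coefficient must vanish. *)
Lemma xx_independent (c : 'I_4 -> k) c0 : \sum_m cst (c m) * xx m = cst c0 -> forall j, c j = 0.
move=> e j;apply/eqP;apply: contraT => nc;move: e;rewrite (bigD1 j)//= => e.
set S := \sum_(i < 4 | i != j) _ in e.
have hS : oge (C j) 0 S.
 rewrite /S;refine (@ksub_sum _ _ _ _ _ (oge_ksub 0 (dC j)) _) => i nij.
 have oc : oge (C j) 0 (cst (c i)) by right;rewrite ord_cst.
 have ox : oge (C j) 0 (xx i) by right;exact: oxx0.
 by have := ogeM (dC j) oc ox;rewrite addr0.
have oc : oge (C j) 0 (cst c0) by right;rewrite ord_cst.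
have ncK : cst (c j) != 0 by rewrite fmorph_eq0.
have : oge (C j) 0 (cst (c j) * xx j).
 by have -> : cst (c j) * xx j = cst c0 - S;[rewrite -e addrK|exact: (ksubB (oge_ksub 0 (dC j)))].
by move/ogeE;rewrite mulf_neq0// ordM// ord_cst// oxx add0r => /(_ isT).
Qed.

(** Otherwise v v = phi v for some phi. Applying this to x and y and subtracting gives phi = a + b;
    substituting back leaves a linear relation between 1 and the x_m with coefficients g_m (a_m - a
    - b). All of them vanish, so a = b = 0, against a + b nonzero. *)
Lemma not_two_closed mu p0 : Xpts p0 -> generic mu -> ~ two_closed (fol mu).
move=> Xp0 gen closed;have [h [u [u' [_ eh _ _ _]]]] := chart_unit gen Xp0;have [nh _] := eh.
pose v := vf mu;have [vD vM vC] : der v := der_vf mu.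
have hF : fol mu p0 (fun z => h * v z).
 apply/(fol_gen _ _ Xp0 eh);exists 1;split;first exact: (lring1 Xp0).
 by apply/funext => z;rewrite mul1r.
have [f [_ ef]] := closed _ _ Xp0 hF.
pose phi := (f - h * v h) / h ^+ 2.
have vv z : v (v z) = phi * v z.
 have /= := congr1 (fun F => F z) ef;rewrite -/v vM => e.
 have {}e : (f - h * v h) * v z = h ^+ 2 * v (v z) by rewrite mulrBl -e;ring.
 by rewrite mulrAC e mulrC mulKf// expf_neq0.
set a := cst (al mu 0);set b := cst (al mu (s 0));set g := gg mu.
have e0 i : v g + (cst (al mu i) + g) ^+ 2 = phi * (cst (al mu i) + g).
 apply: (mulIf (nxx i));have := vv (xx i).
 have vx : v (xx i) = (cst (al mu i) + g) * xx i := vf_xx mu i.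
 by rewrite vx vM vD vC add0r vx => e;rewrite -[RHS]mulrA -e;ring.
have ea := e0 0;have eb := e0 (s 0);rewrite -/a -/b in ea eb.
have nab : a - b != 0.
 by rewrite (oppKK hk b) -rmorphD fmorph_eq0;case: gen.
have ephi : phi = a + b.
 rewrite -[RHS]addr0 -(addKK hk g);apply: (mulIf nab).
 have -> : phi * (a - b) = phi * (a + g) - phi * (b + g) by ring.
 by rewrite -ea -eb;ring.
have vg : v g = \sum_m cst (ga mu m * al mu m) * xx m + g * g.
 rewrite /g (der_sum (der_vf mu : der v)) mulr_suml -big_split;apply: eq_bigr => m _ /=.
 by rewrite vM vC mul0r add0r /v vf_xx rmorphM;ring.
have key : \sum_m cst (ga mu m * (al mu m - (al mu 0 + al mu (s 0)))) * xx m = cst (al mu 0 * al mu (s 0)).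
 have -> : \sum_m cst (ga mu m * (al mu m - (al mu 0 + al mu (s 0)))) * xx m =
  \sum_m cst (ga mu m * al mu m) * xx m - (a + b) * g.
  rewrite mulr_sumr -sumrB;apply: eq_bigr => m _.
  by rewrite !rmorphM rmorphB rmorphD -/a -/b;ring.
 have -> : \sum_m cst (ga mu m * al mu m) * xx m = v g - g * g by rewrite vg addrK.
 have -> : v g = phi * (a + g) - (a + g) ^+ 2 by rewrite -ea addrK.
 rewrite ephi rmorphM -/a -/b.
 have -> : (a + b) * (a + g) - (a + g) ^+ 2 - g * g - (a + b) * g = a * b - (a + g) * (g + g) by ring.
 by rewrite addKK// mulr0 subr0.
have h1 i : al mu i = al mu 0 + al mu (s 0).
 have /eqP := xx_independent key i;rewrite mulf_eq0 (negbTE (gen.2 i)) subr_eq0 => /eqP//.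
have /eqP := h1 0;rewrite -subr_eq0 opprD addNKr oppr_eq0 => /eqP eb0.
have /eqP := h1 (s 0);rewrite -subr_eq0 opprD addrCA subrr addr0 oppr_eq0 => /eqP ea0.
by have := gen.1;rewrite ea0 eb0 addr0 eqxx.
Qed.

(** Equal stalks give v = phi v'. Subtracting the equations for x and y eliminates the g's and shows
    that phi is a constant; linear independence then compares the coefficients. *)
Lemma fol_injective mu mu' p0 : Xpts p0 -> generic mu -> generic mu' -> fol mu p0 = fol mu' p0 ->
 exists c, forall j, mu j = c * mu' j.
move=> Xp0 gen gen' e;have [h [u [u' [_ eh _ _ _]]]] := chart_unit gen Xp0;have [nh _] := eh.
have : fol mu' p0 (fun z => h * vf mu z).
 rewrite -e;apply/(fol_gen _ _ Xp0 eh);exists 1;split;first exact: (lring1 Xp0).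
 by apply/funext => z;rewrite mul1r.
move=> [f [_ ef]];pose phi := f / h.
have e0 i : cst (al mu i) + gg mu = phi * (cst (al mu' i) + gg mu').
 apply: (mulIf (nxx i));rewrite -mulrA -!vf_xx mulrAC -(congr1 (fun F => F (xx i)) ef).
 by rewrite mulrC mulKf.
have ea := e0 0;have eb := e0 (s 0).
have nab : al mu' 0 - al mu' (s 0) != 0.
 rewrite -(fmorph_eq0 cst) rmorphB (oppKK hk) -rmorphD fmorph_eq0;exact: gen'.1.
pose c := (al mu 0 - al mu (s 0)) / (al mu' 0 - al mu' (s 0)).
have ec : phi = cst c.
 have nK : cst (al mu' 0) - cst (al mu' (s 0)) != 0 by rewrite -rmorphB fmorph_eq0.
 apply: (mulIf nK);rewrite -[X in _ = _ * X]rmorphB -rmorphM divfK// rmorphB.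
 have -> : cst (al mu 0) - cst (al mu (s 0)) = (cst (al mu 0) + gg mu) - (cst (al mu (s 0)) + gg mu) by ring.
 by rewrite ea eb;ring.
rewrite ec in ea eb.
have hc : c * (al mu' 0 - al mu' (s 0)) = al mu 0 - al mu (s 0) by rewrite divfK.
clearbody c.
have key : \sum_m cst (ga mu m - c * ga mu' m) * xx m = cst (c * al mu' 0 - al mu 0).
 have -> : \sum_m cst (ga mu m - c * ga mu' m) * xx m = gg mu - cst c * gg mu'.
  by rewrite mulr_sumr -sumrB;apply: eq_bigr => m _;rewrite rmorphB rmorphM;ring.
 have -> : gg mu = cst c * (cst (al mu' 0) + gg mu') - cst (al mu 0) by rewrite -ea;ring.
 by rewrite (rmorphB cst) (rmorphM cst);ring.
have hga m : ga mu m = c * ga mu' m by apply/eqP;rewrite -subr_eq0;apply/eqP;exact: xx_independent key m.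
have ha : al mu 0 = c * al mu' 0.
 move: key;rewrite big1 => [|m _];last by rewrite hga subrr rmorph0 mul0r.
 by move/esym/eqP;rewrite fmorph_eq0 subr_eq0 => /eqP.
have hb : al mu (s 0) = c * al mu' (s 0).
 have -> : al mu (s 0) = al mu 0 - (al mu 0 - al mu (s 0)) by ring.
 by rewrite -hc ha;ring.
exists c => j;have [i ->|m ->] := (split_ordP (j : 'I_(2 + 4)));last exact: hga.
have i01 : i = inord (odd (0%R : 'I_4)) \/ i = inord (odd (s 0%R)).
 by case: i => [[|[|]]]// hi;[left|right];apply/val_inj;rewrite /= inordK.
by case: i01 => ->.
Qed.

Definition coords (lam : ppoint k 5) : 'I_6 -> k := fun j => val lam 0 j.
Definition params : set (ppoint k 5) := [set lam | generic (coords lam)].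

Lemma params_open : zariski_open params.
move=> lam gen;pose r (m : 'I_4) : 'I_6 := rshift 2 m.
pose l (i : 'I_4) : 'I_6 := lshift 4 (inord (odd i) : 'I_2).
have hX1 (j : 'I_6) : ('X_j : {mpoly k[6]}) \is 1.-homog by rewrite dhomogX /= mdeg1.
have pX (j : 'I_6) (q : ppoint k 5) : peval ('X_j : {mpoly k[6]}) q = coords q j by rewrite /peval mevalXU.
exists (1 + (1 + (1 + (1 + 1))))%N.
exists (('X_(l 0) + 'X_(l (s 0))) * ('X_(r 0) * ('X_(r (s 0)) * ('X_(r (s (s 0))) * 'X_(r (s (s (s 0)))))))).
have ev (q : ppoint k 5) : peval (('X_(l 0) + 'X_(l (s 0))) * ('X_(r 0) * ('X_(r (s 0)) * ('X_(r (s (s 0))) * 'X_(r (s (s (s 0)))))))) q =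
  (al (coords q) 0 + al (coords q) (s 0)) * (ga (coords q) 0 * (ga (coords q) (s 0) * (ga (coords q) (s (s 0)) * ga (coords q) (s (s (s 0)))))).
 by rewrite /peval !mevalM mevalD -!/(peval _ q) !pX.
split.
- by do 4 (apply: dhomogM;last by []) || idtac;apply: dhomogM;[apply: rpredD|do 3 (apply: dhomogM => //)].
- by rewrite ev !mulf_neq0;case: gen => // _ h;exact: h.
- move=> q;rewrite ev !mulf_eq0 !negb_or => /and5P [n0 n1 n2 n3 n4];split=> // i.
 by elim/I4_ind: i.
Qed.

Lemma params_nonempty : params !=set0.
pose l (i : 'I_4) : 'I_6 := lshift 4 (inord (odd i) : 'I_2).
(* All coordinates are 1 except the second, so that a + b = 1; with all of them equal to 1 the sum a
   + b would be 0. *)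
pose b (j : 'I_6) : k := (j != l (s 0))%:R.
have lne : l 0 != l (s 0) by rewrite -val_eqE /= !inordK.
have b0 : b (l 0) != 0 by rewrite /b lne oner_neq0.
have [p [c [nc hc]]] := pt_of_vector b0;exists p;split.
 apply: contraTneq (oner_neq0 k) => e.
 have : b (l 0) + b (l (s 0)) = 0 by rewrite !hc -mulrDr e mulr0.
 by rewrite /b lne eqxx addr0 => /eqP;rewrite oner_eq0.
move=> m;apply: contraTneq (oner_neq0 k) => e.
have : b (rshift 2 m) = 0 by rewrite hc -/(coords p _) -/(ga _ m) e mulr0.
rewrite /b (_ : (rshift 2 m : 'I_6) != l (s 0)) => [/eqP|];first by rewrite oner_eq0.
by rewrite -val_eqE /= inordK.
Qed.

(** The local equation h and its domain do not depend on the parameter, and the field is linear in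
    it. *)
Lemma fol_algebraic : algebraic_family params (fun lam => fol (coords lam)).
move=> lam p _ Xp;have [h [u [u' ch]]] := charts Xp;have [nh oh] := chart_eq ch.
exists (fun _ q => eq_locus h q), 1%N, (fun _ (mu : ppoint k 5) z => h * vf (coords mu) z);split=> //.
- move=> nu q hq;have [d [H [hH nH hU]]] := open_locus nh hq.
 have ev (p' : ppoint k 5) q' : \sum_(j < 1) peval (1 : {mpoly k[6]}) p' * peval H q' = peval H q'.
  by rewrite big_ord1 /peval meval1 mul1r.
 exists 0%N, d, 1%N, (fun=> 1), (fun=> H);split=> //.
 + by move=> _;exact: dhomog1.
 + by rewrite ev.
 + by move=> p' q';rewrite ev;exact: hU.
- move=> _;exists 1%N, 6%N, (fun j => 'X_j), (fun j z => h * bas j z);split.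
 + by move=> j;rewrite dhomogX /= mdeg1.
 + by move=> j;rewrite -vf_delta;apply: hvf_tangent.
 + by move=> nu f;rewrite mulr_sumr;apply: eq_bigr => j _;rewrite /peval mevalXU mulrCA.
- move=> nu q _ Xq hq;have eh : equation q h by [].
 apply/seteqP;split=> w.
  move/(fol_gen _ _ Xq eh) => [a [Oa ->]];exists (fun=> a);split=> //.
  by apply/funext => z;rewrite big_ord1.
 move=> [a [Oa ->]];apply/(fol_gen _ _ Xq eh);exists (a 0);split=> //.
 by apply/funext => z;rewrite big_ord1.
Qed.

Lemma fol_family p0 : Xpts p0 -> foliation_family params (fun lam => fol (coords lam)) /\
 forall lam, params lam -> regular_foliation (fol (coords lam)) /\ ~ two_closed (fol (coords lam)).
move=> Xp0;split;last by move=> lam gen;split;[exact: fol_regular|exact: not_two_closed Xp0 gen].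
split;[exact: params_open|exact: params_nonempty| | |exact: fol_algebraic].
- by move=> lam gen;split;[exact: fol_coherent|exact: fol_rank_one Xp0|exact: fol_saturated|exact: fol_bracket].
- move=> lam nu gen gen' e;have [c hc] := fol_injective Xp0 gen gen' (e p0 Xp0).
 exact: (pt_proportional hc).
Qed.
End Family.
End Surface.

Theorem theorem2p32 (k : closedFieldType) (hk : 2%N \in [pchar k])
    (X : projective_variety k) (hX : weak_del_pezzo X) (hdeg : degree X = 4%:Z)
    (C L : 'I_4 -> set (ppoint k (pdim X)))
    (hC_inj : injective C) (hL_inj : injective L)
    (hC : forall Z, neg_curve (X := X) 2 Z <-> exists i, Z = C i)
    (hL : forall Z, neg_curve (X := X) 1 Z <-> exists i, Z = L i)
    (hCC : forall i j, i != j -> C i `&` C j = set0)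
    (hLL : forall i j, i != j -> L i `&` L j = set0)
    (hLC : forall i j, (j == i) || (j == ordS i) ->
       meet_transversally_once (X := X) (L i) (C j))
    (hLC0 : forall i j, ~~ ((j == i) || (j == ordS i)) -> L i `&` C j = set0) :
  exists (U : set (ppoint k 5))
         (F : ppoint k 5 -> ppoint k (pdim X) ->
                set (fun_field X -> fun_field X)),
    foliation_family U F /\
    (forall lam, U lam -> regular_foliation (F lam) /\ ~ two_closed (F lam)).

Proof.
have [sm _ _] := hX.
have nC i : neg_curve (X := X) 2 (C i) by apply/hC;exists i.
have nL i : neg_curve (X := X) 1 (L i) by apply/hL;exists i.
have [x nx hx] := exact_divisor sm hk hdeg nC nL hCC hLL hLC hLC0 0.
have [y ny hy] := exact_divisor sm hk hdeg nC nL hCC hLL hLC hLC0 (ordS 0).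
(* Index i + 2 carries the inverse of index i, because opposite chains exchange zeros and poles. *)
pose xx (i : 'I_4) := match val i with 0%N => x | 1%N => y | 2%N => x^-1 | _ => y^-1 end.
have nxx i : xx i != 0 by case: i => [[|[|[|[|]]]]]// hi;rewrite /xx /= ?invr_eq0.
have xxV i : xx (ordS (ordS i)) = (xx i)^-1 by case: i => [[|[|[|[|]]]]]// hi;rewrite /xx /= ?invrK.
have oxx i B : prime_divisor (X := X) B ->
  ord B (xx i) = cD (chain C L (ordS (ordS i))) B - cD (chain C L i) B.
 move=> dB;elim/I4_ind: i;[exact: hx|exact: hy|rewrite ordS4 -[xx _]/(x^-1)|rewrite ordS4 -[xx _]/(y^-1)].
  by rewrite ordV// hx// opprB.
 by rewrite ordV// hy// opprB.
have dC i := dC sm nC i.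
have nCL := nCL sm nC nL.
have oC i j : ord (C j) (xx i) = (j == ordS (ordS i) : nat)%:Z - (j == i : nat)%:Z.
 by rewrite (ordxx oxx)// !nCL !(eq_CC sm nC hCC) !addr0.
have [[D1 [D2 [hD1 hD2 [e1 e2 e3 e4]]]] _] := coordinates sm hk hdeg nC nL hCC hLL hLC hLC0 nxx xxV oxx.
have [p0 Cp0] := pdiv_point (dC 0).
have h := fol_family sm hk dC nxx xxV _ _ hD1 hD2 e1 e2 e3 e4
 (global_chart_ex sm hk hdeg nC nL hCC hLL hLC hLC0 nxx xxV oxx) (pdiv_sub (dC 0) Cp0).
exists (params (k := k)), (fun lam => fol C xx D1 D2 (coords lam));apply: h => [j|i j nij].
- by rewrite oC eqxx;case: j => [[|[|[|[|]]]]].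
- by rewrite oC [j == i]eq_sym (negbTE nij) subr0.
Qed.
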